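(* Suppose the following hold. (A1) $\mathbb M$ is bounded on $L^2$; there exist positive functions $\phi,\phi^*\in L^2$ and a scalar $\rho>0$ with $\mathbb M\phi=\rho\phi$ and $\mathbb M^*\phi^*=\rho\phi^*$; $\phi$ and $\phi^*$ are the unique (up to scale) positive solutions in $L^2$ of these two problems; $\rho$ is a simple and isolated eigenvalue of $\mathbb M$ and is the largest eigenvalue of $\mathbb M$; and, when $\phi,\phi^*$ are scaled so that $\mathbb E[\phi(X_t)\phi^*(X_t)]=1$, $\lim_{\tau\to\infty}\rho^{-\tau}\mathbb M_\tau\psi(x)=\mathbb E[\psi(X_t)\phi^*(X_t)]\,\phi(x)$ for all $\psi\in L^2$. (A2) $\|\Pi_k\mathbb M-\mathbb M\|=o(1)$. (A3) $\|\widehat{\mathbf G}^o-\mathbf I\|=o_p(1)$ and $\|\widehat{\mathbf M}^o-\mathbf M^o\|=o_p(1)$. (A4) (a) $\|\Pi_k\phi-\phi\|=o(n^{-1/2})$ and $\|\Pi_k\phi^*-\phi^*\|=o(n^{-1/2})$; (b) $\|\widehat{\mathbf G}^o-\mathbf I\|=o_p(n^{-1/4})$ and $\|\widehat{\mathbf M}^o-\mathbf M^o\|=o_p(n^{-1/4})$; (c) $\mathbb E[(\phi^*(X_t)m(X_t,X_{t+1})\phi(X_{t+1}))^2]<\infty$. Normalize $\phi,\phi^*$ so that $\|\phi\|=1$ and $\langle\phi,\phi^*\rangle=1$, and let $$\psi_\rho(x_0,x_1)=\phi^*(x_0)m(x_0,x_1)\phi(x_1)-\rho\,\phi^*(x_0)\phi(x_0),\qquad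 V_\rho=\mathbb E[\psi_\rho(X_0,X_1)^2].$$ Then $$\sqrt n(\hat\rho-\rho)=\frac1{\sqrt n}\sum_{t=0}^{n-1}\psi_\rho(X_t,X_{t+1})+o_p(1)$$ and $\sqrt n(\hat\rho-\rho)\to_dN(0,V_\rho)$.
   Context: $X=\{X_t:t=0,1,2,\dots\}$ is a time-homogeneous, strictly stationary and ergodic first-order Markov process with values in $\mathcal X\subseteq\mathbb R^d$ and stationary distribution $Q$. $m:\mathcal X^2\to(0,\infty)$ is a known measurable function. $L^2$ is the space of $\psi:\mathcal X\to\mathbb R$ with $\int\psi^2\,dQ<\infty$, with norm $\|\cdot\|$ and inner product $\langle\cdot,\cdot\rangle$; functions are identified $Q$-a.e., and ''positive'' means positive $Q$-a.e. The operator $\mathbb M\psi(x)=\mathbb E[m(X_t,X_{t+1})\psi(X_{t+1})\mid X_t=x]$ acts on $L^2$; $\mathbb M_\tau=\mathbb M^\tau$; $\mathbb M^*$ is the adjoint, $\mathbb M^*\psi(x)=\mathbb E[m(X_t,X_{t+1})\psi(X_t)\mid X_{t+1}=x]$. $\|\cdot\|$ also denotes the operator norm on $L^2$ and the operator norm (largest singular value) of matrices. An eigenvalue is simple if it has a unique eigenfunction up to scale, and isolated if some neighborhood of it contains no other point of the spectrum. Sieve: for each $k$, $b_{k1},\dots,b_{kk}\in L^2$ are linearly independent, $B_k$ is their linear span, $b^k(x)=(b_{k1}(x),\dots,b_{kk}(x))'$, and $\Pi_k:L^2\to B_k$ is the orthogonal projection. The dimension $k=k(n)\to\infty$ as $n\to\infty$.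 $\mathbf G=\mathbb E[b^k(X_t)b^k(X_t)']$ (nonsingular) and $\mathbf M=\mathbb E[b^k(X_t)m(X_t,X_{t+1})b^k(X_{t+1})']$. Estimators: from data $X_0,\dots,X_n$, $\widehat{\mathbf G}=\frac1n\sum_{t=0}^{n-1}b^k(X_t)b^k(X_t)'$ and $\widehat{\mathbf M}=\frac1n\sum_{t=0}^{n-1}b^k(X_t)m(X_t,X_{t+1})b^k(X_{t+1})'$. $\hat\rho$ is the largest real generalized eigenvalue of $(\widehat{\mathbf M},\widehat{\mathbf G})$, i.e. of $\widehat{\mathbf M}\hat c=\hat\rho\widehat{\mathbf G}\hat c$ (well defined with probability approaching one). Orthogonalized matrices: $\mathbf M^o=\mathbf G^{-1/2}\mathbf M\mathbf G^{-1/2}$, $\widehat{\mathbf G}^o=\mathbf G^{-1/2}\widehat{\mathbf G}\mathbf G^{-1/2}$, $\widehat{\mathbf M}^o=\mathbf G^{-1/2}\widehat{\mathbf M}\mathbf G^{-1/2}$; $\mathbf I$ is the $k\times k$ identity. *)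

(* Defs.v *)
From mathcomp Require Import all_boot all_order all_algebra.
From mathcomp Require Import complex.
From mathcomp Require Import all_classical all_reals all_analysis.
Import Order.TTheory GRing.Theory Num.Theory.
Import numFieldNormedType.Exports.

Set Implicit Arguments.
Unset Strict Implicit.
Unset Printing Implicit Defensive.

Local Open Scope classical_set_scope.
Local Open Scope ring_scope.

(* ** Processes *)

Section processes.
Context d d' (T : measurableType d) (E : measurableType d') (R : realType).
Variables (P : probability T R) (X : nat -> {RV P >-> E}).

(* Product sigma-algebra on the path space, generated by the coordinates. *)
Definition path_measurable : set (set (nat -> E)) :=
  <<s [set A | exists t (B : set E),
        measurable B /\ A = [set x : nat -> E | B (x t)]] >>.

Definition path_shift (x : nat -> E) : nat -> E := fun t => x t.+1.

Definition sample_path (w : T) : nat -> E := fun t => X t w.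

Definition strictly_stationary : Prop :=
  forall A, path_measurable A ->
    P (sample_path @^-1` (path_shift @^-1` A)) = P (sample_path @^-1` A).

Definition ergodic : Prop :=
  forall A, path_measurable A -> path_shift @^-1` A = A ->
    P (sample_path @^-1` A) = 0%E \/ P (sample_path @^-1` A) = 1%E.

(* Events determined by X_0, ..., X_t. *)
Definition past (t : nat) : set (set T) :=
  <<s [set A | exists s (B : set E),
        [/\ (s <= t)%N, measurable B & A = X s @^-1` B]] >>.

(* For each event B there is a version p of x |-> P(X_{t+1} in B | X_t = x),
   the same for all t, which is also a version of the conditional probability
   given X_0, ..., X_t. No regular version (transition kernel) is required. *)
Definition homogeneous_markov : Prop :=
  forall B : set E, measurable B ->
    exists p : E -> R,
      [/\ measurable_fun setT p, (forall x, 0 <= p x <= 1) &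
        forall t H, past t H ->
          P (H `&` X t.+1 @^-1` B) = (\int[P]_(w in H) (p (X t w))%:E)%E].

End processes.

Section conditional_expectation.
Context d d' (T : measurableType d) (E : measurableType d') (R : realType).
Variables (P : probability T R) (Z : T -> R) (Y : {RV P >-> E}).

Definition is_cond_exp (h : E -> R) : Prop :=
  [/\ measurable_fun setT h,
      P.-integrable setT (EFin \o (h \o Y)) &
      forall B : set E, measurable B ->
        (\int[P]_(w in Y @^-1` B) (h (Y w))%:E =
         \int[P]_(w in Y @^-1` B) (Z w)%:E)%E].

(* A version of x |-> E[Z | Y = x]; it exists whenever Z is integrable. *)
Definition cond_exp : E -> R := xget (fun=> 0) [set h | is_cond_exp h].

End conditional_expectation.

(* ** The real Hilbert space L^2(Q); its elements are represented by functions,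
   and equality in L^2 is written f = g %[ae Q]. *)

Section L2.
Context d (E : measurableType d) (R : realType) (Q : probability E R).
Implicit Types (f g : E -> R) (A : (E -> R) -> (E -> R)) (z : R[i]).

Definition L2 : set (E -> R) := [set f | f \in Lfun Q 2%:E].

Definition l2norm f : R := fine ('N[Q]_2%:E [EFin \o f]).

Definition inner f g : R := \int[Q]_x (f x * g x).

Definition ae_positive f : Prop := {ae Q, forall x, 0 < f x}.

Definition bounded_op A : Prop :=
  exists C : R, forall f, L2 f -> L2 (A f) /\ l2norm (A f) <= C * l2norm f.

Definition opnorm A : \bar R :=
  ereal_sup [set (l2norm (A f))%:E | f in [set f | L2 f /\ l2norm f <= 1]].

Definition eigenpair A (r : R) f : Prop :=
  L2 f /\ A f = (fun x => r * f x) %[ae Q].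

Definition simple_eigenvalue A (r : R) : Prop :=
  exists f, [/\ eigenpair A r f, ~ (f = cst 0 %[ae Q]) &
    forall g, eigenpair A r g -> exists c : R, g = (fun x => c * f x) %[ae Q]].

(* As usual for an operator on a real Hilbert space, eigenvalues and spectrum
   are those of the complexification u + iv |-> A u + i A v. The predicate
   says that (A - z)(u + iv) = f + ig. *)
Definition complex_shift_eq A z (u v f g : E -> R) : Prop :=
  (fun x => A u x - (complex.Re z * u x - complex.Im z * v x)) = f %[ae Q] /\
  (fun x => A v x - (complex.Re z * v x + complex.Im z * u x)) = g %[ae Q].

Definition eigenvalues A : set R[i] := [set z | exists u v,
  [/\ L2 u, L2 v, ~ (u = cst 0 %[ae Q] /\ v = cst 0 %[ae Q]) &
      complex_shift_eq A z u v (cst 0) (cst 0)]].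

(* A - z is a bijection with bounded inverse. *)
Definition resolvent_set A : set R[i] := [set z |
  (exists C : R, forall u v f g, L2 u -> L2 v -> L2 f -> L2 g ->
     complex_shift_eq A z u v f g ->
     l2norm u + l2norm v <= C * (l2norm f + l2norm g)) /\
  (forall f g, L2 f -> L2 g ->
     exists u v, [/\ L2 u, L2 v & complex_shift_eq A z u v f g])].

Definition spectrum A : set R[i] := ~` resolvent_set A.

Definition cdist (z z' : R[i]) : R := ComplexField.Normc.normc (z - z').

Definition isolated_eigenvalue A (r : R) : Prop :=
  exists2 e : R, 0 < e &
    forall z, spectrum A z -> cdist z (r%:C)%C < e -> z = (r%:C)%C.

Definition largest_eigenvalue A (r : R) : Prop :=
  eigenvalues A (r%:C)%C /\
  forall z, eigenvalues A z -> ComplexField.Normc.normc z <= r.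

(* Sieve spaces. *)

Definition lincomb k (b : 'I_k -> E -> R) (c : 'I_k -> R) : E -> R :=
  fun x => \sum_(i < k) c i * b i x.

Definition lin_independent k (b : 'I_k -> E -> R) : Prop :=
  forall c : 'I_k -> R, lincomb b c = cst 0 %[ae Q] -> forall i, c i = 0.

(* Orthogonal projection onto the span of b. *)
Definition sieve_proj k (b : 'I_k -> E -> R) (f : E -> R) : E -> R :=
  xget (fun=> 0) [set g | (exists c, g = lincomb b c) /\
    forall i, inner (fun x => f x - g x) (b i) = 0].

End L2.

(* ** Matrices *)

Section matrices.
Context (R : realType).

Definition enorm k (x : 'cV[R]_k) : R := Num.sqrt (\sum_(i < k) x i 0 ^+ 2).

(* The largest singular value, as the operator norm for the Euclidean norm. *)
Definition mxopnorm k (A : 'M[R]_k) : R :=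
  sup [set enorm (A *m x) | x in [set x | enorm x <= 1]].

Definition posdef k (A : 'M[R]_k) : Prop :=
  A^T = A /\ forall x : 'cV[R]_k, x != 0 -> 0 < (x^T *m A *m x) 0 0.

(* G^{-1/2}: the positive definite square root of the inverse. *)
Definition inv_sqrtmx k (G : 'M[R]_k) : 'M[R]_k :=
  xget 0 [set S | posdef S /\ S *m S = invmx G].

Definition orthogonalize k (G A : 'M[R]_k) : 'M[R]_k :=
  inv_sqrtmx G *m A *m inv_sqrtmx G.

Definition real_geneig k (A B : 'M[R]_k) (r : R) : Prop :=
  exists c : 'cV[R]_k, c != 0 /\ A *m c = r *: (B *m c).

Definition is_largest_real_geneig k (A B : 'M[R]_k) (r : R) : Prop :=
  real_geneig A B r /\ forall s, real_geneig A B s -> s <= r.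

End matrices.

(* ** Stochastic asymptotics *)

Section asymptotics.
Context d (T : measurableType d) (R : realType) (P : probability T R).

(* Y_n = o_p(a_n). *)
Definition little_op (Y : nat -> T -> R) (a : nat -> R) : Prop :=
  forall e : R, 0 < e ->
    P [set w | e * a n < `|Y n w|] @[n --> \oo] --> 0%E.

Definition cvg_in_dist (Y : nat -> T -> R)
    (mu : probability (measurableTypeR R) R) : Prop :=
  forall f : R -> R, continuous f -> (exists C, forall x, `|f x| <= C) ->
    \int[P]_w f (Y n w) @[n --> \oo] --> \int[mu]_x f x.

(* N(0, v). The degenerate case is separate because the second parameter of
   normal_prob is the standard deviation and must be nonzero. *)
Definition centered_normal (v : R) : probability (measurableTypeR R) R :=
  if v == 0 then dirac (0 : measurableTypeR R) : probability _ R
  else normal_prob 0 (Num.sqrt v) : probability _ R.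

End asymptotics.

(* ** The operator and its estimators *)

Section model.
Context d d' (T : measurableType d) (E : measurableType d') (R : realType).
Variables (P : probability T R) (X : nat -> {RV P >-> E}) (m : E * E -> R).

(* By stationarity the date t is immaterial; it is taken to be 0. *)

Definition stat_dist : probability E R := distribution P (X 0%N).

Local Notation Q := stat_dist.

Definition opM (psi : E -> R) : E -> R :=
  cond_exp (fun w => m (X 0%N w, X 1%N w) * psi (X 1%N w)) (X 0%N).

Definition opMadj (psi : E -> R) : E -> R :=
  cond_exp (fun w => m (X 0%N w, X 1%N w) * psi (X 0%N w)) (X 1%N).

Definition mxG k (b : 'I_k -> E -> R) : 'M[R]_k :=
  \matrix_(i, j) \int[P]_w (b i (X 0%N w) * b j (X 0%N w)).

Definition mxM k (b : 'I_k -> E -> R) : 'M[R]_k :=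
  \matrix_(i, j)
    \int[P]_w (b i (X 0%N w) * m (X 0%N w, X 1%N w) * b j (X 1%N w)).

Definition mxGhat k (b : 'I_k -> E -> R) (n : nat) (w : T) : 'M[R]_k :=
  \matrix_(i, j) (n%:R^-1 * \sum_(0 <= t < n) b i (X t w) * b j (X t w)).

Definition mxMhat k (b : 'I_k -> E -> R) (n : nat) (w : T) : 'M[R]_k :=
  \matrix_(i, j) (n%:R^-1 *
    \sum_(0 <= t < n) b i (X t w) * m (X t w, X t.+1 w) * b j (X t.+1 w)).

Definition errG k (b : 'I_k -> E -> R) (n : nat) (w : T) : R :=
  mxopnorm (orthogonalize (mxG b) (mxGhat b n w) - 1%:M).

Definition errM k (b : 'I_k -> E -> R) (n : nat) (w : T) : R :=
  mxopnorm (orthogonalize (mxG b) (mxMhat b n w) -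
            orthogonalize (mxG b) (mxM b)).

Record perron_frobenius (rho : R) (phi phis : E -> R) : Prop := {
  (* opM is well defined on L^2 *)
  pf_integrable : forall psi, L2 Q psi ->
    P.-integrable setT
      (EFin \o (fun w => m (X 0%N w, X 1%N w) * psi (X 1%N w)));
  pf_bounded : bounded_op Q opM;
  pf_rho_gt0 : 0 < rho;
  pf_phi_pos : ae_positive Q phi;
  pf_phis_pos : ae_positive Q phis;
  pf_phi_eigen : eigenpair Q opM rho phi;
  pf_phis_eigen : eigenpair Q opMadj rho phis;
  pf_phi_unique : forall f, ae_positive Q f -> eigenpair Q opM rho f ->
    exists c : R, f = (fun x => c * phi x) %[ae Q];
  pf_phis_unique : forall f, ae_positive Q f -> eigenpair Q opMadj rho f ->
    exists c : R, f = (fun x => c * phis x) %[ae Q];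
  pf_simple : simple_eigenvalue Q opM rho;
  pf_isolated : isolated_eigenvalue Q opM rho;
  pf_largest : largest_eigenvalue Q opM rho;
  pf_long_run : forall a c : R,
    inner Q (fun x => a * phi x) (fun x => c * phis x) = 1 ->
    forall psi, L2 Q psi ->
      {ae Q, forall x,
        (rho ^- tau * iter tau opM psi x) @[tau --> \oo] -->
        inner Q psi (fun y => c * phis y) * (a * phi x)}
}.

Definition psi_rho (rho : R) (phi phis : E -> R) (x0 x1 : E) : R :=
  phis x0 * m (x0, x1) * phi x1 - rho * phis x0 * phi x0.

Definition V_rho (rho : R) (phi phis : E -> R) : R :=
  \int[P]_w (psi_rho rho phi phis (X 0%N w) (X 1%N w) ^+ 2).

End model.

(* Main.v *)
(** By A2 the operator M is a norm limit of finite-rank operators, hence compact;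
    as rho is simple and no real eigenvalue exceeds it, M - l is bounded below on the
    complement { f | <f, phis> = 0 }, uniformly in l >= rho - c. Writing an approximate
    eigenvector as phi_k + h with <h, phis> = 0, this gap shows that the empirical pencil
    has a real eigenvalue near rho, that |h| and |rhohat - rho| are of the order of the
    estimation errors and the sieve bias, and, testing with the projection phis_k of phis, that
      rhohat - rho = <phis_k, (Mhat - rho Ghat) phi_k> + O(errors^2).
    The quadratic term is o_p(n^-1/2) by A4, and replacing phi_k and phis_k by phi and phis
    costs o_p(n^-1/2) in L^1, since E |g(X_0) m f(X_1)| <= |M| |g| |f|. The score psi_rho is a
    stationary ergodic martingale difference sequence: M phi = rho phi and the Markov
    property. Its central limit theorem is obtained by Lindeberg's replacement of one
    increment at a time by a Gaussian, the conditional variances being averaged over blocks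
    with the mean ergodic theorem. *)

From HB Require Import structures.
Require Import Defs.
From mathcomp Require Import all_boot all_order all_algebra.
From mathcomp Require Import complex ring lra.
From mathcomp Require Import all_classical all_reals all_analysis.
From mathcomp Require Import measurable_realfun.
Import Order.TTheory GRing.Theory Num.Theory.
Import numFieldNormedType.Exports.

Set Implicit Arguments.
Unset Strict Implicit.
Unset Printing Implicit Defensive.

Local Open Scope classical_set_scope.
Local Open Scope ring_scope.

(** * Expectations and L2 *)

(** The perturbation argument is deterministic. It bounds the bilinear forms of the pencil in terms
    of the L2 norms of the functions that the coefficient vectors represent; orthogonalization
    enters only to produce these bounds. Since the gap holds on a whole half-line of real l, the
    expansion is valid for every real eigenvalue of the pencil above rho - c, so the largest one
    needs no separate treatment once some eigenvalue is known to lie there, and this comes from the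
    sign change of a determinant. The obstacle on the probabilistic side is that there is no
    transition kernel: conditional expectations are known only through integrals against bounded
    functions, up to null sets. Identities are therefore proved for bounded factors, approximated by
    level sets or truncations, and extended by domination, the bound on E |g(X_0) m f(X_1)|
    providing the dominating functions. In the central limit theorem the block length is fixed
    before n grows; over one block the smoothed test function at the normalized partial sum hardly
    moves, so that it can be frozen while the squared increments average out. *)

Notation Int P f := (P.-integrable setT (EFin \o f)).

Section expectation.
Context d (T : measurableType d) (R : realType) (P : {measure set T -> \bar R}).
Implicit Types f g : T -> R.

Lemma Int_meas f : Int P f -> measurable_fun setT f.
Proof. by case/integrableP => /measurable_EFinP. Qed.

Lemma Int_le f g : measurable_fun setT f -> Int P g ->
  (forall x, `|f x| <= `|g x|) -> Int P f.
Proof.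
move=> mf ig h; apply: (le_integrable _ _ _ ig) => //; first exact/measurable_EFinP.
by move=> x _ /=; rewrite lee_fin.
Qed.

Lemma IntD f g : Int P f -> Int P g -> Int P (fun x => f x + g x).
Proof. by move=> If Ig; have := integrableD measurableT If Ig; apply: eq_integrable. Qed.

Lemma IntB f g : Int P f -> Int P g -> Int P (fun x => f x - g x).
Proof. by move=> If Ig; have := integrableB measurableT If Ig; apply: eq_integrable. Qed.

Lemma IntZ c f : Int P f -> Int P (fun x => c * f x).
Proof. by move=> If; have := integrableZl measurableT c If; apply: eq_integrable. Qed.

Lemma Int_mul_bounded (W g : T -> R) (K : R) : Int P W -> measurable_fun setT g -> (forall x, `|g x| <= K) ->
  Int P (fun x => W x * g x).
Proof.
move=> IW mg bg; apply: (Int_le _ (IntZ K IW)).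
  by apply: measurable_funM => //; exact: Int_meas IW.
move=> x; rewrite !normrM mulrC ler_wpM2r//.
by rewrite (le_trans (bg x))// ler_norm.
Qed.

Lemma IntN f : Int P f -> Int P (fun x => - f x).
Proof. by move=> If; have := integrableN If; apply: eq_integrable. Qed.

Lemma Int_norm f : Int P f -> Int P (fun x => `|f x|).
Proof. by move=> If; have := integrable_norm If; apply: eq_integrable. Qed.

Lemma Int_sum I (s : seq I) (p : pred I) (F : I -> T -> R) :
  (forall i, Int P (F i)) -> Int P (fun x => \sum_(i <- s | p i) F i x).
Proof.
move=> IF; have := integrable_sum measurableT (mu := P) s (P := p) (h := fun i => EFin \o F i).
move=> H; have := H (fun i _ => IF i); apply: eq_integrable => // x _ /=.
by rewrite sumEFin.
Qed.

Lemma ED f g : Int P f -> Int P g ->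
  \int[P]_x (f x + g x) = \int[P]_x f x + \int[P]_x g x.
Proof. by move=> If Ig; rewrite RintegralD. Qed.

Lemma EB f g : Int P f -> Int P g ->
  \int[P]_x (f x - g x) = \int[P]_x f x - \int[P]_x g x.
Proof. by move=> If Ig; rewrite RintegralB. Qed.

Lemma EZ c f : Int P f -> \int[P]_x (c * f x) = c * \int[P]_x f x.
Proof. by move=> If; rewrite RintegralZl. Qed.

Lemma EN f : Int P f -> \int[P]_x (- f x) = - \int[P]_x f x.
Proof.
move=> If; rewrite -mulN1r -EZ//; apply: eq_Rintegral => x _.
by rewrite mulN1r.
Qed.

Lemma E0 : \int[P]_x (0 : R) = 0.
Proof. by rewrite /Rintegral integral0. Qed.

Lemma E_sum I (s : seq I) (p : pred I) (F : I -> T -> R) :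
  (forall i, Int P (F i)) ->
  \int[P]_x (\sum_(i <- s | p i) F i x) = \sum_(i <- s | p i) \int[P]_x F i x.
Proof.
move=> IF; elim: s => [|i s IH].
  rewrite big_nil -[RHS]E0; apply: eq_Rintegral => x _; exact: big_nil.
rewrite big_cons -IH; case: ifP => pi; last first.
  by apply: eq_Rintegral => x _; rewrite big_cons pi.
rewrite -ED//; last exact: Int_sum.
by apply: eq_Rintegral => x _; rewrite big_cons pi.
Qed.

Lemma E_le f g : Int P f -> Int P g -> (forall x, f x <= g x) ->
  \int[P]_x f x <= \int[P]_x g x.
Proof. by move=> If Ig h; apply: le_Rintegral. Qed.

Lemma E_ge0 f : (forall x, 0 <= f x) -> 0 <= \int[P]_x f x.
Proof. by move=> h; apply: Rintegral_ge0. Qed.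

Lemma E_abs f : Int P f -> `|\int[P]_x f x| <= \int[P]_x `|f x|.
Proof. by move=> If; apply: le_normr_Rintegral. Qed.

Lemma E_abs_le f g : Int P f -> Int P g -> (forall x, `|f x| <= g x) ->
  `|\int[P]_x f x| <= \int[P]_x g x.
Proof.
by move=> If Ig h; apply: (le_trans (E_abs If)); apply: E_le => //; exact: Int_norm.
Qed.

Lemma E_EFin f : Int P f -> (\int[P]_x (f x)%:E)%E = (\int[P]_x f x)%:E.
Proof. by move=> If; rewrite /Rintegral fineK//; exact: integrable_fin_num. Qed.

Lemma E_ae f g : measurable_fun setT f -> measurable_fun setT g ->
  f = g %[ae P] -> \int[P]_x f x = \int[P]_x g x.
Proof.
move=> mf mg h; congr fine; apply: ae_eq_integral => //; try exact/measurable_EFinP.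
by apply: filterS h => x /= + _ => /(_ I) ->.
Qed.

Lemma Int_ae f g : measurable_fun setT g -> f = g %[ae P] -> Int P f -> Int P g.
Proof.
move=> mg h If; apply/integrableP; split; first exact/measurable_EFinP.
case/integrableP : If => mf; apply: le_lt_trans.
rewrite (@ae_eq_integral _ _ _ P setT (fun x => `|(f x)%:E|%E) (fun x => `|(g x)%:E|%E))//.
- by do 2 apply: measurableT_comp => //.
- by do 2 apply: measurableT_comp => //.
- by apply: filterS h => x /= + _ => /(_ I) ->.
Qed.

Lemma E_dct (F : nat -> T -> R) f g : (forall n, measurable_fun setT (F n)) ->
  measurable_fun setT f -> Int P g -> (forall n x, `|F n x| <= g x) ->
  {ae P, forall x, F n x @[n --> \oo] --> f x} ->
  Int P f /\ (\int[P]_x F n x @[n --> \oo] --> \int[P]_x f x).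
Proof.
move=> mF mf Ig h cv.
have := @dominated_convergence _ _ _ P setT measurableT (fun n => EFin \o F n)
  (EFin \o f) (EFin \o g).
case.
- by move=> n; exact/measurable_EFinP.
- exact/measurable_EFinP.
- by apply: filterS cv => x /= cv _; apply: cvg_EFin => //; exact: nearW.
- exact: Ig.
- by apply: aeW => x n _ /=; rewrite lee_fin.
move=> If _ cI; split => //.
by apply: fine_cvg; rewrite fineK//; apply: integrable_fin_num.
Qed.

Lemma ge0_Int_ltey f : measurable_fun setT f -> (forall x, 0 <= f x) ->
  (\int[P]_x (f x)%:E < +oo)%E -> Int P f.
Proof.
move=> mf f0 h; apply/integrableP; split; first exact/measurable_EFinP.
by under eq_integral do rewrite /= ger0_norm//.
Qed.

(** Integrability is a conclusion here: the integrals of the truncations [f * (f <= n)] are bounded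
    by [C] and increase to that of [f]. *)
Lemma ge0_Int_trunc f (C : R) : measurable_fun setT f -> (forall x, 0 <= f x) ->
  (forall n : nat, (\int[P]_x (f x * (f x <= n%:R)%R%:R)%:E <= C%:E)%E) -> Int P f /\ \int[P]_x f x <= C.
Proof.
move=> mf f0 h.
have mt n : measurable_fun setT (fun x => f x * (f x <= n%:R)%R%:R).
  apply: measurable_funM => //.
  apply: (@measurableT_comp _ _ _ _ _ _ (fun b : bool => b%:R : R)) => //.
  by apply: measurable_fun_ler.
have H : (\int[P]_x (f x)%:E <= C%:E)%E.
  have := @cvg_monotone_convergence _ _ _ P setT measurableT
    (fun n x => (f x * (f x <= n%:R)%R%:R)%:E).
  move=> /(_ (fun n => proj2 (measurable_EFinP _ _) (mt n))) cv.
  have {}cv := cv _ _.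
  have : ((\int[P]_x (f x * (f x <= n%:R)%R%:R)%:E)%E @[n --> \oo] --> (\int[P]_x (f x)%:E)%E).
    have -> : (\int[P]_x (f x)%:E = \int[P]_x (limn (fun n => (f x * (f x <= n%:R)%R%:R)%:E)))%E.
      apply: eq_integral => x _; apply/esym/cvg_lim => //.
      apply: cvg_EFin; first exact: nearW.
      apply: cvg_near_cst; near=> n.
      rewrite /=; have -> : f x <= n%:R by near: n; exact: nbhs_infty_ger.
      by rewrite mulr1.
    apply: cv => [n x _|x _ m n mn]; first by rewrite lee_fin mulr_ge0.
    rewrite lee_fin ler_wpM2l// ler_nat.
    case: (leP (f x) m%:R) => //= fm.
    by rewrite (le_trans fm) ?ler_nat.
  by move=> cv'; apply: (cvge_le _ cv'); apply: nearW => n; exact: h.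
have If : Int P f by apply: ge0_Int_ltey => //; apply: le_lt_trans H (ltry _).
by split=> //; rewrite -lee_fin -E_EFin.
Unshelve. all: by end_near. Qed.

End expectation.

Section probability_expectation.
Context d (T : measurableType d) (R : realType) (P : probability T R).
Implicit Types f g : T -> R.

Lemma Int_bounded f (C : R) : measurable_fun setT f -> (forall x, `|f x| <= C) ->
  Int P f.
Proof.
move=> mf h; apply: (@Int_le _ _ _ P f (cst C)) => //.
  exact: finite_measure_integrable_cst.
by move=> x /=; rewrite (le_trans (h x)) ?ler_norm.
Qed.

Lemma Int_cst (c : R) : Int P (fun _ : T => c).
Proof. exact: finite_measure_integrable_cst. Qed.

Lemma E_cst (c : R) : \int[P]_x c = c.
Proof.
have := @Rintegral_cst _ _ _ P setT measurableT c.
have -> : fine (P setT) = 1 by rewrite probability_setT.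
by rewrite mulr1.
Qed.

Lemma E_bound f C : Int P f -> (forall x, `|f x| <= C) -> `|\int[P]_x f x| <= C.
Proof.
move=> If h; rewrite -[leRHS]E_cst; apply: E_abs_le => //; exact: Int_cst.
Qed.

Lemma Int_distribution d' (T' : measurableType d') (Y : {RV P >-> T'})
  (f : T' -> R) : measurable_fun setT f ->
  Int P (f \o Y) <-> Int (distribution P Y) f.
Proof.
move=> mf; split => h; apply/integrableP; split.
- exact/measurable_EFinP.
- case/integrableP : h => _; apply: le_lt_trans.
  rewrite ge0_integral_distribution//.
  by do 2 apply: measurableT_comp => //.
- by apply/measurable_EFinP; exact: measurableT_comp.
- case/integrableP : h => _; apply: le_lt_trans.
  rewrite ge0_integral_distribution//.
  by do 2 apply: measurableT_comp => //.
Qed.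

Lemma E_distribution d' (T' : measurableType d') (Y : {RV P >-> T'})
  (f : T' -> R) : measurable_fun setT f -> Int P (f \o Y) ->
  \int[distribution P Y]_x f x = \int[P]_x f (Y x).
Proof.
move=> mf h; rewrite /Rintegral integral_distribution//; exact/measurable_EFinP.
Qed.

Lemma P_indic A : measurable A -> P A = (\int[P]_x \1_A x)%:E.
Proof.
move=> mA; have I1 : Int P (\1_A : T -> R).
  apply: (@Int_bounded _ 1) => [|x]; first exact: measurable_indic.
  by rewrite indicE; case: (_ \in _); rewrite ?normr1 ?normr0.
by rewrite -E_EFin// integral_indic ?setIT.
Qed.

Lemma markov_R f (e : R) : 0 < e -> Int P f ->
  (P [set x | (e < `|f x|)%R ] <= (e^-1 * \int[P]_x `|f x|)%:E)%E.
Proof.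
move=> e0 If; have mA : measurable [set x | e < `|f x|].
  rewrite -[X in measurable X]setTI.
  have -> : [set x | e < `|f x|] = (fun x => `|f x|) @^-1` `]e, +oo[%classic.
    by apply/seteqP; split => x /=; rewrite in_itv/= andbT.
  apply: (measurableT_comp _ (Int_meas If)) => //.
rewrite P_indic// lee_fin -EZ; last exact: Int_norm.
apply: E_le.
- apply: (@Int_bounded _ 1) => [|x]; first exact: measurable_indic.
  by rewrite indicE; case: (_ \in _); rewrite ?normr1 ?normr0.
- by apply: IntZ; exact: Int_norm.
move=> x; rewrite indicE; case: (boolP (x \in _)) => [|_].
  by rewrite inE/= => h; rewrite ler_pdivlMl// mulr1 ltW.
by rewrite mulr_ge0// invr_ge0 ltW.
Qed.

End probability_expectation.

(** * Square-integrable functions: inner product, norm, completeness *)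

Section L2_theory.
Context d (E : measurableType d) (R : realType) (Q : probability E R).
Implicit Types f g h : E -> R.

Lemma L2_meas f : L2 Q f -> measurable_fun setT f.
Proof. by rewrite /L2/= inE => /andP[/[!inE]]. Qed.

Lemma L2_sqr f : L2 Q f -> Int Q (fun x => f x ^+ 2).
Proof. exact: Lfun2_integrable_sqr. Qed.

Lemma L2I f : measurable_fun setT f -> Int Q (fun x => f x ^+ 2) -> L2 Q f.
Proof.
move=> mf If; rewrite /L2/= inE; apply/andP; split; rewrite inE//=.
rewrite /finite_norm unlock poweR_lty//.
case/integrableP : If => _; congr (_ < _)%E; apply: eq_integral => x _ /=.
by rewrite normrX powR_mulrn.
Qed.

Lemma L2_mul f g : L2 Q f -> L2 Q g -> Int Q (fun x => f x * g x).
Proof.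
move=> Lf Lg; have := Lfun2_mul_Lfun1 Lf Lg.
by move/Lfun1_integrable; apply: eq_integrable.
Qed.

Lemma L2_le f g : measurable_fun setT f -> L2 Q g -> (forall x, `|f x| <= `|g x|) -> L2 Q f.
Proof.
move=> mf Lg h; apply: L2I => //; apply: (Int_le _ (L2_sqr Lg)).
  exact: measurable_funX.
by move=> x; rewrite !normrX lerXn2r// nnegrE.
Qed.

Lemma L2Z c f : L2 Q f -> L2 Q (fun x => c * f x).
Proof.
move=> Lf; apply: L2I; first exact: measurable_funM (L2_meas Lf).
by have := IntZ (c ^+ 2) (L2_sqr Lf); apply: eq_integrable => // x _ /=; rewrite exprMn.
Qed.

Lemma L2D f g : L2 Q f -> L2 Q g -> L2 Q (fun x => f x + g x).
Proof.
move=> Lf Lg; apply: L2I; first exact: measurable_funD (L2_meas Lf) (L2_meas Lg).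
have := IntD (IntD (L2_sqr Lf) (L2_sqr Lg)) (IntZ 2 (L2_mul Lf Lg)).
by apply: eq_integrable => // x _ /=; congr (_%:E); ring.
Qed.

Lemma L2N f : L2 Q f -> L2 Q (fun x => - f x).
Proof. by move=> /(L2Z (-1)); congr (L2 Q _); apply/funext => x; rewrite mulN1r. Qed.

Lemma L2B f g : L2 Q f -> L2 Q g -> L2 Q (fun x => f x - g x).
Proof. by move=> Lf Lg; apply: L2D => //; exact: L2N. Qed.

Lemma L2_cst (c : R) : L2 Q (fun=> c).
Proof. by apply: L2I => //; exact: Int_cst. Qed.

Lemma L2_norm f : L2 Q f -> L2 Q (fun x => `|f x|).
Proof.
move=> Lf; apply: (L2_le _ Lf) => [|x]; last by rewrite normr_id.
exact: measurableT_comp (L2_meas Lf).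
Qed.

Lemma L2_sum I (s : seq I) (p : pred I) (F : I -> E -> R) :
  (forall i, L2 Q (F i)) -> L2 Q (fun x => \sum_(i <- s | p i) F i x).
Proof.
move=> IF; elim: s => [|i s IH].
  by under eq_fun do rewrite big_nil; exact: L2_cst.
case pi : (p i).
  by under eq_fun do rewrite big_cons pi; exact: L2D.
by under eq_fun do rewrite big_cons pi.
Qed.

Lemma L2_Int f : L2 Q f -> Int Q f.
Proof.
move=> Lf; have := L2_mul Lf (L2_cst 1); apply: eq_integrable => // x _ /=.
by rewrite mulr1.
Qed.

Lemma L2_bounded f (C : R) : measurable_fun setT f -> (forall x, `|f x| <= C) -> L2 Q f.
Proof.
move=> mf h; apply: (L2_le mf (L2_cst C)) => x.
by rewrite (le_trans (h x))// ler_norm.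
Qed.

Lemma L2_mul_bounded f g (C : R) : measurable_fun setT f -> (forall x, `|f x| <= C) ->
  L2 Q g -> L2 Q (fun x => f x * g x).
Proof.
move=> mf h Lg; apply: (L2_le _ (L2Z C Lg)).
  exact: measurable_funM mf (L2_meas Lg).
move=> x; rewrite !normrM ler_wpM2r//.
by rewrite (le_trans (h x))// ler_norm.
Qed.

Lemma L2_lincomb k (b : 'I_k -> E -> R) c : (forall i, L2 Q (b i)) -> L2 Q (lincomb b c).
Proof. by move=> Lb; apply: L2_sum => i; exact: L2Z. Qed.

Lemma innerC f g : inner Q f g = inner Q g f.
Proof. by apply: eq_Rintegral => x _; rewrite mulrC. Qed.

Lemma innerDl f g h : L2 Q f -> L2 Q g -> L2 Q h ->
  inner Q (fun x => f x + g x) h = inner Q f h + inner Q g h.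
Proof.
move=> Lf Lg Lh; rewrite -ED; try exact: L2_mul.
by apply: eq_Rintegral => x _; rewrite mulrDl.
Qed.

Lemma innerBl f g h : L2 Q f -> L2 Q g -> L2 Q h ->
  inner Q (fun x => f x - g x) h = inner Q f h - inner Q g h.
Proof.
move=> Lf Lg Lh; rewrite -EB; try exact: L2_mul.
by apply: eq_Rintegral => x _; rewrite mulrBl.
Qed.

Lemma innerZl c f h : L2 Q f -> L2 Q h ->
  inner Q (fun x => c * f x) h = c * inner Q f h.
Proof.
move=> Lf Lh; rewrite -EZ; last exact: L2_mul.
by apply: eq_Rintegral => x _; rewrite mulrA.
Qed.

Lemma inner_suml I (s : seq I) (p : pred I) (F : I -> E -> R) h :
  (forall i, L2 Q (F i)) -> L2 Q h ->
  inner Q (fun x => \sum_(i <- s | p i) F i x) h = \sum_(i <- s | p i) inner Q (F i) h.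
Proof.
move=> LF Lh; rewrite /inner -E_sum; last by move=> i; exact: L2_mul.
by apply: eq_Rintegral => x _; rewrite mulr_suml.
Qed.

Lemma innerDr f g h : L2 Q f -> L2 Q g -> L2 Q h ->
  inner Q h (fun x => f x + g x) = inner Q h f + inner Q h g.
Proof. by move=> *; rewrite innerC innerDl// !(innerC h). Qed.

Lemma innerBr f g h : L2 Q f -> L2 Q g -> L2 Q h ->
  inner Q h (fun x => f x - g x) = inner Q h f - inner Q h g.
Proof. by move=> *; rewrite innerC innerBl// !(innerC h). Qed.

Lemma innerZr c f h : L2 Q f -> L2 Q h ->
  inner Q h (fun x => c * f x) = c * inner Q h f.
Proof. by move=> *; rewrite innerC innerZl// (innerC h). Qed.

Lemma inner_lincombl k (b : 'I_k -> E -> R) c h : (forall i, L2 Q (b i)) -> L2 Q h ->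
  inner Q (lincomb b c) h = \sum_i c i * inner Q (b i) h.
Proof.
move=> Lb Lh; rewrite inner_suml//; last by move=> i; exact: L2Z.
by apply: eq_bigr => i _; rewrite innerZl.
Qed.

Lemma inner_ae f f' g g' : L2 Q f -> L2 Q f' -> L2 Q g -> L2 Q g' ->
  f = f' %[ae Q] -> g = g' %[ae Q] -> inner Q f g = inner Q f' g'.
Proof.
move=> Lf Lf' Lg Lg' ff' gg'; apply: E_ae.
- exact: measurable_funM (L2_meas Lf) (L2_meas Lg).
- exact: measurable_funM (L2_meas Lf') (L2_meas Lg').
by apply: filterS2 ff' gg' => x + + _ => /(_ I) -> /(_ I) ->.
Qed.

Lemma inner_ge0 f : 0 <= inner Q f f.
Proof. by apply: E_ge0 => x; rewrite -expr2 sqr_ge0. Qed.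

Lemma l2normE f : L2 Q f -> l2norm Q f = Num.sqrt (inner Q f f).
Proof.
move=> Lf; rewrite /l2norm unlock.
under eq_integral => x _.
  rewrite /= powR_mulrn// real_normK ?num_real//.
  over.
rewrite /= E_EFin; last exact: L2_sqr.
rewrite poweR_EFin/= -powR12_sqrt; last exact: inner_ge0.
by congr (_ `^ _); apply: eq_Rintegral => x _; rewrite expr2.
Qed.

Lemma l2norm_ge0 f : 0 <= l2norm Q f.
Proof. by apply: fine_ge0; exact: Lnorm_ge0. Qed.

Lemma l2norm_sqr f : L2 Q f -> l2norm Q f ^+ 2 = inner Q f f.
Proof. by move=> Lf; rewrite l2normE// sqr_sqrtr ?inner_ge0. Qed.

Lemma inner0_ae f : L2 Q f -> inner Q f f = 0 -> f = cst 0 %[ae Q].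
Proof.
move=> Lf h; have If := L2_mul Lf Lf.
have : (\int[Q]_x `|(f x * f x)%:E| = 0)%E.
  under eq_integral => x _ do rewrite gee0_abs ?lee_fin -?expr2 ?sqr_ge0//.
  rewrite (E_EFin (L2_sqr Lf)); congr (_%:E); rewrite -[RHS]h.
  by apply: eq_Rintegral => x _; rewrite expr2.
have [H _] := ae_eq_integral_abs Q measurableT (measurable_int Q If).
move=> /H; apply: filterS => x /= /(_ I) [] /eqP; rewrite mulf_eq0 orbb => /eqP -> _.
by [].
Qed.

Lemma l2norm0_ae f : L2 Q f -> l2norm Q f = 0 -> f = cst 0 %[ae Q].
Proof. by move=> Lf h; apply: inner0_ae => //; rewrite -l2norm_sqr// h expr0n. Qed.

Lemma l2norm_ae f g : L2 Q f -> L2 Q g -> f = g %[ae Q] -> l2norm Q f = l2norm Q g.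
Proof. by move=> Lf Lg h; rewrite !l2normE//; congr Num.sqrt; exact: inner_ae. Qed.

Lemma l2norm_cst0 : l2norm Q (cst 0) = 0.
Proof.
rewrite l2normE; last exact: L2_cst.
rewrite /inner (_ : (\int[Q]_x _) = 0) ?sqrtr0// -[RHS](E0 Q).
by apply: eq_Rintegral => x _; rewrite /= mulr0.
Qed.

Lemma inner0l f : inner Q (fun=> 0) f = 0.
Proof. by rewrite -[RHS](E0 Q); apply: eq_Rintegral => x _; rewrite /= mul0r. Qed.

Lemma inner_sqrD f g (c : R) : L2 Q f -> L2 Q g ->
  inner Q (fun x => f x + c * g x) (fun x => f x + c * g x) =
  inner Q f f + 2 * c * inner Q f g + c ^+ 2 * inner Q g g.
Proof.
move=> Lf Lg; have Lc := L2Z c Lg; have Ls := L2D Lf Lc.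
rewrite innerDl// !innerDr// innerZl// !innerZr// innerZl// (innerC g f); ring.
Qed.

Lemma cauchy_schwarz f g : L2 Q f -> L2 Q g ->
  `|inner Q f g| <= l2norm Q f * l2norm Q g.
Proof.
move=> Lf Lg.
have key : inner Q f g ^+ 2 <= inner Q f f * inner Q g g.
  have H c := inner_ge0 (fun x => f x + c * g x).
  have [g0|g0] := eqVneq (inner Q g g) 0.
    have := inner_ae Lf Lf Lg (L2_cst 0) (aeW _ (fun _ _ => erefl)) (inner0_ae Lg g0).
    by rewrite [X in _ = X]innerC inner0l => ->; rewrite expr0n/= g0 mulr0.
  have gp : 0 < inner Q g g by rewrite lt_neqAle eq_sym g0 inner_ge0.
  (* This [c] minimizes the quadratic polynomial in [H]. *)
  have := H (- inner Q f g / inner Q g g); rewrite inner_sqrD//.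
  have -> : inner Q f f + 2 * (- inner Q f g / inner Q g g) * inner Q f g +
     (- inner Q f g / inner Q g g) ^+ 2 * inner Q g g =
     (inner Q f f * inner Q g g - inner Q f g ^+ 2) / inner Q g g by field.
  by rewrite pmulr_lge0 ?invr_gt0// subr_ge0.
rewrite -ler_sqr ?nnegrE ?mulr_ge0 ?l2norm_ge0//.
by rewrite real_normK ?num_real// exprMn !l2norm_sqr.
Qed.

Lemma l2normD f g : L2 Q f -> L2 Q g ->
  l2norm Q (fun x => f x + g x) <= l2norm Q f + l2norm Q g.
Proof.
move=> Lf Lg; rewrite -ler_sqr ?nnegrE ?addr_ge0 ?l2norm_ge0//.
rewrite l2norm_sqr; last exact: L2D.
have -> : (fun x => f x + g x) = (fun x => f x + 1 * g x) by apply/funext => x; rewrite mul1r.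
rewrite inner_sqrD// sqrrD !l2norm_sqr// expr1n mul1r mulr1 lerD2r lerD2l.
rewrite mulr_natl ler_pMn2r//.
exact: le_trans (ler_norm _) (cauchy_schwarz Lf Lg).
Qed.

Lemma l2normZ c f : L2 Q f -> l2norm Q (fun x => c * f x) = `|c| * l2norm Q f.
Proof.
move=> Lf; rewrite !l2normE//; last exact: L2Z.
rewrite innerZl ?innerZr//; last exact: L2Z.
by rewrite mulrA -expr2 sqrtrM ?sqr_ge0// sqrtr_sqr.
Qed.

Lemma l2normN f : L2 Q f -> l2norm Q (fun x => - f x) = l2norm Q f.
Proof.
move=> Lf; have := l2normZ (-1) Lf; rewrite normrN1 mul1r => <-.
by congr l2norm; apply/funext => x; rewrite mulN1r.
Qed.

Lemma l2normB f g : L2 Q f -> L2 Q g ->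
  l2norm Q (fun x => f x - g x) <= l2norm Q f + l2norm Q g.
Proof.
move=> Lf Lg; have := l2normD Lf (L2N Lg); by rewrite l2normN.
Qed.

Lemma l2norm_distC f g : L2 Q f -> L2 Q g ->
  l2norm Q (fun x => f x - g x) = l2norm Q (fun x => g x - f x).
Proof.
move=> Lf Lg; rewrite -l2normN; last exact: L2B.
by congr l2norm; apply/funext => x; rewrite opprB.
Qed.

Lemma l2norm_triangle f g h : L2 Q f -> L2 Q g -> L2 Q h ->
  l2norm Q (fun x => f x - h x) <= l2norm Q (fun x => f x - g x) + l2norm Q (fun x => g x - h x).
Proof.
move=> Lf Lg Lh; apply: le_trans (l2normD (L2B Lf Lg) (L2B Lg Lh)).
by under [X in _ <= l2norm Q X]eq_fun do rewrite addrA subrK.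
Qed.

Lemma l2norm_le f g : L2 Q f -> L2 Q g -> (forall x, `|f x| <= `|g x|) ->
  l2norm Q f <= l2norm Q g.
Proof.
move=> Lf Lg h; rewrite !l2normE// ler_sqrt ?inner_ge0//.
apply: E_le => [||x]; try exact: L2_mul.
by rewrite -!expr2 -[leLHS]real_normK ?num_real// -[leRHS]real_normK ?num_real// lerXn2r ?nnegrE.
Qed.

Lemma l2norm_norm f : L2 Q f -> l2norm Q (fun x => `|f x|) = l2norm Q f.
Proof.
move=> Lf; rewrite !l2normE//; last exact: L2_norm.
by congr Num.sqrt; apply: eq_Rintegral => x _; rewrite -!expr2 real_normK ?num_real.
Qed.

Lemma l2norm_sum I (s : seq I) (p : pred I) (F : I -> E -> R) :
  (forall i, L2 Q (F i)) ->
  l2norm Q (fun x => \sum_(i <- s | p i) F i x) <= \sum_(i <- s | p i) l2norm Q (F i).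
Proof.
move=> LF; elim: s => [|i s IH].
  rewrite big_nil; under eq_fun do rewrite big_nil; by rewrite l2norm_cst0.
rewrite big_cons; case pi : (p i).
  under [X in l2norm Q X]eq_fun do rewrite big_cons pi.
  by apply: (le_trans (l2normD (LF i) (L2_sum _ _ LF))); rewrite lerD2l.
by under [X in l2norm Q X]eq_fun do rewrite big_cons pi.
Qed.

(** Riesz-Fischer for geometric increments. They are summable in L1, so the sequence converges
    almost everywhere; Fatou's lemma then turns the bounds on [g q - g p] into a bound on
    [f - g p]. *)
Lemma L2_complete (g : nat -> E -> R) : (forall p, L2 Q (g p)) ->
  (forall p, l2norm Q (fun x => g p.+1 x - g p x) <= 2^-1 ^+ p) ->
  exists2 f, L2 Q f & l2norm Q (fun x => g p x - f x) @[p --> \oo] --> 0.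
Proof.
move=> Lg hg.
pose a (p : nat) (x : E) : R := `|g p.+1 x - g p x|.
have a0 p x : 0 <= a p x by exact: normr_ge0.
have La p : L2 Q (a p) by apply/L2_norm/L2B.
have Ea p : \int[Q]_x a p x <= 2^-1 ^+ p.
  have := cauchy_schwarz (La p) (L2_cst 1).
  rewrite l2norm_norm; last exact: L2B.
  rewrite (_ : l2norm Q (fun=> 1) = 1) ?mulr1; last first.
    rewrite l2normE; last exact: L2_cst.
    by rewrite /inner (_ : \int[Q]_x _ = 1) ?sqrtr1// mulr1 E_cst.
  move=> h; apply: le_trans (le_trans h (hg p)).
  rewrite /inner; under [X in `|X|]eq_Rintegral do rewrite mulr1.
  exact: ler_norm.
have ma p : measurable_fun setT (fun x => (a p x)%:E) by exact/measurable_EFinP/L2_meas.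
have s0 x : (0 <= \sum_(0 <= p <oo) (a p x)%:E)%E.
  by apply: nneseries_ge0 => n _ _; rewrite lee_fin a0.
have fin : {ae Q, forall x, (\sum_(0 <= p <oo) (a p x)%:E < +oo)%E}.
  have : (\int[Q]_x (\sum_(0 <= p <oo) (a p x)%:E) < +oo)%E.
    rewrite integral_nneseries//; last by move=> n x _; rewrite lee_fin a0.
    apply: (@le_lt_trans _ _ (\sum_(0 <= p <oo) (2^-1 ^+ p)%:E)%E).
      apply: lee_nneseries => [n _ _|n _]; first by apply: integral_ge0 => x _; rewrite lee_fin a0.
      by rewrite (E_EFin (L2_Int (La n))) lee_fin.
    have : eseries (fun p => (2^-1 ^+ p : R)%:E) @ \oo --> (2 : R)%:E.
      have := @cvg_geometric_series R 1 2^-1; rewrite ger0_norm ?invr_ge0//.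
      rewrite invf_lt1 ?ltr1n// => /(_ isT).
      rewrite (_ : 1 / (1 - 2^-1) = 2 :> R); last by field.
      move=> h; apply: cvg_EFin; first by apply: nearW => n; rewrite /eseries/= sumEFin.
      apply: cvg_trans h; apply: near_eq_cvg; near=> n.
      by rewrite /eseries/series/= sumEFin/=; apply: eq_bigr => i _; rewrite mul1r.
    by move/cvg_lim => -> //; rewrite ltry.
  move=> h; have := @integrable_ae _ _ _ Q setT measurableT (fun x => \sum_(0 <= p <oo) (a p x)%:E)%E.
  case.
    apply/integrableP; split.
      by apply: ge0_emeasurable_sum => // n x _ _; rewrite lee_fin a0.
    under eq_integral do rewrite gee0_abs//.
    exact: h.
  move=> N [mN N0 sN]; exists N; split=> // x /= hx; apply: sN => /= /(_ I) fi.
  by apply: hx; rewrite -ge0_fin_numE.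
(* The upper limit is measurable whether or not the sequence converges; it is the limit wherever one
   exists, and [fine] supplies a real value elsewhere. *)
pose f x := fine (limn_esup (fun p => (g p x)%:E)).
have mf : measurable_fun setT f.
  apply: (measurableT_comp (@fine_measurable _ _ _)) => //.
  by apply: measurable_fun_limn_esup => p; exact/measurable_EFinP/L2_meas.
have gf : {ae Q, forall x, g p x @[p --> \oo] --> f x}.
  apply: filterS fin => x hx.
  have cs : cvgn (series (fun p => g p.+1 x - g p x)).
    apply: normed_cvg.
    apply: nondecreasing_is_cvgn.
      by apply: nondecreasing_series => i _ /=.
    exists (fine (\sum_(0 <= p <oo) (a p x)%:E)%E) => _ [n _ <-].
    rewrite -lee_fin fineK; last by rewrite ge0_fin_numE.
    rewrite /= /series/= -sumEFin.
    by apply: nneseries_lim_ge => i _ _; rewrite lee_fin a0.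
  have cg : cvgn (fun p => g p x).
    have -> : (fun p => g p x) = (fun p => g 0%N x + series (fun p => g p.+1 x - g p x) p).
      by apply/funext => p; rewrite /series/= telescope_sumr// addrC subrK.
    by apply: is_cvgD => //; exact: is_cvg_cst.
  rewrite /f.
  have /cvg_ex[l gl] := cg.
  have h : (g p x)%:E @[p --> \oo] --> l%:E by apply: cvg_EFin => //; exact: nearW.
  by rewrite (cvg_limn_einf_sup h).2/=.
(* The exact partial sum of the geometric series, rather than the bound [2 * 2^-1 ^+ p], makes the
   induction on [j] go through. *)
have dist p j : l2norm Q (fun x => g (p + j)%N x - g p x) <= 2 * 2^-1 ^+ p - 2 * 2^-1 ^+ (p + j).
  elim: j => [|j IH].
    rewrite addn0 subrr (_ : (fun x => _) = cst 0) ?l2norm_cst0//.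
    by apply/funext => x; rewrite subrr.
  rewrite addnS; apply: (le_trans (l2norm_triangle (Lg _) (Lg (p + j)%N) (Lg p))).
  apply: (le_trans (lerD (hg _) IH)); rewrite exprS; lra.
have fatouI p : (\int[Q]_x ((f x - g p x) ^+ 2)%:E <= ((2 * 2^-1 ^+ p) ^+ 2)%:E)%E.
  apply: (@le_trans _ _ (\int[Q]_x (limn_einf (fun q => ((g q x - g p x) ^+ 2)%:E)))%E).
    rewrite le_eqVlt; apply/orP; left; apply/eqP; apply: ae_eq_integral => //.
    - by apply/measurable_EFinP/measurable_funX/measurable_funB => //; exact: L2_meas.
    - rewrite (_ : (fun x => _) = (fun x => - limn_esup (fun q => (- (g q x - g p x) ^+ 2)%:E))%E).
        apply: measurableT_comp => //; apply: measurable_fun_limn_esup => q.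
        apply/measurable_EFinP/measurableT_comp => //.
        by apply/measurable_funX/measurable_funB => //; exact: L2_meas.
      apply/funext => x; rewrite -limn_einfN; congr limn_einf.
      by apply/funext => q; rewrite /= opprK.
    apply: filterS gf => x hx _; apply/esym.
    have h : ((g q x - g p x) ^+ 2)%:E @[q --> \oo] --> ((f x - g p x) ^+ 2)%:E.
      apply: cvg_EFin; first exact: nearW.
      rewrite expr2 /=; under eq_fun do rewrite /= expr2.
      by apply: cvgM; apply: cvgB => //; exact: cvg_cst.
    by rewrite (cvg_limn_einf_sup h).1.
  apply: (le_trans (fatou _ _ _ _)) => //.
  - move=> q; by apply/measurable_EFinP/measurable_funX/measurable_funB => //; exact: L2_meas.
  - by move=> q x _; rewrite lee_fin sqr_ge0.
  rewrite limn_einf_lim; apply: lime_le; first exact: is_cvg_einfs.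
  apply: nearW => n; apply: ereal_inf_le; exists (\int[Q]_x ((g (p + n)%N x - g p x) ^+ 2)%:E)%E.
    by exists (p + n)%N => //=; exact: leq_addl.
  have Ld := L2B (Lg (p + n)%N) (Lg p).
  rewrite (E_EFin (L2_sqr Ld)) lee_fin.
  rewrite (_ : Rintegral _ _ _ = l2norm Q (fun x => g (p + n)%N x - g p x) ^+ 2); last first.
    by rewrite l2norm_sqr//; apply: eq_Rintegral => x _; rewrite expr2.
  have e0 m : 0 <= 2 * 2^-1 ^+ m :> R by rewrite mulr_ge0// exprn_ge0// invr_ge0.
  by rewrite ler_sqr ?nnegrE ?l2norm_ge0// (le_trans (dist _ _))// gerBl.
have Lfg p : L2 Q (fun x => f x - g p x).
  have mfg : measurable_fun setT (fun x => f x - g p x) by apply: measurable_funB => //; exact: L2_meas.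
  apply: L2I => //; apply: ge0_Int_ltey.
  - exact: measurable_funX.
  - by move=> x; rewrite sqr_ge0.
  - exact: le_lt_trans (fatouI p) (ltry _).
have Lf : L2 Q f.
  have := L2D (Lfg 0%N) (Lg 0%N); congr (L2 Q _); apply/funext => x; exact: subrK.
exists f => //.
apply: (@squeeze_cvgr _ _ _ _ (fun=> 0) (fun p => 2 * 2^-1 ^+ p)).
- apply: nearW => p; rewrite l2norm_ge0/= l2norm_distC//.
  rewrite -ler_sqr ?nnegrE ?l2norm_ge0//.
  rewrite l2norm_sqr// -lee_fin; apply: le_trans (fatouI p).
  rewrite (E_EFin (L2_sqr (Lfg p))) lee_fin le_eqVlt; apply/orP; left; apply/eqP.
  by apply: eq_Rintegral => x _; rewrite expr2.
- exact: cvg_cst.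
- by apply: (@cvg_geometric R 2 2^-1); rewrite ger0_norm ?invr_ge0// invf_lt1 ?ltr1n.
Unshelve. all: end_near. Qed.

End L2_theory.

Lemma cvg_bigsum (R : realType) (I T : Type) (s : seq I) (F : set_system T) (FF : Filter F)
  (f : I -> T -> R) (l : I -> R) : (forall i, f i x @[x --> F] --> l i) ->
  \sum_(i <- s) f i x @[x --> F] --> \sum_(i <- s) l i.
Proof.
move=> h; elim: s => [|i s IH].
  by rewrite big_nil; under eq_fun do rewrite big_nil; exact: cvg_cst.
by rewrite big_cons; under eq_fun do rewrite big_cons; exact: cvgD.
Qed.

(** Ultrafilters replace subsequences: along one fixed [U] every bounded sequence converges, so
    several limits can be taken at once without diagonal extraction. *)
Lemma ultra_bounded_cvg (R : realType) (U : set_system nat) (u : nat -> R) (C : R) :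
  UltraFilter U -> (forall n, `|u n| <= C) -> exists l : R, u n @[n --> U] --> l.
Proof.
move=> UU hu.
have := @segment_compact R (- C) C; rewrite compact_ultra.
move=> /(_ (u @ U)) [].
- split; first exact: fmap_proper_filter.
  move=> G PG sG; apply/seteqP; split => // A.
  move=> GA; have [//|] := @in_ultra_setVsetC _ U (u @^-1` A) UU.
  move=> UnA; exfalso; have /sG GnA : (u @ U) (~` A) by exact: UnA.
  apply: (@filter_not_empty _ _ PG); rewrite -(setICr A); exact: filterI.
- suff : U (u @^-1` `[- C, C]%classic) by [].
  by apply: filterE => n; rewrite /= in_itv/= -ler_norml; exact: hu.
by move=> l [_ h]; exists l.
Qed.

(** * Lower bound for the resolvent on the complement of the eigenfunction *)

Section key_lemma.
Context d (E : measurableType d) (R : realType) (Q : probability E R).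
Variables (A : (E -> R) -> E -> R) (C rho : R) (phi phis : E -> R).
Hypotheses (C0 : 0 <= C)
  (AL : forall f, L2 Q f -> L2 Q (A f))
  (Ab : forall f, L2 Q f -> l2norm Q (A f) <= C * l2norm Q f)
  (AD : forall c f g, L2 Q f -> L2 Q g ->
     A (fun x => f x + c * g x) = (fun x => A f x + c * A g x) %[ae Q])
  (rho0 : 0 < rho) (Lphi : L2 Q phi) (Lphis : L2 Q phis)
  (phi1 : inner Q phi phis = 1)
  (A_top : forall l f, L2 Q f -> rho < l -> A f = (fun x => l * f x) %[ae Q] ->
     f = cst 0 %[ae Q])
  (A_simple : forall f, L2 Q f -> A f = (fun x => rho * f x) %[ae Q] ->
     exists c, f = (fun x => c * phi x) %[ae Q])
  (A_compact : forall e : R, 0 < e -> exists k (b : 'I_k -> E -> R) (H : 'M[R]_k),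
     (forall i, L2 Q (b i)) /\ forall f, L2 Q f -> l2norm Q f <= 1 ->
     l2norm Q (fun x => lincomb b (fun i => \sum_j H i j * inner Q (A f) (b j)) x - A f x) <= e).

Lemma opB f g : L2 Q f -> L2 Q g -> A (fun x => f x - g x) = (fun x => A f x - A g x) %[ae Q].
Proof.
move=> Lf Lg; have := AD (-1) Lf Lg.
by under [X in A X]eq_fun do rewrite mulN1r; under [X in _ = X %[ae Q]]eq_fun do rewrite mulN1r.
Qed.

(** [A] is linear only almost everywhere and [A 0] need not be literally zero; writing [c f] as
    [(f - f) + c f] reduces homogeneity to [AD]. *)
Lemma opZ c f : L2 Q f -> A (fun x => c * f x) = (fun x => c * A f x) %[ae Q].
Proof.
move=> Lf; have h0 := opB Lf Lf; have h1 := AD c (L2B Lf Lf) Lf.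
have h2 : A (fun x => c * f x) = A (fun x => f x - f x + c * f x).
  by congr A; apply/funext => x; rewrite subrr add0r.
by rewrite h2; apply: filterS2 h0 h1 => x /= + + _ => /(_ I) e /(_ I) ->; rewrite e subrr add0r.
Qed.

Lemma opB_norm f g : L2 Q f -> L2 Q g ->
  l2norm Q (fun x => A f x - A g x) <= C * l2norm Q (fun x => f x - g x).
Proof.
move=> Lf Lg; rewrite -(l2norm_ae _ _ (opB Lf Lg)).
- exact/Ab/L2B.
- exact/AL/L2B.
- by apply: L2B; exact: AL.
Qed.

(* Otherwise approximate eigenvectors orthogonal to [phis] would converge, by compactness,
   to an eigenvector contradicting that rho is simple and largest. *)
Lemma resolvent_lower_bound : exists2 c, 0 < c & forall l f, rho - c <= l -> L2 Q f ->
  inner Q f phis = 0 -> c * l2norm Q f <= l2norm Q (fun x => A f x - l * f x).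
Proof.
apply: contrapT => contra.
(* Failure of the bound with [c = n.+1%:R^-1], after normalization of [f]. *)
have seqE (n : nat) : exists lh : R * (E -> R), [/\ rho - n.+1%:R^-1 <= lh.1, L2 Q lh.2,
    inner Q lh.2 phis = 0, l2norm Q lh.2 = 1 &
    l2norm Q (fun x => A lh.2 x - lh.1 * lh.2 x) <= n.+1%:R^-1].
  apply: contrapT => hn; apply: contra; exists n.+1%:R^-1; first by rewrite invr_gt0.
  move=> l f hl Lf f0; rewrite leNgt; apply/negP => hlt; apply: hn.
  have fp : 0 < l2norm Q f.
    rewrite lt_neqAle l2norm_ge0 andbT; apply/eqP => f0'.
    by move: hlt; rewrite -f0' mulr0 ltNge l2norm_ge0.
  have nf : `|(l2norm Q f)^-1| = (l2norm Q f)^-1 by rewrite ger0_norm// invr_ge0 ltW.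
  exists (l, fun x => (l2norm Q f)^-1 * f x); split => //=.
  - exact: L2Z.
  - by rewrite innerZl// f0 mulr0.
  - by rewrite l2normZ// nf mulVf// gt_eqF.
  rewrite (@l2norm_ae _ _ _ _ _ (fun x => (l2norm Q f)^-1 * (A f x - l * f x))).
  - rewrite l2normZ; last by apply: L2B; [exact: AL|exact: L2Z].
    by rewrite nf mulrC ler_pdivrMr// ltW.
  - by apply: L2B; [apply: AL|apply: L2Z]; exact: L2Z.
  - by apply: L2Z; apply: L2B; [exact: AL|exact: L2Z].
  - by apply: filterS (opZ (l2norm Q f)^-1 Lf) => x + _ => /(_ I) ->; ring.
have {seqE} /choice[lh lhP] := seqE.
pose l n := (lh n).1; pose h n := (lh n).2.
have lb n : rho - n.+1%:R^-1 <= l n by case: (lhP n).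
have Lh n : L2 Q (h n) by case: (lhP n).
have ho n : inner Q (h n) phis = 0 by case: (lhP n).
have h1 n : l2norm Q (h n) = 1 by case: (lhP n).
have lhn n : l2norm Q (fun x => A (h n) x - l n * h n x) <= n.+1%:R^-1 by case: (lhP n).
have Ah1 n : l2norm Q (A (h n)) <= C by have := Ab (Lh n); rewrite h1 mulr1.
have inv1 n : n.+1%:R^-1 <= 1 :> R by rewrite invf_le1// ler1n.
(* The [l n] are bounded below by choice; the bound above holds because [|l n|] is the norm of
   [l n * h n], at most the norm of [A (h n)] plus the residual. *)
have lub n : `|l n| <= C + 1.
  have := l2norm_triangle (L2Z (l n) (Lh n)) (AL (Lh n)) (L2_cst Q 0).
  under [X in l2norm Q X <= _]eq_fun do rewrite subr0.
  under [X in _ <= _ + l2norm Q X]eq_fun do rewrite subr0.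
  rewrite l2normZ// h1 mulr1 => le1; apply: (le_trans le1); rewrite addrC lerD//.
  rewrite l2norm_distC; [|exact: L2Z|exact: AL].
  exact: le_trans (lhn n) (inv1 n).
have [U [UU sU]] := ultraFilterLemma (@eventually_filter).
have PU : ProperFilter U by exact: ultra_proper.
have [lam lamU] := ultra_bounded_cvg UU lub.
have n0 : n.+1%:R^-1 @[n --> \oo] --> (0 : R) by exact: cvg_harmonic.
have n0U : n.+1%:R^-1 @[n --> U] --> (0 : R) by move=> B /n0 /sU.
have lam_ge : rho <= lam.
  have : rho - n.+1%:R^-1 @[n --> U] --> rho - 0 by apply: cvgB => //; exact: cvg_cst.
  rewrite subr0 => /ler_cvg_to => /(_ _ _ lamU); apply; exact: filterE.
have lam0 : 0 < lam by exact: lt_le_trans lam_ge.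
(* The finite-rank approximation of [A (h n)] has bounded coefficients, which converge along [U].
   One quarter pays for the approximation, another for the coefficients; the resulting factor [2^-1]
   leaves consecutive [g p] within [2^-1 ^+ p], as [L2_complete] requires. *)
have approx (p : nat) : exists g, L2 Q g /\
   \forall n \near U, l2norm Q (fun x => A (h n) x - g x) <= 2^-1 * 2^-1 ^+ p.
  have e0 : 0 < 4^-1 * 2^-1 ^+ p :> R by rewrite mulr_gt0// exprn_gt0.
  have [k [b [H [Lb hb]]]] := A_compact e0.
  pose c n i := \sum_j H i j * inner Q (A (h n)) (b j).
  have : forall i, exists ci : R, c n i @[n --> U] --> ci.
    move=> i; apply: (@ultra_bounded_cvg _ _ _ (\sum_j `|H i j| * (C * l2norm Q (b j)))) => n.
    apply: (le_trans (ler_norm_sum _ _ _)); apply: ler_sum => j _.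
    rewrite normrM ler_wpM2l//; apply: (le_trans (cauchy_schwarz (AL (Lh n)) (Lb j))).
    by rewrite ler_wpM2r// l2norm_ge0.
  move=> /choice[ci hci].
  exists (lincomb b ci); split; first exact: L2_lincomb.
  have cz : (\sum_i `|c n i - ci i| * l2norm Q (b i)) @[n --> U] --> \sum_(i < k) (0 : R).
    apply: cvg_bigsum => i; rewrite -[X in _ --> X](mul0r (l2norm Q (b i))).
    apply: cvgM; last exact: cvg_cst.
    rewrite -(normr0 R); apply: cvg_norm; rewrite -(subrr (ci i)).
    by apply: cvgB; [exact: hci|exact: cvg_cst].
  have : \forall n \near U, \sum_i `|c n i - ci i| * l2norm Q (b i) <= 4^-1 * 2^-1 ^+ p.
    by move: cz; rewrite big1// => /cvgr_le; apply.
  apply: filterS => n hn.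
  apply: (le_trans (l2norm_triangle (AL (Lh n)) (L2_lincomb (c n) Lb) (L2_lincomb ci Lb))).
  have -> : 2^-1 * 2^-1 ^+ p = 4^-1 * 2^-1 ^+ p + 4^-1 * 2^-1 ^+ p :> R by field.
  apply: lerD.
    rewrite l2norm_distC; [|exact: AL|exact: L2_lincomb].
    by apply: hb; rewrite ?h1.
  apply: le_trans hn.
  have -> : (fun x => lincomb b (c n) x - lincomb b ci x) =
      (fun x => \sum_i (c n i - ci i) * b i x).
    apply/funext => x; rewrite /lincomb -sumrB; apply: eq_bigr => i _; ring.
  apply: (le_trans (l2norm_sum _ _ _)); first by move=> i; exact: L2Z.
  by apply: ler_sum => i _; rewrite l2normZ.
have /choice[g gP] := approx.
have Lg p : L2 Q (g p) by case: (gP p).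
have gU p : \forall n \near U, l2norm Q (fun x => A (h n) x - g p x) <= 2^-1 * 2^-1 ^+ p by case: (gP p).
have [G LG gG] : exists2 G, L2 Q G & l2norm Q (fun x => g p x - G x) @[p --> \oo] --> 0.
  apply: L2_complete => // p.
  have [n [hn1 hn2]] := filter_ex (filterI (gU p) (gU p.+1)).
  apply: (le_trans (l2norm_triangle (Lg _) (AL (Lh n)) (Lg p))).
  rewrite l2norm_distC; [|exact: Lg|exact: AL].
  apply: (le_trans (lerD hn2 hn1)); rewrite exprS.
  have : 0 <= 2^-1 ^+ p :> R by rewrite exprn_ge0// invr_ge0.
  lra.
have AhG e : 0 < e -> \forall n \near U, l2norm Q (fun x => A (h n) x - G x) <= e.
  move=> e0.
  have e2 : 0 < e / 2 by rewrite divr_gt0.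
  have c1 : \forall p \near \oo, l2norm Q (fun x => g p x - G x) <= e / 2.
    by move/cvgr_le : gG; apply.
  have c2 : \forall p \near \oo, 2^-1 * 2^-1 ^+ p <= e / 2 :> R.
    have := @cvg_geometric R 2^-1 2^-1; rewrite ger0_norm ?invr_ge0// invf_lt1 ?ltr1n// => /(_ isT).
    by move/cvgr_le; apply.
  have [p [p1 p2]] := filter_ex (filterI c1 c2).
  apply: filterS (gU p) => n hn.
  apply: (le_trans (l2norm_triangle (AL (Lh n)) (Lg p) LG)).
  by rewrite [leRHS]splitr lerD// (le_trans hn).
pose f x := lam^-1 * G x.
have Lf : L2 Q f by exact: L2Z.
(* Up to the residual, [h n] is [A (h n) / l n], and [l n] tends to [lam >= rho > 0]; convergence of
   [A (h n)] thus passes to [h n]. *)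
have hf e : 0 < e -> \forall n \near U, l2norm Q (fun x => h n x - f x) <= e.
  move=> e0; have e3 : 0 < lam * e / 3 by rewrite divr_gt0// mulr_gt0.
  have c1 : \forall n \near U, `|lam - l n| <= lam * e / 3.
    have : (fun n => `|lam - l n|) n @[n --> U] --> `|lam - lam|.
      by apply: cvg_norm; apply: cvgB => //; exact: cvg_cst.
    by rewrite subrr normr0 => /cvgr_le; apply.
  have c2 : \forall n \near U, n.+1%:R^-1 <= lam * e / 3 by move/cvgr_le : n0U; apply.
  apply: filterS3 c1 c2 (AhG _ e3) => n q1 q2 q3.
  have -> : (fun x => h n x - f x) = (fun x => lam^-1 * (lam * h n x - G x)).
    by apply/funext => x; rewrite /f; field; rewrite gt_eqF.
  rewrite l2normZ; last by apply: L2B => //; exact: L2Z.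
  rewrite ger0_norm ?invr_ge0 ?(ltW lam0)// ler_pdivrMl//.
  apply: (le_trans (l2norm_triangle (L2Z lam (Lh n)) (L2Z (l n) (Lh n)) LG)).
  have -> : (fun x => lam * h n x - l n * h n x) = (fun x => (lam - l n) * h n x).
    by apply/funext => x; ring.
  rewrite l2normZ// h1 mulr1.
  apply: (le_trans (lerD q1 (l2norm_triangle (L2Z (l n) (Lh n)) (AL (Lh n)) LG))).
  rewrite l2norm_distC; [|exact: L2Z|exact: AL].
  have q4 := le_trans (lhn n) q2; lra.
have f1 : 2^-1 <= l2norm Q f.
  have e0 : 0 < 2^-1 :> R by rewrite invr_gt0.
  have [n hn] := filter_ex (hf _ e0).
  have := l2normD Lf (L2B (Lh n) Lf).
  under [X in l2norm Q X <= _]eq_fun do rewrite addrC subrK.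
  rewrite h1; lra.
have fo : inner Q f phis = 0.
  apply/eqP; rewrite -normr_eq0 eq_le normr_ge0 andbT; apply/ler_addgt0Pl => e e0.
  rewrite addr0.
  have e0' : 0 < e / (l2norm Q phis + 1) by rewrite divr_gt0// ltr_wpDl// l2norm_ge0.
  have [n hn] := filter_ex (hf _ e0').
  have -> : inner Q f phis = - inner Q (fun x => h n x - f x) phis.
    by rewrite innerBl// ho sub0r opprK.
  rewrite normrN; apply: (le_trans (cauchy_schwarz (L2B (Lh n) Lf) Lphis)).
  apply: (@le_trans _ _ (e / (l2norm Q phis + 1) * (l2norm Q phis + 1))).
    by rewrite ler_pM ?l2norm_ge0// lerDl.
  by rewrite divfK// gt_eqF// ltr_wpDl// l2norm_ge0.
have Af : A f = (fun x => lam * f x) %[ae Q].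
  have : l2norm Q (fun x => A f x - G x) = 0.
    apply/eqP; rewrite eq_le l2norm_ge0 andbT; apply/ler_addgt0Pl => e e0; rewrite addr0.
    have e0' : 0 < e / (C + 1) by rewrite divr_gt0// ltr_wpDl.
    have [n [hn1 hn2]] := filter_ex (filterI (hf _ e0') (AhG _ e0')).
    apply: (le_trans (l2norm_triangle (AL Lf) (AL (Lh n)) LG)).
    apply: (le_trans (lerD (opB_norm Lf (Lh n)) hn2)).
    rewrite l2norm_distC//.
    apply: (@le_trans _ _ (C * (e / (C + 1)) + e / (C + 1))); first by rewrite lerD2r ler_wpM2l.
    by rewrite (_ : C * _ + _ = e)//; field; rewrite gt_eqF// ltr_wpDl.
  move=> hz; have := l2norm0_ae (L2B (AL Lf) LG) hz; apply: filterS => x + _ => /(_ I) /eqP.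
  by rewrite subr_eq0 => /eqP ->; rewrite /f mulrA mulfV ?mul1r// gt_eqF.
have : f = cst 0 %[ae Q].
  (* For [lam = rho] the limit is a multiple of [phi], and orthogonality to [phis] makes the factor
     vanish; for [lam > rho] there is no eigenfunction. *)
  move: lam_ge; rewrite le_eqVlt => /predU1P[lamE|lt]; last exact: A_top Lf lt Af.
  rewrite -lamE in Af; have [c hc] := A_simple Lf Af.
  have c0 : c = 0.
    rewrite -[LHS]mulr1 -phi1 -innerZl// -fo; apply/esym; apply: inner_ae => //; first exact: L2Z.
    exact: aeW.
  by apply: filterS hc => x + _ => /(_ I) ->; rewrite c0 mul0r.
move=> fz; have := l2norm_ae Lf (L2_cst Q 0) fz; rewrite l2norm_cst0; move: f1; lra.
Qed.

End key_lemma.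

(** * Ergodic theorem *)

Section ergodic_theorem.
Context d (T : measurableType d) (R : realType) (P : probability T R).
Variable th : {RV P >-> T}.
Hypothesis th_pres : forall A, measurable A -> P (th @^-1` A) = P A.

Lemma shift_Int (f : T -> R) : Int P f -> Int P (f \o th).
Proof.
move=> If; have mf := Int_meas If.
apply/Int_distribution => //; apply/integrableP; split; first exact/measurable_EFinP.
case/integrableP : If => _; apply: le_lt_trans.
by rewrite (@eq_measure_integral _ _ _ _ P)// => A mA _; exact: th_pres.
Qed.

Lemma shift_E (f : T -> R) : Int P f -> \int[P]_x f (th x) = \int[P]_x f x.
Proof.
move=> If; have mf := Int_meas If.
rewrite -(E_distribution mf (shift_Int If)).
congr fine; apply: eq_measure_integral => A mA _; exact: th_pres.
Qed.

Lemma measurable_iter_shift n : measurable_fun setT (iter n th).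
Proof.
elim: n => [|n IH] /=; first exact: measurable_id.
by apply: measurableT_comp => //; exact: measurable_funP.
Qed.

Lemma iter_shift_Int (f : T -> R) n : Int P f -> Int P (fun x => f (iter n th x)).
Proof.
move=> If; elim: n => [//|n IH].
have := shift_Int IH; apply: eq_integrable => // x _ /=.
by rewrite -iterSr.
Qed.

Lemma iter_shift_E (f : T -> R) n : Int P f ->
  \int[P]_x f (iter n th x) = \int[P]_x f x.
Proof.
move=> If; elim: n => [//|n IH].
rewrite -IH -(shift_E (iter_shift_Int n If)).
by apply: eq_Rintegral => x _; rewrite -iterSr.
Qed.

Hypothesis th_ergodic : forall A, measurable A -> th @^-1` A = A ->
  P A = 0%E \/ P A = 1%E.

Definition partial_sum (f : T -> R) n x := \sum_(0 <= j < n) f (iter j th x).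

Lemma partial_sumS f n x : partial_sum f n.+1 x = f x + partial_sum f n (th x).
Proof.
rewrite /partial_sum big_nat_recl//; congr (_ + _).
by apply: eq_bigr => j _; rewrite iterSr.
Qed.

Lemma partial_sum_Int f n : Int P f -> Int P (partial_sum f n).
Proof. by move=> If; apply: Int_sum => j; exact: iter_shift_Int. Qed.

Lemma partial_sum_E f n : Int P f -> \int[P]_x partial_sum f n x = n%:R * \int[P]_x f x.
Proof.
move=> If; rewrite E_sum; last by move=> j; exact: iter_shift_Int.
rewrite (eq_bigr (fun=> \int[P]_x f x)); last by move=> j _; exact: iter_shift_E.
by rewrite sumr_const_nat subn0 mulr_natl.
Qed.

(** The maximum of the partial sums of lengths 1 to n + 1. The recursive form is the identity on
    which the maximal ergodic argument rests. *)
Fixpoint running_max (f : T -> R) n x : R :=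
  if n is n'.+1 then f x + Num.max 0 (running_max f n' (th x)) else f x.

Lemma running_max_ge f n k x : (k < n.+1)%N -> partial_sum f k.+1 x <= running_max f n x.
Proof.
elim: n k x => [|n IH] k x.
  by rewrite ltnS leqn0 => /eqP ->; rewrite /partial_sum big_nat1.
case: k => [_|k]; first by rewrite /partial_sum big_nat1/= lerDl le_max lexx.
by rewrite ltnS => kn; rewrite partial_sumS/= lerD2l le_max IH ?orbT.
Qed.

Lemma running_maxS f n x : running_max f n x <= running_max f n.+1 x.
Proof.
elim: n x => [|n IH] x; first by rewrite /= lerDl le_max lexx.
by rewrite [leLHS]/= [leRHS]/= lerD2l ge_max !le_max lexx /= IH orbT.
Qed.

Lemma running_max_nd f x m n : (m <= n)%N -> running_max f m x <= running_max f n x.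
Proof. move=> /subnK <-; elim: (n - m)%N => [//|j IH].
exact: le_trans IH (running_maxS _ _ _). Qed.

Lemma running_max_Int f n : Int P f -> Int P (running_max f n).
Proof.
move=> If; elim: n => [//|n IH].
apply: IntD => //; have Is := shift_Int IH.
apply: (Int_le _ Is); first by apply: measurable_maxr => //; exact: Int_meas Is.
move=> x /=; rewrite /Num.max; case: ifP => // _; by rewrite normr0.
Qed.

(** Let [M_n] be the running maximum and [A] the set where it is unbounded; [A] is invariant. Over
    [A], the integral of [M_{n+1} - M_n o th] equals that of [M_{n+1} - M_n], hence is nonnegative,
    while the integrand tends to [f]. So [f] has a nonnegative integral over [A], which excludes
    [P A = 1]. *)
Lemma maximal_ergodic (f : T -> R) : Int P f -> \int[P]_x f x < 0 ->
  {ae P, forall x, exists K : R, forall n, partial_sum f n.+1 x <= K}.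
Proof.
move=> If f0.
have mM n : measurable_fun setT (running_max f n) by exact: Int_meas (running_max_Int n If).
pose A := [set x | forall K : nat, exists n, K%:R < running_max f n x].
have mA : measurable A.
  have -> : A = \bigcap_K \bigcup_n [set x | K%:R < running_max f n x].
    apply/seteqP; split => x /= h K; first by move=> _; have [n hn] := h K; exists n.
    by have [n _ hn] := h K I; exists n.
  apply: bigcap_measurable => // K _; apply: bigcup_measurable => n _.
  rewrite -[X in measurable X]setTI.
  have -> : [set x | K%:R < running_max f n x] = running_max f n @^-1` `]K%:R, +oo[%classic.
    by apply/seteqP; split => x /=; rewrite in_itv/= andbT.
  exact: mM.
have iA : th @^-1` A = A.
  apply/seteqP; split => x /= hx K.
    have [m hm] : exists m : nat, K%:R + `|f x| < m%:R.
      by exists (Num.bound (K%:R + `|f x|)); apply: archi_boundP; rewrite addr_ge0.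
    have [n hn] := hx m; exists n.+1; rewrite /= -ltrBlDl lt_max; apply/orP; right.
    apply: le_lt_trans hn; apply: ltW; apply: le_lt_trans hm.
    by rewrite lerD2l -normrN ler_norm.
  have [m hm] : exists m : nat, K%:R + `|f x| < m%:R.
    by exists (Num.bound (K%:R + `|f x|)); apply: archi_boundP; rewrite addr_ge0.
  have [n hn] := hx m; exists n.
  have := lt_le_trans hn (running_maxS f n x); rewrite /= -ltrBlDl lt_max.
  have K0 : (0 : R) <= K%:R by [].
  have fn := ler_norm (f x).
  by case/orP; lra.
have I1A : forall g, Int P g -> Int P (fun x => \1_A x * g x).
  move=> g Ig; apply: (Int_le _ Ig).
    by apply: measurable_funM; [exact: measurable_indic|exact: Int_meas Ig].
  move=> x; rewrite indicE; case: (x \in A) => /=; first by rewrite mul1r.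
  by rewrite mul0r normr0.
have A1 x : \1_A (th x) = \1_A x :> R by rewrite !indicE -[in RHS]iA; congr (nat_of_bool _)%:R; rewrite !inE.
pose D n x := \1_A x * (running_max f n.+1 x - running_max f n (th x)).
have ID n : Int P (D n).
  apply: I1A; apply: IntB; first exact: running_max_Int.
  exact: shift_Int (running_max_Int n If).
have ED0 n : 0 <= \int[P]_x D n x.
  have -> : \int[P]_x D n x = \int[P]_x (\1_A x * (running_max f n.+1 x - running_max f n x)).
    have e1 : \int[P]_x D n x = \int[P]_x (\1_A x * running_max f n.+1 x) -
        \int[P]_x (\1_A x * running_max f n (th x)).
      rewrite -EB.
      - by apply: eq_Rintegral => x _; rewrite /D mulrBr.
      - exact/I1A/running_max_Int.
      - exact/I1A/(shift_Int (running_max_Int n If)).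
    have e2 : \int[P]_x (\1_A x * running_max f n (th x)) = \int[P]_x (\1_A x * running_max f n x).
      rewrite -(shift_E (I1A _ (running_max_Int n If))).
      by apply: eq_Rintegral => x _; rewrite A1.
    rewrite e1 e2 -EB; [|exact/I1A/running_max_Int|exact/I1A/running_max_Int].
    by apply: eq_Rintegral => x _; rewrite mulrBr.
  apply: E_ge0 => x; apply: mulr_ge0; last by rewrite subr_ge0 running_maxS.
  by rewrite indicE; case: (_ \in _).
have [_ cD] : Int P (fun x => \1_A x * f x) /\
    (\int[P]_x D n x @[n --> \oo] --> \int[P]_x (\1_A x * f x)).
  apply: (@E_dct _ _ _ _ D _ (fun x => `|f x| + `|f (th x)|)).
  - by move=> n; exact: Int_meas (ID n).
  - exact: Int_meas (I1A _ If).
  - apply: IntD; apply: Int_norm => //; exact: shift_Int.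
  (* On [A], [D n] is [f + max 0 (- M_n o th)], and [M_n o th >= f o th]; this gives the dominating
     function. *)
  - move=> n x; rewrite /D indicE; case: (x \in A) => /=; last by rewrite mul0r normr0 addr_ge0.
    rewrite mul1r -addrA; apply: (le_trans (ler_normD _ _)); rewrite lerD2l.
    have := running_max_nd f (th x) (leq0n n); rewrite /=.
    rewrite /Num.max; case: ifP => h0 fm; first by rewrite subrr normr0.
    rewrite sub0r normrN; have h1 : running_max f n (th x) <= 0 by rewrite leNgt h0.
    rewrite !ler0_norm//; first by rewrite lerN2.
    exact: le_trans fm h1.
  (* By invariance, [M_n] at [th x] is positive for large [n] when [x] is in [A]; from then on
     [D n x] is [f x]. *)
  - apply: aeW => x; rewrite /D indicE; case: (boolP (x \in A)) => /=; last first.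
      by move=> _; rewrite mul0r; under eq_fun do rewrite mul0r; exact: cvg_cst.
    rewrite -{1}iA inE /= => hx.
    have [n hn] := hx 0%N.
    apply: cvg_near_cst; exists n => // m /= nm.
    have h0 := lt_le_trans hn (running_max_nd f (th x) nm).
    by rewrite !mul1r /Num.max h0 addrK.
have f1A : 0 <= \int[P]_x (\1_A x * f x).
  by apply: (ler_cvg_to _ cD); [exact: (@cvg_cst R 0)|exact: nearW].
have PA0 : P A = 0%E.
  case: (th_ergodic mA iA) => // PA1; exfalso.
  have : \int[P]_x (\1_A x * f x) = \int[P]_x f x.
    apply: E_ae.
    - exact: Int_meas (I1A _ If).
    - exact: Int_meas If.
    exists (~` A); split.
    - exact: measurableC.
    - have e : (P (~` A) = 1 - P A)%E := probability_setC P mA.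
      by apply: (etrans e); rewrite PA1 subee.
    - move=> x /= h nx; apply: h => _; move: nx; rewrite indicE => /mem_set ->.
      by rewrite mul1r.
  by move=> e; move: f1A; rewrite e leNgt f0.
exists A; split => // x /= hx K; apply: contrapT => hn; apply: hx; exists K%:R => n.
apply: (le_trans (running_max_ge f x (leqnn n.+1))).
by rewrite leNgt; apply/negP => h; apply: hn; exists n.
Qed.

(** The maximal bound is applied to [f] and [- f], each lowered by its mean plus [j.+1%:R^-1]:
    partial sums bounded above by [K] keep the averages within [j.+1%:R^-1 + K / n] of the mean. *)
Lemma birkhoff (f : T -> R) : Int P f ->
  {ae P, forall x, n%:R^-1 * partial_sum f n x @[n --> \oo] --> \int[P]_x f x}.
Proof.
move=> If; set m := \int[P]_x f x.
have up g (Ig : Int P g) : {ae P, forall x, forall j : nat, exists K : R, forall n,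
    partial_sum g n.+1 x <= n.+1%:R * (\int[P]_x g x + j.+1%:R^-1) + K}.
  apply: ae_foralln => j.
  have Ic (c : R) : Int P (fun _ : T => c) := Int_cst P c.
  have := @maximal_ergodic (fun x => g x - (\int[P]_x g x + j.+1%:R^-1)).
  case.
  - exact: IntB.
  - by rewrite EB// E_cst opprD addrA subrr sub0r oppr_lt0 invr_gt0.
  move=> N [mN N0 sN]; exists N; split => // x /= hx; apply: sN => /= -[K hK]; apply: hx.
  exists K => n; rewrite -lerBlDl; apply: le_trans (hK n).
  by rewrite /partial_sum sumrB sumr_const_nat subn0 mulr_natl.
have := up f If; have := up (fun x => - f x) (IntN If).
rewrite EN// => h1 h2; apply: filterS2 h1 h2 => x h1 h2.
apply/cvgrPdist_le => e e0.
have [j hj] : exists j : nat, j.+1%:R^-1 < e / 2.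
  have := near (near_infty_natSinv_lt (PosNum (divr_gt0 e0 (ltr0n R 2)))).
  case: (near_infty_natSinv_lt (PosNum (divr_gt0 e0 (ltr0n R 2)))) => N _ /(_ N (leqnn N)) h _.
  by exists N.
have [K1 hK1] := h1 j; have [K2 hK2] := h2 j.
have [N hN] : exists N : nat, (`|K1| + `|K2|) / (e / 2) < N%:R.
  exists (Num.bound ((`|K1| + `|K2|) / (e / 2))); apply: archi_boundP.
  by rewrite divr_ge0 ?addr_ge0// ltW// divr_gt0.
exists N.+1 => // n /= Nn; case: n Nn => // n; rewrite ltnS => Nn.
have n0 : 0 < n.+1%:R :> R by [].
have hNn : `|K1| + `|K2| < n.+1%:R * (e / 2).
  rewrite -ltr_pdivrMr ?divr_gt0//; apply: lt_le_trans hN _.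
  by rewrite ler_nat (leq_trans Nn).
have k1 := hK1 n; have k2 := hK2 n; rewrite -/m in k1 k2.
have sN : partial_sum (fun x => - f x) n.+1 x = - partial_sum f n.+1 x by rewrite /partial_sum sumrN.
rewrite sN in k1.
have -> : m - n.+1%:R^-1 * partial_sum f n.+1 x = (n.+1%:R * m - partial_sum f n.+1 x) / n.+1%:R.
  by field; rewrite gt_eqF.
rewrite normrM (ger0_norm (ltW _ : 0 <= n.+1%:R^-1)) ?invr_gt0// ler_pdivrMr//.
have b1 : n.+1%:R * j.+1%:R^-1 <= n.+1%:R * (e / 2) by rewrite ler_wpM2l// ltW.
have a1 := ler_norm K1; have a2 := ler_norm K2; have p1 := normr_ge0 K1; have p2 := normr_ge0 K2.
have aux (N' s m' e' q k1' k2' a b : R) : - s <= N' * (- m' + q) + k1' ->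
    s <= N' * (m' + q) + k2' -> N' * q <= N' * (e' / 2) -> a + b < N' * (e' / 2) ->
    k1' <= a -> k2' <= b -> 0 <= a -> 0 <= b -> `|N' * m' - s| <= e' * N'.
  by move=> *; rewrite ler_norml; apply/andP; split; lra.
exact: aux k1 k2 b1 hNn a1 a2 p1 p2.
Qed.

(** Scheffe's argument. For [n >= 1] the average has mean exactly [m], so its L1 distance to [m] is
    twice the integral of the positive part of [m - a n]; this part lies between 0 and [m] because
    [f >= 0], and dominated convergence applies. *)
Lemma mean_ergodic (f : T -> R) : Int P f -> (forall x, 0 <= f x) ->
  \int[P]_x `|n%:R^-1 * partial_sum f n x - \int[P]_x f x| @[n --> \oo] --> 0.
Proof.
move=> If f0; set m := \int[P]_x f x.
have m0 : 0 <= m by exact: E_ge0.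
pose a n x := n%:R^-1 * partial_sum f n x.
have Ia n : Int P (a n) by exact: IntZ (partial_sum_Int n If).
have Ic (c : R) : Int P (fun _ : T => c) := Int_cst P c.
have a0 n x : 0 <= a n x by rewrite mulr_ge0// sumr_ge0.
pose h n x := Num.max 0 (m - a n x).
have Ih n : Int P (h n).
  apply: (@Int_bounded _ _ _ P _ m).
    apply: measurable_maxr => //; apply: measurable_funB => //; exact: Int_meas (Ia n).
  move=> x; rewrite ger0_norm /h ?le_max ?lexx// ge_max m0/= lerBlDr lerDl; exact: a0.
have [_ ch] : Int P (fun _ : T => 0 : R) /\ (\int[P]_x h n x @[n --> \oo] --> \int[P]_x (0 : R)).
  apply: (@E_dct _ _ _ _ h _ (fun=> m)).
  - by move=> n; exact: Int_meas (Ih n).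
  - exact: measurable_cst.
  - exact: Ic.
  - move=> n x; rewrite ger0_norm /h ?le_max ?lexx// ge_max m0/= lerBlDr lerDl; exact: a0.
  - apply: filterS (birkhoff If) => x hx.
    have : Num.max 0 (m - a n x) @[n --> \oo] --> Num.max 0 (m - m).
      rewrite maxr_absE; under eq_fun do rewrite maxr_absE.
      apply: cvgM; last exact: cvg_cst.
      have c1 : m - a n x @[n --> \oo] --> m - m by apply: cvgB => //; exact: cvg_cst.
      apply: cvgD; first by apply: cvgD => //; exact: cvg_cst.
      by apply: cvg_norm; apply: cvgB => //; exact: cvg_cst.
    by rewrite subrr maxxx.
rewrite E0 in ch.
have : 2 * \int[P]_x h n x @[n --> \oo] --> (2 * 0 : R) by apply: cvgM => //; exact: cvg_cst.
rewrite mulr0; apply: cvg_trans; apply: near_eq_cvg.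
exists 1%N => // n /= n1.
have Ian : \int[P]_x a n x = m.
  by rewrite EZ ?partial_sum_E ?mulrA ?mulVf ?mul1r// ?pnatr_eq0 -?lt0n//; exact: partial_sum_Int.
have -> : \int[P]_x `|a n x - m| = \int[P]_x ((a n x - m) + 2 * h n x).
  apply: eq_Rintegral => x _; rewrite /h /Num.max; case: ifP => hlt.
    by rewrite ltr0_norm; [ring|rewrite -oppr_gt0 opprB].
  rewrite mulr0 addr0 ger0_norm// -oppr_le0 opprB leNgt; exact/negbT.
rewrite ED; [|exact: IntB|exact: IntZ].
by rewrite EB// E_cst Ian subrr add0r EZ.
Qed.

End ergodic_theorem.

(** * Martingale central limit theorem *)

Section smooth_class.
Context (R : realType).
Implicit Types (u : R -> R) (nu : probability (measurableTypeR R) R).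

Definition lipschitz_by (K : R) u := forall x h, `|u (x + h) - u x| <= K * `|h|.

Lemma lipschitz_continuous K u : lipschitz_by K u -> continuous u.
Proof.
move=> hu x.
apply/cvgrPdist_le => e e0.
have K1 : 0 < `|K| + 1 by rewrite ltr_wpDl.
near=> y.
have hy : `|u y - u x| <= K * `|y - x| by have := hu x (y - x); rewrite [x + _]addrC subrK.
rewrite distrC; apply: (le_trans hy).
apply: (@le_trans _ _ ((`|K| + 1) * `|y - x|)).
  by rewrite ler_wpM2r// (le_trans (ler_norm _))// lerDl.
rewrite -ler_pdivlMl// mulrC distrC.
near: y; apply: cvgr_dist_le; first exact: cvg_id.
by rewrite divr_gt0.
Unshelve. all: by end_near. Qed.

Lemma lipschitz_measurable K u : lipschitz_by K u -> measurable_fun setT u.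
Proof. by move=> hu; apply: continuous_measurable_fun; exact: lipschitz_continuous hu. Qed.

(* [u1] and [u2] play the roles of the first two derivatives of [u]; unlike differentiability,
   these bounds are obviously stable under averaging. *)
Record taylor2 (K : R) u u1 u2 : Prop := {
  t2_K : 0 <= K;
  t2_b : forall x, `|u x| <= K;
  t2_b1 : forall x, `|u1 x| <= K;
  t2_b2 : forall x, `|u2 x| <= K;
  t2_l : lipschitz_by K u;
  t2_l1 : lipschitz_by K u1;
  t2_l2 : lipschitz_by K u2;
  t2_rem : forall x h, `|u (x + h) - u x - h * u1 x - h ^+ 2 / 2 * u2 x| <=
    K * (h ^+ 2 * Num.min 1 `|h|) }.

(** The smoothing operator of Lindeberg's method: expectation after adding an independent increment
    of law [nu]. Its iterates add as many independent increments. *)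
Definition avg nu u (x : R) : R := \int[nu]_y u (x + y).

Lemma shift_meas u (x : R) : measurable_fun setT u ->
  measurable_fun setT (fun y => u (x + y)).
Proof. by move=> mu; apply: measurableT_comp => //; exact: measurable_funD. Qed.

Lemma avg_Int nu u K (x : R) : lipschitz_by K u -> (forall x, `|u x| <= K) -> Int nu (fun y : R => u (x + y)).
Proof.
move=> lu bu; apply: (@Int_bounded _ _ _ nu _ K) => [|y]; last exact: bu.
exact: shift_meas (lipschitz_measurable lu).
Qed.

Lemma avg_bound nu u K : lipschitz_by K u -> (forall x, `|u x| <= K) -> forall x, `|avg nu u x| <= K.
Proof. by move=> lu bu x; apply: E_bound => [|y]; [exact: avg_Int lu bu|exact: bu]. Qed.

Lemma avg_lipschitz nu u K : lipschitz_by K u -> (forall x, `|u x| <= K) -> lipschitz_by K (avg nu u).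
Proof.
move=> lu bu x h; rewrite /avg -EB; [|exact: avg_Int lu bu|exact: avg_Int lu bu].
apply: E_bound => [|y]; first by apply: IntB; exact: avg_Int lu bu.
by rewrite addrAC.
Qed.

Lemma avg_taylor2 nu K u u1 u2 : taylor2 K u u1 u2 ->
  taylor2 K (avg nu u) (avg nu u1) (avg nu u2).
Proof.
case=> K0 b b1 b2 l l1 l2 rem; split=> //; try exact: avg_bound; try exact: avg_lipschitz.
move=> x h.
have I0 := avg_Int nu x l b; have I1 := avg_Int nu x l1 b1; have I2 := avg_Int nu x l2 b2.
have Ih := avg_Int nu (x + h) l b.
rewrite /avg -(EZ h I1) -(EZ (h ^+ 2 / 2) I2) -EB// -EB; [|exact: IntB|exact: IntZ].
rewrite -EB; [|by apply: IntB; [exact: IntB|exact: IntZ]|exact: IntZ].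
apply: E_bound => [|y].
  by apply: IntB; [apply: IntB; [exact: IntB|exact: IntZ]|exact: IntZ].
by rewrite (addrAC x h y).
Qed.

Lemma min1_ge0 (h : R) : 0 <= Num.min 1 `|h|.
Proof. by rewrite le_min ler01/=. Qed.

Section one_step.
Variables (nu : probability (measurableTypeR R) R) (s2 tau a : R).
Hypotheses (I2 : Int nu (fun y : R => y ^+ 2))
  (m1 : \int[nu]_y (y : R) = 0) (m2 : \int[nu]_y ((y : R) ^+ 2) = s2)
  (m3 : \int[nu]_y ((y : R) ^+ 2 * Num.min 1 `|y|) <= tau)
  (ma : \int[nu]_y `|y : R| <= a).

Lemma Int_id : Int nu (fun y : R => y).
Proof.
apply: (@Int_le _ _ _ nu _ (fun y : R => 1 + y ^+ 2)).
- exact: measurable_id.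
- by apply: IntD => //; exact: Int_cst.
move=> y; rewrite [leRHS]ger0_norm ?addr_ge0 ?sqr_ge0//.
rewrite -real_normK ?num_real//; have := normr_ge0 y; set z := `|y|; nra.
Qed.

Lemma Int_min : Int nu (fun y : R => y ^+ 2 * Num.min 1 `|y|).
Proof.
apply: (Int_le _ I2).
  apply: measurable_funM; first exact: measurable_funX.
  by apply: measurable_minr => //; exact: measurableT_comp.
move=> y; rewrite normrM ler_piMr// ger0_norm ?min1_ge0//.
Qed.

(** The comparison half of a replacement: centering removes the first-order Taylor term, the
    variance leaves [s2 / 2 * u2], and the remainder integrates to at most [K * tau]. *)
Lemma avg_step K u u1 u2 : taylor2 K u u1 u2 ->
  forall x, `|avg nu u x - u x - s2 / 2 * u2 x| <= K * tau.
Proof.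
case=> K0 b b1 b2 l l1 l2 rem x.
have I0 := avg_Int nu x l b; have Ic := Int_cst nu.
have J1 : Int nu (fun y : R => u1 x * y) := IntZ (u1 x) Int_id.
have J2 : Int nu (fun y : R => u2 x / 2 * y ^+ 2) := IntZ (u2 x / 2) I2.
have -> : avg nu u x - u x - s2 / 2 * u2 x =
   \int[nu]_y (u (x + y) - u x - u1 x * y - u2 x / 2 * y ^+ 2).
  rewrite EB//; last by apply: IntB => //; exact: IntB.
  rewrite EB//; last exact: IntB.
  rewrite EB// E_cst (EZ _ I2) (EZ _ Int_id) m1 m2 mulr0 subr0.
  by congr (_ - _); ring.
apply: (@le_trans _ _ (\int[nu]_y (K * (y ^+ 2 * Num.min 1 `|y : R|)))).
  apply: E_abs_le.
  - by apply: IntB => //; apply: IntB => //; exact: IntB.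
  - by apply: IntZ; exact: Int_min.
  move=> y; have := rem x y; congr (_ <= _); congr (`| _ |); congr (_ - _); last by ring.
  by congr (_ - _); rewrite mulrC.
by rewrite (EZ K Int_min) ler_wpM2l.
Qed.

(** Consecutive functions in the telescoping sum differ by one more smoothing; this bounds their
    drift from one step to the next. *)
Lemma avg_close K v : lipschitz_by K v -> 0 <= K -> (forall x, `|v x| <= K) ->
  forall x, `|avg nu v x - v x| <= K * a.
Proof.
move=> lv K0 bv x; have I0 := avg_Int nu x lv bv.
rewrite -[X in _ - X](E_cst nu) -EB//; last exact: Int_cst.
apply: (@le_trans _ _ (\int[nu]_y (K * `|y : R|))).
  apply: E_abs_le.
  - by apply: IntB => //; exact: Int_cst.
  - by apply/IntZ/Int_norm/Int_id.
  by move=> y; exact: lv.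
by rewrite (EZ K (Int_norm Int_id)) ler_wpM2l.
Qed.

End one_step.
End smooth_class.

(** * Lindeberg replacement for stationary ergodic martingale differences *)

Section martingale_clt.
Context d (T : measurableType d) (R : realType) (P : probability T R).
Variable th : {RV P >-> T}.
Hypothesis th_pres : forall A, measurable A -> P (th @^-1` A) = P A.
Hypothesis th_ergodic : forall A, measurable A -> th @^-1` A = A ->
  P A = 0%E \/ P A = 1%E.
Variables (D : T -> R) (sig2 : R).
Hypotheses (ID : Int P D) (ID2 : Int P (fun x => D x ^+ 2)) (ED2 : \int[P]_x (D x ^+ 2) = sig2).
Local Notation S := (partial_sum th D).
(** The test functions of Lindeberg's method see the past through [S j] alone, so the martingale
    property is expressed as orthogonality to bounded functions of [S j], with no filtration. *)
Hypothesis mart : forall j (g : R -> R) (K : R), measurable_fun setT g -> (forall x, `|g x| <= K) ->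
  \int[P]_x (D (iter j th x) * g (S j x)) = 0.

Let sq n : R := Num.sqrt n%:R.

Lemma mS j : measurable_fun setT (S j).
Proof. exact: Int_meas (partial_sum_Int th_pres j ID). Qed.

Lemma mDj j : measurable_fun setT (fun x => D (iter j th x)).
Proof. exact: Int_meas (iter_shift_Int th_pres j ID). Qed.

Lemma S_recr j x : S j.+1 x = S j x + D (iter j th x).
Proof. by rewrite /partial_sum big_nat_recr. Qed.

Lemma Int_bS (g : R -> R) K c j : measurable_fun setT g -> (forall x, `|g x| <= K) ->
  Int P (fun x => g (c * S j x)).
Proof.
move=> mg bg; apply: (@Int_bounded _ _ _ P _ K) => [|x]; last exact: bg.
by apply: measurableT_comp => //; apply: measurable_funM => //; exact: mS.
Qed.

Lemma Int_lind c : Int P (fun x => (c * D x) ^+ 2 * Num.min 1 `|c * D x|).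
Proof.
have mc : measurable_fun setT (fun x => c * D x) by apply: measurable_funM => //; exact: Int_meas ID.
apply: (Int_le _ (IntZ (c ^+ 2) ID2)).
  apply: measurable_funM; first exact: measurable_funX.
  by apply: measurable_minr => //; exact: measurableT_comp.
move=> x; rewrite normrM exprMn ler_piMr// ger0_norm ?min1_ge0//.
Qed.

(** A Lindeberg-type truncated moment. The factor [min 1 |h|] combines the bounds [h^2] and [|h|^3]
    on the Taylor remainder, so that a finite second moment of [D] is enough. *)
Definition lind_err (c : R) := \int[P]_x ((c * D x) ^+ 2 * Num.min 1 `|c * D x|).

(** The martingale half of a replacement: in the Taylor expansion at [c * S j] the linear term
    vanishes by [mart]. The quadratic term keeps the random square of the increment; its replacement
    by [sig2] is left to the blocks. *)
Lemma martingale_step K u u1 u2 c j : taylor2 K u u1 u2 ->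
  `|\int[P]_x u (c * S j.+1 x) - \int[P]_x u (c * S j x) -
    c ^+ 2 / 2 * \int[P]_x (D (iter j th x) ^+ 2 * u2 (c * S j x))| <= K * lind_err c.
Proof.
case=> K0 b b1 b2 l l1 l2 rem.
have mu := lipschitz_measurable l; have mu1 := lipschitz_measurable l1; have mu2 := lipschitz_measurable l2.
have I1 := Int_bS c j.+1 mu b; have I0 := Int_bS c j mu b.
have mcS : measurable_fun setT (fun x => c * S j x) by apply: measurable_funM => //; exact: mS.
have J2 : Int P (fun x => D (iter j th x) ^+ 2 * u2 (c * S j x)).
  apply: (Int_mul_bounded (iter_shift_Int th_pres j ID2) (measurableT_comp mu2 mcS)).
  by move=> x; exact: b2.
have J1 : Int P (fun x => D (iter j th x) * u1 (c * S j x)).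
  apply: (Int_mul_bounded (iter_shift_Int th_pres j ID) (measurableT_comp mu1 mcS)).
  by move=> x; exact: b1.
have z1 : \int[P]_x (D (iter j th x) * u1 (c * S j x)) = 0.
  apply: (mart j (g := fun s => u1 (c * s)) (K := K)) => [|x]; last exact: b1.
  by apply: measurableT_comp => //; exact: measurable_funM.
rewrite -(EZ (c ^+ 2 / 2) J2) -EB//.
have -> : \int[P]_x (u (c * S j.+1 x) - u (c * S j x)) = 
    \int[P]_x (u (c * S j.+1 x) - u (c * S j x) - c * (D (iter j th x) * u1 (c * S j x))).
  rewrite [RHS]EB; [|exact: IntB|exact: IntZ].
  by rewrite EZ// z1 mulr0 subr0.
rewrite -EB; [|by apply: IntB; [exact: IntB|exact: IntZ]|exact: IntZ].
have Il := iter_shift_Int th_pres j (Int_lind c).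
rewrite /lind_err -(iter_shift_E th_pres j (Int_lind c)) -(EZ K Il).
apply: E_abs_le.
- by apply: IntB; [apply: IntB; [exact: IntB|exact: IntZ]|exact: IntZ].
- exact: IntZ.
move=> x; rewrite S_recr mulrDr.
have := rem (c * S j x) (c * D (iter j th x)); congr (`| _ | <= _).
by rewrite exprMn; congr (_ - _ - _); ring.
Qed.

(** With [c = 1 / sqrt n] the factor [n] cancels [c ^+ 2]; what remains is dominated by [D ^+ 2] and
    tends to 0 pointwise. *)
Lemma lind_err_cvg : n%:R * lind_err (sq n)^-1 @[n --> \oo] --> 0.
Proof.
pose F n x := D x ^+ 2 * Num.min 1 `|(sq n)^-1 * D x|.
have mF n : measurable_fun setT (F n).
  have mc : measurable_fun setT (fun x => (sq n)^-1 * D x) by apply: measurable_funM => //; exact: Int_meas ID.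
  apply: measurable_funM; first by apply: measurable_funX; exact: Int_meas ID.
  by apply: measurable_minr => //; exact: measurableT_comp.
have [_ cF] : Int P (fun _ : T => 0 : R) /\ (\int[P]_x F n x @[n --> \oo] --> \int[P]_x (0 : R)).
  apply: (@E_dct _ _ _ _ F _ _ mF _ ID2); first exact: measurable_cst.
  - move=> n x; rewrite normrM (ger0_norm (sqr_ge0 _)) ler_piMr ?sqr_ge0// ger0_norm ?min1_ge0//.
  - apply: aeW => x.
    apply: (@squeeze_cvgr _ _ _ _ (fun=> 0) (fun n => D x ^+ 2 * ((sq n)^-1 * `|D x|))).
    + apply: nearW => n; rewrite /F mulr_ge0 ?sqr_ge0 ?min1_ge0//=.
      rewrite ler_wpM2l ?sqr_ge0// ge_min; apply/orP; right.
      by rewrite normrM ger0_norm// invr_ge0 sqrtr_ge0.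
    + exact: cvg_cst.
    + have -> : 0 = D x ^+ 2 * (0 * `|D x|) by rewrite mul0r mulr0.
      apply: cvgM; first exact: cvg_cst.
      apply: cvgM; last exact: cvg_cst.
      apply/gtr0_cvgV0; last first.
        apply/cvgryPge => A; near=> n.
        rewrite /sq (le_trans (ler_norm A))// -sqrtr_sqr ler_sqrt//.
        near: n; exact: nbhs_infty_ger.
      near=> n; rewrite sqrtr_gt0 ltr0n; near: n; exact: nbhs_infty_gt.
rewrite E0 in cF; apply: cvg_trans cF; apply: near_eq_cvg; near=> n.
have n0 : 0 < n%:R :> R by rewrite ltr0n; near: n; exact: nbhs_infty_gt.
have s0 : sq n ^+ 2 = n%:R by rewrite sqr_sqrtr.
rewrite /lind_err -EZ; last exact: Int_lind.
apply: eq_Rintegral => x _; rewrite /F exprMn exprVn s0 !mulrA mulfV ?mul1r//.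
by rewrite gt_eqF.
Unshelve. all: by end_near. Qed.

Lemma S_add j0 i x : S (j0 + i) x = S j0 x + S i (iter j0 th x).
Proof.
elim: i => [|i IH]; first by rewrite addn0 [S 0 _]big_geq// addr0.
by rewrite addnS !S_recr IH addrA -iterD addnC.
Qed.

Lemma sig2_ge0 : 0 <= sig2.
Proof. by rewrite -ED2; apply: E_ge0 => x; exact: sqr_ge0. Qed.

Section blocks.
Variables (K : R) (K0 : 0 <= K).

Definition erg_err L := \int[P]_x `|L%:R^-1 * partial_sum th (fun x => D x ^+ 2) L x - sig2|.

(** Change of [v] along a block: the Lipschitz bound in space, where the argument moves by
    [c * |S i|], plus a drift of [K * a] per step. The cap [2 * K] keeps it bounded when it
    multiplies the squared increment. *)
Definition osc (c a : R) L i x : R := Num.min (2 * K) (K * (c * `|S i x| + L%:R * a)).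

Lemma osc_bound c a L i x : 0 <= c -> 0 <= a -> 0 <= osc c a L i x <= 2 * K.
Proof.
move=> c0 a0; rewrite /osc ge_min lexx andbT le_min mulr_ge0//= mulr_ge0// addr_ge0// mulr_ge0//.
Qed.

Lemma measurable_osc c a L i : measurable_fun setT (osc c a L i).
Proof.
apply: measurable_minr => //; apply: measurable_funM => //; apply: measurable_funD => //.
by apply: measurable_funM => //; apply: measurableT_comp => //; exact: mS.
Qed.

Definition osc_err (c a : R) L i :=
  \int[P]_x ((D (iter i th x) ^+ 2 + sig2) * osc c a L i x).

Lemma Int_DD i : Int P (fun x => D (iter i th x) ^+ 2 + sig2).
Proof. by apply: IntD; [exact: (iter_shift_Int th_pres i ID2)|exact: Int_cst]. Qed.

Lemma Int_osc c a L i : 0 <= c -> 0 <= a ->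
  Int P (fun x => (D (iter i th x) ^+ 2 + sig2) * osc c a L i x).
Proof.
move=> c0 a0; apply: (Int_mul_bounded (K := 2 * K) (Int_DD i)); first exact: measurable_osc.
move=> x; have /andP[h1 h2] := osc_bound L i x c0 a0; rewrite ger0_norm//; exact: h2.
Qed.

Variables (v : nat -> R -> R) (c a : R).
Hypotheses (c0 : 0 <= c) (a0 : 0 <= a) (bv : forall j s, `|v j s| <= K)
  (lv : forall j, lipschitz_by K (v j)) (vv : forall j s, `|v j.+1 s - v j s| <= K * a).

Lemma v_drift j i s : `|v (j + i)%N s - v j s| <= K * (i%:R * a).
Proof.
elim: i => [|i IH]; first by rewrite addn0 subrr normr0 mul0r mulr0.
rewrite addnS -[X in `|X|](subrKA (v (j + i)%N s)).
apply: (le_trans (ler_normD _ _)); apply: (le_trans (lerD (vv _ _) IH)).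
by rewrite -[i.+1]add1n natrD; lra.
Qed.

Let x_ j w := D (iter j th w) ^+ 2 - sig2.
Let g j w := v j (c * S j w).

Lemma meas_g j : measurable_fun setT (g j).
Proof.
apply: (measurableT_comp (lipschitz_measurable (lv j))).
by apply: measurable_funM => //; exact: mS.
Qed.

Lemma Int_x j : Int P (x_ j).
Proof. by apply: IntB; [exact: (iter_shift_Int th_pres j ID2)|exact: Int_cst]. Qed.

Lemma Int_xg i j : Int P (fun w => x_ i w * g j w).
Proof. by apply: (Int_mul_bounded (K := K) (Int_x i)); [exact: meas_g|move=> w; exact: bv]. Qed.

Lemma block_bound j0 L : `|\sum_(0 <= i < L) \int[P]_w (x_ (j0 + i) w * g (j0 + i) w)| <=
  K * (L%:R * erg_err L) + \sum_(0 <= i < L) osc_err c a L i.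
Proof.
have -> : \sum_(0 <= i < L) \int[P]_w (x_ (j0 + i) w * g (j0 + i) w) =
   \int[P]_w ((\sum_(0 <= i < L) x_ (j0 + i) w) * g j0 w) +
   \sum_(0 <= i < L) \int[P]_w (x_ (j0 + i) w * (g (j0 + i) w - g j0 w)).
  rewrite [X in X + _](_ : _ = \sum_(0 <= i < L) \int[P]_w (x_ (j0 + i) w * g j0 w)); last first.
    rewrite -E_sum; last by move=> i; exact: Int_xg.
    by apply: eq_Rintegral => w _; rewrite mulr_suml.
  rewrite -big_split/=; apply: eq_bigr => i _; rewrite -ED; last 2 first.
  - exact: Int_xg.
  - have := IntB (Int_xg (j0 + i) (j0 + i)) (Int_xg (j0 + i) j0).
    by apply: eq_integrable => // w _ /=; rewrite mulrBr.
  by apply: eq_Rintegral => w _; ring.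
apply: (le_trans (ler_normD _ _)); apply: lerD.
  have IS : Int P (fun w => \sum_(0 <= i < L) x_ (j0 + i) w) by apply: Int_sum => i; exact: Int_x.
  pose F w := L%:R^-1 * partial_sum th (fun x => D x ^+ 2) L w - sig2.
  have IF : Int P F by apply: IntB; [apply: IntZ; exact: partial_sum_Int|exact: Int_cst].
  have SF w : \sum_(0 <= i < L) x_ (j0 + i) w = L%:R * F (iter j0 th w).
    rewrite /x_ sumrB sumr_const_nat subn0 /F mulrBr.
    case: L {IS F IF} => [|L]; first by rewrite big_geq// !mul0r mulr0n.
    rewrite mulrA mulfV ?mul1r ?pnatr_eq0// mulr_natl; congr (_ - _).
    by apply: eq_bigr => i _; rewrite addnC iterD.
  have In := iter_shift_Int th_pres j0 (Int_norm IF).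
  apply: (@le_trans _ _ (\int[P]_w (K * L%:R * `|F (iter j0 th w)|))).
    apply: E_abs_le.
    - apply: (Int_mul_bounded (K := K) IS); first exact: meas_g.
      by move=> w; exact: bv.
    - exact: IntZ.
    move=> w; rewrite SF normrM mulrC normrM (ger0_norm (ler0n _ L)) mulrA.
    by rewrite ler_wpM2r// ler_wpM2r//; exact: bv.
  by rewrite EZ// /erg_err -(iter_shift_E th_pres j0 (Int_norm IF)) mulrA.
apply: (le_trans (ler_norm_sum _ _ _)); rewrite big_nat_cond [leRHS]big_nat_cond.
apply: ler_sum => i; rewrite andbT => /andP[_ iL].
have Io := Int_osc L i c0 a0.
rewrite /osc_err -(iter_shift_E th_pres j0 Io); apply: E_abs_le.
- have := IntB (Int_xg (j0 + i) (j0 + i)) (Int_xg (j0 + i) j0).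
  by apply: eq_integrable => // w _ /=; rewrite mulrBr.
- exact: (iter_shift_Int th_pres j0 Io).
move=> w; rewrite normrM -iterD (addnC i j0); apply: ler_pM => //.
  rewrite /x_; apply: (le_trans (ler_normB _ _)).
  by rewrite !ger0_norm ?sqr_ge0 ?sig2_ge0.
rewrite /osc le_min; apply/andP; split.
  apply: (le_trans (ler_normB _ _)); rewrite mulrDl mul1r; apply: lerD; exact: bv.
rewrite /g -[X in `|X|](subrKA (v (j0 + i)%N (c * S j0 w))).
apply: (le_trans (ler_normD _ _)); rewrite mulrDr; apply: lerD.
  rewrite S_add mulrDr; apply: (le_trans (lv _ _ _)).
  by rewrite normrM (ger0_norm c0).
apply: (le_trans (v_drift _ _ _)); rewrite ler_wpM2l// ler_wpM2r// ler_nat ltnW//.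
Qed.

(** Blocks of length [L] are cut off from the end. The initial stretch shorter than [L] is bounded
    termwise by [2 * sig2 * K], whence the last summand, which does not grow with [m]. *)
Lemma sum_bound L m : (0 < L)%N ->
  `|\sum_(0 <= j < m) \int[P]_w (x_ j w * g j w)| <=
  m%:R * (K * erg_err L + L%:R^-1 * \sum_(0 <= i < L) osc_err c a L i) + L%:R * (2 * sig2 * K).
Proof.
move=> L0.
have e0 : 0 <= K * erg_err L by rewrite mulr_ge0// E_ge0.
have o0 i : 0 <= osc_err c a L i.
  apply: E_ge0 => w; apply: mulr_ge0; first by rewrite addr_ge0 ?sqr_ge0 ?sig2_ge0.
  by case/andP: (osc_bound L i w c0 a0).
have so0 : 0 <= L%:R^-1 * \sum_(0 <= i < L) osc_err c a L i.
  by rewrite mulr_ge0 ?invr_ge0//; apply: sumr_ge0.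
have one j : `|\int[P]_w (x_ j w * g j w)| <= 2 * sig2 * K.
  apply: (@le_trans _ _ (\int[P]_w (K * (D (iter j th w) ^+ 2 + sig2)))).
    apply: E_abs_le; [exact: Int_xg|exact/IntZ/Int_DD|move=> w].
    rewrite normrM mulrC ler_pM//; first exact: bv.
    rewrite /x_; apply: (le_trans (ler_normB _ _)).
    by rewrite !ger0_norm ?sqr_ge0 ?sig2_ge0.
  rewrite EZ; last exact: Int_DD.
  rewrite ED; [|exact: (iter_shift_Int th_pres j ID2)|exact: Int_cst].
  by rewrite (iter_shift_E th_pres j ID2) ED2 E_cst mulrC mulr_natl mulr2n.
have s2K : 0 <= 2 * sig2 * K by rewrite !mulr_ge0// sig2_ge0.
elim/ltn_ind: m => m IH.
have [mL|Lm] := ltnP m L.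
  apply: (le_trans (ler_norm_sum _ _ _)).
  apply: (@le_trans _ _ (m%:R * (2 * sig2 * K))).
    rewrite mulr_natl -[X in _ *+ X]subn0 -sumr_const_nat; apply: ler_sum => j _; exact: one.
  apply: (@le_trans _ _ (L%:R * (2 * sig2 * K))); first by rewrite ler_wpM2r// ler_nat ltnW.
  by rewrite lerDr mulr_ge0// addr_ge0.
have IHm := IH (m - L)%N; rewrite (big_cat_nat (leq0n (m - L)) (leq_subr L m))/=.
apply: (le_trans (ler_normD _ _)).
have hlt : (m - L < m)%N by rewrite ltn_subrL L0 (leq_trans L0).
have b2 : `|\sum_(m - L <= j < m) \int[P]_w (x_ j w * g j w)| <=
    L%:R * (K * erg_err L + L%:R^-1 * \sum_(0 <= i < L) osc_err c a L i).
  have := block_bound (m - L) L.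
  have -> : \sum_(m - L <= j < m) \int[P]_w (x_ j w * g j w) =
      \sum_(0 <= i < L) \int[P]_w (x_ (m - L + i) w * g (m - L + i) w).
    rewrite -[X in \sum_(X <= _ < _) _]add0n big_addn subKn//.
    by apply: eq_bigr => i _; rewrite addnC.
  move=> h; apply: (le_trans h); rewrite le_eqVlt; apply/orP; left; apply/eqP; field.
  by rewrite pnatr_eq0 -lt0n.
apply: (le_trans (lerD (IHm hlt) b2)).
by rewrite natrB// le_eqVlt; apply/orP; left; apply/eqP; ring.
Qed.

End blocks.

(** Dominated convergence at fixed [L] and [i]; this is why the block length must not depend on
    [n]. *)
Lemma osc_err_cvg K L i (K0 : 0 <= K) (c_ a_ : nat -> R) : (forall n, 0 <= c_ n) -> (forall n, 0 <= a_ n) ->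
  c_ n @[n --> \oo] --> 0 -> a_ n @[n --> \oo] --> 0 ->
  osc_err K (c_ n) (a_ n) L i @[n --> \oo] --> 0.
Proof.
move=> c0 a0 cc ca.
have [_ +] : Int P (fun _ : T => 0 : R) /\
   (osc_err K (c_ n) (a_ n) L i @[n --> \oo] --> \int[P]_x (0 : R)).
  apply: (@E_dct _ _ _ _ (fun n x => (D (iter i th x) ^+ 2 + sig2) * osc K (c_ n) (a_ n) L i x) _
    (fun x => 2 * K * (D (iter i th x) ^+ 2 + sig2))).
  - by move=> n; exact: Int_meas (Int_osc K0 L i (c0 n) (a0 n)).
  - exact: measurable_cst.
  - by apply: IntZ; exact: Int_DD.
  - move=> n x; have /andP[h1 h2] := osc_bound K0 L i x (c0 n) (a0 n).
    rewrite normrM mulrC ler_pM// ger0_norm// addr_ge0 ?sqr_ge0 ?sig2_ge0//.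
  - apply: aeW => x; rewrite -(mulr0 (D (iter i th x) ^+ 2 + sig2)).
    apply: cvgM; first exact: cvg_cst.
    apply: (@squeeze_cvgr _ _ _ _ (fun=> 0) (fun n => K * (c_ n * `|S i x| + L%:R * a_ n))).
    + apply: nearW => n; have /andP[-> _] := osc_bound K0 L i x (c0 n) (a0 n).
      by rewrite /osc ge_min lexx orbT.
    + exact: cvg_cst.
    + rewrite -[X in _ --> X](_ : K * (0 * `|S i x| + L%:R * 0) = 0); last by rewrite mul0r mulr0 addr0 mulr0.
      apply: cvgM; first exact: cvg_cst.
      by apply: cvgD; apply: cvgM => //; exact: cvg_cst.
by rewrite E0.
Qed.

Section lindeberg.
Variables (nu : nat -> probability (measurableTypeR R) R) (tau a : nat -> R).
Hypotheses (I2 : forall n, Int (nu n) (fun y : R => y ^+ 2))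
  (m1 : forall n, \int[nu n]_y (y : R) = 0)
  (m2 : forall n, (0 < n)%N -> \int[nu n]_y ((y : R) ^+ 2) = n%:R^-1 * sig2)
  (m3 : forall n, \int[nu n]_y ((y : R) ^+ 2 * Num.min 1 `|y|) <= tau n)
  (ma : forall n, \int[nu n]_y `|y : R| <= a n)
  (ctau : n%:R * tau n @[n --> \oo] --> 0) (ca : a n @[n --> \oo] --> 0).

(** Telescoping of the expectations of [U (n - j) (c * S j)], [U i] being [u] smoothed [i] times:
    step [j] trades one increment of law [nu n] for the increment [j] of the martingale. [A j] is
    the Taylor error of the latter, [B j] that of the former, and the third sum is the cost of
    replacing squared increments by [sig2]. *)
Lemma lindeberg_bound K u u1 u2 n L : taylor2 K u u1 u2 -> (0 < n)%N -> (0 < L)%N ->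
  `|\int[P]_x u ((sq n)^-1 * S n x) - iter n (avg (nu n)) u 0| <=
  K * (n%:R * lind_err (sq n)^-1) + K * (n%:R * tau n) +
  K * erg_err L + L%:R^-1 * (\sum_(0 <= i < L) osc_err K (sq n)^-1 (a n) L i) +
  n%:R^-1 * (L%:R * (2 * sig2 * K)).
Proof.
move=> tu n0 L0; set c := (sq n)^-1.
have c0 : 0 <= c by rewrite invr_ge0 sqrtr_ge0.
have c2 : c ^+ 2 = n%:R^-1 by rewrite exprVn sqr_sqrtr.
have an0 : 0 <= a n by apply: le_trans (ma n); exact: E_ge0.
have tU i : taylor2 K (iter i (avg (nu n)) u) (iter i (avg (nu n)) u1) (iter i (avg (nu n)) u2).
  by elim: i => [//|i IH]; exact: avg_taylor2.
pose U i := iter i (avg (nu n)) u.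
(* The second-derivative companion of [U (n - j.+1)]. Truncated subtraction makes it constant once
   [j.+1 >= n], so the drift bound holds for all [j]. *)
pose v j := iter (n - j.+1) (avg (nu n)) u2.
have bv j s : `|v j s| <= K := t2_b2 (tU _) s.
have lv j : lipschitz_by K (v j) := t2_l2 (tU _).
have K0 := t2_K tu.
have vv j s : `|v j.+1 s - v j s| <= K * a n.
  rewrite /v; have [jn|jn] := ltnP j.+1 n; last first.
    have e1 : (n - j.+1 = 0)%N by apply/eqP; rewrite subn_eq0.
    have e2 : (n - j.+2 = 0)%N by apply/eqP; rewrite subn_eq0 (leq_trans jn).
    by rewrite e1 e2 subrr normr0 mulr_ge0.
  rewrite -[(n - j.+1)%N]prednK ?subn_gt0// -subnS/= distrC.
  by apply: (avg_close (I2 n) (ma n)) => //; [exact: t2_l2 (tU _)|exact: t2_b2 (tU _)].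
pose g j x := v j (c * S j x).
have tel : \int[P]_x u (c * S n x) - iter n (avg (nu n)) u 0 =
   \sum_(0 <= j < n) (\int[P]_x U (n - j.+1)%N (c * S j.+1 x) - \int[P]_x U (n - j)%N (c * S j x)).
  rewrite telescope_sumr//= subnn subn0; congr (_ - _).
  rewrite -[LHS](E_cst P); apply: eq_Rintegral => x _.
  by rewrite /partial_sum big_geq// mulr0.
rewrite tel.
pose A j := \int[P]_x U (n - j.+1)%N (c * S j.+1 x) - \int[P]_x U (n - j.+1)%N (c * S j x) -
    c ^+ 2 / 2 * \int[P]_x (D (iter j th x) ^+ 2 * v j (c * S j x)).
pose B j := \int[P]_x U (n - j.+1)%N (c * S j x) - \int[P]_x U (n - j)%N (c * S j x) +
    c ^+ 2 / 2 * sig2 * \int[P]_x v j (c * S j x).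
have Iv j : Int P (fun x => v j (c * S j x)).
  exact: Int_bS c j (lipschitz_measurable (lv j)) (bv j).
have IU i j : Int P (fun x => U i (c * S j x)).
  exact: Int_bS c j (lipschitz_measurable (t2_l (tU i))) (t2_b (tU i)).
have mv j : measurable_fun setT (fun x => v j (c * S j x)) := Int_meas (Iv j).
have ID2v j : Int P (fun x => D (iter j th x) ^+ 2 * v j (c * S j x)).
  by apply: (Int_mul_bounded (K := K) (iter_shift_Int th_pres j ID2)) => // x; exact: bv.
have -> : \sum_(0 <= j < n) (\int[P]_x U (n - j.+1)%N (c * S j.+1 x) - \int[P]_x U (n - j)%N (c * S j x)) =
  \sum_(0 <= j < n) A j + \sum_(0 <= j < n) B j +
  c ^+ 2 / 2 * \sum_(0 <= j < n) \int[P]_x ((D (iter j th x) ^+ 2 - sig2) * v j (c * S j x)).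
  rewrite mulr_sumr -!big_split/=; apply: eq_bigr => j _.
  have -> : \int[P]_x ((D (iter j th x) ^+ 2 - sig2) * v j (c * S j x)) =
     \int[P]_x (D (iter j th x) ^+ 2 * v j (c * S j x)) - sig2 * \int[P]_x v j (c * S j x).
    rewrite -EZ// -EB//; last exact: IntZ.
    by apply: eq_Rintegral => x _; rewrite mulrBl.
  rewrite /A /B; ring.
have hA j : `|A j| <= K * lind_err c.
  exact: (martingale_step c j (tU (n - j.+1)%N)).
have hB j : (j < n)%N -> `|B j| <= K * tau n.
  move=> jn.
  have -> : B j = - \int[P]_x (U (n - j)%N (c * S j x) - U (n - j.+1)%N (c * S j x) -
       n%:R^-1 * sig2 / 2 * v j (c * S j x)).
    rewrite EB; [|exact: IntB|exact: IntZ].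
    rewrite EB// EZ// /B c2; ring.
  rewrite normrN; apply: E_bound => [|x].
    by apply: IntB; [exact: IntB|exact: IntZ].
  have -> : (n - j = (n - j.+1).+1)%N by rewrite subnS prednK// subn_gt0.
  have := avg_step (I2 n) (m1 n) (m2 n0) (m3 n) (tU (n - j.+1)%N) (c * S j x).
  by rewrite [n%:R^-1 * sig2 / 2]mulrAC.
have hT := sum_bound K0 c0 an0 bv lv vv n L0.
apply: (le_trans (ler_normD _ _)); rewrite -!addrA; apply: (le_trans (lerD (ler_normD _ _) (lexx _))).
rewrite -addrA; apply: lerD.
  apply: (le_trans (ler_norm_sum _ _ _)).
  apply: (@le_trans _ _ (\sum_(0 <= j < n) K * lind_err c)); first by apply: ler_sum => j _; exact: hA.
  by rewrite sumr_const_nat subn0 mulr_natl mulrnAr.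
apply: lerD.
  apply: (le_trans (ler_norm_sum _ _ _)).
  apply: (@le_trans _ _ (\sum_(0 <= j < n) K * tau n)).
    by rewrite big_nat_cond [leRHS]big_nat_cond; apply: ler_sum => j; rewrite andbT => /andP[_]; exact: hB.
  by rewrite sumr_const_nat subn0 mulr_natl mulrnAr.
rewrite normrM c2 ger0_norm; last by rewrite mulr_ge0// invr_ge0.
set z := `|_| in hT *; have z0 : 0 <= z by exact: normr_ge0.
have n0' : 0 < n%:R :> R by rewrite ltr0n.
have nV : n%:R^-1 * n%:R = 1 :> R by rewrite mulVf// gt_eqF.
apply: (@le_trans _ _ (n%:R^-1 * z)).
  by rewrite ler_wpM2r// ler_piMr ?invr_ge0 ?(ltW n0')// invf_le1// ler1n.
apply: (le_trans (ler_wpM2l _ hT)); first by rewrite invr_ge0 ltW.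
by rewrite mulrDr (mulrA n%:R^-1 n%:R) nV mul1r -addrA.
Qed.

(** [hl] expresses that the [n]-fold convolution of [nu n] does not depend on [n], as for Gaussian
    laws of variance [sig2 / n]. [L] is chosen from the ergodic error first; all other terms of the
    bound vanish as [n] grows. *)
Lemma martingale_clt K u u1 u2 (l : R) : taylor2 K u u1 u2 ->
  (forall n, (0 < n)%N -> iter n (avg (nu n)) u 0 = l) ->
  \int[P]_x u ((sq n)^-1 * S n x) @[n --> \oo] --> l.
Proof.
move=> tu hl; have K0 := t2_K tu.
have sq0 : (sq n)^-1 @[n --> \oo] --> 0.
  apply/gtr0_cvgV0; last first.
    apply/cvgryPge => A; near=> n.
    rewrite /sq (le_trans (ler_norm A))// -sqrtr_sqr ler_sqrt//.
    near: n; exact: nbhs_infty_ger.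
  near=> n; rewrite sqrtr_gt0 ltr0n; near: n; exact: nbhs_infty_gt.
apply/cvgrPdist_le => e e0.
have e3 : 0 < e / 2 by rewrite divr_gt0.
have [L [L0 hL]] : exists L, (0 < L)%N /\ K * erg_err L <= e / 2.
  have : K * erg_err n @[n --> \oo] --> (K * 0 : R).
    apply: cvgM; first exact: cvg_cst.
    have := mean_ergodic th_pres th_ergodic ID2 (fun x => sqr_ge0 (D x)).
    by rewrite ED2.
  rewrite mulr0 => /cvgr_le /(_ _ e3) h.
  have [L [h1 h2]] := filter_ex (filterI h (nbhs_infty_gt 0)).
  by exists L.
pose err n := K * (n%:R * lind_err (sq n)^-1) + K * (n%:R * tau n) +
  L%:R^-1 * (\sum_(0 <= i < L) osc_err K (sq n)^-1 (a n) L i) +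
  n%:R^-1 * (L%:R * (2 * sig2 * K)).
have cerr : err n @[n --> \oo] --> (K * 0 + K * 0 + L%:R^-1 * (\sum_(0 <= i < L) 0) + 0 * (L%:R * (2 * sig2 * K)) : R).
  apply: cvgD; [apply: cvgD; [apply: cvgD|]|].
  - by apply: cvgM; [exact: cvg_cst|exact: lind_err_cvg].
  - by apply: cvgM; [exact: cvg_cst|exact: ctau].
  - apply: cvgM; first exact: cvg_cst.
    apply: cvg_bigsum => i; apply: osc_err_cvg => //.
    + by move=> n; rewrite invr_ge0 sqrtr_ge0.
    + by move=> n; apply: le_trans (ma n); exact: E_ge0.
  - apply: cvgM; last exact: cvg_cst.
    by rewrite -(cvg_shiftS (fun n : nat => n%:R^-1 : R))/=; exact: cvg_harmonic.
move: cerr; rewrite !mulr0 big1// mulr0 mul0r !addr0 => /cvgr_le /(_ _ e3) cerr.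
near=> n.
have n0 : (0 < n)%N by near: n; exact: nbhs_infty_gt.
rewrite distrC -(hl _ n0); apply: (le_trans (lindeberg_bound tu n0 L0)).
have : err n <= e / 2 by near: n.
rewrite /err; move: hL; lra.
Unshelve. all: by end_near. Qed.

End lindeberg.

End martingale_clt.

(** * Smooth approximation of continuous test functions *)

Section smoothing.
Context (R : realType).
Implicit Types f g F G H : R -> R.

Definition primitive_of F f := forall x : R, is_derive x 1 F (f x).

Lemma primitive_continuous F f : primitive_of F f -> continuous F.
Proof.
move=> h x; apply/differentiable_continuous/derivable1_diffP.
by have [] := h x.
Qed.

Lemma mean_value F f (x h : R) : primitive_of F f ->
  exists2 c, `|c - x| <= `|h| & F (x + h) - F x = f c * h.
Proof.
move=> Ff; have cF := primitive_continuous Ff.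
have [h0|h0|->] := ltgtP h 0; last by exists x; rewrite ?subrr ?normr0// addr0 subrr mulr0.
  have xh : x + h < x by rewrite gtrDl.
  have [c] := @MVT R F f _ _ xh (fun y _ => Ff y) (continuous_subspaceT cF).
  rewrite in_itv/= => /andP[c1 c2] e; exists c.
    by rewrite (ltr0_norm h0) ltr0_norm; lra.
  by rewrite -[LHS]opprB e; ring.
have xh : x < x + h by rewrite ltrDl.
have [c] := @MVT R F f _ _ xh (fun y _ => Ff y) (continuous_subspaceT cF).
rewrite in_itv/= => /andP[c1 c2] e; exists c.
  by rewrite (gtr0_norm h0) gtr0_norm; lra.
by rewrite e; ring.
Qed.

Lemma primitive_lipschitz F f K : primitive_of F f -> (forall x, `|f x| <= K) -> lipschitz_by K F.
Proof.
move=> Ff bf x h; have [c _ ->] := mean_value x h Ff.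
by rewrite normrM ler_wpM2r.
Qed.

Lemma primitive_shift F f e : primitive_of F f ->
  primitive_of (fun x => F (x + e)) (fun x => f (x + e)).
Proof.
move=> Ff x.
have Fx := Ff (x + e).
have Dx : is_derive x 1 (fun y : R => y + e) (1 + 0) by apply: is_deriveD.
by have := @is_derive1_comp R F (fun y => y + e) x _ _ Fx Dx; rewrite addr0 mulr1.
Qed.

Lemma primitiveB F f G g : primitive_of F f -> primitive_of G g ->
  primitive_of (fun x => F x - G x) (fun x => f x - g x).
Proof. by move=> Ff Gg x; have [? ?] := (Ff x, Gg x); exact: is_deriveB. Qed.

Lemma primitiveZ c F f : primitive_of F f -> primitive_of (fun x => c * F x) (fun x => c * f x).
Proof. by move=> Ff x; have ? := Ff x; exact: is_deriveZ. Qed.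

Definition dif e F (x : R) := F (x + e) - F x.

Lemma primitive_dif e F f : primitive_of F f -> primitive_of (dif e F) (dif e f).
Proof. by move=> Ff; apply: primitiveB => //; exact: primitive_shift. Qed.

Lemma dif_mv e F f x : primitive_of F f -> exists2 c, `|c - x| <= `|e| & dif e F x = f c * e.
Proof. by move=> Ff; exact: mean_value. Qed.

Lemma dif_bound e F K : (forall x, `|F x| <= K) -> forall x, `|dif e F x| <= 2 * K.
Proof.
move=> bF x; apply: (le_trans (ler_normB _ _)).
by rewrite mulrDl mul1r; exact: lerD.
Qed.

(** The remainder [r] has derivative [r'], so two mean value theorems write [r h] as
    [c * (u2 z - u2 x) * h] with [|c| <= |h|]. The difference of [u2] is at most [2 * K], and at
    most [K * |h|] through [u3]; the former explains the doubled constant. *)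
Lemma taylor2_primitives K u u1 u2 u3 : 0 <= K -> primitive_of u u1 -> primitive_of u1 u2 -> primitive_of u2 u3 ->
  (forall x, `|u x| <= K) -> (forall x, `|u1 x| <= K) -> (forall x, `|u2 x| <= K) -> (forall x, `|u3 x| <= K) ->
  taylor2 (2 * K) u u1 u2.
Proof.
move=> K0 p p1 p2 b b1 b2 b3.
have K2 : K <= 2 * K by rewrite ler_peMl// ler1n.
have l2 := primitive_lipschitz p2 b3.
have w v : (forall x, `|v x| <= K) -> forall x, `|v x| <= 2 * K by move=> h x; exact: le_trans (h x) K2.
have lw v : lipschitz_by K v -> lipschitz_by (2 * K) v.
  by move=> h x y; apply: le_trans (h x y) _; rewrite ler_wpM2r.
split; try exact: w.
- by rewrite mulr_ge0.
- exact/lw/(primitive_lipschitz p).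
- exact/lw/(primitive_lipschitz p1).
- exact/lw.
move=> x h.
pose r t := u (x + t) - u x - t * u1 x - t ^+ 2 / 2 * u2 x.
pose r' t := u1 (x + t) - u1 x - t * u2 x.
have rr : primitive_of r r'.
  move=> t.
  have D0 : is_derive t 1 (fun s : R => x + s) (0 + 1) by apply: is_deriveD.
  have Du := @is_derive1_comp R u (fun s => x + s) t _ _ (p (x + t)) D0.
  rewrite add0r mulr1 in Du.
  have Dt : is_derive t 1 (fun s : R => s * u1 x) (u1 x).
    have := is_deriveM (is_derive_id t 1) (is_derive_cst (u1 x) t 1).
    by rewrite scaler0 add0r => h1; apply: is_derive_eq h1 _; rewrite /GRing.scale/= mulr1.
  have Dt2 : is_derive t 1 (fun s : R => s ^+ 2 / 2 * u2 x) (t * u2 x).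
    have := is_deriveZ (u2 x / 2) (is_deriveX 2 (is_derive_id t 1)) .
    move=> h1; have -> : (fun s : R => s ^+ 2 / 2 * u2 x) = (u2 x / 2) \*: (fun s => s ^+ 2).
      by apply/funext => s; transitivity (u2 x / 2 * s ^+ 2); [field|].
    by apply: is_derive_eq h1 _; rewrite /GRing.scale/= mulr1 expr1; field.
  have := is_deriveB (is_deriveB (is_deriveB Du (is_derive_cst (u x) t 1)) Dt) Dt2.
  by rewrite subr0.
have r0 : r 0 = 0 by rewrite /r addr0 subrr mul0r expr0n/= mul0r mul0r !subr0.
have [c hc] := mean_value 0 h rr.
rewrite add0r r0 !subr0 in hc * => e.
rewrite -/(r h) e normrM.
have [z hz ez] := mean_value x c p1.
have -> : r' c = c * (u2 z - u2 x) by rewrite /r' ez; ring.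
have q1 : `|u2 z - u2 x| <= 2 * K.
  by apply: (le_trans (ler_normB _ _)); rewrite mulrDl mul1r; exact: lerD.
have q2 : `|u2 z - u2 x| <= K * `|h|.
  have := l2 x (z - x); rewrite [x + _]addrC subrK => q; apply: (le_trans q).
  by rewrite ler_wpM2l// (le_trans hz).
have q3 : `|u2 z - u2 x| <= 2 * K * Num.min 1 `|h|.
  rewrite /Num.min; case: ifP => _; first by rewrite mulr1.
  by apply: (le_trans q2); rewrite ler_wpM2r.
rewrite normrM -[h ^+ 2]real_normK ?num_real// expr2.
rewrite (_ : 2 * K * (`|h| * `|h| * Num.min 1 `|h|) = `|h| * (2 * K * Num.min 1 `|h|) * `|h|); last by ring.
by rewrite ler_wpM2r// ler_pM.
Qed.

(** Vanishing on a left half-line makes the integral from minus infinity finite, and the primitive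
    inherits it, so the construction can be iterated. *)
Lemma exists_primitive f (a : R) : continuous f -> (forall x, x <= a -> f x = 0) ->
  exists2 F, primitive_of F f & forall x, x <= a -> F x = 0.
Proof.
move=> cf f0.
pose F x : R := \int[lebesgue_measure]_(t in [set` `]-oo, x]]) f t.
have mf : measurable_fun setT f by exact: continuous_measurable_fun.
have If u : lebesgue_measure.-integrable [set` `]-oo, u]] (EFin \o f).
  rewrite integrable_mkcond//; have -> : (EFin \o f) \_ `]-oo, u]%classic = (EFin \o f) \_ `[a, u]%classic.
    apply/funext => x; rewrite !patchE; case: ifPn => h1; case: ifPn => h2 //.
      have xa : x <= a.
        have [//|ax] := leP x a; exfalso; move: h2 => /negP; apply.
        by move: h1; rewrite !inE/= !in_itv/= (ltW ax).
      by rewrite /= f0.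
    exfalso; move: h1 => /negP; apply.
    by move: h2; rewrite !inE/= !in_itv/= => /andP[].
  rewrite -integrable_mkcond//; apply: continuous_compact_integrable; first exact: segment_compact.
  exact: continuous_subspaceT.
exists F => x; last first.
  move=> xa; rewrite /F; under eq_Rintegral => t.
    rewrite inE/= in_itv/= => tx; rewrite f0; last exact: le_trans xa.
    over.
  by rewrite /Rintegral integral0.
have xx : x < x + 1 by rewrite ltrDl.
have ny : (-oo%O < BRight x)%E by exact: ltNyr.
have [dF eF] := @continuous_FTC1 R f -oo%O x (x + 1) xx (If _) ny (cf x).
have eF' : 'D_1 F x = f x by rewrite -derive1E; exact: eF.
exact: DeriveDef dF eF'.
Qed.

(* [u] is the third difference quotient of a third primitive of [f]. *)
Lemma smooth_approx f (a C : R) : continuous f -> (forall x, x <= a -> f x = 0) ->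
  (forall x, `|f x| <= C) -> forall e : R, 0 < e ->
  exists K u u1 u2, taylor2 K u u1 u2 /\ forall x, exists2 y, `|y - x| <= 3 * e & u x = f y.
Proof.
move=> cf f0 bf e e0.
have [F pF F0] := exists_primitive cf f0.
have [G pG G0] := exists_primitive (primitive_continuous pF) F0.
have [H pH _] := exists_primitive (primitive_continuous pG) G0.
pose D3 (g : R -> R) := dif e (dif e (dif e g)).
pose c := e^-1 ^+ 3.
(* Each mean value theorem removes one difference and one primitive, gains a factor [e] and moves
   the point by at most [e]; hence the normalization [c = e^-1 ^+ 3] and the radius [3 * e]. *)
have mv3 x : exists2 y, `|y - x| <= 3 * e & D3 H x = f y * e ^+ 3.
  have [y1 h1 e1] := dif_mv e x (primitive_dif e (primitive_dif e pH)).
  have [y2 h2 e2] := dif_mv e y1 (primitive_dif e pG).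
  have [y3 h3 e3] := dif_mv e y2 pF.
  rewrite !(gtr0_norm e0) in h1 h2 h3.
  exists y3; last by rewrite /D3 e1 e2 e3 !exprS expr0; ring.
  have := ler_normD (y3 - y2) (y2 - x); rewrite addrA subrK => h4.
  have := ler_normD (y2 - y1) (y1 - x); rewrite addrA subrK => h5.
  lra.
have C0 : 0 <= C by exact: le_trans (normr_ge0 _) (bf 0).
have b3 : forall x, `|D3 f x| <= 2 * (2 * (2 * C)) by do 3 apply: dif_bound.
(* In the bounds below, the mean value theorem removes as many differences as there are primitives;
   the triangle inequality handles the others, with a factor 2 each. *)
have bF x : `|dif e F x| <= C * e.
  have [y _ ->] := dif_mv e x pF; by rewrite normrM (gtr0_norm e0) ler_wpM2r// ltW.
have b2 : forall x, `|D3 F x| <= 2 * (2 * (C * e)) by do 2 apply: dif_bound.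
have bG x : `|dif e (dif e G) x| <= C * e * e.
  have [y _ ->] := dif_mv e x (primitive_dif e pG).
  by rewrite normrM (gtr0_norm e0) ler_wpM2r// ltW.
have b1 : forall x, `|D3 G x| <= 2 * (C * e * e) by apply: dif_bound.
have b0 x : `|D3 H x| <= C * e ^+ 3.
  have [y _ ->] := mv3 x; rewrite normrM (gtr0_norm (exprn_gt0 3 e0)).
  by rewrite ler_wpM2r// exprn_ge0// ltW.
pose K := `|c| * (2 * (2 * (2 * C)) + 2 * (2 * (C * e)) + 2 * (C * e * e) + C * e ^+ 3).
have e0' := ltW e0.
have p0 : 0 <= 2 * (2 * (2 * C)) by rewrite !mulr_ge0.
have p1 : 0 <= 2 * (2 * (C * e)) by rewrite !mulr_ge0.
have p2 : 0 <= 2 * (C * e * e) by rewrite !mulr_ge0.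
have p3 : 0 <= C * e ^+ 3 by rewrite mulr_ge0// exprn_ge0.
exists (2 * K), (fun x => c * D3 H x), (fun x => c * D3 G x), (fun x => c * D3 F x); split.
  apply: (@taylor2_primitives K _ _ _ (fun x => c * D3 f x)).
  - by rewrite /K mulr_ge0// !addr_ge0.
  - by apply: primitiveZ; do 3 apply: primitive_dif.
  - by apply: primitiveZ; do 3 apply: primitive_dif.
  - by apply: primitiveZ; do 3 apply: primitive_dif.
  - by move=> x; rewrite normrM /K ler_wpM2l//; have := b0 x; lra.
  - by move=> x; rewrite normrM /K ler_wpM2l//; have := b1 x; lra.
  - by move=> x; rewrite normrM /K ler_wpM2l//; have := b2 x; lra.
  - by move=> x; rewrite normrM /K ler_wpM2l//; have := b3 x; lra.
move=> x; have [y hy ey] := mv3 x; exists y => //.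
by rewrite ey /c exprVn mulrC mulfK// expf_neq0// gt_eqF.
Qed.

(** Heine's theorem. Pairs of nearby points violating uniform continuity stay bounded, since [f]
    vanishes at both points of a pair lying far out; their common limit along an ultrafilter
    contradicts continuity. *)
Lemma compact_support_unif f (L : R) : continuous f -> (forall x, L <= `|x| -> f x = 0) ->
  forall e : R, 0 < e -> exists2 dl, 0 < dl & forall x y, `|x - y| <= dl -> `|f x - f y| <= e.
Proof.
move=> cf f0 e e0; apply: contrapT => hn.
have seqE (n : nat) : exists xy : R * R, `|xy.1 - xy.2| <= n.+1%:R^-1 /\ e < `|f xy.1 - f xy.2|.
  apply: contrapT => hn'; apply: hn; exists n.+1%:R^-1; first by rewrite invr_gt0.
  move=> x y hxy; rewrite leNgt; apply/negP => h; apply: hn'; by exists (x, y).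
have {seqE} /choice[xy xyP] := seqE.
have bx n : `|(xy n).1| <= `|L| + 1.
  have [h1 h2] := xyP n; rewrite leNgt; apply/negP => hx.
  have l1 := ler_norm L.
  have i1 : n.+1%:R^-1 <= 1 :> R by rewrite invf_le1// ler1n.
  have i2 := le_trans h1 i1.
  have hy : L <= `|(xy n).2|.
    have := ler_normD ((xy n).1 - (xy n).2) (xy n).2; rewrite subrK; lra.
  have hx' : L <= `|(xy n).1| by lra.
  by move: h2; rewrite !f0// subrr normr0; lra.
have [U [UU sU]] := ultraFilterLemma (@eventually_filter).
have PU : ProperFilter U by exact: ultra_proper.
have [x0 cx] := ultra_bounded_cvg UU bx.
have n0 : n.+1%:R^-1 @[n --> U] --> (0 : R) by move=> B hB; apply: sU; exact: (@cvg_harmonic R) hB.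
have cd : (xy n).1 - (xy n).2 @[n --> U] --> (0 : R).
  apply: norm_cvg0; apply: (@squeeze_cvgr _ _ _ _ (fun=> 0) (fun n => n.+1%:R^-1)) => //.
  - by apply: filterE => n; rewrite normr_ge0/=; case: (xyP n).
  - exact: cvg_cst.
have cy : (xy n).2 @[n --> U] --> x0.
  have -> : (fun n => (xy n).2) = (fun n => (xy n).1 - ((xy n).1 - (xy n).2)).
    by apply/funext => n; rewrite subKr.
  by rewrite -[X in _ --> X]subr0; exact: cvgB.
have cf1 : f (xy n).1 @[n --> U] --> f x0 by apply: continuous_cvg => //; exact: cf.
have cf2 : f (xy n).2 @[n --> U] --> f x0 by apply: continuous_cvg => //; exact: cf.
have c3 : `|f (xy n).1 - f (xy n).2| @[n --> U] --> (0 : R).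
  by rewrite -(normr0 R) -(subrr (f x0)); apply: cvg_norm; exact: cvgB.
have h : \forall n \near U, `|f (xy n).1 - f (xy n).2| <= e by move/cvgr_le : c3; apply.
have [n hnn] := filter_ex h.
by have [_] := xyP n; rewrite ltNge hnn.
Qed.

End smoothing.

(** * Gaussian laws: density, convolution, moments, scaling *)

Section gaussian.
Context (R : realType).
Local Notation mu := (@lebesgue_measure R).
Implicit Types (f : R -> R) (s a b : R).

(** Change of measure through the Radon-Nikodym derivative with respect to Lebesgue measure, which
    agrees almost everywhere with [normal_pdf] because both have the same integral on every
    measurable set. *)
Lemma ge0_integral_normal m s f : s != 0 -> measurable_fun setT f -> (forall x, 0 <= f x) ->
  (\int[normal_prob m s]_x (f x)%:E = \int[mu]_x (f x * normal_pdf m s x)%:E)%E.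
Proof.
move=> s0 mf f0.
have dom := @normal_prob_dominates R m s.
have mfE : measurable_fun setT (EFin \o f) by exact/measurable_EFinP.
have f0E x : (0 <= (EFin \o f) x)%E by rewrite lee_fin.
rewrite -(@Radon_Nikodym_SigmaFinite.change_of_variables _ _ _ (normal_prob m s) mu dom (EFin \o f) setT f0E measurableT mfE).
apply: ae_eq_integral => //.
- apply: emeasurable_funM => //; apply: measurable_int.
  exact: Radon_Nikodym_SigmaFinite.f_integrable.
- by apply/measurable_EFinP/measurable_funM => //; exact: measurable_normal_pdf.
have : ae_eq mu setT (Radon_Nikodym_SigmaFinite.f (normal_prob m s) mu) (fun x => (normal_pdf m s x)%:E).
  apply: integral_ae_eq => //.
  - exact: Radon_Nikodym_SigmaFinite.f_integrable.
  - by apply/measurable_EFinP; exact: measurable_normal_pdf.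
  - by move=> A _ mA; rewrite -Radon_Nikodym_SigmaFinite.f_integral.
by apply: filterS => x /= + _ => /(_ I) ->; rewrite EFinM.
Qed.

Lemma affine_substitution f (c e : R) : 0 < c -> continuous f -> (forall x, 0 <= f x) ->
  (\int[mu]_x (f x)%:E = \int[mu]_x (f (c * x + e) * c)%:E)%E.
Proof.
move=> c0 cf f0; pose F (x : R) := c * x + e.
have dF (x : R) : is_derive x 1 F c.
  have := is_deriveD (is_deriveZ c (is_derive_id x 1)) (is_derive_cst e x 1).
  by rewrite addr0 /GRing.scale/= mulr1.
have F'E : F^`()%classic = cst c by apply/funext => x; rewrite derive1E; exact: derive_val.
rewrite (@increasing_ge0_integration_by_substitutionT R F f) ?F'E//.
- by move=> x y xy; rewrite /F ltrD2r ltr_pM2l.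
- by move=> x; exact: cvg_cst.
- exact: is_cvg_cst.
- exact: is_cvg_cst.
- apply/cvgrNyPle => A; near=> x.
  rewrite /F -lerBrDr mulrC -ler_pdivlMr//; near: x; exact: nbhs_ninfty_le.
- apply/cvgryPge => A; near=> x.
  rewrite /F -lerBlDr mulrC -ler_pdivrMr//; near: x; exact: nbhs_pinfty_ge.
Unshelve. all: by end_near. Qed.

Definition std_pdf : R -> R := normal_pdf 0 1.
Local Notation p := std_pdf.

Lemma pE x : p x = normal_peak 1 * expR (- x ^+ 2 / 2).
Proof. by rewrite /std_pdf normal_pdfE ?oner_neq0// /normal_fun subr0 expr1n. Qed.

Lemma p_ge0 x : 0 <= p x. Proof. exact: normal_pdf_ge0. Qed.

Lemma p_cont : continuous p. Proof. by apply: continuous_normal_pdf; rewrite oner_neq0. Qed.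

Lemma normal_peakE s : 0 < s -> normal_peak s = normal_peak 1 / s.
Proof.
move=> s0; rewrite /normal_peak expr1n mul1r -mulrnAr sqrtrM ?sqr_ge0// sqrtr_sqr gtr0_norm//.
by rewrite invfM mulrC.
Qed.

Lemma normal_pdf_scale m s x : 0 < s -> normal_pdf m s x = p ((x - m) / s) / s.
Proof.
move=> s0; rewrite normal_pdfE ?gt_eqF// /normal_fun pE normal_peakE//.
rewrite (_ : - (x - m) ^+ 2 / (s ^+ 2 *+ 2) = - ((x - m) / s) ^+ 2 / 2); first by ring.
by rewrite -mulr_natr; field; rewrite gt_eqF.
Qed.

Lemma comp_affine_cont f (c e : R) : continuous f -> continuous (fun x : R => f (c * x + e)).
Proof.
move=> cf x; apply: continuous_comp; last exact: cf.
by apply: cvgD; [apply: cvgM; [exact: cvg_cst|exact: cvg_id]|exact: cvg_cst].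
Qed.

Lemma prod_cont f g : continuous f -> continuous g -> continuous (fun x : R => f x * g x : R).
Proof. by move=> cf cg x; apply: cvgM; [exact: cf|exact: cg]. Qed.

Lemma ge0_normal_scale s f : 0 < s -> continuous f -> (forall x, 0 <= f x) ->
  (\int[normal_prob 0 s]_x (f x)%:E = \int[normal_prob 0 1%R]_x (f (s * x))%:E)%E.
Proof.
move=> s0 cf f0.
have mf : measurable_fun setT f by exact: continuous_measurable_fun.
have sn : s != 0 by rewrite gt_eqF.
have mfs : measurable_fun setT (fun x => f (s * x)).
  by apply: measurableT_comp => //; exact: measurable_funM.
rewrite (ge0_integral_normal 0 sn mf f0) (ge0_integral_normal 0 (oner_neq0 R) mfs (fun x => f0 _)).
have cg : continuous (fun x => f x * normal_pdf 0 s x).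
  by apply: prod_cont => //; apply: continuous_normal_pdf; rewrite gt_eqF.
have g0 x : 0 <= f x * normal_pdf 0 s x by rewrite mulr_ge0// normal_pdf_ge0.
rewrite (affine_substitution 0 s0 cg g0).
apply: eq_integral => x _; rewrite addr0 normal_pdf_scale// subr0 -/std_pdf.
have -> : s * x / s = x by field; rewrite gt_eqF.
by congr (_%:E); field; rewrite gt_eqF.
Qed.

(** In the variables [z] and [y = a z + b w] the joint density factors into the density of [y],
    centered with deviation [c], and the conditional density of [z], normal with mean [a y / c^2]
    and deviation [b / c]. After exchanging the integrals, the latter integrates to 1. *)
Lemma gaussian_convolution_density (a b c x : R) (u : R -> R) : 0 < a -> 0 < b -> 0 < c -> c ^+ 2 = a ^+ 2 + b ^+ 2 ->
  continuous u -> (forall x, 0 <= u x) ->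
  (\int[mu]_z ((p z)%:E * \int[mu]_w (u (x + (a * z + b * w)) * p w)%:E) =
   \int[mu]_z (u (x + c * z) * p z)%:E)%E.
Proof.
move=> a0 b0 c0 cE cu u0.
have mu_ : measurable_fun setT u by exact: continuous_measurable_fun.
have mp : measurable_fun setT p by exact: measurable_normal_pdf.
have bn : b != 0 by rewrite gt_eqF.
have cn : c != 0 by rewrite gt_eqF.
have inner z : (\int[mu]_w (u (x + (a * z + b * w)) * p w)%:E =
   \int[mu]_y (u (x + y) * (p ((y - a * z) / b) / b))%:E)%E.
  rewrite (@affine_substitution (fun w => u (x + (a * z + b * w)) * p w) b^-1 (- (a * z / b)))//.
  - apply: eq_integral => y _; rewrite -mulrA; congr (u _ * (p _ / _))%:E.
      by congr (x + _); field.
    by field.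
  - by rewrite invr_gt0.
  - apply: prod_cont; last exact: p_cont.
    have := @comp_affine_cont u b (x + a * z) cu.
    by under eq_fun do rewrite addrC -addrA.
  - by move=> w; rewrite mulr_ge0// p_ge0.
pose G (zy : R * R) : \bar R := (u (x + zy.2) * (p zy.1 * (p ((zy.2 - a * zy.1) / b) / b)))%:E.
have mG : measurable_fun setT G.
  apply/measurable_EFinP; apply: measurable_funM.
    by apply: measurableT_comp => //; apply: measurable_funD => //; exact: measurable_snd.
  apply: measurable_funM; first by apply: measurableT_comp => //; exact: measurable_fst.
  apply: measurable_funM => //; apply: measurableT_comp => //.
  apply: measurable_funM => //; apply: measurable_funB; first exact: measurable_snd.
  by apply: measurable_funM => //; exact: measurable_fst.
have G0 zy : (0 <= G zy)%E by rewrite lee_fin !mulr_ge0 ?p_ge0 ?invr_ge0// ltW.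
transitivity (\int[mu]_z \int[mu]_y G (z, y))%E.
  apply: eq_integral => z _; rewrite inner -ge0_integralZl//.
  - by apply: eq_integral => y _; rewrite /G/= -EFinM; congr (_%:E); ring.
  - apply/measurable_EFinP; apply: measurable_funM.
      by apply: measurableT_comp => //; exact: measurable_funD.
    apply: measurable_funM => //; apply: measurableT_comp => //.
    by apply: measurable_funM => //; exact: measurable_funB.
  - by move=> y _; rewrite lee_fin !mulr_ge0 ?p_ge0 ?invr_ge0// ltW.
  - by rewrite lee_fin p_ge0.
rewrite (@fubini_tonelli _ _ _ _ _ mu mu G mG G0).
transitivity (\int[mu]_y (u (x + y) * (p (y / c) / c))%:E)%E.
  apply: eq_integral => y _.
  have ident z : p z * (p ((y - a * z) / b) / b) = p (y / c) / c * normal_pdf (a * y / c ^+ 2) (b / c) z.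
    rewrite normal_pdf_scale ?divr_gt0// !pE.
    rewrite (_ : normal_peak 1 * expR (- z ^+ 2 / 2) * (normal_peak 1 * expR (- ((y - a * z) / b) ^+ 2 / 2) / b) =
       normal_peak 1 ^+ 2 / b * (expR (- z ^+ 2 / 2) * expR (- ((y - a * z) / b) ^+ 2 / 2))); last by ring.
    rewrite (_ : normal_peak 1 * expR (- (y / c) ^+ 2 / 2) / c *
       (normal_peak 1 * expR (- ((z - a * y / c ^+ 2) / (b / c)) ^+ 2 / 2) / (b / c)) =
       normal_peak 1 ^+ 2 / b * (expR (- (y / c) ^+ 2 / 2) * expR (- ((z - a * y / c ^+ 2) / (b / c)) ^+ 2 / 2))); last first.
      by field; rewrite cn bn.
    congr (_ * _); rewrite -!expRD; congr expR.
    (* Completing the square: the coefficients of [z ^+ 2] and [y ^+ 2] in the difference of the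
       exponents vanish by this relation. *)
    have aE : a ^+ 2 = c ^+ 2 - b ^+ 2 by rewrite cE addrK.
    apply/eqP; rewrite -subr_eq0; apply/eqP.
    rewrite (_ : _ - _ = (- z ^+ 2 * (b ^+ 2 + a ^+ 2 - c ^+ 2) / b ^+ 2 + y ^+ 2 * (c ^+ 2 * b ^+ 2 - c ^+ 4 + c ^+ 2 * a ^+ 2) / (c ^+ 4 * b ^+ 2)) / 2); last first.
      by field; rewrite cn bn.
    by rewrite aE; field; rewrite cn bn.
  rewrite (_ : (fun z => G (z, y)) = (fun z => (u (x + y) * (p (y / c) / c))%:E * (normal_pdf (a * y / c ^+ 2) (b / c) z)%:E)%E); last first.
    by apply/funext => z; rewrite /G/= ident -EFinM mulrA.
  rewrite ge0_integralZl//.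
  - by rewrite integral_normal_pdf mule1.
  - by apply/measurable_EFinP; exact: measurable_normal_pdf.
  - by move=> z _; rewrite lee_fin normal_pdf_ge0.
  - by rewrite lee_fin !mulr_ge0 ?p_ge0 ?invr_ge0// ltW.
rewrite (@affine_substitution (fun y => u (x + y) * (p (y / c) / c)) c 0)//.
- apply: eq_integral => z _; rewrite addr0; congr (_%:E).
  by rewrite (_ : c * z / c = z); field.
- apply: prod_cont.
    have := @comp_affine_cont u 1 x cu.
    by under eq_fun do rewrite mul1r addrC.
  apply: prod_cont; last by move=> ?; exact: cvg_cst.
  have := @comp_affine_cont p c^-1 0 p_cont.
  by under eq_fun do rewrite addr0 mulrC.
- by move=> y; rewrite !mulr_ge0 ?p_ge0 ?invr_ge0// ltW.
Qed.

Lemma ge0_normal01 f : measurable_fun setT f -> (forall x, 0 <= f x) ->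
  (\int[normal_prob 0 1%R]_x (f x)%:E = \int[mu]_x (f x * p x)%:E)%E.
Proof. by move=> mf f0; rewrite (ge0_integral_normal 0 (oner_neq0 R) mf f0). Qed.

Local Notation g := (normal_prob 0 1 : probability (measurableTypeR R) R).

Lemma gaussian_convolution (a b c x K : R) (u : R -> R) : 0 < a -> 0 < b -> 0 < c -> c ^+ 2 = a ^+ 2 + b ^+ 2 ->
  lipschitz_by K u -> (forall x, `|u x| <= K) ->
  \int[g]_z (\int[g]_w u (x + (a * (z : R) + b * (w : R)))) = \int[g]_z u (x + c * (z : R)).
Proof.
move=> a0 b0 c0 cE lu bu.
have K0 : 0 <= K by exact: le_trans (normr_ge0 _) (bu 0).
have mu0 := lipschitz_measurable lu.
(* Adding the bound [K] makes the integrand nonnegative, as the density formula requires; it is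
   subtracted again at the end. *)
pose v y := u y + K.
have v0 y : 0 <= v y by have := bu y; rewrite ler_norml /v; lra.
have cu : continuous u := lipschitz_continuous lu.
have cv : continuous v by move=> y; apply: cvgD; [exact: cu|exact: cvg_cst].
have mv : measurable_fun setT v by exact: continuous_measurable_fun.
have Iu (h : R -> R) : measurable_fun setT h -> Int g (fun w : R => u (h w)).
  by move=> mh; apply: (@Int_bounded _ _ _ g _ K) => [|y]; [exact: measurableT_comp|exact: bu].
have Ic (k : R) : Int g (fun _ : R => k) := Int_cst g k.
have maff (k q : R) : measurable_fun setT (fun w : R => x + (q + k * w)).
  by apply: measurable_funD => //; apply: measurable_funD => //; exact: measurable_funM.
have maff1 (k : R) : measurable_fun setT (fun w : R => x + k * w).
  by apply: measurable_funD => //; exact: measurable_funM.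
have Iz z : Int g (fun w : R => u (x + (a * z + b * w))) := Iu _ (maff b (a * z)).
pose h (z : R) := \int[g]_w u (x + (a * z + b * (w : R))).
have mh : measurable_fun setT h.
  apply: (@lipschitz_measurable R (K * `|a|)) => z e.
  rewrite /h -EB; [|exact: Iz|exact: Iz].
  apply: E_bound => [|w]; first by apply: IntB; exact: Iz.
  rewrite (_ : x + (a * (z + e) + b * w) = x + (a * z + b * w) + a * e); last by ring.
  by apply: (le_trans (lu _ _)); rewrite normrM mulrA.
have hK z : \int[g]_w v (x + (a * z + b * (w : R))) = h z + K.
  by rewrite ED ?E_cst//; exact: Iz.
have hv z : (\int[mu]_w (v (x + (a * z + b * w)) * p w)%:E = (h z + K)%:E)%E.
  rewrite -ge0_normal01//; last by apply: measurableT_comp => //; exact: maff.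
  rewrite E_EFin ?hK//; apply: IntD => //; exact: Iz.
have bh z : `|h z| <= K by apply: E_bound => [|w]; [exact: Iz|exact: bu].
have Ih : Int g (fun z : R => h z) by exact: (@Int_bounded _ _ _ g _ K mh bh).
have := @gaussian_convolution_density a b c x v a0 b0 c0 cE cv v0.
under eq_integral => z _ do rewrite hv -EFinM mulrC.
have hp z : 0 <= h z + K by have := bh z; rewrite ler_norml; lra.
have mhK : measurable_fun setT (fun z => h z + K) by exact: measurable_funD.
have mvc : measurable_fun setT (fun z => v (x + c * z)) by apply: measurableT_comp => //; exact: maff1.
rewrite -(ge0_normal01 mhK hp) -(ge0_normal01 mvc (fun z => v0 _)).
rewrite E_EFin; last exact: IntD.
have Ix1 : Int g (fun w : R => u (x + c * w)) := Iu _ (maff1 c).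
rewrite E_EFin; last exact: IntD.
move=> [] e1; apply: (addIr K).
by rewrite -[in LHS](E_cst g K) -[in RHS](E_cst g K) -!ED.
Unshelve. all: by end_near. Qed.

Lemma p_is_derive (x : R) : is_derive x 1 p (- x * p x).
Proof.
have -> : p = (fun y => normal_peak 1 * expR (- y ^+ 2 / 2)) by apply/funext => y; rewrite pE.
have D1 : is_derive x 1 (fun y : R => - y ^+ 2 / 2) (- x).
  have := is_deriveZ (- 2^-1) (is_deriveX 2 (is_derive_id x 1)).
  move=> h1; have -> : (fun s : R => - s ^+ 2 / 2) = (- 2^-1) \*: (fun s => s ^+ 2).
    by apply/funext => s; transitivity (- 2^-1 * s ^+ 2); [field|].
  by apply: is_derive_eq h1 _; rewrite /GRing.scale/= mulr1 expr1; field.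
have D2 := @is_derive1_comp R (@expR R) (fun y : R => - y ^+ 2 / 2) x _ _ (is_derive_expR _) D1.
have := is_deriveZ (normal_peak 1) D2 => h1.
by apply: is_derive_eq h1 _; rewrite /GRing.scale/=; ring.
Qed.

Lemma xp_is_derive (x : R) : is_derive x 1 (fun y : R => - (y * p y)) ((x ^+ 2 - 1) * p x).
Proof.
have := is_deriveN (is_deriveM (is_derive_id x 1) (p_is_derive x)) => h1.
by apply: is_derive_eq h1 _; rewrite /GRing.scale/=; ring.
Qed.

Lemma xp_cvg : - (x * p x) @[x --> +oo] --> (0 : R).
Proof.
rewrite -[X in _ --> X]oppr0; apply: cvgN.
apply: (@squeeze_cvgr _ _ _ _ (fun=> 0) (fun x => 2 * normal_peak 1 * x^-1)).
- near=> x; have x0 : 0 < x by near: x; exact: nbhs_pinfty_gt.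
  rewrite mulr_ge0 ?p_ge0 ?(ltW x0)//= pE.
  have e1 := expR_ge1Dx (x ^+ 2 / 2).
  have e2 : expR (- x ^+ 2 / 2) <= 2 / x ^+ 2.
    rewrite mulNr expRN invf_ple ?posrE ?expR_gt0 ?divr_gt0 ?exprn_gt0//.
    by rewrite invf_div; apply: le_trans e1; rewrite lerDr.
  rewrite (_ : 2 * normal_peak 1 / x = x * (normal_peak 1 * (2 / x ^+ 2))); last first.
    by field; rewrite gt_eqF.
  by rewrite !ler_wpM2l ?normal_peak_ge0 ?(ltW x0).
- exact: cvg_cst.
- rewrite -[X in _ --> X](mulr0 (2 * normal_peak 1)); apply: cvgM; first exact: cvg_cst.
  apply/gtr0_cvgV0; last exact: cvg_id.
  exact: nbhs_pinfty_gt.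
Unshelve. all: by end_near. Qed.

Lemma sq_cont : continuous (fun x : R => x ^+ 2 : R).
Proof. by move=> x; exact: exprn_continuous. Qed.

(** [(x^2 - 1) p] is the derivative of [- x p], which vanishes at 0 and at infinity, so [x^2 p] and
    [p] have the same integral on the half-line. The cut at 1, where [x^2 - 1] changes sign, keeps
    all integrands nonnegative: each side contributes [p 1], once to either integral. *)
Lemma std_normal_second_moment : (\int[g]_x (x ^+ 2)%:E = 1)%E.
Proof.
rewrite ge0_normal01 => [||x]; [|exact: measurable_funX|exact: sqr_ge0].
have mp : measurable_fun setT p by exact: measurable_normal_pdf.
have mx2p : measurable_fun setT (fun x : R => x ^+ 2 * p x) by apply: measurable_funM => //; exact: measurable_funX.
have cx2p : continuous (fun x : R => x ^+ 2 * p x) by apply: prod_cont; [exact: sq_cont|exact: p_cont].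
have peven x : p (- x) = p x by rewrite !pE sqrrN.
have x2p0 x : 0 <= x ^+ 2 * p x by rewrite mulr_ge0 ?sqr_ge0 ?p_ge0.
have e1 := ge0_symfun_integralT x2p0 cx2p.
have e2 := ge0_symfun_integralT p_ge0 p_cont.
rewrite e1; last by move=> x; rewrite /= peven sqrrN.
have pT : (\int[mu]_x (p x)%:E = 1)%E by exact: integral_normal_pdf.
rewrite -pT e2; last by move=> x; rewrite /= peven.
congr (_ * _)%E.
have split_ (f : R -> R) : measurable_fun setT f -> (forall x, 0 <= f x) ->
   (\int[mu]_(x in [set x : R | (0 <= x)%R]) (f x)%:E =
    \int[mu]_(x in `[0%R, 1%R[) (f x)%:E + \int[mu]_(x in `[1%R, +oo[) (f x)%:E)%E.
  move=> mf f0; rewrite -ge0_integral_setU//.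
  - congr (integral _ _ _); apply/seteqP; split => x /=; rewrite !in_itv/= ?andbT.
      by move=> ->; have [|] := ltP x 1; [left|right].
    by case=> [/andP[]//|]; exact: le_trans.
  - by apply/measurable_EFinP/measurable_funTS.
  - by move=> x _; rewrite lee_fin.
  - by apply/disj_setPLR => x /=; rewrite !in_itv/= andbT => /andP[_]; rewrite ltNge => /negP.
rewrite !split_//; last by move=> x; exact: p_ge0.
have c01 (f : R -> R) : measurable_fun setT f -> (\int[mu]_(x in `[0%R, 1%R[) (f x)%:E = \int[mu]_(x in `[0%R, 1%R]) (f x)%:E)%E.
  by move=> mf; rewrite integral_itv_bndo_bndc//; exact/measurable_EFinP/measurable_funTS.
rewrite !c01//.
have derF x : (fun y : R => - (y * p y))^`()%classic x = (x ^+ 2 - 1) * p x.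
  by have D := xp_is_derive x; rewrite derive1E; exact: derive_val.
have contF : continuous (fun y : R => - (y * p y)).
  by move=> x; apply/differentiable_continuous/derivable1_diffP; have [] := xp_is_derive x.
have contf : continuous (fun x : R => (x ^+ 2 - 1) * p x).
  apply: prod_cont; last exact: p_cont.
  by move=> x; apply: cvgB; [exact: sq_cont|exact: cvg_cst].
have A1 : (\int[mu]_(x in `[1%R, +oo[) ((x ^+ 2 - 1) * p x)%:E = (p 1)%:E)%E.
  rewrite (@ge0_continuous_FTC2y _ _ (fun y => - (y * p y)) 1 0).
  - by rewrite mul1r sub0e EFinN oppeK.
  - by move=> x x1; rewrite mulr_ge0 ?p_ge0// subr_ge0 exprn_ege1.
  - exact: continuous_subspaceT.
  - exact: xp_cvg.
  - by move=> x _; have [] := xp_is_derive x.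
  - exact/cvg_at_right_filter/contF.
  - by move=> x _; exact: derF.
have A2 : (\int[mu]_(x in `[0%R, 1%R]) ((1 - x ^+ 2) * p x)%:E = (p 1)%:E)%E.
  have contG : continuous (fun y : R => y * p y) by apply: prod_cont; [move=> x; exact: cvg_id|exact: p_cont].
  rewrite (@continuous_FTC2 _ _ (fun y => y * p y) 0 1)//.
  - by rewrite mul1r mul0r sube0.
  - apply: continuous_subspaceT => x; apply: cvgM; last exact: p_cont.
    by apply: cvgB; [exact: cvg_cst|exact: sq_cont].
  - split.
    + by move=> x _; have [] := is_deriveM (is_derive_id x 1) (p_is_derive x).
    + exact/cvg_at_right_filter/contG.
    + exact/cvg_at_left_filter/contG.
  - move=> x _; have D := is_deriveM (is_derive_id x 1) (p_is_derive x).
    by rewrite derive1E derive_val /GRing.scale/=; ring.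
have mf1 (D : set R) (f : R -> R) : measurable_fun setT f -> measurable_fun D (fun x => (f x)%:E).
  by move=> mf; exact/measurable_EFinP/measurable_funTS.
have msq : measurable_fun setT (fun x : R => x ^+ 2) by exact: measurable_funX.
have B1 : (\int[mu]_(x in `[1%R, +oo[) (x ^+ 2 * p x)%:E = (p 1)%:E + \int[mu]_(x in `[1%R, +oo[) (p x)%:E)%E.
  rewrite -A1 -ge0_integralD//.
  - by apply: eq_integral => x _; rewrite -EFinD; congr (_%:E); ring.
  - move=> x /=; rewrite in_itv/= andbT => x1.
    by rewrite lee_fin mulr_ge0 ?p_ge0// subr_ge0 exprn_ege1.
  - by apply: mf1; exact: continuous_measurable_fun.
  - by move=> x _; rewrite lee_fin p_ge0.
  - exact: mf1.
have B2 : (\int[mu]_(x in `[0%R, 1%R]) (p x)%:E = (p 1)%:E + \int[mu]_(x in `[0%R, 1%R]) (x ^+ 2 * p x)%:E)%E.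
  rewrite -A2 -ge0_integralD//.
  - by apply: eq_integral => x _; rewrite -EFinD; congr (_%:E); ring.
  - move=> x /=; rewrite in_itv/= => /andP[x0 x1].
    by rewrite lee_fin mulr_ge0 ?p_ge0// subr_ge0 exprn_ile1.
  - by apply: mf1; apply: measurable_funM => //; exact: measurable_funB.
  - by move=> x _; rewrite lee_fin x2p0.
  - exact: mf1.
by rewrite B1 B2 addeCA addeA.
Qed.

Lemma std_normal_Int2 : Int g (fun z : R => z ^+ 2).
Proof.
apply: ge0_Int_ltey; [exact: measurable_funX|by move=> x; exact: sqr_ge0|].
by rewrite std_normal_second_moment ltry.
Qed.

Lemma std_normal_E2 : \int[g]_z ((z : R) ^+ 2) = 1.
Proof. by rewrite /Rintegral std_normal_second_moment. Qed.

(** The symmetry rule concerns nonnegative even integrands; it is applied to the absolute value,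
    through [z = 2 max(z, 0) - |z|]. *)
Lemma std_normal_E1 : \int[g]_z (z : R) = 0.
Proof.
have I1 := Int_id std_normal_Int2.
have Ia : Int g (fun z : R => `|z|) := Int_norm I1.
have mm : measurable_fun setT (fun z : R => Num.max z 0) by exact: measurable_maxr.
have Im : Int g (fun z : R => Num.max z 0).
  apply: (@Int_le _ _ _ g _ (fun z : R => `|z|) mm Ia) => z.
  by rewrite normr_id /Num.max; case: ifP => // _; rewrite normr0.
have ma : measurable_fun setT (fun z : R => `|z|) by exact: normr_measurable.
have cn : continuous (fun z : R => `|z| * p z).
  by apply: prod_cont; [move=> z; exact: norm_continuous|exact: p_cont].
have e1 : (\int[g]_z (`|z : R|)%:E = 2 * \int[g]_z (Num.max (z : R) 0)%:E)%E.
  rewrite (ge0_normal01 ma (fun z => normr_ge0 z)) (ge0_normal01 mm); last by move=> z; rewrite le_max lexx orbT.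
  rewrite (ge0_symfun_integralT _ cn).
  - congr (_ * _)%E; rewrite integral_mkcond; apply: eq_integral => z _.
    rewrite patchE /Num.max; case: ifPn; rewrite ?inE ?notin_setE /= => h.
      by case: ifP => h2; [move: h2; rewrite ltNge h|rewrite ger0_norm].
    by case: ifP => h2; [rewrite mul0r|exfalso; apply: h; rewrite leNgt h2].
  - by move=> z; rewrite mulr_ge0// p_ge0.
  - by move=> z; rewrite /= normrN !pE sqrrN.
rewrite (E_EFin Ia) (E_EFin Im) -EFinM in e1; case: e1 => e1.
have -> : \int[g]_z (z : R) = \int[g]_z (2 * Num.max (z : R) 0 - `|z : R|).
  apply: eq_Rintegral => z _; rewrite /Num.max; case: ifP => h.
    by rewrite ltr0_norm//; ring.
  by rewrite ger0_norm ?leNgt ?h//; ring.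
by rewrite EB//; [rewrite EZ// -e1 subrr|exact: IntZ].
Qed.

Definition scale_rv (c : R) : measurableTypeR R -> measurableTypeR R := fun z => c * z.

Lemma measurable_scale_rv c : measurable_fun setT (scale_rv c).
Proof. exact: measurable_funM. Qed.

HB.instance Definition _ c := isMeasurableFun.Build _ _ _ _ (scale_rv c) (measurable_scale_rv c).

(** The image of the standard normal law under scaling allows [c = 0], where it is the Dirac mass at
    0. This covers [sig2 = 0] without a separate comparison law. *)
Definition gauss_law (c : R) : probability (measurableTypeR R) R := distribution g (scale_rv c).

Lemma avg_gauss_law (c K : R) u x : lipschitz_by K u -> (forall x, `|u x| <= K) ->
  avg (gauss_law c) u x = \int[g]_z u (x + c * (z : R)).
Proof.
move=> lu bu; rewrite /avg /gauss_law E_distribution//.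
- exact: shift_meas (lipschitz_measurable lu).
- apply: (@Int_bounded _ _ _ g _ K) => [|y]; last exact: bu.
  apply: (measurableT_comp (shift_meas _ (lipschitz_measurable lu))); exact: measurable_scale_rv.
Qed.

Lemma iter_avg_gauss (c K : R) u n x : 0 < c -> lipschitz_by K u -> (forall x, `|u x| <= K) ->
  iter n.+1 (avg (gauss_law c)) u x = \int[g]_z u (x + c * Num.sqrt n.+1%:R * (z : R)).
Proof.
move=> c0 lu bu.
have LB m : lipschitz_by K (iter m (avg (gauss_law c)) u) /\ (forall x, `|iter m (avg (gauss_law c)) u x| <= K).
  elim: m => [//|m [l b]]; split; [exact: avg_lipschitz|exact: avg_bound].
elim: n x => [|n IH] x; first by rewrite /= (avg_gauss_law c x lu bu) sqrtr1 mulr1.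
have [l b] := LB n.+1.
rewrite iterS (avg_gauss_law c x l b).
have sn m : 0 < c * Num.sqrt m.+1%:R by rewrite mulr_gt0// sqrtr_gt0.
have e : (c * Num.sqrt n.+2%:R) ^+ 2 = c ^+ 2 + (c * Num.sqrt n.+1%:R) ^+ 2.
  by rewrite !exprMn !sqr_sqrtr// -[X in X + _]mulr1 -mulrDr -[n.+2]add1n natrD.
rewrite -(gaussian_convolution x c0 (sn n) (sn n.+1) e lu bu).
apply: eq_Rintegral => z _; rewrite IH; apply: eq_Rintegral => w _.
by rewrite addrA.
Qed.

Lemma E_centered_normal (v : R) (f : R -> R) (C : R) : 0 <= v -> continuous f -> (forall x, `|f x| <= C) ->
  \int[centered_normal v]_x f x = \int[g]_z f (Num.sqrt v * (z : R)).
Proof.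
move=> v0 cf bf; rewrite /centered_normal; have mf : measurable_fun setT f by exact: continuous_measurable_fun.
case: eqVneq => [->|vn0].
  rewrite sqrtr0; under [RHS]eq_Rintegral do rewrite mul0r.
  rewrite E_cst /Rintegral integral_dirac//; last exact/measurable_EFinP.
  by rewrite diracT mul1e.
have vp : 0 < v by rewrite lt_neqAle eq_sym vn0.
have sp : 0 < Num.sqrt v by rewrite sqrtr_gt0.
have fC x : 0 <= f x + C by have := bf x; rewrite ler_norml; lra.
have cfC : continuous (fun x => f x + C) by move=> x; apply: cvgD; [exact: cf|exact: cvg_cst].
have := ge0_normal_scale sp cfC fC.
have If (nu : probability (measurableTypeR R) R) (h : R -> R) : measurable_fun setT h -> Int nu (fun z : R => f (h z)).
  by move=> mh; apply: (@Int_bounded _ _ _ nu _ C) => [|y]; [exact: measurableT_comp|exact: bf].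
have I1 : Int (normal_prob 0 (Num.sqrt v) : probability (measurableTypeR R) R) (fun z : R => f z) := If _ _ (@measurable_id _ _ _).
have I2 : Int g (fun z : R => f (Num.sqrt v * z)) := If _ _ (measurable_scale_rv _).
rewrite E_EFin; last by apply: IntD => //; exact: Int_cst.
rewrite E_EFin; last by apply: IntD => //; exact: Int_cst.
move=> e0; have e1 := EFin_inj e0.
rewrite (ED I1 (Int_cst _ C)) (ED I2 (Int_cst g C)) !E_cst in e1.
exact: (addIr _ e1).
Qed.

End gaussian.

(** * Gaussian limit of the normalized martingale *)

Section clt_limit.
Context d (T : measurableType d) (R : realType) (P : probability T R).
Variable th : {RV P >-> T}.
Hypothesis th_pres : forall A, measurable A -> P (th @^-1` A) = P A.
Hypothesis th_ergodic : forall A, measurable A -> th @^-1` A = A ->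
  P A = 0%E \/ P A = 1%E.
Variables (D : T -> R) (sig2 : R).
Hypotheses (ID : Int P D) (ID2 : Int P (fun x => D x ^+ 2)) (ED2 : \int[P]_x (D x ^+ 2) = sig2).
Hypothesis mart : forall j (g : R -> R) (K : R), measurable_fun setT g -> (forall x, `|g x| <= K) ->
  \int[P]_x (D (iter j th x) * g (partial_sum th D j x)) = 0.
Local Notation g := (normal_prob 0 1 : probability (measurableTypeR R) R).

(** The comparison law at stage [n] is centered Gaussian with variance [sig2 / n]; by the
    convolution formula its [n]-fold iterate is the limit law. *)
Lemma martingale_clt_normal K u u1 u2 : taylor2 K u u1 u2 ->
  \int[P]_x u ((Num.sqrt n%:R)^-1 * partial_sum th D n x) @[n --> \oo] -->
  \int[centered_normal sig2]_x u x.
Proof.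
move=> tu.
have s0 : 0 <= sig2 by rewrite -ED2; apply: E_ge0 => x; exact: sqr_ge0.
pose s := Num.sqrt sig2.
have ss : s ^+ 2 = sig2 by rewrite sqr_sqrtr.
pose c (n : nat) : R := s / Num.sqrt n%:R.
have Ig1 : Int g (fun z : R => z) := Int_id (std_normal_Int2 R).
have Ig2 := std_normal_Int2 R.
have msc (k : R) := @measurable_scale_rv R k.
have cs : (Num.sqrt n%:R)^-1 @[n --> \oo] --> (0 : R).
  apply/gtr0_cvgV0; last first.
    apply/cvgryPge => A; near=> n.
    rewrite (le_trans (ler_norm A))// -sqrtr_sqr ler_sqrt//.
    near: n; exact: nbhs_infty_ger.
  near=> n; rewrite sqrtr_gt0 ltr0n; near: n; exact: nbhs_infty_gt.
have mmin : measurable_fun setT (fun y : R => y ^+ 2 * Num.min 1 `|y|).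
  apply: measurable_funM; first exact: measurable_funX.
  by apply: measurable_minr => //; exact: normr_measurable.
have I2c n : Int g (fun z : R => (scale_rv (c n) z) ^+ 2).
  by have := IntZ (c n ^+ 2) Ig2; apply: eq_integrable => // z _ /=; congr (_%:E); rewrite [RHS]exprMn.
have Imin n : Int g (fun z : R => (scale_rv (c n) z) ^+ 2 * Num.min 1 `|scale_rv (c n) z|).
  apply: (Int_le _ (I2c n)).
    exact: (measurableT_comp mmin (msc _)).
  by move=> z; rewrite normrM ler_piMr// ger0_norm ?min1_ge0//.
apply: (@martingale_clt _ _ _ _ th th_pres th_ergodic D sig2 ID ID2 ED2 mart (fun n => gauss_law (c n))
   (fun n => \int[g]_z ((scale_rv (c n) z) ^+ 2 * Num.min 1 `|scale_rv (c n) z|))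
   (fun n => \int[g]_z `|scale_rv (c n) z|) _ _ _ _ _ _ _ K u u1 u2 _ tu).
- move=> n; apply/Int_distribution; first exact: measurable_funX.
  exact: I2c.
- move=> n; rewrite E_distribution; [|exact: measurable_id|exact: (IntZ (c n) Ig1)].
  by rewrite (EZ (c n) Ig1) std_normal_E1 mulr0.
- move=> n n0; rewrite E_distribution; [|exact: measurable_funX|exact: I2c].
  have -> : \int[g]_x (scale_rv (c n) x) ^+ 2 = \int[g]_x (c n ^+ 2 * (x : R) ^+ 2).
    by apply: eq_Rintegral => z _; rewrite [LHS]exprMn.
  by rewrite (EZ _ Ig2) std_normal_E2 mulr1 /c exprMn exprVn ss sqr_sqrtr// mulrC.
- by move=> n; rewrite E_distribution//; exact: Imin.
- move=> n; rewrite E_distribution//.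
  exact: (Int_norm (IntZ (c n) Ig1)).
(* The truncated moment of the comparison law is [lind_err] of the variable [s * z] under the
   standard normal law. *)
- have := @lind_err_cvg _ _ _ g (fun z : R => s * z) (IntZ s Ig1).
  have I2s : Int g (fun z : R => (s * z) ^+ 2).
    by have := IntZ (s ^+ 2) Ig2; apply: eq_integrable => // z _ /=; rewrite exprMn.
  move=> H1; have H2 := H1 I2s; apply: cvg_trans H2; apply: near_eq_cvg; apply: nearW => n.
  congr (_ * _); apply: eq_Rintegral => z _.
  by rewrite /scale_rv /c mulrA [s / _]mulrC.
- have -> : (fun n => \int[g]_z `|scale_rv (c n) z|) = (fun n => s * (Num.sqrt n%:R)^-1 * \int[g]_z `|z : R|).
    apply/funext => n; rewrite -(EZ _ (Int_norm Ig1)); apply: eq_Rintegral => z _.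
    by rewrite /scale_rv normrM ger0_norm// /c mulr_ge0// ?invr_ge0 sqrtr_ge0.
  rewrite -[X in _ --> X](mul0r (\int[g]_z `|z : R|)); apply: cvgM; last exact: cvg_cst.
  by rewrite -[X in _ --> X](mulr0 s); apply: cvgM => //; exact: cvg_cst.
move=> [//|n] _.
have lu := t2_l tu; have bu := t2_b tu.
have cu : continuous u by exact: lipschitz_continuous lu.
rewrite (E_centered_normal s0 cu bu) -/s.
(* In the degenerate case the comparison law is the Dirac mass at 0 and [avg] is the identity. *)
have [s00|sn0] := eqVneq s 0.
  have a0 : avg (gauss_law (c n.+1)) u = u.
    apply/funext => x; rewrite (avg_gauss_law _ _ lu bu) /c s00.
    by under eq_Rintegral do rewrite !mul0r addr0; rewrite E_cst.
  rewrite (iter_fix n.+1 a0).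
  by rewrite s00; under eq_Rintegral do rewrite mul0r; rewrite E_cst.
have sp : 0 < s by rewrite lt_neqAle eq_sym sn0 sqrtr_ge0.
have cp : 0 < c n.+1 by rewrite divr_gt0// sqrtr_gt0.
rewrite (iter_avg_gauss n 0 cp lu bu); apply: eq_Rintegral => z _.
by rewrite add0r /c divfK// gt_eqF// sqrtr_gt0.
Unshelve. all: by end_near. Qed.

End clt_limit.

(** * From smooth test functions to convergence in distribution *)

Section portmanteau_inequalities.
Context (R : realType).

(** If [|y| > L], either [y] is at distance more than 1 from [w], or [|w| >= L - 1] and Chebyshev's
    weight [w^2 / (L - 1)^2] is at least 1. *)
Lemma cutoff_error (C L q f y w : R) : 0 < C -> 2 <= L -> `|f| <= C -> 0 <= q <= 1 ->
  (`|y| <= L -> q = 1) ->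
  `|f * (1 - q)| <= C * (1 < `|y - w|)%R%:R + C / (L - 1) ^+ 2 * w ^+ 2.
Proof.
move=> C0 L2 fC /andP[q0 q1] hq; have L1 : 0 < L - 1 by lra.
have W0 : 0 <= C / (L - 1) ^+ 2 * w ^+ 2.
  by apply: mulr_ge0; [apply: divr_ge0; [exact: ltW|exact: sqr_ge0]|exact: sqr_ge0].
have [yL|yL] := leP `|y| L.
  rewrite hq// subrr mulr0 normr0; apply: addr_ge0 => //.
  by apply: mulr_ge0; [exact: ltW|exact: ler0n].
apply: (@le_trans _ _ C).
  by rewrite normrM -[leRHS]mulr1 ler_pM// ger0_norm; lra.
case: (ltP 1 `|y - w|) => yw; first by rewrite mulr1 lerDl.
have wL : L - 1 <= `|w| by have := ler_normD (y - w) w; rewrite subrK; lra.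
rewrite mulr0 add0r -[w ^+ 2]real_normK ?num_real// -mulrA ler_peMr ?(ltW C0)//.
by rewrite ler_pdivlMl ?exprn_gt0// mulr1 lerXn2r// nnegrE; lra.
Qed.

(** Five links cost [e / 8], and [p], [q], [r] are the three remaining eighths. *)
Lemma dist_chain (e p q r x0 x1 x2 x3 x4 x5 x6 : R) :
  `|x0 - x1| <= e / 8 -> `|x2 - x1| <= e / 8 -> `|x2 - x3| <= e / 8 -> `|x4 - x3| <= e / 8 ->
  `|x5 - x4| <= e / 8 + r -> `|x6 - x5| <= p + q ->
  p <= e / 8 -> q <= e / 8 -> r <= e / 8 -> `|x0 - x6| <= e.
Proof.
rewrite !ler_norml => /andP[? ?] /andP[? ?] /andP[? ?] /andP[? ?] /andP[? ?] /andP[? ?] *.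
by apply/andP; split; lra.
Qed.

End portmanteau_inequalities.

Section portmanteau.
Context d (T : measurableType d) (R : realType) (P : probability T R).

(** The test function is cut off to a compact support, at a cost controlled by the second moments of
    [W], then replaced by a smooth [u], uniformly close by uniform continuity. Passing from [Y] to
    [W] costs the probability that they differ by more than [dl]. *)
Lemma portmanteau (W Y : nat -> T -> R) (mu : probability (measurableTypeR R) R) (K2 : R) :
  (forall n, measurable_fun setT (Y n)) ->
  (forall n, measurable_fun setT (W n)) ->
  (forall n, Int P (fun w => W n w ^+ 2)) -> (forall n, \int[P]_w (W n w ^+ 2) <= K2) ->
  little_op P (fun n w => Y n w - W n w) (fun=> 1) ->
  (forall K u u1 u2, taylor2 K u u1 u2 ->
     \int[P]_w u (W n w) @[n --> \oo] --> \int[mu]_x u x) ->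
  cvg_in_dist P Y mu.
Proof.
move=> mY mW IW EW op hu f cf [C0 bf0].
pose C := `|C0| + 1.
have C1 : 0 < C by rewrite ltr_wpDl.
have bf x : `|f x| <= C.
  apply: (le_trans (bf0 x)); apply: (le_trans (ler_norm _)); by rewrite lerDl.
have mf : measurable_fun setT f by exact: continuous_measurable_fun.
(* Continuous cutoff: 1 on [[-L, L]], 0 outside [[-L-1, L+1]], affine in between. *)
pose chi (L x : R) := Num.max 0 (Num.min 1 (L + 1 - `|x|)).
have chi01 L x : 0 <= chi L x <= 1 by rewrite /chi le_max lexx/= ge_max ler01 ge_min lexx.
have chi1 L x : `|x| <= L -> chi L x = 1.
  move=> h; rewrite /chi (_ : Num.min 1 _ = 1); first by rewrite /Num.max ltr01.
  by apply/min_idPl; lra.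
have chi0 L x : L + 1 <= `|x| -> chi L x = 0.
  move=> h; rewrite /chi /Num.max; case: ifP => //; rewrite lt_min => /andP[_]; lra.
have chiE L x : chi L x = (0 + Num.min 1 (L + 1 - `|x|) + `|0 - Num.min 1 (L + 1 - `|x|)|) / 2.
  by rewrite /chi maxr_absE.
have cchi L : continuous (chi L).
  move=> x.
  have cm : Num.min 1 (L + 1 - `|y|) @[y --> x] --> Num.min 1 (L + 1 - `|x|).
    rewrite minr_absE; under eq_fun do rewrite minr_absE.
    apply: cvgM; last exact: cvg_cst.
    have ca : L + 1 - `|y| @[y --> x] --> L + 1 - `|x|.
      by apply: cvgB; [exact: cvg_cst|exact: norm_continuous].
    apply: cvgB; first by apply: cvgD; [exact: cvg_cst|].
    by apply: cvg_norm; apply: cvgB => //; exact: cvg_cst.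
  rewrite (_ : chi L = fun y => (0 + Num.min 1 (L + 1 - `|y|) + `|0 - Num.min 1 (L + 1 - `|y|)|) / 2); last first.
    by apply/funext => y; exact: chiE.
  apply: cvgM; last exact: cvg_cst.
  apply: cvgD; first by apply: cvgD => //; exact: cvg_cst.
  by apply: cvg_norm; apply: cvgB => //; exact: cvg_cst.
pose h L x := f x * chi L x.
have ch L : continuous (h L) by exact: prod_cont.
have bh L x : `|h L x| <= C.
  have /andP[q0 q1] := chi01 L x.
  by rewrite normrM (ger0_norm q0) (le_trans _ (bf x))// ler_piMr.
have mh L : measurable_fun setT (h L) by exact: continuous_measurable_fun.
have Ib d' (T' : measurableType d') (nu : probability T' R) (k : R -> R) (K : R) (V : T' -> R) :
    measurable_fun setT k -> (forall x, `|k x| <= K) -> measurable_fun setT V ->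
    Int nu (fun w => k (V w)).
  by move=> mk bk mV; apply: (@Int_bounded _ _ _ nu _ K) => [|w]; [exact: measurableT_comp|exact: bk].
apply/cvgrPdist_le => e e0.
have e8 : 0 < e / 8 by rewrite divr_gt0.
have K20 : 0 <= K2 by apply: le_trans (EW 0%N); apply: E_ge0 => w; exact: sqr_ge0.
have [L [L2 [hL1 hL2]]] : exists L : R, [/\ 2 <= L, `|\int[mu]_x f x - \int[mu]_x h L x| <= e / 8 &
    C * K2 / (L - 1) ^+ 2 <= e / 8].
  have c1 : \int[mu]_x h n%:R x @[n --> \oo] --> \int[mu]_x f x.
    have H : {ae mu, forall x, h n%:R x @[n --> \oo] --> f x}.
      apply: aeW => x; apply: cvg_near_cst; near=> n.
      by rewrite /h chi1 ?mulr1//; near: n; exact: nbhs_infty_ger.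
    have [_ +] := @E_dct _ _ _ mu (fun n => h n%:R) f (fun=> C) (fun n => mh _) mf (Int_cst mu C) (fun n x => bh _ x) H.
    exact.
  have /cvgrPdist_le /(_ _ e8) c2 := c1.
  near \oo => n.
  exists n%:R; split.
  - by near: n; exact: nbhs_infty_ger.
  - by near: n.
  - have n1 : 1 + (C * K2 / (e / 8) + 1) <= n%:R by near: n; exact: nbhs_infty_ger.
    have q0 : 0 <= C * K2 / (e / 8) by apply: divr_ge0; [apply: mulr_ge0 => //; exact: ltW|exact: ltW].
    have q1 : 1 <= n%:R - 1 :> R by lra.
    rewrite ler_pdivrMr; last by rewrite exprn_gt0//; lra.
    rewrite -ler_pdivrMl// [leLHS]mulrC.
    have q2 : n%:R - 1 <= (n%:R - 1) ^+ 2 :> R by rewrite expr2 ler_peMr//; lra.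
    by apply: le_trans q2; lra.
have gsupp x : L + 1 <= `|x| -> h L x = 0 by move=> q; rewrite /h chi0 ?mulr0.
have [dl dl0 hdl] := compact_support_unif (ch L) gsupp e8.
have gneg x : x <= - (L + 1) -> h L x = 0.
  move=> q; apply: gsupp; rewrite ler0_norm; lra.
(* [smooth_approx] moves the argument by up to three times its parameter. *)
have dl3 : 0 < dl / 3 by rewrite divr_gt0.
have [K [u [u1 [u2 [tu hu2]]]]] := smooth_approx (ch L) gneg (bh L) dl3.
have ug x : `|u x - h L x| <= e / 8.
  have [y hy ->] := hu2 x; apply: hdl; apply: (le_trans hy).
  by rewrite mulrC divfK.
have mu_ := lipschitz_measurable (t2_l tu); have bu := t2_b tu.
pose A dd n := [set w | dd * 1 < `|Y n w - W n w|].
have mA dd n : measurable (A dd n).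
  rewrite -[X in measurable X]setTI.
  have -> : A dd n = (fun w => `|Y n w - W n w|) @^-1` `]dd * 1, +oo[%classic.
    by apply/seteqP; split => w /=; rewrite in_itv/= andbT.
  have mYW : measurable_fun setT (fun w => `|Y n w - W n w|).
    by apply: measurableT_comp => //; exact: measurable_funB.
  exact: mYW.
pose pr dd n := \int[P]_w (\1_(A dd n) w : R).
have I1 dd n : Int P (\1_(A dd n) : T -> R).
  apply: (@Int_bounded _ _ _ P _ 1) => [|w]; first exact: measurable_indic.
  by rewrite indicE; case: (_ \in _); rewrite ?normr1 ?normr0.
have cpr dd : 0 < dd -> pr dd n @[n --> \oo] --> (0 : R).
  move=> dd0; have := op dd dd0.
  have -> : (fun n => P [set w | dd * 1 < `|Y n w - W n w|]) = (fun n => (pr dd n)%:E).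
    by apply/funext => n; rewrite -P_indic.
  by move/fine_cvg.
have c3 : C * pr 1 n @[n --> \oo] --> (C * 0 : R) by apply: cvgM; [exact: cvg_cst|exact: cpr].
have c4 : 2 * C * pr dl n @[n --> \oo] --> (2 * C * 0 : R) by apply: cvgM; [exact: cvg_cst|exact: cpr].
rewrite mulr0 in c3; rewrite mulr0 in c4.
have /cvgrPdist_le /(_ _ e8) c5 := hu K u u1 u2 tu.
have c3' : \forall n \near \oo, C * pr 1 n <= e / 8 by move/cvgr_le : c3; apply.
have c4' : \forall n \near \oo, 2 * C * pr dl n <= e / 8 by move/cvgr_le : c4; apply.
near=> n.
have p3 : C * pr 1 n <= e / 8 by near: n.
have p4 : 2 * C * pr dl n <= e / 8 by near: n.
have p5 : `|\int[mu]_x u x - \int[P]_w u (W n w)| <= e / 8 by near: n.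
have b1 : `|\int[P]_w f (Y n w) - \int[P]_w h L (Y n w)| <= C * pr 1 n + C * K2 / (L - 1) ^+ 2.
  rewrite -EB; [|exact: Ib mf bf (mY n)|exact: Ib (mh L) (bh L) (mY n)].
  have L1 : 0 < L - 1 by lra.
  have IR : Int P (fun w => C * \1_(A 1 n) w + C / (L - 1) ^+ 2 * W n w ^+ 2).
    by apply: IntD; apply: IntZ => //; exact: I1.
  apply: (@le_trans _ _ (\int[P]_w (C * \1_(A 1 n) w + C / (L - 1) ^+ 2 * W n w ^+ 2))).
    apply: E_abs_le => //.
      by apply: IntB; [exact: Ib mf bf (mY n)|exact: Ib (mh L) (bh L) (mY n)].
    move=> w; rewrite /h -[X in X - _]mulr1 -mulrBr.
    have -> : \1_(A 1 n) w = (1 < `|Y n w - W n w|)%R%:R :> R.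
      by rewrite indicE; congr (nat_of_bool _)%:R; apply/idP/idP; rewrite inE /A/= mulr1.
    by apply: cutoff_error => //; exact: chi1.
  rewrite ED; [|by apply: IntZ; exact: I1|exact: IntZ].
  rewrite (EZ C (I1 1 n)) (EZ (C / (L - 1) ^+ 2) (IW n)).
  rewrite lerD2l [leRHS]mulrAC ler_wpM2l// divr_ge0// ?sqr_ge0// ltW//.
have b2 : `|\int[P]_w h L (Y n w) - \int[P]_w h L (W n w)| <= e / 8 + 2 * C * pr dl n.
  rewrite -EB; [|exact: Ib (mh L) (bh L) (mY n)|exact: Ib (mh L) (bh L) (mW n)].
  apply: (@le_trans _ _ (\int[P]_w (e / 8 + 2 * C * \1_(A dl n) w))).
    apply: E_abs_le.
    - by apply: IntB; [exact: Ib (mh L) (bh L) (mY n)|exact: Ib (mh L) (bh L) (mW n)].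
    - by apply: IntD; [exact: Int_cst|apply: IntZ; exact: I1].
    move=> w; rewrite indicE; case: (boolP (w \in A dl n)) => [_|/negP nA].
      rewrite mulr1; apply: (le_trans (ler_normB _ _)).
      have := bh L (Y n w); have := bh L (W n w); lra.
    rewrite mulr0 addr0; apply: hdl; rewrite leNgt; apply/negP => q; apply: nA.
    by rewrite inE /A/= mulr1; exact: q.
  rewrite ED ?E_cst; [|exact: Int_cst|by apply: IntZ; exact: I1].
  by rewrite EZ//; exact: I1.
have b3 : `|\int[P]_w h L (W n w) - \int[P]_w u (W n w)| <= e / 8.
  rewrite -EB; [|exact: Ib (mh L) (bh L) (mW n)|exact: Ib mu_ bu (mW n)].
  apply: E_bound => [|w]; last by rewrite distrC.
  by apply: IntB; [exact: Ib (mh L) (bh L) (mW n)|exact: Ib mu_ bu (mW n)].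
have mid := @measurable_id _ (measurableTypeR R) setT.
have b4 : `|\int[mu]_x u x - \int[mu]_x h L x| <= e / 8.
  rewrite -EB; [|exact: (Ib _ _ mu _ _ id mu_ bu mid)|exact: (Ib _ _ mu _ _ id (mh L) (bh L) mid)].
  apply: E_bound => [|x]; last exact: ug.
  by apply: IntB; [exact: (Ib _ _ mu _ _ id mu_ bu mid)|exact: (Ib _ _ mu _ _ id (mh L) (bh L) mid)].
exact: (dist_chain hL1 b4 p5 b3 b2 b1 p3 hL2 p4).
Unshelve. all: by end_near. Qed.

End portmanteau.

(** * Conditional expectations and the Markov property *)

Section truncation.
Context (R : realType).

Definition trunc (n : nat) (r : R) : R := r * \1_[set x : R | `|x| <= n%:R] r.

Lemma measurable_trunc n : measurable_fun setT (trunc n).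
Proof.
apply: measurable_funM => //; apply: measurable_indic.
rewrite (_ : [set x | _] = Num.norm @^-1` `]-oo, n%:R]%classic).
  by rewrite -[X in measurable X]setTI; exact: normr_measurable.
by apply/seteqP; split => x /=; rewrite in_itv.
Qed.

Lemma trunc_bound n r : `|trunc n r| <= n%:R.
Proof.
rewrite /trunc normrM indicE; case: (boolP (r \in _)); rewrite ?normr0 ?mulr0//.
by rewrite inE/= normr1 mulr1.
Qed.

Lemma le_trunc n r : `|trunc n r| <= `|r|.
Proof.
rewrite /trunc normrM ler_piMr// indicE.
by case: (_ \in _); rewrite ?normr1 ?normr0.
Qed.

Lemma trunc_eq n r : `|r| <= n%:R -> trunc n r = r.
Proof. by move=> h; rewrite /trunc indicE mem_set// mulr1. Qed.

Lemma le_trunc_mull n r a : `|trunc n r * a| <= `|r * a|.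
Proof. by rewrite [leLHS]normrM [leRHS]normrM ler_wpM2r// le_trunc. Qed.

Lemma le_trunc_mulr n r a : `|a * trunc n r| <= `|a * r|.
Proof. by rewrite ![a * _]mulrC le_trunc_mull. Qed.

Lemma cvg_trunc r : trunc n r @[n --> \oo] --> r.
Proof.
apply: cvg_near_cst; near=> n; apply: trunc_eq.
by near: n; exact: nbhs_infty_ger.
Unshelve. all: by end_near. Qed.

End truncation.

Section weighted_indicators.
Context d (T : measurableType d) (R : realType) (P : probability T R).
Implicit Types (W g : T -> R).

Lemma indic_bound (A : set T) x : `|\1_A x : R| <= 1.
Proof. by rewrite indicE; case: (_ \in _); rewrite ?normr1 ?normr0. Qed.

Lemma Int_mul_indic W (A : set T) : Int P W -> measurable A -> Int P (fun x => W x * \1_A x).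
Proof.
move=> IW mA; apply: (Int_mul_bounded IW (K := 1)); first exact: measurable_indic.
exact: indic_bound.
Qed.

Lemma integral_indic_E W (A : set T) : Int P W -> measurable A ->
  (\int[P]_(x in A) (W x)%:E = (\int[P]_x (W x * \1_A x))%:E)%E.
Proof.
move=> IW mA; rewrite -E_EFin; last exact: Int_mul_indic.
rewrite [LHS]integral_mkcond; apply: eq_integral => x _.
by rewrite patchE indicE; case: ifP => _; rewrite ?mulr1 ?mulr0.
Qed.

(** The sum counts the positive integers below [y], that is, its integer part. After scaling, it
    approximates a bounded function uniformly by indicators of upper level sets. *)
Lemma staircase (N : nat) (y : R) : 0 <= y <= N%:R ->
  0 <= y - \sum_(j < N) (j.+1%:R <= y)%R%:R <= 1.
Proof.
have full (n : nat) (z : R) : n%:R <= z -> \sum_(j < n) (j.+1%:R <= z)%R%:R = n%:R :> R.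
  move=> nz; rewrite (eq_bigr (fun=> 1)) ?big_const_ord ?iter_addr_0// => j _.
  by rewrite (le_trans _ nz)// ler_nat.
elim: N => [|N IH] /andP[y0 yN].
  by rewrite big_ord0 subr0 y0 (le_trans yN).
rewrite big_ord_recr/=; have [yN'|yN'] := leP y N%:R.
  have -> : (N.+1%:R <= y)%R = false.
    by apply/negP => h; have := le_trans h yN'; rewrite ler_nat ltnn.
  by rewrite addr0; apply: IH; rewrite y0.
rewrite (full N y (ltW yN')); case: (leP N.+1%:R y) => h.
  have -> : true%:R = 1 :> R by [].
  by move: yN h; rewrite -natr1 => ? ?; apply/andP; split; lra.
by move: yN h; rewrite -natr1 addr0 => ? ?; apply/andP; split; lra.
Qed.

(** The staircase applied to [(g + K) * n.+1] gives a combination [q] of indicators of level sets of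
    [g], within [n.+1%:R^-1] of [g + K]. The integral of [W * q] vanishes, so that of [W * g] is at
    most [n.+1%:R^-1] times the L1 norm of [W]. *)
Lemma E_mul_bounded0 W g K : Int P W -> measurable_fun setT g -> (forall x, `|g x| <= K) ->
  (forall B : set R, measurable B -> \int[P]_x (W x * \1_(g @^-1` B) x) = 0) ->
  \int[P]_x (W x * g x) = 0.
Proof.
move=> IW mg bg h.
have K0 : 0 <= K by apply: le_trans (bg point).
have EW0 : \int[P]_x W x = 0.
  by rewrite -[RHS](h setT measurableT); apply: eq_Rintegral => x _; rewrite preimage_setT indicT mulr1.
have mB (c : R) : measurable (g @^-1` `[c, +oo[%classic).
  by rewrite -[X in measurable X]setTI; exact: mg.
suff H (n : nat) : `|\int[P]_x (W x * g x)| <= n.+1%:R^-1 * \int[P]_x `|W x|.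
  apply/eqP; rewrite -normr_le0; apply/ler_addgt0Pr => e e0; rewrite add0r.
  have c0 : n.+1%:R^-1 * \int[P]_x `|W x| @[n --> \oo] --> (0 : R).
    rewrite -(mul0r (\int[P]_x `|W x|)); apply: cvgM; last exact: cvg_cst.
    exact: cvg_harmonic.
  near \oo => n; apply: le_trans (H n) _.
  by near: n; move/cvgr_le : c0; apply.
pose N := (Num.truncn (2 * K * n.+1%:R)).+1.
have hN : 2 * K * n.+1%:R <= N%:R.
  by apply/ltW/truncnS_gt.
pose c (j : nat) : R := j.+1%:R / n.+1%:R - K.
pose q x : R := n.+1%:R^-1 * (\sum_(j < N) \1_(g @^-1` `[c j, +oo[%classic) x).
have mq : measurable_fun setT q.
  apply: measurable_funM => //.
  by apply: measurable_sum => j; apply: measurable_indic.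
have n0 : (0 : R) < n.+1%:R by [].
have qg x : `|g x + K - q x| <= n.+1%:R^-1.
  have := @staircase N ((g x + K) * n.+1%:R).
  have /andP[g1 g2] : - K <= g x <= K by rewrite -ler_norml.
  have -> : 0 <= (g x + K) * n.+1%:R <= N%:R.
    apply/andP; split; first by rewrite mulr_ge0//; lra.
    by apply: le_trans hN; rewrite ler_wpM2r//; lra.
  move=> /(_ isT).
  have -> : \sum_(j < N) (j.+1%:R <= (g x + K) * n.+1%:R)%R%:R = n.+1%:R * q x :> R.
    rewrite /q mulrA divff// mul1r; apply: eq_bigr => j _; rewrite indicE; congr (nat_of_bool _)%:R.
    rewrite -ler_pdivrMr// -lerBlDr; apply/esym.
    by apply/idP/idP; rewrite inE/= in_itv/= andbT.
  move=> /andP[h1 h2]; rewrite ler_norml.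
  have e1 : (g x + K) * n.+1%:R - n.+1%:R * q x = n.+1%:R * (g x + K - q x) by ring.
  rewrite e1 in h1 h2; rewrite pmulr_rge0// in h1; rewrite -ler_pdivlMl// mulr1 in h2.
  by rewrite h2 andbT (le_trans _ h1)// oppr_le0 ltW// invr_gt0.
have IWq : Int P (fun x => W x * q x).
  apply: (Int_mul_bounded IW mq (K := n.+1%:R^-1 + 2 * K)) => x.
  have /andP[g1 g2] : - K <= g x <= K by rewrite -ler_norml.
  have i0 : 0 < n.+1%:R^-1 :> R by rewrite invr_gt0.
  move: (qg x) i0; move: (n.+1%:R^-1) => i; rewrite !ler_norml => /andP[h1 h2] i0.
  by apply/andP; split; lra.
have EWq : \int[P]_x (W x * q x) = 0.
  transitivity (\int[P]_x (\sum_(j < N) n.+1%:R^-1 * (W x * \1_(g @^-1` `[c j, +oo[%classic) x))).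
    apply: eq_Rintegral => x _; rewrite /q mulrCA !mulr_sumr.
    by apply: eq_bigr => j _.
  rewrite E_sum; last by move=> j; apply: IntZ; exact: Int_mul_indic.
  rewrite big1// => j _; rewrite EZ ?h ?mulr0//; exact: Int_mul_indic.
have IWg := Int_mul_bounded IW mg bg.
have -> : \int[P]_x (W x * g x) = \int[P]_x (W x * g x + K * W x - W x * q x).
  rewrite EB//; last by apply: IntD => //; exact: IntZ.
  by rewrite ED ?EZ ?EW0 ?EWq//; [rewrite mulr0 addr0 subr0|exact: IntZ].
rewrite -EZ; last exact: Int_norm.
apply: E_abs_le.
- by apply: IntB => //; apply: IntD => //; exact: IntZ.
- by apply: IntZ; exact: Int_norm.
move=> x; have -> : W x * g x + K * W x - W x * q x = (g x + K - q x) * W x by ring.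
by rewrite normrM ler_wpM2r.
Unshelve. all: by end_near. Qed.

(** Signed weights are allowed; for disjoint unions in the Dynkin class, convergence is dominated by
    [|W|]. *)
Lemma E_pi_lambda0 d' (T' : measurableType d') (Y : T -> T') W (G : set (set T')) :
  measurable_fun setT Y -> Int P W -> \int[P]_x W x = 0 ->
  @measurable _ T' = <<s G >> -> setI_closed G ->
  (forall A, G A -> \int[P]_x (W x * \1_(Y @^-1` A) x) = 0) ->
  forall A, measurable A -> \int[P]_x (W x * \1_(Y @^-1` A) x) = 0.
Proof.
move=> mY IW EW mG GI h A mA.
have mYA B : measurable B -> measurable (Y @^-1` B).
  by move=> mB; rewrite -[X in measurable X]setTI; exact: mY.
apply: (@dynkin_induction _ T' G (fun A => \int[P]_x (W x * \1_(Y @^-1` A) x) = 0)) => //.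
- by rewrite -[RHS]EW; apply: eq_Rintegral => x _; rewrite preimage_setT indicT mulr1.
- move=> S mS hS.
  rewrite -[RHS](subr0 0) -{1}EW -hS -EB//; last by apply: Int_mul_indic => //; exact: mYA.
  by apply: eq_Rintegral => x _; rewrite preimage_setC !indicE in_setC; case: (_ \in _); rewrite /= ?mulr0 ?mulr1 ?subr0 ?subrr.
- move=> F mF tF hF.
  have c1 := @E_dct _ _ _ P (fun n x => W x * \sum_(k < n) \1_(Y @^-1` F k) x)
     (fun x => W x * \1_(Y @^-1` (\bigcup_k F k)) x) (fun x => `|W x|).
  have sE n x : \sum_(k < n) \1_(Y @^-1` F k) x = \1_(\big[setU/set0]_(k < n) (Y @^-1` F k)) x :> R.
    elim: n => [|n IH]; first by rewrite !big_ord0 indic0.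
    rewrite !big_ord_recr/= IH !indicE in_setU -(bigcup_mkord n (fun k => Y @^-1` F k)).
    case: (boolP (x \in Y @^-1` F n)) => [|_]; last by rewrite orbF addr0.
    rewrite inE => Fn; rewrite memNset ?add0r// => -[j /= jn Fj].
    have jE := tF j n I I (ex_intro _ (Y x) (conj Fj Fn)).
    by move: jn; rewrite jE ltnn.
  have [| | | | |_] := c1.
  + move=> n; apply: measurable_funM; first exact: Int_meas IW.
    by apply: measurable_sum => j; apply: measurable_indic; exact: mYA.
  + apply: measurable_funM; first exact: Int_meas IW.
    by apply: measurable_indic; apply: mYA; exact: bigcup_measurable.
  + exact: Int_norm.
  + move=> n x; rewrite normrM ler_piMr// sE; exact: indic_bound.
  + apply: aeW => x; apply: cvgM; first exact: cvg_cst.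
    under eq_fun do rewrite sE.
    have [[k _ Fk]|nF] := pselect ((\bigcup_k F k) (Y x)).
      apply: cvg_near_cst; near=> n.
      rewrite !indicE !mem_set//; first by exists k.
      rewrite -(bigcup_mkord n (fun k => Y @^-1` F k)); exists k => //=.
      by near: n; exact: nbhs_infty_gt.
    apply: cvg_near_cst; near=> n.
    rewrite !indicE !memNset// -(bigcup_mkord n (fun k => Y @^-1` F k)) => -[k /= _ Fk]; apply: nF; by exists k.
  have -> : (fun n => \int[P]_x (W x * \sum_(k < n) \1_(Y @^-1` F k) x)) = (fun=> 0).
    apply/funext => n; under eq_Rintegral do rewrite mulr_sumr.
    rewrite E_sum ?big1// => k; last by apply: Int_mul_indic => //; exact: mYA.
  by move=> c2; have := cvg_lim (@Rhausdorff R) c2; rewrite lim_cst => // <-.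
- by rewrite -mG.
Unshelve. all: by end_near. Qed.

End weighted_indicators.

(** * Conditional expectation given a random variable *)

Section conditional_expectation_theory.
Context d d' (T : measurableType d) (E : measurableType d') (R : realType).
Variables (P : probability T R) (Y : {RV P >-> E}).

(** The charge with density [Z] is pushed forward by [Y] and differentiated with respect to the law
    of [Y]. The derivative is directly a function on [E], with no factorization through [Y] to be
    shown. *)
Lemma cond_exp_exists Z : Int P Z -> is_cond_exp Z Y (cond_exp Z Y).
Proof.
move=> IZ.
suff [h hh] : exists h, is_cond_exp Z Y h.
  exact: (@xgetPex _ (fun=> 0) [set h | is_cond_exp Z Y h]) (ex_intro _ h hh).
have mY : measurable_fun setT Y by [].
pose nu : {charge set T -> \bar R} := induced_charge IZ.
pose nuY : {charge set E -> \bar R} := [the charge _ _ of pushforward nu Y].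
have dom : nuY mY `<< distribution P Y.
  apply/null_content_dominatesP => A mA A0.
  have mYA : measurable (Y @^-1` A) by rewrite -[X in measurable X]setTI; exact: mY.
  change (\int[P]_(x in Y @^-1` A) (Z x)%:E = 0)%E.
  apply: null_set_integral => //.
  by apply: measurable_funTS; exact: measurable_int IZ.
pose f := Radon_Nikodym (nuY mY) (distribution P Y).
have ff x : f x \is a fin_num by exact: Radon_Nikodym_fin_num.
have If : (distribution P Y).-integrable setT f by exact: Radon_Nikodym_integrable.
have fE : f = EFin \o (fine \o f) by apply/funext => x /=; rewrite fineK.
have mf : measurable_fun setT (fine \o f).
  by apply/measurable_EFinP; rewrite -fE; exact: measurable_int If.
have IfY : Int P ((fine \o f) \o Y).
  by apply/Int_distribution => //; rewrite -fE.
exists (fine \o f); split => // B mB.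
have := Radon_Nikodym_integral dom mB.
rewrite -/f fE => H.
transitivity (pushforward nu Y B); last by [].
rewrite H integral_pushforward//; first exact/measurable_EFinP.
have mYB : measurable (Y @^-1` B).
  by rewrite -[X in measurable X]setTI; exact: (mY measurableT B mB).
exact: (integrableS measurableT mYB _ IfY).
Qed.

Lemma cond_exp_meas Z : Int P Z -> measurable_fun setT (cond_exp Z Y).
Proof. by case/cond_exp_exists. Qed.

Lemma cond_exp_Int Z : Int P Z -> Int P (fun w => cond_exp Z Y (Y w)).
Proof. by case/cond_exp_exists. Qed.

Lemma cond_expE Z (g : E -> R) (K : R) : Int P Z -> measurable_fun setT g -> (forall x, `|g x| <= K) ->
  \int[P]_w (cond_exp Z Y (Y w) * g (Y w)) = \int[P]_w (Z w * g (Y w)).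
Proof.
move=> IZ mg bg; have [mh Ih hB] := cond_exp_exists IZ.
have mgY : measurable_fun setT (fun w => g (Y w)) by exact: measurableT_comp.
have bgY w : `|g (Y w)| <= K by [].
apply/eqP; rewrite -subr_eq0 -EB; [|exact: (Int_mul_bounded Ih mgY bgY)|exact: (Int_mul_bounded IZ mgY bgY)].
under eq_Rintegral do rewrite -mulrBl.
apply/eqP; apply: (@E_mul_bounded0 _ _ _ P _ _ K) => //; first exact: IntB.
move=> B mB.
have mYB : measurable (Y @^-1` (g @^-1` B)).
  rewrite -[X in measurable X]setTI; apply: measurable_funPT => //.
  by rewrite -[X in measurable X]setTI; exact: mg.
rewrite comp_preimage.
under eq_Rintegral do rewrite mulrBl.
rewrite EB; [|exact: Int_mul_indic|exact: Int_mul_indic].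
have := hB (g @^-1` B); rewrite !integral_indic_E//.
have mgB : measurable (g @^-1` B) by rewrite -[X in measurable X]setTI; exact: mg.
by move=> H; have e0 := H mgB; rewrite (EFin_inj e0) subrr.
Qed.

End conditional_expectation_theory.

(** * The path space and its shift *)

Section path_space.
Context d d' (T : measurableType d) (E : measurableType d') (R : realType).
Variables (P : probability T R) (X : nat -> {RV P >-> E}).

Definition coordinate_events : set (set (nat -> E)) :=
  [set A | exists t (B : set E), measurable B /\ A = [set x : nat -> E | B (x t)]].

(** On [T] the process need not be the orbit of a transformation; on path space it is, under the
    shift, and the ergodic theorem and the martingale limit theorem apply there. *)
Definition pathT := g_sigma_algebraType coordinate_events.

Lemma measurable_coordinate t : measurable_fun setT (fun x : pathT => x t).
Proof.
move=> _ B mB; rewrite setTI; apply: sub_sigma_algebra.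
by exists t, B.
Qed.

Lemma measurable_to_pathT d1 (T1 : measurableType d1) (f : T1 -> pathT) :
  (forall t, measurable_fun setT (fun w => f w t)) -> measurable_fun setT f.
Proof.
move=> mf; apply: (@measurability _ _ T1 pathT setT f coordinate_events erefl) => _ [_ [t [B [mB ->]]] <-].
exact: mf.
Qed.

Definition path_rv : T -> pathT := sample_path X.

Lemma measurable_path_rv : measurable_fun setT path_rv.
Proof. apply: measurable_to_pathT => t; exact: measurable_funP. Qed.

HB.instance Definition _ := isMeasurableFun.Build _ _ _ _ path_rv measurable_path_rv.

Definition path_law : probability pathT R := distribution P path_rv.

Definition shift_map : pathT -> pathT := @path_shift _ E.

Lemma measurable_shift_map : measurable_fun setT shift_map.
Proof. apply: measurable_to_pathT => t; exact: measurable_coordinate. Qed.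

HB.instance Definition _ := isMeasurableFun.Build _ _ _ _ shift_map measurable_shift_map.

Definition shift_rv : {RV path_law >-> pathT} := shift_map.

Lemma iter_shift n (x : pathT) t : iter n shift_rv x t = x (n + t)%N.
Proof. by elim: n t => [//|n IH] t /=; rewrite /shift_map/path_shift IH addnS. Qed.

Lemma shift_preserves : strictly_stationary X ->
  forall A : set pathT, measurable A -> path_law (shift_rv @^-1` A) = path_law A.
Proof. by move=> st A mA; exact: st. Qed.

Lemma shift_ergodic : ergodic X ->
  forall A : set pathT, measurable A -> shift_rv @^-1` A = A ->
  path_law A = 0%E \/ path_law A = 1%E.
Proof. by move=> er A mA; exact: er. Qed.

Lemma path_Int (f : pathT -> R) : measurable_fun setT f ->
  Int P (fun w => f (sample_path X w)) <-> Int path_law f.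
Proof. by move=> mf; exact: Int_distribution. Qed.

Lemma path_E (f : pathT -> R) : measurable_fun setT f -> Int P (fun w => f (sample_path X w)) ->
  \int[path_law]_x f x = \int[P]_w f (sample_path X w).
Proof. by move=> mf If; exact: (E_distribution (Y := path_rv)). Qed.

Hypothesis X_stationary : strictly_stationary X.

Lemma measurable_transition (F : E * E -> R) t s : measurable_fun setT F ->
  measurable_fun setT (fun x : pathT => F (x t, x s)).
Proof.
move=> mF; apply: (measurableT_comp mF).
by apply/measurable_fun_pairP; split; exact: measurable_coordinate.
Qed.

Lemma stationary_Int (F : E * E -> R) t : measurable_fun setT F ->
  Int P (fun w => F (X 0%N w, X 1%N w)) -> Int P (fun w => F (X t w, X t.+1 w)).
Proof.
move=> mF IF.
have m01 := measurable_transition 0 1 mF.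
have I1 : Int path_law (fun x : pathT => F (x 0%N, x 1%N)) by apply/path_Int.
have := iter_shift_Int (shift_preserves X_stationary) t I1.
under [X in Int _ X]eq_fun do rewrite !iter_shift addn0 addn1.
by move/path_Int; apply; exact: measurable_transition.
Qed.

Lemma stationary_E (F : E * E -> R) t : measurable_fun setT F ->
  Int P (fun w => F (X 0%N w, X 1%N w)) ->
  \int[P]_w F (X t w, X t.+1 w) = \int[P]_w F (X 0%N w, X 1%N w).
Proof.
move=> mF IF.
have m01 := measurable_transition 0 1 mF.
have I1 : Int path_law (fun x : pathT => F (x 0%N, x 1%N)) by apply/path_Int.
have := iter_shift_E (shift_preserves X_stationary) t I1.
under eq_Rintegral do rewrite !iter_shift addn0 addn1.
rewrite path_E//; last 2 first.
- exact: measurable_transition.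
- exact: stationary_Int.
by rewrite path_E.
Qed.

Lemma stationary_Int1 (f : E -> R) t : measurable_fun setT f ->
  Int P (fun w => f (X 0%N w)) -> Int P (fun w => f (X t w)).
Proof.
move=> mf If; apply: (@stationary_Int (fun p => f p.1)) => //.
exact: (measurableT_comp mf).
Qed.

Lemma stationary_E1 (f : E -> R) t : measurable_fun setT f ->
  Int P (fun w => f (X 0%N w)) -> \int[P]_w f (X t w) = \int[P]_w f (X 0%N w).
Proof.
move=> mf If; apply: (@stationary_E (fun p => f p.1)) => //.
exact: (measurableT_comp mf).
Qed.

End path_space.

(** * The Markov property for functions of a transition *)

Section markov.
Context d d' (T : measurableType d) (E : measurableType d') (R : realType).
Variables (P : probability T R) (X : nat -> {RV P >-> E}).
Hypothesis X_markov : homogeneous_markov X.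
Hypothesis X_stationary : strictly_stationary X.

Definition past_events t : set (set T) :=
  [set A | exists s (B : set E), [/\ (s <= t)%N, measurable B & A = X s @^-1` B]].

Lemma past_preimage t (f : g_sigma_algebraType (past_events t) -> R) (B : set R) :
  measurable_fun setT f -> measurable B -> past X t (f @^-1` B).
Proof. by move=> mf mB; have := mf measurableT B mB; rewrite setTI. Qed.

Lemma past_X t s : (s <= t)%N ->
  measurable_fun setT (X s : g_sigma_algebraType (past_events t) -> E).
Proof.
move=> st _ B mB; rewrite setTI; apply: sub_sigma_algebra; by exists s, B.
Qed.

Lemma past_measurable t H : past X t H -> measurable H.
Proof.
apply: smallest_sub; first exact: sigma_algebra_measurable.
move=> _ [s [B [_ mB ->]]]; rewrite -[X in measurable X]setTI; exact: measurable_funP.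
Qed.

Lemma pastX t B : measurable B -> past X t (X t @^-1` B).
Proof. by move=> mB; apply: sub_sigma_algebra; exists t, B. Qed.

Lemma pastI t A B : past X t A -> past X t B -> past X t (A `&` B).
Proof.
by move=> pA pB; apply: (@measurableI _ (g_sigma_algebraType (past_events t))).
Qed.

Lemma measurable_preX t B : measurable B -> measurable (X t @^-1` B).
Proof. by move=> mB; rewrite -[X in measurable X]setTI; exact: measurable_funP. Qed.

(** The conditional expectation of the indicator takes values in [0, 1] only almost surely. Clipping
    provides a version bounded everywhere, hence usable as a bounded weight. *)
Lemma cond_prob_version t H : measurable H ->
  exists q : E -> R, [/\ measurable_fun setT q, (forall x, `|q x| <= 1) &
    forall (g : E -> R) K, measurable_fun setT g -> (forall x, `|g x| <= K) ->
      \int[P]_w (\1_H w * g (X t w)) = \int[P]_w (q (X t w) * g (X t w))].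
Proof.
move=> mH; pose Z : T -> R := \1_H.
have IZ : Int P Z by apply: (@Int_bounded _ _ _ P _ 1) => [|w]; [exact: measurable_indic|exact: indic_bound].
pose h := cond_exp Z (X t).
have mh : measurable_fun setT h := cond_exp_meas (X t) IZ.
have Ih : Int P (fun w => h (X t w)) := cond_exp_Int (X t) IZ.
have hE (g : E -> R) K : measurable_fun setT g -> (forall x, `|g x| <= K) ->
  \int[P]_w (h (X t w) * g (X t w)) = \int[P]_w (Z w * g (X t w)) by exact: cond_expE.
pose q x := Num.max 0 (Num.min 1 (h x)).
have mq : measurable_fun setT q.
  apply: measurable_maxr => //; exact: measurable_minr.
have q01 x : 0 <= q x <= 1 by rewrite /q le_max lexx/= ge_max ler01 ge_min lexx.
have bq x : `|q x| <= 1 by have /andP[q0 q1] := q01 x; rewrite ger0_norm.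
have IqX : Int P (fun w => q (X t w)).
  by apply: (@Int_bounded _ _ _ P _ 1) => [|w]; [exact: measurableT_comp|exact: bq].
pose B1 := h @^-1` `]1, +oo[%classic.
pose B0 := h @^-1` `]-oo, 0[%classic.
have mB1 : measurable B1 by rewrite -[X in measurable X]setTI; exact: mh.
have mB0 : measurable B0 by rewrite -[X in measurable X]setTI; exact: mh.
have iX (B : set E) : measurable B -> Int P (fun w => \1_B (X t w) : R).
  move=> mB; apply: (@Int_bounded _ _ _ P _ 1) => [|w]; last exact: indic_bound.
  by apply: measurableT_comp; [exact: measurable_indic|exact: measurable_funP].
have mX (B : set E) (W : T -> R) : measurable B -> Int P W -> Int P (fun w => W w * \1_B (X t w)).
  move=> mB IW; apply: (Int_mul_bounded IW (K := 1)) => [|w]; last exact: indic_bound.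
  by apply: measurableT_comp; [exact: measurable_indic|exact: measurable_funP].
have e1 : \int[P]_w (h (X t w) * \1_B1 (X t w) - \1_B1 (X t w)) <= 0.
  rewrite EB; [|exact: mX|exact: iX].
  rewrite (hE _ 1); [|exact: measurable_indic|exact: indic_bound].
  rewrite subr_le0; apply: E_le; [exact: mX|exact: iX|].
  move=> w; rewrite /Z !indicE; case: (w \in H); case: (_ \in B1); rewrite ?mul0r ?mul1r ?mulr0//.
have e0 : 0 <= \int[P]_w (h (X t w) * \1_B0 (X t w)).
  rewrite (hE _ 1); [|exact: measurable_indic|exact: indic_bound].
  by apply: E_ge0 => w; rewrite /Z !indicE mulr_ge0.
(* [h] and [q] differ only where [h > 1] or [h < 0]. Testing [h] on these two sets shows that the
   integral of the difference is at most 0. *)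
have hq w : `|h (X t w) - q (X t w)| =
    (h (X t w) * \1_B1 (X t w) - \1_B1 (X t w)) - h (X t w) * \1_B0 (X t w).
  rewrite !indicE /q.
  have -> : (X t w \in B1) = (1 < h (X t w)).
    by apply/idP/idP; rewrite inE /B1/= in_itv/= andbT.
  have -> : (X t w \in B0) = (h (X t w) < 0).
    by apply/idP/idP; rewrite inE /B0/= in_itv/=.
  case: (ltP 1 (h (X t w))) => h1.
    rewrite (_ : (h (X t w) < 0) = false); last by apply/negbTE; rewrite -leNgt; lra.
    rewrite (_ : Num.max 0 1 = 1 :> R); last by apply/max_idPr.
    by rewrite mulr1 mulr0 subr0 ger0_norm//; lra.
  case: (ltP (h (X t w)) 0) => h0.
    by rewrite mulr1 mulr0 !subr0 sub0r ltr0_norm.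
  by rewrite subrr normr0 !mulr0 !subr0.
have Ihq : Int P (fun w => h (X t w) - q (X t w)) by exact: IntB.
have dq : \int[P]_w `|h (X t w) - q (X t w)| <= 0.
  rewrite (_ : \int[P]_w _ = \int[P]_w ((h (X t w) * \1_B1 (X t w) - \1_B1 (X t w)) - h (X t w) * \1_B0 (X t w))); last first.
    by apply: eq_Rintegral => w _; rewrite hq.
  rewrite EB; [|by apply: IntB; [exact: mX|exact: iX]|exact: mX].
  by rewrite subr_le0 (le_trans e1).
exists q; split => // g K mg bg; rewrite -(hE g K)//.
have mgX : measurable_fun setT (fun w => g (X t w)) by apply: measurableT_comp.
have bgX w : `|g (X t w)| <= K by [].
have K0 : 0 <= K by apply: le_trans (bg point).
apply/eqP; rewrite -subr_eq0 -EB; [|exact: (Int_mul_bounded Ih mgX bgX)|exact: (Int_mul_bounded IqX mgX bgX)].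
rewrite -normr_le0; apply: (@le_trans _ _ (\int[P]_w (K * `|h (X t w) - q (X t w)|))).
  apply: E_abs_le.
  - by apply: IntB; [exact: (Int_mul_bounded Ih mgX bgX)|exact: (Int_mul_bounded IqX mgX bgX)].
  - by apply: IntZ; exact: Int_norm.
  by move=> w; rewrite -mulrBl normrM mulrC ler_wpM2r.
by rewrite (EZ K (Int_norm Ihq)) mulr_ge0_le0.
Qed.

(* There is no transition kernel to integrate against: H is replaced by a version q(X_t) of
   P(H | X_t), which is a pi-lambda argument on rectangles of [E * E]. *)
Lemma markov_transition t H (F : E * E -> R) : past X t H -> measurable_fun setT F ->
  Int P (fun w => F (X 0%N w, X 1%N w)) ->
  (forall g : E -> R, measurable_fun setT g -> (forall x, `|g x| <= 1) ->
     \int[P]_w (F (X 0%N w, X 1%N w) * g (X 0%N w)) = 0) ->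
  \int[P]_w (F (X t w, X t.+1 w) * \1_H w) = 0.
Proof.
move=> pH mF IF F0.
have mH := past_measurable pH.
have [q [mq bq qE]] := cond_prob_version t mH.
have mqX s : measurable_fun setT (fun w => q (X s w)) by apply: measurableT_comp.
have IqX s : Int P (fun w => q (X s w)).
  by apply: (@Int_bounded _ _ _ P _ 1) => [|w]; [exact: mqX|exact: bq].
have IH : Int P (\1_H : T -> R).
  by apply: (@Int_bounded _ _ _ P _ 1) => [|w]; [exact: measurable_indic|exact: indic_bound].
(* [W] is orthogonal to bounded functions of [X t] by the choice of [q]; the Markov property extends
   this to functions of the pair of states at dates [t] and [t.+1]. *)
pose W w := \1_H w - q (X t w).
have IW : Int P W by exact: IntB.
have bW w : `|W w| <= 2.
  apply: (le_trans (ler_normB _ _)); have := bq (X t w); have := @indic_bound _ T R H w; lra.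
pose Y w := (X t w, X t.+1 w).
have mY : measurable_fun setT Y.
  by apply/measurable_fun_pairP; split; exact: measurable_funP.
have EW : \int[P]_w W w = 0.
  rewrite EB//; have := qE (cst 1) 1 (measurable_cst _).
  by under eq_Rintegral do rewrite mulr1; under [in X in _ = X]eq_Rintegral do rewrite mulr1; move=> ->; rewrite ?subrr// => x; rewrite normr1.
have mark B : measurable B -> exists p : E -> R, [/\ measurable_fun setT p, (forall x, `|p x| <= 1) &
    forall H', past X t H' -> \int[P]_w (\1_H' w * \1_(X t.+1 @^-1` B) w) = \int[P]_w (p (X t w) * \1_H' w)].
  move=> mB; have [p [mp p01 pE]] := X_markov mB.
  exists p; split => //; first by move=> x; have /andP[p0 p1] := p01 x; rewrite ger0_norm.
  move=> H' pH'; have := pE t H' pH'.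
  have IpX : Int P (fun w => p (X t w)).
    apply: (@Int_bounded _ _ _ P _ 1) => [|w]; first by apply: measurableT_comp.
    by have /andP[p0 p1] := p01 (X t w); rewrite ger0_norm.
  rewrite integral_indic_E//; last exact: past_measurable pH'.
  rewrite P_indic; last by apply: measurableI; [exact: past_measurable pH'|exact: measurable_preX].
  move=> e0; rewrite -(EFin_inj e0); apply: eq_Rintegral => w _.
  by rewrite indicI.
(* On a rectangle, the indicator of [A2] at date [t.+1] is [p (X t w)] plus [V w]. The first part is
   a function of [X t], orthogonal to [W]; [V] is orthogonal to the events of the past and, by level
   sets, to bounded functions of [X t]. *)
have rect (A : set (E * E)) : [set A1 `*` A2 | A1 in measurable & A2 in measurable] A ->
    \int[P]_w (W w * \1_(Y @^-1` A) w) = 0.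
  move=> [A1 mA1 [A2 mA2 <-]]; have [p [mp bp pE]] := mark A2 mA2.
  have IpX : Int P (fun w => p (X t w)).
    by apply: (@Int_bounded _ _ _ P _ 1) => [|w]; [apply: measurableT_comp|exact: bp].
  have mpX : measurable_fun setT (fun w => p (X t w)) by apply: measurableT_comp.
  pose g x := q x * \1_A1 x.
  have mg : measurable_fun setT g by apply: measurable_funM => //; exact: measurable_indic.
  have bg x : `|g x| <= 1.
    by rewrite normrM mulr_ile1// indic_bound.
  pose V w := \1_(X t.+1 @^-1` A2) w - p (X t w) : R.
  have IV : Int P V.
    apply: IntB => //; apply: (@Int_bounded _ _ _ P _ 1) => [|w]; last exact: indic_bound.
    by apply: measurable_indic; exact: measurable_preX.
  have V0 H' : past X t H' -> \int[P]_w (V w * \1_H' w) = 0.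
    move=> pH'; have mH' := past_measurable pH'.
    under eq_Rintegral do rewrite mulrBl [X in X - _]mulrC.
    rewrite EB; [by rewrite pE// subrr|..].
      have I1 : Int P (\1_H' : T -> R).
        by apply: (@Int_bounded _ _ _ P _ 1) => [|w]; [exact: measurable_indic|exact: indic_bound].
      by apply: Int_mul_indic => //; exact: measurable_preX.
    exact: Int_mul_indic.
  have h1 : \int[P]_w (V w * g (X t w)) = 0.
    apply: (@E_mul_bounded0 _ _ _ P _ _ 1) => //; first by apply: measurableT_comp.
    move=> B mB; apply: V0.
    rewrite (_ : _ @^-1` B = X t @^-1` (g @^-1` B))//; apply: pastX.
    by rewrite -[X in measurable X]setTI; exact: mg.
  have h2 : \int[P]_w (V w * \1_(H `&` X t @^-1` A1) w) = 0 by apply: V0; apply: pastI => //; exact: pastX.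
  have h3 := qE (fun x => \1_A1 x * p x) 1.
  have {}h3 : \int[P]_w (\1_H w * (\1_A1 (X t w) * p (X t w))) = \int[P]_w (q (X t w) * (\1_A1 (X t w) * p (X t w))).
    apply: h3; first by apply: measurable_funM => //; exact: measurable_indic.
    by move=> x; rewrite normrM mulr_ile1// indic_bound.
  have mA1X : measurable_fun setT (fun w => \1_A1 (X t w) : R).
    by apply: measurableT_comp; [exact: measurable_indic|exact: measurable_funP].
  have mAp : measurable_fun setT (fun w => \1_A1 (X t w) * p (X t w)) by exact: measurable_funM.
  have bAp w : `|\1_A1 (X t w) * p (X t w)| <= 1 by rewrite normrM mulr_ile1// indic_bound.
  have I1 := Int_mul_bounded IH mAp bAp.
  have I2 := Int_mul_bounded (IqX t) mAp bAp.
  have I3 : Int P (fun w => V w * g (X t w)).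
    by apply: (Int_mul_bounded IV (K := 1)) => [|w]; [apply: measurableT_comp|exact: bg].
  have I4 : Int P (fun w => V w * \1_(H `&` X t @^-1` A1) w).
    by apply: Int_mul_indic => //; apply: measurableI => //; exact: measurable_preX.
  have -> : \int[P]_w (W w * \1_(Y @^-1` (A1 `*` A2)) w) =
     \int[P]_w ((V w * \1_(H `&` X t @^-1` A1) w - V w * g (X t w)) +
       (\1_H w * (\1_A1 (X t w) * p (X t w)) - q (X t w) * (\1_A1 (X t w) * p (X t w)))).
    apply: eq_Rintegral => w _.
    have -> : \1_(Y @^-1` (A1 `*` A2)) w = \1_A1 (X t w) * \1_(X t.+1 @^-1` A2) w :> R.
      rewrite !indicE -natrM mulnb; congr (nat_of_bool _)%:R.
      by apply/idP/andP; rewrite !inE.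
    have -> : \1_(H `&` X t @^-1` A1) w = \1_H w * \1_A1 (X t w) :> R by rewrite indicI.
    by rewrite /W /V /g; ring.
  rewrite ED; [|exact: IntB|exact: IntB].
  by rewrite EB// EB// h1 h2 h3 !subrr addr0.
have piG : setI_closed [set (A1 : set E) `*` (A2 : set E) | A1 in measurable & A2 in measurable].
  move=> _ _ [A1 mA1 [A2 mA2 <-]] [B1 mB1 [B2 mB2 <-]].
  exists (A1 `&` B1); first exact: measurableI.
  exists (A2 `&` B2); first exact: measurableI.
  by rewrite setXI.
have WA := @E_pi_lambda0 _ _ _ P _ _ Y W _ mY IW EW (measurable_prod_measurableType E E) piG rect.
have IFt := stationary_Int X_stationary t mF IF.
have IFq s : Int P (fun w => F (X s w, X s.+1 w) * q (X s w)).
  by apply: (Int_mul_bounded (stationary_Int X_stationary s mF IF) (mqX s) (K := 1)).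
(* [F] is only integrable: its truncations are handled by level sets, and [|W| <= 2] gives the
   domination by [2 * |F|]. *)
have FW : \int[P]_w (F (Y w) * W w) = 0.
  have h n : \int[P]_w (W w * trunc n (F (Y w))) = 0.
    apply: (@E_mul_bounded0 _ _ _ P _ _ n%:R) => //; [|by move=> w; exact: trunc_bound|].
      by apply: (measurableT_comp (measurable_trunc n)); exact: measurableT_comp.
    move=> B mB; apply: (WA ((trunc n \o F) @^-1` B)).
    rewrite -[X in measurable X]setTI; exact: (measurableT_comp (measurable_trunc n) mF).
  have [| | | | |_] := @E_dct _ _ _ P (fun n w => W w * trunc n (F (Y w))) (fun w => F (Y w) * W w)
     (fun w => 2 * `|F (Y w)|).
  - move=> n; apply: measurable_funM; first exact: Int_meas IW.
    by apply: (measurableT_comp (measurable_trunc n)); exact: measurableT_comp.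
  - by apply: measurable_funM; [exact: measurableT_comp|exact: Int_meas IW].
  - by apply: IntZ; exact: Int_norm.
  - by move=> n w; rewrite normrM ler_pM// le_trunc.
  - apply: aeW => w; rewrite mulrC; apply: cvgM; first exact: cvg_cst.
    exact: cvg_trunc.
  under eq_fun do rewrite h.
  by move=> c2; have := cvg_lim (@Rhausdorff R) c2; rewrite lim_cst => // <-.
have -> : \int[P]_w (F (X t w, X t.+1 w) * \1_H w) =
    \int[P]_w (F (Y w) * W w + F (X t w, X t.+1 w) * q (X t w)).
  by apply: eq_Rintegral => w _; rewrite /W /Y; ring.
rewrite ED//; last first.
  apply: (Int_mul_bounded IFt _ (K := 2)) => //; exact: Int_meas IW.
rewrite FW add0r.
(* The remaining weight [q (X t w)] depends on the current state alone, so stationarity brings the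
   integral to date 0, where [F0] applies. *)
have mFq : measurable_fun setT (fun p : E * E => F p * q p.1).
  by apply: measurable_funM => //; exact: (measurableT_comp mq).
rewrite (@stationary_E _ _ _ _ _ _ X X_stationary (fun p => F p * q p.1) t mFq (IFq 0%N)).
exact: F0.
Qed.

End markov.

(** * The operator and the score *)

Section L2_ext.
Context d (E : measurableType d) (R : realType) (Q : probability E R).

Lemma L2_ext (u v : E -> R) : L2 Q u -> L2 Q v -> (forall h, L2 Q h -> inner Q h u = inner Q h v) ->
  u = v %[ae Q].
Proof.
move=> Lu Lv h.
have Lw : L2 Q (fun x => u x - v x) by exact: L2B.
have : inner Q (fun x => u x - v x) (fun x => u x - v x) = 0.
  by rewrite innerBr// h// subrr.
move=> /(inner0_ae Lw); apply: filterS => x + _ => /(_ I) /eqP.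
by rewrite subr_eq0 => /eqP.
Qed.

End L2_ext.

Section operator.
Context d d' (T : measurableType d) (E : measurableType d') (R : realType).
Variables (P : probability T R) (X : nat -> {RV P >-> E}) (S : set E) (m : E * E -> R).
Hypothesis X_in_S : forall t w, S (X t w).
Hypothesis X_stationary : strictly_stationary X.
Hypothesis m_measurable : measurable_fun setT m.
Hypothesis m_pos : forall x y, S x -> S y -> 0 < m (x, y).
Variables (rho : R) (phi phis : E -> R).
Hypothesis A1 : perron_frobenius X m rho phi phis.
Local Notation Q := (stat_dist X).
Local Notation M := (opM X m).

Lemma Q_Int t f : Int Q f -> Int P (fun w => f (X t w)).
Proof.
move=> If; have mf := Int_meas If.
exact: (stationary_Int1 X_stationary t mf ((Int_distribution (X 0%N) mf).2 If)).
Qed.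

Lemma Q_E t f : Int Q f -> \int[P]_w f (X t w) = \int[Q]_x f x.
Proof.
move=> If; have mf := Int_meas If.
have I0 := (Int_distribution (X 0%N) mf).2 If.
by rewrite (stationary_E1 X_stationary t mf I0) -(E_distribution mf I0).
Qed.

Lemma opM_L2 f : L2 Q f -> L2 Q (M f).
Proof. by have [C h] := pf_bounded A1; move=> /h[]. Qed.

Definition opM_const : R := `|sval (cid (pf_bounded A1))|.

Lemma opM_const_ge0 : 0 <= opM_const. Proof. exact: normr_ge0. Qed.

Lemma opM_bound f : L2 Q f -> l2norm Q (M f) <= opM_const * l2norm Q f.
Proof.
rewrite /opM_const; case: cid => C h /= /h[_ le]; apply: (le_trans le).
by rewrite ler_wpM2r ?l2norm_ge0// ler_norm.
Qed.

Lemma m_gt0 s t w : 0 < m (X s w, X t w).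
Proof. exact: m_pos. Qed.

Lemma measurable_mX s t : measurable_fun setT (fun w => m (X s w, X t w)).
Proof.
apply: (measurableT_comp m_measurable).
by apply/measurable_fun_pairP; split; exact: measurable_funP.
Qed.

Lemma measurable_form (g f : E -> R) s t : measurable_fun setT g -> measurable_fun setT f ->
  measurable_fun setT (fun w => g (X s w) * m (X s w, X t w) * f (X t w)).
Proof.
move=> mg mf; apply: measurable_funM; last by apply: measurableT_comp.
by apply: measurable_funM; [apply: measurableT_comp|exact: measurable_mX].
Qed.

(** The conditional expectation given [X 0] determines the form only for bounded [g]; the extension
    to [L2] rests on [form_abs]. *)
Lemma opM_bounded_form f (g : E -> R) K : L2 Q f -> measurable_fun setT g -> (forall x, `|g x| <= K) ->
  Int P (fun w => g (X 0%N w) * m (X 0%N w, X 1%N w) * f (X 1%N w)) /\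
  \int[P]_w (g (X 0%N w) * m (X 0%N w, X 1%N w) * f (X 1%N w)) = inner Q g (M f).
Proof.
move=> Lf mg bg; have IZ := pf_integrable A1 Lf.
have mgX : measurable_fun setT (fun w => g (X 0%N w)) by apply: measurableT_comp.
have eqi : (fun w => g (X 0%N w) * m (X 0%N w, X 1%N w) * f (X 1%N w)) =
   (fun w => m (X 0%N w, X 1%N w) * f (X 1%N w) * g (X 0%N w)).
  by apply/funext => w; ring.
split; first by rewrite eqi; apply: (Int_mul_bounded IZ mgX (K := K)).
under eq_Rintegral do rewrite -mulrA mulrC.
rewrite -(cond_expE (X 0%N) IZ mg bg).
rewrite (@Q_E 0%N (fun x => M f x * g x)) 1?innerC//.
by apply: L2_mul; [exact: opM_L2|exact: L2_bounded bg].
Qed.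

Lemma trunc_L2 n g : L2 Q g -> L2 Q (fun x => trunc n (g x)).
Proof.
move=> Lg; apply: (L2_le _ Lg) => [|x]; last exact: le_trunc.
by apply: measurableT_comp (L2_meas Lg); exact: measurable_trunc.
Qed.

(* [E |g(X_0) m f(X_1)| = <|g|, M |f|>], first for truncations of g. *)
Lemma form_abs f g : L2 Q f -> L2 Q g ->
  Int P (fun w => `|g (X 0%N w) * m (X 0%N w, X 1%N w) * f (X 1%N w)|) /\
  \int[P]_w `|g (X 0%N w) * m (X 0%N w, X 1%N w) * f (X 1%N w)| <= opM_const * l2norm Q f * l2norm Q g.
Proof.
move=> Lf Lg; pose F w := `|g (X 0%N w) * m (X 0%N w, X 1%N w) * f (X 1%N w)|.
have mF : measurable_fun setT F.
  by apply: measurableT_comp => //; exact: measurable_form (L2_meas Lg) (L2_meas Lf).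
have Ln := L2_norm Lf.
pose G N w := `|trunc N (g (X 0%N w))| * m (X 0%N w, X 1%N w) * `|f (X 1%N w)|.
have mtr N : measurable_fun setT (fun x => `|trunc N (g x)|).
  by apply: measurableT_comp => //; exact: L2_meas (trunc_L2 N Lg).
have GE N : Int P (G N) /\ \int[P]_w G N w <= opM_const * l2norm Q f * l2norm Q g.
  have [IG EG] := @opM_bounded_form _ (fun x => `|trunc N (g x)|) N%:R Ln (mtr N)
     (fun x => ltac:(by rewrite normr_id trunc_bound)).
  split => //; rewrite EG; apply: (le_trans (ler_norm _)).
  have Lt := L2_norm (trunc_L2 N Lg).
  apply: (le_trans (cauchy_schwarz Lt (opM_L2 Ln))).
  rewrite mulrC ler_pM ?l2norm_ge0//.
    by rewrite -(l2norm_norm Lf); exact: opM_bound.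
  by apply: l2norm_le => // x; rewrite normr_id le_trunc.
have G0 N w : 0 <= G N w by rewrite /G !mulr_ge0// ltW// m_gt0.
have FE w : F w = `|g (X 0%N w)| * m (X 0%N w, X 1%N w) * `|f (X 1%N w)|.
  by rewrite /F !normrM (ger0_norm (ltW (m_gt0 _ _ _))).
have GF N w : G N w <= F w.
  rewrite FE /G ler_wpM2r// ler_wpM2r ?le_trunc// ltW// m_gt0//.
(* Two cutoffs: truncating [g] at [N] makes [opM_bounded_form] available, and restricting to
   [F <= n] gives a constant dominating function for the limit in [N]. *)
apply: ge0_Int_trunc => // n.
have mI : measurable_fun setT (fun w => (F w <= n%:R)%R%:R : R).
  rewrite (_ : (fun w => _) = \1_(F @^-1` `]-oo, n%:R]%classic)).
    by apply: measurable_indic; rewrite -[X in measurable X]setTI; exact: mF.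
  apply/funext => w; rewrite indicE; congr (nat_of_bool _)%:R.
  by apply/esym; apply/idP/idP; rewrite inE/= in_itv/=.
have I01 w : 0 <= ((F w <= n%:R)%R%:R : R) <= 1 by case: (F w <= n%:R)%R; rewrite lexx ler01.
have [| | | | |IFn cF] := @E_dct _ _ _ P (fun N w => G N w * (F w <= n%:R)%R%:R) (fun w => F w * (F w <= n%:R)%R%:R) (fun=> n%:R).
- by move=> N; apply: measurable_funM => //; exact: Int_meas (GE N).1.
- exact: measurable_funM.
- exact: Int_cst.
- move=> N w; have := GF N w; have := G0 N w; case: (leP (F w) n%:R) => h g0 gf; rewrite /= ?mulr1n ?mulr0n ?mulr1 ?mulr0 ?normr0//.
  by rewrite ger0_norm// (le_trans gf).
- apply: aeW => w; apply: cvgM; last exact: cvg_cst.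
  rewrite FE; apply: cvgM; last exact: cvg_cst.
  apply: cvgM; last exact: cvg_cst.
  by apply: cvg_norm; exact: cvg_trunc.
rewrite E_EFin// lee_fin.
apply: (@cvgr_to_le _ _ _ _ _ _ _ cF); apply: nearW => N.
apply: (le_trans _ (GE N).2); apply: E_le => //.
- apply: (Int_mul_bounded (GE N).1 mI (K := 1)) => w; have /andP[i0 i1] := I01 w.
  by rewrite ger0_norm.
- exact: (GE N).1.
by move=> w; have /andP[i0 i1] := I01 w; rewrite ler_piMr.
Qed.

Lemma form_Int f g : L2 Q f -> L2 Q g ->
  Int P (fun w => g (X 0%N w) * m (X 0%N w, X 1%N w) * f (X 1%N w)).
Proof.
move=> Lf Lg; have [Ia _] := form_abs Lf Lg.
apply: (Int_le _ Ia) => [|w]; last by rewrite normr_id.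
exact: measurable_form (L2_meas Lg) (L2_meas Lf).
Qed.

(** Truncations of [g] converge on both sides; [form_abs] gives the dominating function under [P],
    Cauchy-Schwarz the one under [Q]. *)
Lemma form_E f g : L2 Q f -> L2 Q g ->
  \int[P]_w (g (X 0%N w) * m (X 0%N w, X 1%N w) * f (X 1%N w)) = inner Q g (M f).
Proof.
move=> Lf Lg; have [Ia _] := form_abs Lf Lg.
have LMf := opM_L2 Lf.
have mtr N : measurable_fun setT (fun x => trunc N (g x)).
  exact: L2_meas (trunc_L2 N Lg).
have [| | | | |_ c1] := @E_dct _ _ _ P
    (fun N w => trunc N (g (X 0%N w)) * m (X 0%N w, X 1%N w) * f (X 1%N w))
    (fun w => g (X 0%N w) * m (X 0%N w, X 1%N w) * f (X 1%N w))
    (fun w => `|g (X 0%N w) * m (X 0%N w, X 1%N w) * f (X 1%N w)|).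
- by move=> N; exact: (measurable_form 0 1 (mtr N) (L2_meas Lf)).
- exact: measurable_form (L2_meas Lg) (L2_meas Lf).
- exact: Ia.
- by move=> N w; rewrite -[X in `|X| <= _]mulrA -[X in _ <= `|X|]mulrA; exact: le_trunc_mull.
- apply: aeW => w; apply: cvgM; last exact: cvg_cst.
  by apply: cvgM; [exact: cvg_trunc|exact: cvg_cst].
have [| | | | |_ c2] := @E_dct _ _ _ Q (fun N x => trunc N (g x) * M f x) (fun x => g x * M f x)
    (fun x => `|g x * M f x|).
- by move=> N; exact: (measurable_funM (mtr N) (L2_meas LMf)).
- exact: measurable_funM (L2_meas Lg) (L2_meas LMf).
- by apply: Int_norm; exact: L2_mul.
- by move=> N w; exact: le_trunc_mull.
- by apply: aeW => x; apply: cvgM; [exact: cvg_trunc|exact: cvg_cst].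
have eqs : (fun N => \int[P]_w (trunc N (g (X 0%N w)) * m (X 0%N w, X 1%N w) * f (X 1%N w))) =
    (fun N => \int[Q]_x (trunc N (g x) * M f x)).
  apply/funext => N.
  by have [_ ->] := @opM_bounded_form _ (fun x => trunc N (g x)) N%:R Lf (mtr N) (fun x => trunc_bound N (g x)).
rewrite eqs in c1.
by rewrite -(cvg_lim (@Rhausdorff R) c1) (cvg_lim (@Rhausdorff R) c2).
Qed.

(** [cond_exp] picks a version of each conditional expectation independently, so linearity holds
    only almost everywhere. It is read off from the bilinear form tested against all of [L2]. *)
Lemma opM_linear c f g : L2 Q f -> L2 Q g ->
  M (fun x => f x + c * g x) = (fun x => M f x + c * M g x) %[ae Q].
Proof.
move=> Lf Lg; have Lcg := L2Z c Lg; have Lfg := L2D Lf Lcg.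
have LMf := opM_L2 Lf; have LMg := opM_L2 Lg.
apply: L2_ext; [exact: opM_L2|by apply: L2D => //; exact: L2Z|].
move=> h Lh; rewrite -form_E// innerDr//; last exact: L2Z.
rewrite innerZr// -!form_E// -EZ; last exact: form_Int.
rewrite -ED; [|exact: form_Int|by apply: IntZ; exact: form_Int].
by apply: eq_Rintegral => w _; ring.
Qed.

Lemma opM_phi : M phi = (fun x => rho * phi x) %[ae Q].
Proof. exact: (pf_phi_eigen A1).2. Qed.

Lemma phi_L2 : L2 Q phi. Proof. exact: (pf_phi_eigen A1).1. Qed.

Lemma phis_L2 : L2 Q phis. Proof. exact: (pf_phis_eigen A1).1. Qed.

Lemma inner_opM_phi g : L2 Q g -> inner Q g (M phi) = rho * inner Q g phi.
Proof.
move=> Lg; rewrite -innerZr//; last exact: phi_L2.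
apply: inner_ae => //; [exact: opM_L2 phi_L2|by apply: L2Z; exact: phi_L2|exact: aeW|exact: opM_phi].
Qed.

(** For bounded [f] this is the conditional expectation given [X 1], whose law is [Q] by
    stationarity, combined with the equation of [phis]; truncation of [f] gives the general case. *)
Lemma inner_phis_opM f : L2 Q f -> inner Q phis (M f) = rho * inner Q phis f.
Proof.
move=> Lf; have Lp := phis_L2.
have [Lp' eqp] := pf_phis_eigen A1.
have Lone : L2 Q (fun=> 1) := L2_cst Q 1.
pose Z w := m (X 0%N w, X 1%N w) * phis (X 0%N w).
have IZ : Int P Z.
  have := form_Int Lone Lp; apply: eq_integrable => // w _ /=.
  by rewrite mulr1 mulrC.
have mA : measurable_fun setT (opMadj X m phis) := cond_exp_meas (X 1%N) IZ.
have LA : Int Q (fun x => opMadj X m phis x).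
  apply: (Int_ae (f := fun x => rho * phis x)) => //.
    by apply: filterS eqp => x + _ => /(_ I) ->.
  by apply: IntZ; exact: L2_Int.
have bcase (f' : E -> R) K : measurable_fun setT f' -> (forall x, `|f' x| <= K) ->
    \int[P]_w (phis (X 0%N w) * m (X 0%N w, X 1%N w) * f' (X 1%N w)) = rho * inner Q phis f'.
  move=> mf' bf'; have Lf' := L2_bounded Q mf' bf'.
  transitivity (\int[P]_w (Z w * f' (X 1%N w))).
    by apply: eq_Rintegral => w _; rewrite /Z; ring.
  rewrite -(cond_expE (X 1%N) IZ mf' bf').
  rewrite (@Q_E 1%N (fun x => opMadj X m phis x * f' x)); last exact: (Int_mul_bounded LA mf' bf').
  rewrite -innerZl//; apply: E_ae.
  - exact: measurable_funM.
  - by apply: measurable_funM => //; apply: measurable_funM => //; exact: L2_meas Lp.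
  by apply: filterS eqp => x + _ => /(_ I) ->.
have [Ia _] := form_abs Lf Lp.
have [| | | | |_ c1] := @E_dct _ _ _ P
    (fun N w => phis (X 0%N w) * m (X 0%N w, X 1%N w) * trunc N (f (X 1%N w)))
    (fun w => phis (X 0%N w) * m (X 0%N w, X 1%N w) * f (X 1%N w))
    (fun w => `|phis (X 0%N w) * m (X 0%N w, X 1%N w) * f (X 1%N w)|).
- by move=> N; apply: (@measurable_form _ (fun x => trunc N (f x))); [exact: L2_meas Lp|exact: L2_meas (trunc_L2 N Lf)].
- exact: measurable_form (L2_meas Lp) (L2_meas Lf).
- exact: Ia.
- by move=> N w; exact: le_trunc_mulr.
- by apply: aeW => w; apply: cvgM; [exact: cvg_cst|exact: cvg_trunc].
have [| | | | |_ c2] := @E_dct _ _ _ Q (fun N x => phis x * trunc N (f x)) (fun x => phis x * f x)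
    (fun x => `|phis x * f x|).
- by move=> N; apply: measurable_funM; [exact: L2_meas Lp|exact: L2_meas (trunc_L2 N Lf)].
- exact: measurable_funM (L2_meas Lp) (L2_meas Lf).
- by apply: Int_norm; exact: L2_mul.
- by move=> N w; exact: le_trunc_mulr.
- by apply: aeW => x; apply: cvgM; [exact: cvg_cst|exact: cvg_trunc].
rewrite -form_E//.
have c3 : rho * \int[Q]_x (phis x * trunc N (f x)) @[N --> \oo] --> rho * inner Q phis f.
  by apply: cvgM; [exact: cvg_cst|exact: c2].
have eqs : (fun N => \int[P]_w (phis (X 0%N w) * m (X 0%N w, X 1%N w) * trunc N (f (X 1%N w)))) =
    (fun N => rho * \int[Q]_x (phis x * trunc N (f x))).
  apply/funext => N; rewrite (bcase (fun x => trunc N (f x)) N%:R)//.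
    exact: L2_meas (trunc_L2 N Lf).
  by move=> x; exact: trunc_bound.
rewrite eqs in c1.
by rewrite -(cvg_lim (@Rhausdorff R) c1) (cvg_lim (@Rhausdorff R) c3).
Qed.

Lemma opM0 : M (cst 0) = cst 0 %[ae Q].
Proof.
have L0 : L2 Q (cst 0) := L2_cst Q 0.
apply: l2norm0_ae; first exact: opM_L2.
apply/eqP; rewrite eq_le l2norm_ge0 andbT (le_trans (opM_bound L0))//.
by rewrite l2norm_cst0 mulr0.
Qed.

(** A real eigenfunction [f] is the complex one with imaginary part 0, so its eigenvalue obeys the
    bound on moduli. *)
Lemma opM_top l f : L2 Q f -> rho < l -> M f = (fun x => l * f x) %[ae Q] -> f = cst 0 %[ae Q].
Proof.
move=> Lf rl eqf; apply: contrapT => f0.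
have [_ /(_ (l%:C)%C)] := pf_largest A1.
have ev : eigenvalues Q M (l%:C)%C.
  exists f, (cst 0); split => //; [exact: L2_cst|by case|split].
    by apply: filterS eqf => x + _ => /(_ I) /= ->; rewrite mulr0 subr0 subrr.
  by apply: filterS opM0 => x + _ => /(_ I) /= ->; rewrite mulr0 mul0r addr0 subrr.
move=> /(_ ev); rewrite /ComplexField.Normc.normc /= expr0n addr0 sqrtr_sqr => h.
by move: (le_lt_trans (le_trans (ler_norm l) h) rl); rewrite ltxx.
Qed.

(** Simplicity speaks of some eigenfunction [h]. [phi] is a multiple of it, with a nonzero factor
    because [inner phi phis] is 1, so [phi] spans the eigenspace as well. *)
Lemma opM_simple f : L2 Q f -> M f = (fun x => rho * f x) %[ae Q] -> inner Q phi phis = 1 ->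
  exists c, f = (fun x => c * phi x) %[ae Q].
Proof.
move=> Lf eqf phi1; have [h [hh h0 hu]] := pf_simple A1.
have [c hc] := hu f (conj Lf eqf).
have [c' hc'] := hu phi (pf_phi_eigen A1).
have c'0 : c' != 0.
  apply/eqP => c'0; move: phi1; rewrite (inner_ae _ _ _ _ hc' (g' := phis)).
  - rewrite (innerZl _ hh.1) ?c'0 ?mul0r; first by move/eqP; rewrite eq_sym oner_eq0.
    exact: phis_L2.
  - exact: phi_L2.
  - by apply: L2Z; exact: hh.1.
  - exact: phis_L2.
  - exact: phis_L2.
  - exact: aeW.
exists (c / c'); apply: filterS2 hc hc' => x + + _ => /(_ I) -> /(_ I) ->.
by rewrite mulrA divfK.
Qed.

(** * The score: moments and martingale property *)

Local Notation psi := (psi_rho m rho phi phis).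

Lemma measurable_psi : measurable_fun setT (fun p : E * E => psi p.1 p.2).
Proof.
have mp := L2_meas phi_L2; have mps := L2_meas phis_L2.
have m1 (f : E -> R) : measurable_fun setT f -> measurable_fun setT (fun p : E * E => f p.1).
  by move=> mf; apply: (measurableT_comp mf).
have m2 (f : E -> R) : measurable_fun setT f -> measurable_fun setT (fun p : E * E => f p.2).
  by move=> mf; apply: (measurableT_comp mf).
apply: measurable_funB.
  apply: measurable_funM; last exact: m2.
  apply: measurable_funM; first exact: m1.
  by under eq_fun do rewrite -surjective_pairing.
by apply: measurable_funM; [apply: measurable_funM => //; exact: m1|exact: m1].
Qed.

Lemma psi_Int : Int P (fun w => psi (X 0%N w) (X 1%N w)).
Proof.
apply: IntB; first exact: form_Int phi_L2 phis_L2.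
have := IntZ rho (Q_Int 0%N (L2_mul phis_L2 phi_L2)).
by apply: eq_integrable => // w _ /=; rewrite mulrA.
Qed.

Lemma psi_centered (g : E -> R) K : measurable_fun setT g -> (forall x, `|g x| <= K) ->
  \int[P]_w (psi (X 0%N w) (X 1%N w) * g (X 0%N w)) = 0.
Proof.
move=> mg bg; have Lp := phi_L2; have Lps := phis_L2.
have Lg : L2 Q (fun x => g x * phis x) := L2_mul_bounded mg bg Lps.
transitivity (\int[P]_w ((g (X 0%N w) * phis (X 0%N w)) * m (X 0%N w, X 1%N w) * phi (X 1%N w) -
    rho * ((g (X 0%N w) * phis (X 0%N w)) * phi (X 0%N w)))).
  by apply: eq_Rintegral => w _; rewrite /psi_rho; ring.
rewrite EB; [|exact: (form_Int Lp Lg)|by apply: IntZ; exact: (Q_Int 0%N (L2_mul Lg Lp))].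
rewrite (form_E Lp Lg) inner_opM_phi// EZ; last exact: (Q_Int 0%N (L2_mul Lg Lp)).
by rewrite (Q_E 0%N (L2_mul Lg Lp)) subrr.
Qed.

Hypothesis A4c : (\int[P]_w ((phis (X 0%N w) * m (X 0%N w, X 1%N w) * phi (X 1%N w)) ^+ 2)%:E < +oo)%E.

(* rho phis phi is a version of E[phis(X_0) m(X_0, X_1) phi(X_1) | X_0], hence square integrable. *)
Lemma psi_sqr_Int : Int P (fun w => psi (X 0%N w) (X 1%N w) ^+ 2).
Proof.
have Lp := phi_L2; have Lps := phis_L2; have r0 := pf_rho_gt0 A1.
pose G w := phis (X 0%N w) * m (X 0%N w, X 1%N w) * phi (X 1%N w).
have mG : measurable_fun setT G by exact: measurable_form (L2_meas Lps) (L2_meas Lp).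
have IG2 : Int P (fun w => G w ^+ 2).
  by apply: ge0_Int_ltey => //; [exact: measurable_funX|move=> w; exact: sqr_ge0].
pose u x := phis x * phi x.
have mu_ : measurable_fun setT u by exact: measurable_funM (L2_meas Lps) (L2_meas Lp).
have mu2 : measurable_fun setT (fun x => u x ^+ 2) by exact: measurable_funX.
have IG : Int P G := form_Int Lp Lps.
have [Iu2 _] : Int Q (fun x => u x ^+ 2) /\ \int[Q]_x (u x ^+ 2) <= (\int[P]_w (G w ^+ 2)) / rho ^+ 2.
  (* Square integrability of [u] being the goal, only [g], equal to [u] where [u ^+ 2 <= n] and 0
     elsewhere, may serve as a test function. *)
  apply: ge0_Int_trunc => // [x|n]; first exact: sqr_ge0.
  pose i x : R := (u x ^+ 2 <= n%:R)%R%:R.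
  have mi : measurable_fun setT i.
    rewrite (_ : i = \1_((fun x => u x ^+ 2) @^-1` `]-oo, n%:R]%classic)).
      by apply: measurable_indic; rewrite -[X in measurable X]setTI; exact: mu2.
    apply/funext => x; rewrite indicE; congr (nat_of_bool _)%:R.
    by apply/esym; apply/idP/idP; rewrite inE/= in_itv/=.
  have ii x : i x * i x = i x by rewrite /i; case: (_ <= _)%R; rewrite ?mulr1 ?mulr0.
  pose g x := u x * i x.
  have mg : measurable_fun setT g by exact: measurable_funM.
  have bg x : `|g x| <= n%:R + 1.
    rewrite /g /i; case: (leP (u x ^+ 2) n%:R) => h; last by rewrite /= mulr0n mulr0 normr0.
    rewrite /= mulr1n mulr1; have := sqr_ge0 (`|u x| - 1); rewrite -real_normK ?num_real// in h.
    rewrite sqrrB expr1n mulr1 => h'; have := normr_ge0 (u x); lra.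
  have Lg := L2_bounded Q mg bg.
  have gE x : u x ^+ 2 * (u x ^+ 2 <= n%:R)%R%:R = g x ^+ 2.
    by transitivity (u x ^+ 2 * (i x * i x)); [rewrite ii|rewrite /g; ring].
  under eq_integral do rewrite gE.
  rewrite E_EFin; last exact: L2_sqr.
  rewrite lee_fin; set a := \int[Q]_x _.
  have Lgphis : L2 Q (fun x => g x * phis x) := L2_mul_bounded mg bg Lps.
  have e1 : \int[P]_w (g (X 0%N w) * G w) = rho * a.
    have -> : rho * a = rho * inner Q (fun x => g x * phis x) phi.
      congr (_ * _); apply: eq_Rintegral => x _.
      by transitivity (u x ^+ 2 * (i x * i x)); [rewrite /g; ring|rewrite ii /g /u; ring].
    rewrite -inner_opM_phi// -form_E//.
    by apply: eq_Rintegral => w _; rewrite /G; ring.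
  have IgG : Int P (fun w => g (X 0%N w) * G w).
    have := form_Int Lp Lgphis; apply: eq_integrable => // w _ /=; congr _%:E.
    by rewrite /G; ring.
  have IQ := Q_Int 0%N (L2_sqr Lg).
  have r2 : 0 < rho ^+ 2 by rewrite exprn_gt0.
  (* Jensen's inequality in the form of the expectation of [(rho g - G)^2 >= 0]: since [g G] has
     expectation [rho a], this gives [rho^2 a <= E G^2], uniformly in [n]. *)
  have e2 : 2 * rho * (rho * a) <= rho ^+ 2 * a + \int[P]_w (G w ^+ 2).
    have Qa : \int[P]_w (g (X 0%N w) ^+ 2) = a := Q_E 0%N (L2_sqr Lg).
    rewrite -e1 -Qa -EZ// -EZ// -ED//; last exact: IntZ.
    apply: E_le; [exact: IntZ|by apply: IntD => //; exact: IntZ|].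
    move=> w; have := sqr_ge0 (rho * g (X 0%N w) - G w); nra.
  by rewrite ler_pdivlMr// mulrC; nra.
have Iu0 : Int P (fun w => u (X 0%N w) ^+ 2) := Q_Int 0%N Iu2.
have Ib : Int P (fun w => 2 * G w ^+ 2 + 2 * rho ^+ 2 * u (X 0%N w) ^+ 2).
  by apply: IntD; exact: IntZ.
apply: (Int_le _ Ib).
  by apply: measurable_funX; exact: Int_meas psi_Int.
move=> w; rewrite ger0_norm ?sqr_ge0//; apply: le_trans (ler_norm _).
have -> : psi (X 0%N w) (X 1%N w) = G w - rho * u (X 0%N w) by rewrite /psi_rho /G /u; ring.
have := sqr_ge0 (G w + rho * u (X 0%N w)); nra.
Qed.

Hypothesis X_markov : homogeneous_markov X.

Definition psi_path (x : @pathT _ E) : R := psi (x 0%N) (x 1%N).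

Local Notation th := (shift_rv X).

Lemma measurable_psi_path : measurable_fun setT psi_path.
Proof. exact: (measurable_transition 0 1 measurable_psi). Qed.

Lemma psi_path_shift j (w : T) : psi_path (iter j th (sample_path X w)) = psi (X j w) (X j.+1 w).
Proof. by rewrite /psi_path !iter_shift addn0 addn1. Qed.

Lemma partial_sum_psi n w : partial_sum th psi_path n (sample_path X w) =
  \sum_(0 <= t < n) psi (X t w) (X t.+1 w).
Proof. by apply: eq_bigr => j _; rewrite psi_path_shift. Qed.

Lemma measurable_partial_sum_psi n : measurable_fun setT (partial_sum th psi_path n).
Proof.
apply: measurable_sum => j; apply: (measurableT_comp measurable_psi_path).
exact: measurable_iter_shift.
Qed.

Lemma psi_path_Int : Int (path_law X) psi_path.
Proof. by apply/path_Int; [exact: measurable_psi_path|exact: psi_Int]. Qed.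

Lemma psi_path_sqr_Int : Int (path_law X) (fun x => psi_path x ^+ 2).
Proof.
apply/path_Int; first by apply: measurable_funX; exact: measurable_psi_path.
exact: psi_sqr_Int.
Qed.

Lemma psi_path_sqr_E : \int[path_law X]_x (psi_path x ^+ 2) = V_rho X m rho phi phis.
Proof.
rewrite path_E//; first by apply: measurable_funX; exact: measurable_psi_path.
exact: psi_sqr_Int.
Qed.

Local Notation D t w := (psi (X t w) (X t.+1 w)).

Lemma increment_Int t : Int P (fun w => D t w).
Proof. exact: (@stationary_Int _ _ _ _ _ _ X X_stationary (fun p => psi p.1 p.2) t measurable_psi psi_Int). Qed.

Lemma increment_sqr_Int t : Int P (fun w => D t w ^+ 2).
Proof.
apply: (@stationary_Int _ _ _ _ _ _ X X_stationary (fun p => psi p.1 p.2 ^+ 2) t) => //.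
  by apply: measurable_funX; exact: measurable_psi.
exact: psi_sqr_Int.
Qed.

Lemma increment_sqr_E t : \int[P]_w (D t w ^+ 2) = V_rho X m rho phi phis.
Proof.
apply: (@stationary_E _ _ _ _ _ _ X X_stationary (fun p => psi p.1 p.2 ^+ 2) t) => //.
  by apply: measurable_funX; exact: measurable_psi.
exact: psi_sqr_Int.
Qed.

(** Level sets of [g] at the partial sum are events of the past up to date [j], since the sum stops
    at the state [X j]; there the Markov property reduces the claim to [psi_centered]. *)
Lemma increment_mart j (g : R -> R) (K : R) : measurable_fun setT g -> (forall x, `|g x| <= K) ->
  \int[P]_w (D j w * g (\sum_(0 <= t < j) D t w)) = 0.
Proof.
move=> mg bg; pose Sj w := \sum_(0 <= t < j) D t w.
have mSj : measurable_fun setT Sj by apply: measurable_sum => t; exact: Int_meas (increment_Int t).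
have mgS : measurable_fun setT (fun w => g (Sj w)) by apply: measurableT_comp.
apply: (@E_mul_bounded0 _ _ _ P _ _ K) => //; first exact: increment_Int.
move=> B mB.
apply: (@markov_transition _ _ _ _ _ _ X X_markov X_stationary j _ (fun p => psi p.1 p.2)).
- apply: (@past_preimage _ _ _ _ _ _ X j (fun w => g (Sj w))) => //.
  apply: (measurableT_comp mg).
  rewrite /Sj; under eq_fun do rewrite big_mkord.
  apply: measurable_sum => t.
  have mp : measurable_fun setT (fun w : g_sigma_algebraType (past_events X j) => (X t w, X t.+1 w)).
    by apply/measurable_fun_pairP; split; apply: past_X; [exact: ltnW|exact: ltn_ord].
  exact: (measurableT_comp measurable_psi mp).
- exact: measurable_psi.
- exact: psi_Int.
- by move=> h mh bh; exact: (psi_centered mh bh).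
Qed.

Lemma psi_path_mart j (g : R -> R) (K : R) : measurable_fun setT g -> (forall x, `|g x| <= K) ->
  \int[path_law X]_x (psi_path (iter j th x) * g (partial_sum th psi_path j x)) = 0.
Proof.
move=> mg bg.
have mS : measurable_fun setT (fun w => g (\sum_(0 <= t < j) D t w)).
  by apply: measurableT_comp => //; apply: measurable_sum => t; exact: Int_meas (increment_Int t).
rewrite path_E; last 2 first.
- apply: measurable_funM; last exact: (measurableT_comp mg (measurable_partial_sum_psi j)).
  by apply: (measurableT_comp measurable_psi_path); exact: measurable_iter_shift.
- have := Int_mul_bounded (increment_Int j) mS (fun w => bg _); apply: eq_integrable => // w _ /=.
  by rewrite partial_sum_psi psi_path_shift.
rewrite -[RHS](increment_mart j mg bg).
by apply: eq_Rintegral => w _; rewrite partial_sum_psi psi_path_shift.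
Qed.

Lemma increment_L2 t : L2 P (fun w => D t w).
Proof. by apply: L2I; [exact: Int_meas (increment_Int t)|exact: increment_sqr_Int]. Qed.

Lemma increment_sum_L2 n : L2 P (fun w => \sum_(0 <= t < n) D t w).
Proof. by apply: L2_sum => t; exact: increment_L2. Qed.

(** The partial sum is unbounded, so [increment_mart] applies to its truncations. *)
Lemma increment_orth j : inner P (fun w => \sum_(0 <= t < j) D t w) (fun w => D j w) = 0.
Proof.
have LS := increment_sum_L2 j; have LD := increment_L2 j; have mS := L2_meas LS; have mD := L2_meas LD.
have mt N : measurable_fun setT (fun w => trunc N (\sum_(0 <= t < j) D t w)).
  by apply: (measurableT_comp (measurable_trunc N)).
have [| | | | |_ c1] := @E_dct _ _ _ P
  (fun N w => D j w * trunc N (\sum_(0 <= t < j) D t w)) (fun w => D j w * \sum_(0 <= t < j) D t w)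
  (fun w => `|D j w * \sum_(0 <= t < j) D t w|).
- by move=> N; exact: measurable_funM.
- exact: measurable_funM.
- by apply: Int_norm; exact: L2_mul.
- by move=> N w; exact: le_trunc_mulr.
- by apply: aeW => w; apply: cvgM; [exact: cvg_cst|exact: cvg_trunc].
rewrite innerC; move: c1.
have -> : (fun N => \int[P]_w (D j w * trunc N (\sum_(0 <= t < j) D t w))) = (fun=> 0).
  by apply/funext => N; apply: (increment_mart j (measurable_trunc N) (trunc_bound N)).
move=> c2; have h := cvg_lim (@Rhausdorff R) c2.
transitivity (lim ((fun=> 0 : R) @ \oo)); first exact: (esym (h _)).
exact: (cvg_lim (@Rhausdorff R) (cvg_cst _)).
Qed.

Lemma increment_sum_sqr n : \int[P]_w ((\sum_(0 <= t < n) D t w) ^+ 2) = n%:R * V_rho X m rho phi phis.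
Proof.
have LS := increment_sum_L2; have LD := increment_L2.
have sE k : \int[P]_w ((\sum_(0 <= t < k) D t w) ^+ 2) =
  inner P (fun w => \sum_(0 <= t < k) D t w) (fun w => \sum_(0 <= t < k) D t w).
  by apply: eq_Rintegral => w _; rewrite expr2.
elim: n => [|n IH].
  by under eq_Rintegral do rewrite big_geq// expr0n; rewrite E0 mul0r.
rewrite sE in IH; rewrite sE.
have eS : (fun w => \sum_(0 <= t < n.+1) D t w) = (fun w => \sum_(0 <= t < n) D t w + 1 * D n w).
  by apply/funext => w; rewrite big_nat_recr//= mul1r.
rewrite eS (inner_sqrD _ (LS n) (LD n)) increment_orth IH mulr0 addr0 expr1n mul1r -natr1 mulrDl mul1r.
by congr (_ + _); rewrite -(increment_sqr_E n); apply: eq_Rintegral => w _; rewrite expr2.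
Qed.

End operator.

(** * Matrices *)

Section euclidean.
Context (R : realType).

Definition bil k (A : 'M[R]_k) (y x : 'cV[R]_k) : R := (y^T *m A *m x) 0 0.

Lemma bilE k (A : 'M[R]_k) y x : bil A y x = \sum_i \sum_j y i 0 * A i j * x j 0.
Proof.
rewrite /bil -mulmxA mxE; apply: eq_bigr => i _.
rewrite !mxE mulr_sumr; apply: eq_bigr => j _; by rewrite mulrA.
Qed.

Lemma bil_dot k (A : 'M[R]_k) y x : bil A y x = \sum_i y i 0 * (A *m x) i 0.
Proof. by rewrite /bil -mulmxA mxE; apply: eq_bigr => i _; rewrite mxE. Qed.

Lemma bilDr k (A : 'M[R]_k) y x x' : bil A y (x + x') = bil A y x + bil A y x'.
Proof. by rewrite /bil mulmxDr mxE. Qed.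

Lemma bilZr k (A : 'M[R]_k) y a x : bil A y (a *: x) = a * bil A y x.
Proof. by rewrite /bil -scalemxAr mxE. Qed.

Lemma bilBm k (A B : 'M[R]_k) y x : bil (A - B) y x = bil A y x - bil B y x.
Proof. by rewrite /bil mulmxBr mulmxBl !mxE. Qed.

Lemma bilZm k a (A : 'M[R]_k) y x : bil (a *: A) y x = a * bil A y x.
Proof. by rewrite /bil -scalemxAr -scalemxAl mxE. Qed.

Lemma bil_mulmx0 k (A : 'M[R]_k) y x : A *m x = 0 -> bil A y x = 0.
Proof. by move=> h; rewrite /bil -mulmxA h mulmx0 mxE. Qed.

Lemma enorm_ge0 k (x : 'cV[R]_k) : 0 <= enorm x. Proof. exact: sqrtr_ge0. Qed.

Lemma enorm_sqr k (x : 'cV[R]_k) : enorm x ^+ 2 = \sum_i x i 0 ^+ 2.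
Proof. by rewrite sqr_sqrtr// sumr_ge0// => i _; exact: sqr_ge0. Qed.

Lemma enormZ k a (x : 'cV[R]_k) : enorm (a *: x) = `|a| * enorm x.
Proof.
rewrite /enorm -sqrtr_sqr -sqrtrM ?sqr_ge0// mulr_sumr; congr Num.sqrt.
by apply: eq_bigr => i _; rewrite mxE exprMn.
Qed.

Lemma enorm_eq0 k (x : 'cV[R]_k) : enorm x = 0 -> x = 0.
Proof.
move=> h; have /eqP := enorm_sqr x; rewrite h expr0n/= eq_sym psumr_eq0; last by move=> i _; exact: sqr_ge0.
move/allP => H; apply/matrixP => i j; rewrite ord1 mxE.
by have := H i (mem_index_enum i); rewrite /= sqrf_eq0 => /eqP.
Qed.

Lemma sum_cauchy_schwarz k (u v : 'I_k -> R) :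
  (\sum_i u i * v i) ^+ 2 <= (\sum_i u i ^+ 2) * (\sum_i v i ^+ 2).
Proof.
set a := \sum_i u i ^+ 2; set b := \sum_i v i ^+ 2; set s := \sum_i _.
have a0 : 0 <= a by apply: sumr_ge0 => i _; exact: sqr_ge0.
have [a00|an0] := eqVneq a 0.
  have u0 i : u i = 0.
    move: a00 => /eqP; rewrite psumr_eq0; last by move=> j _; exact: sqr_ge0.
    by move/allP => /(_ i (mem_index_enum i)) /=; rewrite sqrf_eq0 => /eqP.
  rewrite (_ : s = 0) ?expr0n ?a00 ?mul0r//.
  by rewrite /s big1// => i _; rewrite u0 mul0r.
have ap : 0 < a by rewrite lt_neqAle eq_sym an0.
have : 0 <= \sum_i (a * v i - s * u i) ^+ 2 by apply: sumr_ge0 => i _; exact: sqr_ge0.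
have -> : \sum_i (a * v i - s * u i) ^+ 2 = a * (a * b - s ^+ 2).
  transitivity (\sum_i (a ^+ 2 * v i ^+ 2 - 2 * a * s * (u i * v i) + s ^+ 2 * u i ^+ 2)).
    by apply: eq_bigr => i _; ring.
  by rewrite big_split/= sumrB -!mulr_sumr -/a -/b -/s; ring.
by rewrite pmulr_rge0// subr_ge0.
Qed.

Lemma dot_le k (y x : 'cV[R]_k) : `|\sum_i y i 0 * x i 0| <= enorm y * enorm x.
Proof.
rewrite -ler_sqr ?nnegrE ?mulr_ge0 ?enorm_ge0// real_normK ?num_real// exprMn !enorm_sqr.
exact: sum_cauchy_schwarz.
Qed.

Lemma enorm_mulmx_bound k (A : 'M[R]_k) : exists2 K, 0 <= K & forall x, enorm (A *m x) <= K * enorm x.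
Proof.
exists (Num.sqrt (\sum_i \sum_j A i j ^+ 2)); first exact: sqrtr_ge0.
have s0 : 0 <= \sum_i \sum_j A i j ^+ 2.
  by apply: sumr_ge0 => i _; apply: sumr_ge0 => j _; exact: sqr_ge0.
move=> x; rewrite -ler_sqr ?nnegrE ?mulr_ge0 ?enorm_ge0 ?sqrtr_ge0//.
rewrite exprMn !enorm_sqr sqr_sqrtr// mulr_suml; apply: ler_sum => i _.
by rewrite mxE; exact: sum_cauchy_schwarz.
Qed.

Lemma mxopnorm_has_sup k (A : 'M[R]_k) : has_sup [set enorm (A *m x) | x in [set x | enorm x <= 1]].
Proof.
have [K K0 hK] := enorm_mulmx_bound A; split.
  exists (enorm (A *m 0)), 0 => //=.
  by rewrite -(scale0r 0) enormZ normr0 mul0r.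
exists K => _ [x /= x1 <-]; apply: (le_trans (hK x)); by rewrite ler_piMr.
Qed.

Lemma le_mxopnorm k (A : 'M[R]_k) x : enorm (A *m x) <= mxopnorm A * enorm x.
Proof.
have [x0|xn0] := eqVneq (enorm x) 0.
  rewrite (enorm_eq0 x0) mulmx0 -(scale0r 0) enormZ normr0 mul0r.
  by rewrite mulr0.
have xp : 0 < enorm x by rewrite lt_neqAle eq_sym xn0 enorm_ge0.
rewrite -ler_pdivrMr//.
have -> : enorm (A *m x) / enorm x = enorm (A *m ((enorm x)^-1 *: x)).
  by rewrite -scalemxAr enormZ ger0_norm ?invr_ge0 ?enorm_ge0// mulrC.
apply: (sup_upper_bound (mxopnorm_has_sup A)).
by exists ((enorm x)^-1 *: x) => //=; rewrite enormZ ger0_norm ?invr_ge0 ?enorm_ge0// mulVf.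
Qed.

Lemma mxopnorm_ge0 k (A : 'M[R]_k) : 0 <= mxopnorm A.
Proof.
apply: le_trans (sup_upper_bound (mxopnorm_has_sup A) _); last first.
  by exists 0 => //=; rewrite -(scale0r 0) enormZ normr0 mul0r.
exact: enorm_ge0.
Qed.

Lemma bil_le_mxopnorm k (A : 'M[R]_k) y x : `|bil A y x| <= mxopnorm A * enorm y * enorm x.
Proof.
rewrite bil_dot (le_trans (dot_le _ _))// mulrAC [leRHS]mulrC.
by rewrite ler_wpM2l ?enorm_ge0// le_mxopnorm.
Qed.

Lemma mxopnorm_opp1 k : (0 < k)%N -> 1 <= mxopnorm (- (1%:M : 'M[R]_k)).
Proof.
case: k => // k _.
have e1 : enorm (delta_mx 0 0 : 'cV[R]_k.+1) = 1.
  rewrite /enorm (bigD1 0)//= big1 ?addr0 ?mxE ?eqxx ?expr1n ?sqrtr1// => i i0.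
  by rewrite mxE (negbTE i0) expr0n.
have := le_mxopnorm (- (1%:M : 'M[R]_k.+1)) (delta_mx 0 0).
by rewrite mulNmx mul1mx -scaleN1r enormZ normrN1 e1 !mulr1.
Qed.

Local Notation qv q := (map_mx (ratr : rat -> R) q).

Lemma enorm_cvg k (u : nat -> 'cV[R]_k) (x : 'cV[R]_k) :
  (forall i, (u n) i 0 @[n --> \oo] --> x i 0) ->
  enorm (u n) @[n --> \oo] --> enorm x.
Proof.
move=> h; apply: (@continuous_cvg _ _ _ _ _ _ (Num.sqrt : R -> R)); first exact: sqrt_continuous.
apply: cvg_bigsum => i; rewrite expr2; under eq_fun do rewrite expr2.
by apply: cvgM; exact: h.
Qed.

(** A countable description of the norm, for measurability. Rational vectors approximating a vector
    of the unit ball may lie slightly outside it, hence the division by [max 1] of the norm. *)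
Lemma lt_mxopnorm k (A : 'M[R]_k) e : e < mxopnorm A <->
  exists q : 'cV[rat]_k, e < enorm (A *m qv q) / Num.max 1 (enorm (qv q)).
Proof.
split.
  move=> /(sup_gt (mxopnorm_has_sup A).1) [_ [x /= x1 <-] ex].
  have /choice[q hq] (n : nat) : exists q : 'cV[rat]_k, forall i, `|x i 0 - ratr (q i 0)| < n.+1%:R^-1.
    have /choice[f hf] (i : 'I_k) : exists r : rat, `|x i 0 - ratr r| < n.+1%:R^-1.
      have : 0 < n.+1%:R^-1 :> R by rewrite invr_gt0.
      move: (n.+1%:R^-1) (x i 0) => z y z0.
      have [|r] := @rat_in_itvoo R (y - z) (y + z); first lra.
      by rewrite in_itv/= => /andP[r1 r2]; exists r; rewrite ltr_norml; apply/andP; split; lra.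
    by exists (\col_i f i) => i; rewrite mxE.
  have cq i : qv (q n) i 0 @[n --> \oo] --> x i 0.
    apply/cvgrPdist_lt => d d0.
    have c0 : n.+1%:R^-1 @[n --> \oo] --> (0 : R) := cvg_harmonic.
    have h1 : \forall n \near \oo, n.+1%:R^-1 < d by move/cvgr_lt : c0; apply.
    near=> n; rewrite mxE; apply: (lt_trans (hq n i)).
    by near: n.
  have cA : enorm (A *m qv (q n)) @[n --> \oo] --> enorm (A *m x).
    apply: enorm_cvg => i; rewrite mxE; under eq_fun do rewrite mxE.
    by apply: cvg_bigsum => j; apply: cvgM; [exact: cvg_cst|exact: cq].
  have cm : Num.max 1 (enorm (qv (q n))) @[n --> \oo] --> Num.max 1 (enorm x).
    have ce := enorm_cvg cq.
    rewrite maxr_absE; under eq_fun do rewrite maxr_absE.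
    apply: cvgM; last exact: cvg_cst.
    apply: cvgD; first by apply: cvgD => //; exact: cvg_cst.
    by apply: cvg_norm; apply: cvgB => //; exact: cvg_cst.
  have cr : enorm (A *m qv (q n)) / Num.max 1 (enorm (qv (q n))) @[n --> \oo] -->
      enorm (A *m x) / Num.max 1 (enorm x).
    apply: cvgM => //; apply: cvgV => //.
    by rewrite gt_eqF// lt_max ltr01.
  rewrite (_ : Num.max 1 (enorm x) = 1) ?divr1 in cr; last by apply/max_idPl.
  near \oo => n; exists (q n).
  by near: n; move/cvgr_gt : cr; apply.
move=> [q eq]; apply: (lt_le_trans eq).
set z := qv q in eq *; have mp : 0 < Num.max 1 (enorm z) by rewrite lt_max ltr01.
rewrite ler_pdivrMr//; apply: (le_trans (le_mxopnorm A z)).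
by rewrite ler_wpM2l ?mxopnorm_ge0// le_max lexx orbT.
Unshelve. all: by end_near. Qed.

Lemma measurable_mxopnorm d (T : measurableType d) k (A : T -> 'M[R]_k) e :
  (forall i j, measurable_fun setT (fun w => A w i j)) ->
  measurable [set w | e < mxopnorm (A w)].
Proof.
move=> mA.
rewrite (_ : [set w | _] = \bigcup_(q in [set: 'cV[rat]_k])
    (fun w => enorm (A w *m qv q) / Num.max 1 (enorm (qv q))) @^-1` `]e, +oo[%classic); last first.
  apply/seteqP; split => w /=.
    by move/lt_mxopnorm => [q hq]; exists q => //=; rewrite in_itv/= andbT.
  by move=> [q _] /=; rewrite in_itv/= andbT => hq; apply/lt_mxopnorm; exists q.
apply: countable_bigcupT_measurable; first exact: countableP.
move=> q; rewrite -[X in measurable X]setTI.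
suff mf : measurable_fun setT (fun w => enorm (A w *m qv q) / Num.max 1 (enorm (qv q))) by exact: mf.
apply: measurable_funM => //.
apply: (@measurableT_comp _ _ _ _ _ _ (Num.sqrt : R -> R)).
  by apply: continuous_measurable_fun; exact: sqrt_continuous.
apply: measurable_sum => i; apply: measurable_funX.
under eq_fun do rewrite mxE.
by apply: measurable_sum => j; exact: measurable_funM.
Qed.

Lemma unitmx_inj0 k (A : 'M[R]_k) : (forall x : 'cV[R]_k, A *m x = 0 -> x = 0) -> A \in unitmx.
Proof.
move=> h; rewrite -unitmx_tr -row_free_unit; apply: inj_row_free => v hv.
apply: trmx_inj; rewrite trmx0; apply: h; apply: trmx_inj.
by rewrite trmx_mul trmxK hv trmx0.
Qed.

Lemma det_eq0_kernel k (A : 'M[R]_k) : \det A = 0 -> exists2 x : 'cV[R]_k, x != 0 & A *m x = 0.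
Proof.
rewrite -det_tr => /eqP /det0P[v v0 hv]; exists v^T.
  by apply: contraNneq v0 => h; rewrite -[v]trmxK h trmx0.
by apply: trmx_inj; rewrite trmx_mul trmxK hv trmx0.
Qed.

Lemma kernel_det_eq0 k (A : 'M[R]_k) (x : 'cV[R]_k) : x != 0 -> A *m x = 0 -> \det A = 0.
Proof.
move=> x0 hx; apply/eqP/negPn; rewrite -unitfE -unitmxE; apply/negP => uA.
by move/eqP : x0; apply; rewrite -(mulKmx uA x) hx mulmx0.
Qed.

Lemma det_pencil_poly k (A B : 'M[R]_k) : exists p : {poly R}, forall l, p.[l] = \det (A - l *: B).
Proof.
exists (\det (map_mx polyC A - 'X *: map_mx polyC B)) => l.
rewrite -horner_evalE -det_map_mx; congr (\det _); apply/matrixP => i j.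
by rewrite !mxE /= /horner_eval !hornerE.
Qed.

Lemma poly_no_root_sign (p : {poly R}) a b : a <= b -> (forall x, a <= x <= b -> p.[x] != 0) ->
  0 < p.[a] * p.[b].
Proof.
move=> ab h; rewrite ltNge; apply/negP => pab.
have [x /andP[ax xb] /rootP px] : exists2 x, a <= x <= b & root p x.
  have [pa|pa] := leP p.[a] 0.
    have [pb|pb] := leP 0 p.[b]; first by apply: poly_ivt => //; rewrite pa.
    have pa0 : p.[a] != 0 by apply: h; rewrite lexx.
    have q : 0 < p.[a] * p.[b] by rewrite nmulr_lgt0// lt_neqAle pa0.
    by move: (lt_le_trans q pab); rewrite ltxx.
  have [pb|pb] := leP p.[b] 0.
    have [||x hx rx] := @poly_ivt R (- p) a b => //.
      by rewrite !hornerN oppr_le0 oppr_ge0 (ltW pa).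
    by exists x => //; rewrite -rootN.
  have q : 0 < p.[a] * p.[b] by rewrite mulr_gt0.
  by move: (lt_le_trans q pab); rewrite ltxx.
by have := h x; rewrite ax xb px eqxx => /(_ isT).
Qed.

(** Otherwise each root has a larger one, and an increasing chain of roots outgrows the degree. *)
Lemma poly_largest_root (p : {poly R}) r : p != 0 -> root p r ->
  exists2 l, root p l & forall s, root p s -> s <= l.
Proof.
move=> p0 pr; apply: contrapT => no.
have next l : root p l -> exists2 s, root p s & l < s.
  move=> pl; apply: contrapT => ns; apply: no; exists l => // s ps.
  by rewrite leNgt; apply/negP => ls; apply: ns; exists s.
have long n : exists s : seq R, [/\ size s = n, all (root p) s & uniq s] /\
    exists2 y, root p y & all (fun x => x < y) s.
  elim: n => [|n [s [[sn sp su] [y py ys]]]]; first by exists [::]; split => //; exists r.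
  exists (y :: s); split.
    split; rewrite /= ?sn ?py// su andbT; apply/negP => /(allP ys).
    by rewrite ltxx.
  have [z pz yz] := next y py; exists z => //=; rewrite yz/=.
  by apply/allP => x /(allP ys) xy; exact: lt_trans xy yz.
have [s [[sn sp su] _]] := long (size p).
by have := max_poly_roots p0 sp su; rewrite sn ltnn.
Qed.

End euclidean.

(** * The inverse square root of the Gram matrix *)

Section inverse_square_root.
Context (R : realType) (k : nat) (G : 'M[R]_k).

(** The default value of [xget] is 0, so a nonzero value certifies that a root was found. *)
Lemma inv_sqrtmx_spec : inv_sqrtmx G != 0 ->
  posdef (inv_sqrtmx G) /\ inv_sqrtmx G *m inv_sqrtmx G = invmx G.
Proof.
by rewrite /inv_sqrtmx; case: xgetP => [S _ hS _ //|_ /eqP].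
Qed.

Hypothesis uG : G \in unitmx.
Local Notation S := (inv_sqrtmx G).
Hypothesis S0 : S != 0.

Lemma inv_sqrtmx_unit : S \in unitmx.
Proof.
have [[_ Sp] _] := inv_sqrtmx_spec S0.
apply: unitmx_inj0 => x hx; apply/eqP/negPn/negP => /Sp.
by rewrite -mulmxA hx mulmx0 mxE ltxx.
Qed.

Lemma inv_sqrtmxK : S *m G *m S = 1%:M.
Proof.
have [_ SS] := inv_sqrtmx_spec S0; have uS := inv_sqrtmx_unit.
have e : G *m (S *m S) = 1%:M by rewrite SS mulmxV.
transitivity (S *m (G *m (S *m S)) *m invmx S); first by rewrite !mulmxA mulmxK.
by rewrite e mulmx1 mulmxV.
Qed.

(** In the coordinates [invmx S *m x] the Euclidean norm is the norm defined by [G], which is the L2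
    norm of the represented function when [G] is a Gram matrix. The norm of an orthogonalized matrix
    thus bounds its form on functions. *)
Lemma inv_sqrtmx_bil (B : 'M[R]_k) y x : 
  `|bil B y x| <= mxopnorm (S *m B *m S) * Num.sqrt (bil G y y) * Num.sqrt (bil G x x).
Proof.
have [[Ssym _] _] := inv_sqrtmx_spec S0; have uS := inv_sqrtmx_unit.
have iSsym : (invmx S)^T = invmx S by rewrite trmx_inv Ssym.
have nE z : enorm (invmx S *m z) = Num.sqrt (bil G z z).
  have -> : bil G z z = bil 1%:M (invmx S *m z) (invmx S *m z).
    rewrite /bil -inv_sqrtmxK trmx_mul iSsym !mulmxA mulmxKV// -!mulmxA.
    by rewrite (mulmxA S (invmx S)) mulmxV// mul1mx.
  congr Num.sqrt; rewrite bil_dot; apply: eq_bigr => i _.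
  by rewrite mul1mx expr2.
rewrite -!nE.
have -> : bil B y x = bil (S *m B *m S) (invmx S *m y) (invmx S *m x).
  rewrite /bil trmx_mul iSsym !mulmxA mulmxKV// -!mulmxA.
  by rewrite (mulmxA S (invmx S)) mulmxV// mul1mx.
exact: bil_le_mxopnorm.
Qed.

End inverse_square_root.

(** * Perturbation of the eigenvalue *)

Section sieve.
Context d (E : measurableType d) (R : realType) (Q : probability E R).
Variables (k : nat) (b : 'I_k -> E -> R).
Hypotheses (Lb : forall i, L2 Q (b i)) (indep : lin_independent Q b).

Definition comb (c : 'cV[R]_k) : E -> R := lincomb b (fun i => c i 0).

Definition gram : 'M[R]_k := \matrix_(i, j) inner Q (b i) (b j).

Lemma comb_L2 c : L2 Q (comb c). Proof. exact: L2_lincomb. Qed.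

Lemma combD c c' : comb (c + c') = fun x => comb c x + comb c' x.
Proof.
by apply/funext => x; rewrite -big_split; apply: eq_bigr => i _; rewrite mxE mulrDl.
Qed.

Lemma combZ a c : comb (a *: c) = fun x => a * comb c x.
Proof.
by apply/funext => x; rewrite /comb/lincomb mulr_sumr; apply: eq_bigr => i _; rewrite mxE mulrA.
Qed.

Lemma comb0 : comb 0 = cst 0.
Proof. by apply/funext => x; rewrite /comb/lincomb big1// => i _; rewrite mxE mul0r. Qed.

Lemma inner_comb c h : L2 Q h -> inner Q (comb c) h = \sum_i c i 0 * inner Q (b i) h.
Proof. by move=> Lh; rewrite inner_lincombl. Qed.

Lemma inner_combr h c : L2 Q h -> inner Q h (comb c) = \sum_i c i 0 * inner Q h (b i).
Proof. by move=> Lh; rewrite innerC inner_comb//; apply: eq_bigr => i _; rewrite innerC. Qed.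

Lemma bil_gram y x : bil gram y x = inner Q (comb y) (comb x).
Proof.
rewrite bilE inner_comb; last exact: comb_L2.
apply: eq_bigr => i _; rewrite inner_combr// mulr_sumr; apply: eq_bigr => j _.
by rewrite mxE; ring.
Qed.

Lemma comb_norm0 c : l2norm Q (comb c) = 0 -> c = 0.
Proof.
move=> /(l2norm0_ae (comb_L2 c)) /indep h.
by apply/matrixP => i j; rewrite ord1 mxE h.
Qed.

Lemma gram_unit : gram \in unitmx.
Proof.
apply: unitmx_inj0 => x hx; apply: comb_norm0.
rewrite l2normE; last exact: comb_L2.
by rewrite -bil_gram bil_mulmx0// sqrtr0.
Qed.

Lemma orth_comb h c : L2 Q h -> (forall i, inner Q h (b i) = 0) -> inner Q h (comb c) = 0.
Proof. by move=> Lh hb; rewrite inner_combr// big1// => i _; rewrite hb mulr0. Qed.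

Definition proj_coef (f : E -> R) : 'cV[R]_k := invmx gram *m \col_j inner Q f (b j).

Lemma gram_mul c i : (gram *m c) i 0 = inner Q (comb c) (b i).
Proof.
rewrite mxE inner_comb//; apply: eq_bigr => j _.
by rewrite mxE mulrC innerC.
Qed.

Lemma proj_coefP f : L2 Q f -> forall i, inner Q (fun x => f x - comb (proj_coef f) x) (b i) = 0.
Proof.
move=> Lf i; rewrite innerBl//; last exact: comb_L2.
rewrite -gram_mul /proj_coef mulmxA mulmxV ?gram_unit// mul1mx mxE.
by rewrite subrr.
Qed.

Lemma sieve_projE f : L2 Q f -> sieve_proj Q b f = comb (proj_coef f).
Proof.
move=> Lf; rewrite /sieve_proj; case: xgetP => [g _ /= [[c ->] hc]|no]; last first.
  exfalso; apply: (no (comb (proj_coef f))); split; last exact: proj_coefP.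
  by exists (fun i => proj_coef f i 0).
have cE : lincomb b c = comb (\col_i c i) by congr lincomb; apply/funext => i; rewrite mxE.
rewrite cE; congr comb; rewrite /proj_coef.
apply: (can_inj (mulKmx gram_unit)); rewrite mulmxA mulmxV ?gram_unit// mul1mx.
apply/matrixP => i j; rewrite ord1 gram_mul mxE; apply/eqP; rewrite eq_sym -subr_eq0.
rewrite -innerBl//; last exact: comb_L2.
by rewrite -cE hc.
Qed.

Lemma inner_comb_orth f p y : L2 Q f -> (forall i, inner Q (fun x => f x - comb p x) (b i) = 0) ->
  inner Q (comb y) f = inner Q (comb y) (comb p).
Proof.
move=> Lf hp; apply/eqP; rewrite -subr_eq0 -innerBr//; try exact: comb_L2.
by rewrite innerC orth_comb//; apply: L2B => //; exact: comb_L2.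
Qed.

Lemma proj_norm_le f p : L2 Q f -> (forall i, inner Q (fun x => f x - comb p x) (b i) = 0) ->
  l2norm Q (comb p) <= l2norm Q f.
Proof.
move=> Lf hp; have Lp := comb_L2 p; have [n0|n0] := eqVneq (l2norm Q (comb p)) 0.
  by rewrite n0 l2norm_ge0.
have np : 0 < l2norm Q (comb p) by rewrite lt_neqAle eq_sym n0 l2norm_ge0.
rewrite -(ler_pM2l np) -expr2 l2norm_sqr// -(inner_comb_orth _ Lf hp).
exact: (le_trans (ler_norm _) (cauchy_schwarz Lp Lf)).
Qed.

End sieve.

(** * Deterministic expansion of the eigenvalue of the pencil *)

Section perturbation.
Context d (E : measurableType d) (R : realType) (Q : probability E R).
Variables (A : (E -> R) -> E -> R) (C c rho : R) (phi phis : E -> R).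
Hypotheses (C0 : 0 <= C) (c0 : 0 < c) (rho0 : 0 < rho)
  (AL : forall f, L2 Q f -> L2 Q (A f))
  (Ab : forall f, L2 Q f -> l2norm Q (A f) <= C * l2norm Q f)
  (AD : forall c f g, L2 Q f -> L2 Q g ->
     A (fun x => f x + c * g x) = (fun x => A f x + c * A g x) %[ae Q])
  (Lphi : L2 Q phi) (Lphis : L2 Q phis)
  (phi1 : l2norm Q phi = 1) (phi_phis : inner Q phi phis = 1)
  (eig : forall g, L2 Q g -> inner Q g (A phi) = rho * inner Q g phi)
  (eigs : forall f, L2 Q f -> inner Q phis (A f) = rho * inner Q phis f)
  (gap : forall l f, rho - c <= l -> L2 Q f -> inner Q f phis = 0 ->
     c * l2norm Q f <= l2norm Q (fun x => A f x - l * f x)).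
Local Notation "`| f |2" := (l2norm Q f) (format "`| f |2").
Local Notation "<[ f , g ]>" := (inner Q f g).
Local Notation sg := (l2norm Q phis).

Lemma sg_ge1 : 1 <= sg.
Proof.
have := cauchy_schwarz Lphi Lphis; rewrite phi_phis phi1 mul1r => h.
by apply: le_trans h; rewrite ger0_norm.
Qed.

Variables (k : nat) (b : 'I_k -> E -> R).
Hypotheses (Lb : forall i, L2 Q (b i)) (indep : lin_independent Q b).
Local Notation F := (comb b).
Variables (p ps : 'cV[R]_k) (del dels eps eM eG : R) (Mh Gh : 'M[R]_k).
Hypotheses (hp : forall i, <[fun x => phi x - F p x, b i]> = 0)
  (hps : forall i, <[fun x => phis x - F ps x, b i]> = 0)
  (hdel : l2norm Q (fun x => phi x - F p x) <= del)
  (hdels : l2norm Q (fun x => phis x - F ps x) <= dels)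
  (heps : forall x, exists z, (forall i, <[fun y => A (F x) y - F z y, b i]> = 0) /\
     l2norm Q (fun y => A (F x) y - F z y) <= eps * l2norm Q (F x))
  (eps0 : 0 <= eps) (eM0 : 0 <= eM) (eG0 : 0 <= eG)
  (hM : forall y x, `|bil Mh y x - <[F y, A (F x)]>| <= eM * l2norm Q (F y) * l2norm Q (F x))
  (hG : forall y x, `|bil Gh y x - <[F y, F x]>| <= eG * l2norm Q (F y) * l2norm Q (F x)).

(** [2 * (C + 1)] bounds the real eigenvalues of the pencil when [eM <= 1] and [eG <= 2^-1];
    [rho + c] covers the interval around [rho] on which the bordered matrix is studied. *)
Definition eig_bound : R := 2 * (C + 1) + rho + c.
(** Errors of the equation per unit of the vector: [eM] from [Mh], [eig_bound * eG] from [l *: Gh],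
    and [C * del] from using the projection [F p] in place of the eigenfunction [phi]. *)
Definition eta : R := eM + eig_bound * eG + C * del.
(** [small1] keeps [inner (F p) phis] within 1/2 of 1 and absorbs the term [|r| * del]; [small2]
    absorbs the terms in the norm of [F h] into [c] times that norm. *)
Hypotheses (small1 : del * sg <= 2^-1) (small2 : 8 * sg * (eta + eps) <= c).

Let LF x : L2 Q (F x). Proof. exact: comb_L2. Qed.
Let del0 : 0 <= del. Proof. exact: le_trans (l2norm_ge0 _ _) hdel. Qed.
Let dels0 : 0 <= dels. Proof. exact: le_trans (l2norm_ge0 _ _) hdels. Qed.
Let eig_bound0 : 0 <= eig_bound.
Proof. by rewrite /eig_bound addr_ge0 ?(ltW c0)// addr_ge0 ?(ltW rho0)// mulr_ge0// addr_ge0. Qed.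
Let sg1 := sg_ge1.
Let eta0 : 0 <= eta.
Proof. by rewrite /eta addr_ge0 ?mulr_ge0// addr_ge0// mulr_ge0. Qed.

Let inner_le f g a e : L2 Q f -> L2 Q g -> l2norm Q f <= a -> l2norm Q g <= e -> `|<[f, g]>| <= a * e.
Proof.
move=> Lf Lg fa ge; apply: (le_trans (cauchy_schwarz Lf Lg)).
by apply: ler_pM => //; exact: l2norm_ge0.
Qed.

Lemma Fp_le1 : l2norm Q (F p) <= 1.
Proof. by rewrite -phi1; exact: proj_norm_le. Qed.

Lemma Fps_le : l2norm Q (F ps) <= sg.
Proof. exact: proj_norm_le. Qed.

Lemma Fp_phis : `|<[F p, phis]> - 1| <= 2^-1.
Proof.
have -> : <[F p, phis]> - 1 = - <[fun x => phi x - F p x, phis]>.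
  by rewrite innerBl// phi_phis; ring.
rewrite normrN; apply: le_trans small1; apply: inner_le => //; exact: L2B.
Qed.

Lemma A_comb_split a h y : <[F y, A (F (a *: p + h))]> =
  a * <[F y, A (F p)]> + <[F y, A (F h)]>.
Proof.
have -> : F (a *: p + h) = fun x => F h x + a * F p x.
  by rewrite combD combZ; apply/funext => x; rewrite addrC.
rewrite (inner_ae (LF y) (LF y) (AL (L2D (LF h) (L2Z a (LF p)))) _ _ (AD a (LF h) (LF p))).
- have L1 := AL (LF h); have L1' := AL (LF p).
  by rewrite (innerDr L1 (L2Z a L1') (LF y)) (innerZr a L1' (LF y)) addrC.
- by apply: L2D; [exact: AL|apply: L2Z; exact: AL].
- exact: aeW.
Qed.

Lemma A_phip y : `|<[F y, A (F p)]> - rho * <[F y, F p]>| <= C * del * l2norm Q (F y).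
Proof.
rewrite -(inner_comb_orth Lb y Lphi hp) -eig// -innerBr//; try exact: AL.
rewrite mulrC; apply: inner_le => //; first by apply: L2B; exact: AL.
apply: (le_trans (opB_norm AL Ab AD (LF p) Lphi)).
by rewrite ler_wpM2l// l2norm_distC.
Qed.

(* Test the equation with the projection of [A h - l h + r phi], r := a (rho - l) - s, and pair
   the result with [phis], which annihilates [A h - l h]. *)
Lemma estimate l a s h : rho - c <= l -> `|l| <= eig_bound -> <[F h, phis]> = 0 ->
  (forall y, bil Mh y (a *: p + h) - l * bil Gh y (a *: p + h) = s * <[F y, F p]>) ->
  l2norm Q (F h) <= 8 * sg / c * eta * `|a| /\ `|a * (rho - l) - s| <= 4 * sg * eta * `|a|.
Proof.
(* [s = 0] is the eigenvalue equation; nonzero [s] serves the bordered matrix. The case [a = 0]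
   yields injectivity: both bounds then force [F h] and [s] to vanish. *)
move=> lc lL h0 eqn; set r := a * (rho - l) - s.
have [z [hz nz]] := heps h.
set nh := l2norm Q (F h).
have nh0 : 0 <= nh by exact: l2norm_ge0.
pose x := a *: p + h.
have nx : l2norm Q (F x) <= `|a| + nh.
  rewrite /x combD combZ; apply: (le_trans (l2normD (L2Z a (LF p)) (LF h))).
  by rewrite l2normZ// lerD2r ler_piMr// Fp_le1.
have FxE : F x = fun u => a * F p u + F h u by rewrite /x combD combZ.
pose y := z - l *: h + r *: p.
have FyE : F y = fun x => F z x - l * F h x + r * F p x.
  rewrite /y combD combZ -scaleNr combD combZ; apply/funext => u; ring.
have LAh := AL (LF h).
have ny : l2norm Q (F y) <= eta * (`|a| + nh).
  have [y0|yn0] := eqVneq (l2norm Q (F y)) 0.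
    by rewrite y0; apply: mulr_ge0 => //; exact: addr_ge0.
  have yp : 0 < l2norm Q (F y) by rewrite lt_neqAle eq_sym yn0 l2norm_ge0.
  rewrite -(ler_pM2r yp) -expr2 l2norm_sqr//.
  (* One factor [F y] is expanded by its definition; the equation tested at [y] then leaves only the
     errors of [Mh] and [Gh] and the defect of [F p] as an eigenfunction. *)
  have -> : <[F y, F y]> = (a * (<[F y, A (F p)]> - rho * <[F y, F p]>)) * -1
     + l * (bil Gh y x - <[F y, F x]>) - (bil Mh y x - <[F y, A (F x)]>).
    rewrite {2}FyE innerDr ?innerBr ?innerZr//; try exact: L2Z; try by apply: L2B => //; exact: L2Z.
    rewrite -(inner_comb_orth Lb y LAh hz).
    have := eqn y; rewrite -/x => e1.
    have -> : <[F y, F x]> = a * <[F y, F p]> + <[F y, F h]>.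
      by rewrite FxE (innerDr (L2Z a (LF p)) (LF h) (LF y)) (innerZr a (LF p) (LF y)).
    rewrite (A_comb_split a h y).
    have {}e1 : bil Mh y x = l * bil Gh y x + s * <[F y, F p]> by rewrite -e1; ring.
    by rewrite e1 /r; ring.
  have b1 : `|a * (<[F y, A (F p)]> - rho * <[F y, F p]>) * -1| <= `|a| * (C * del * l2norm Q (F y)).
    by rewrite mulrN1 normrN normrM ler_wpM2l// A_phip.
  have b2 : `|l * (bil Gh y x - <[F y, F x]>)| <= eig_bound * (eG * l2norm Q (F y) * (`|a| + nh)).
    rewrite normrM; apply: ler_pM => //; apply: (le_trans (hG y x)).
    by rewrite ler_wpM2l// mulr_ge0// l2norm_ge0.
  have b3 : `|bil Mh y x - <[F y, A (F x)]>| <= eM * l2norm Q (F y) * (`|a| + nh).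
    apply: (le_trans (hM y x)).
    by rewrite ler_wpM2l// mulr_ge0// l2norm_ge0.
  apply: (le_trans (ler_norm _)); apply: (le_trans (ler_normB _ _)).
  apply: (le_trans (lerD (ler_normD _ _) (lexx _))).
  apply: (le_trans (lerD (lerD b1 b2) b3)).
  rewrite /eta -subr_ge0; set n := l2norm Q (F y).
  rewrite (_ : _ - _ = C * del * n * nh); last by ring.
  by rewrite !mulr_ge0// l2norm_ge0.
pose v := fun u => (A (F h) u - l * F h u) + r * phi u.
have LAl : L2 Q (fun u => A (F h) u - l * F h u) by apply: L2B => //; exact: L2Z.
have Lv : L2 Q v by apply: L2D => //; exact: L2Z.
have vE : v = fun u => F y u + ((A (F h) u - F z u) + r * (phi u - F p u)).
  by apply/funext => u; rewrite FyE /v; ring.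
have LB1 : L2 Q (fun u => A (F h) u - F z u) by exact: L2B.
have LB2 : L2 Q (fun u => phi u - F p u) by exact: L2B.
pose Z := eta * (`|a| + nh) + eps * nh.
have Z0 : 0 <= Z by rewrite /Z addr_ge0 ?mulr_ge0// addr_ge0.
have nv : l2norm Q v <= Z + `|r| * del.
  rewrite vE; apply: (le_trans (l2normD (LF y) (L2D LB1 (L2Z r LB2)))).
  rewrite /Z -addrA; apply: lerD => //.
  apply: (le_trans (l2normD LB1 (L2Z r LB2))); apply: lerD => //.
  by rewrite l2normZ// ler_wpM2l.
have rE : <[v, phis]> = r.
  rewrite /v innerDl ?innerZl ?innerBl ?innerZl//; try exact: L2Z.
  by rewrite h0 phi_phis [X in X - _]innerC eigs// innerC h0; ring.
have r1 : `|r| <= (Z + `|r| * del) * sg by rewrite -{1}rE; exact: inner_le.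
have r2 : `|r| <= 2 * sg * Z.
  have q : `|r| * del * sg <= `|r| * 2^-1 by rewrite -mulrA ler_wpM2l.
  by move: r1 q; rewrite mulrDl [Z * sg]mulrC -mulrA => r1 q; lra.
have g1 : c * nh <= l2norm Q v + `|r|.
  apply: (le_trans (gap lc (LF h) h0)).
  have -> : (fun u => A (F h) u - l * F h u) = (fun u => v u - r * phi u).
    by apply/funext => u; rewrite /v addrK.
  apply: (le_trans (l2normB Lv (L2Z r Lphi))).
  by rewrite l2normZ// phi1 mulr1.
have del2 : del <= 2^-1.
  by apply: le_trans small1; rewrite ler_peMr.
have g2 : c * nh <= 4 * sg * Z.
  have q1 : `|r| * del <= `|r| * 2^-1 by rewrite ler_wpM2l.
  have q2 : Z <= sg * Z by rewrite ler_peMl.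
  have r2' : `|r| <= 2 * (sg * Z) by rewrite mulrA.
  by rewrite -mulrA; lra.
(* By [small2], [4 * sg * (eta + eps)] is at most [c / 2], so half of the left-hand side remains
   after absorption. *)
have g3 : c * nh <= 4 * sg * eta * `|a| + (c / 2) * nh.
  apply: (le_trans g2).
  have -> : 4 * sg * Z = 4 * sg * eta * `|a| + 4 * sg * (eta + eps) * nh by rewrite /Z; ring.
  rewrite lerD2l ler_wpM2r// ler_pdivlMr//; apply: le_trans small2.
  by rewrite le_eqVlt; apply/orP; left; apply/eqP; ring.
have g4 : nh <= 8 * sg / c * eta * `|a|.
  rewrite (_ : 8 * sg / c * eta * `|a| = (8 * (sg * eta * `|a|)) / c); last by ring.
  rewrite ler_pdivlMr//.
  have -> : 8 * (sg * eta * `|a|) = 2 * (4 * sg * eta * `|a|) by ring.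
  by lra.
split => //; apply: (le_trans r2).
have -> : 2 * sg * Z = 2 * sg * eta * `|a| + 2 * sg * (eta + eps) * nh by rewrite /Z; ring.
have q : 2 * sg * (eta + eps) * nh <= c / 4 * nh.
  rewrite ler_wpM2r// ler_pdivlMr//; apply: le_trans small2.
  by rewrite le_eqVlt; apply/orP; left; apply/eqP; ring.
have q2 : c / 4 * nh <= c / 4 * (8 * sg / c * eta * `|a|) by rewrite ler_wpM2l// ltW// divr_gt0.
have q3 : c / 4 * (8 * sg / c * eta * `|a|) = 2 * sg * eta * `|a|.
  by field; rewrite gt_eqF.
lra.
Qed.

Lemma pencil_kernel l : \det (Mh - l *: Gh) = 0 <-> real_geneig Mh Gh l.
Proof.
split.
  move=> /det_eq0_kernel[x x0 hx]; exists x; split => //.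
  by apply/eqP; rewrite -subr_eq0 scalemxAl -mulmxBl hx.
by move=> [x [x0 hx]]; apply: (kernel_det_eq0 x0); rewrite mulmxBl -scalemxAl hx subrr.
Qed.

Hypotheses (eM1 : eM <= 1) (eG1 : eG <= 2^-1).

(** Rayleigh quotient: the numerator is at most [(C + 1) * n ^+ 2], the denominator at least
    [n ^+ 2 / 2]. *)
Lemma geneig_le_bound l : real_geneig Mh Gh l -> `|l| <= eig_bound.
Proof.
move=> [x [x0 hx]]; set n := l2norm Q (F x).
have n0 : 0 < n.
  rewrite lt_neqAle l2norm_ge0 andbT eq_sym; apply/eqP => h.
  by move/eqP: x0; apply; exact: comb_norm0 Lb indep _ h.
have e1 : bil Mh x x = l * bil Gh x x.
  by rewrite /bil -mulmxA hx -scalemxAr mxE mulmxA.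
have b1 : `|bil Mh x x| <= (C + 1) * n ^+ 2.
  have -> : bil Mh x x = (bil Mh x x - <[F x, A (F x)]>) + <[F x, A (F x)]> by rewrite subrK.
  apply: (le_trans (ler_normD _ _)); rewrite mulrDl mul1r addrC; apply: lerD.
    rewrite (_ : C * n ^+ 2 = n * (C * n)); last by ring.
    by apply: inner_le => //; [exact: AL|exact: Ab].
  apply: (le_trans (hM x x)); rewrite -mulrA -expr2 ler_piMl//; exact: sqr_ge0.
have b2 : n ^+ 2 / 2 <= bil Gh x x.
  have := hG x x; rewrite -/n -(l2norm_sqr (LF x)) -/n -mulrA -expr2 ler_norml => /andP[h _].
  have q : eG * n ^+ 2 <= 2^-1 * n ^+ 2 by rewrite ler_wpM2r// sqr_ge0.
  lra.
have n2 : 0 < n ^+ 2 by rewrite exprn_gt0.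
have g0 : 0 < bil Gh x x by apply: lt_le_trans b2; rewrite divr_gt0.
have b3 : `|l| * (n ^+ 2 / 2) <= (C + 1) * n ^+ 2.
  apply: le_trans b1; rewrite e1 normrM (gtr0_norm g0); exact: ler_wpM2l.
have b4 : `|l| <= 2 * (C + 1).
  rewrite -(ler_pM2r (x := n ^+ 2 / 2)); last by rewrite divr_gt0.
  by apply: (le_trans b3); rewrite le_eqVlt; apply/orP; left; apply/eqP; field.
apply: (le_trans b4); rewrite /eig_bound -addrA lerDl; exact: ltW (addr_gt0 rho0 c0).
Qed.

Lemma Fp_phis_gt0 : 0 < <[F p, phis]>.
Proof. by have := Fp_phis; rewrite ler_norml => /andP[h _]; lra. Qed.

Definition total_error := del + dels + eM + eG.
Definition eta_coef := 1 + eig_bound + C.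
Definition cross_coef := C + rho + sg + rho * sg.
(** The first summand comes from [rho - l] times the error in the normalization by [Gh], the second
    from the form at [h]; each is a product of two first-order bounds. *)
Definition expansion_coef := 8 * sg ^+ 2 * eta_coef + cross_coef * (8 * sg / c) * eta_coef.

Let total_error0 : 0 <= total_error. Proof. by rewrite /total_error !addr_ge0. Qed.
Let sg0 : 0 <= sg. Proof. exact: l2norm_ge0. Qed.
Let one_C_ge0 : 0 <= 1 + C. Proof. by rewrite addr_ge0. Qed.

Lemma eta_le : eta <= eta_coef * total_error.
Proof.
have h1 : 0 <= eig_bound * del by rewrite mulr_ge0.
have h2 : 0 <= eig_bound * dels by rewrite mulr_ge0.
have h3 : 0 <= eig_bound * eM by rewrite mulr_ge0.
have h4 : 0 <= C * dels by rewrite mulr_ge0.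
have h5 : 0 <= C * eM by rewrite mulr_ge0.
have h6 : 0 <= C * eG by rewrite mulr_ge0.
have -> : eta_coef * total_error = eta + (del + dels + eG + eig_bound * del + eig_bound * dels + eig_bound * eM + C * dels + C * eM + C * eG).
  by rewrite /eta /eta_coef /total_error; ring.
by rewrite lerDl !addr_ge0.
Qed.

(** With the eigenvector scaled to [p + h], where [F h] is orthogonal to [phis], testing with [ps]
    writes the left-hand side as [(rho - l) * (Gh(ps, p + h) - 1)] plus the form of [Mh - rho Gh] at
    [ps] and [h]. Both terms are products of two small factors. *)
Lemma geneig_expand l : rho - c <= l -> real_geneig Mh Gh l ->
  `|l - rho - (bil Mh ps p - rho * bil Gh ps p)| <= expansion_coef * total_error ^+ 2.
Proof.
move=> lc hl; have lL := geneig_le_bound hl; have [x0 [x00 hx0]] := hl.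
have pp := Fp_phis_gt0.
have eqn0 y : bil Mh y x0 - l * bil Gh y x0 = 0.
  by rewrite /bil -mulmxA hx0 -scalemxAr mxE mulmxA subrr.
pose a := <[F x0, phis]> / <[F p, phis]>.
pose h0 := x0 - a *: p.
have Fh0 : <[F h0, phis]> = 0.
  rewrite /h0 -scaleNr combD combZ (innerDl (LF x0) (L2Z (- a) (LF p)) Lphis).
  by rewrite (innerZl (- a) (LF p) Lphis) /a mulNr divfK ?gt_eqF// subrr.
have x0E : a *: p + h0 = x0 by rewrite /h0 addrC subrK.
(* If [a] were 0, the eigenvector would be orthogonal to [phis], and [estimate] would annihilate
   it. *)
have a0 : a != 0.
  apply/eqP => a00; have [] := @estimate l 0 0 h0 lc lL Fh0.
    by move=> y; rewrite mul0r; have := eqn0 y; rewrite -x0E a00.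
  rewrite normr0 mulr0 => nh _; move/eqP: x00; apply; rewrite -x0E a00 scale0r add0r.
  by apply: (comb_norm0 Lb indep); apply/eqP; rewrite eq_le nh l2norm_ge0.
pose h := a^-1 *: h0.
have Fh : <[F h, phis]> = 0 by rewrite /h combZ (innerZl _ (LF h0) Lphis) Fh0 mulr0.
have eqn y : bil Mh y (1 *: p + h) - l * bil Gh y (1 *: p + h) = 0 * <[F y, F p]>.
  have -> : 1 *: p + h = a^-1 *: x0 by rewrite -x0E scalerDr scalerA mulVf.
  by rewrite !bilZr mulrCA -mulrBr eqn0 mulr0 mul0r.
have [nh nl] := estimate lc lL Fh eqn.
rewrite normr1 mulr1 in nh; rewrite normr1 mul1r mulr1 subr0 in nl.
clear eqn0 Fh0 x0E a0; clearbody h; clear h0 a x00 hx0 x0.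
set n := l2norm Q (F h) in nh.
have n0 : 0 <= n by exact: l2norm_ge0.
have n1 : n <= 1.
  apply: (le_trans nh); rewrite mulrAC ler_pdivrMr// mul1r; apply: le_trans small2.
  by rewrite ler_wpM2l ?mulr_ge0// lerDl.
have := eqn ps; rewrite mul0r scale1r !bilDr => e1.
have LAh := AL (LF h).
have gE : `|bil Gh ps p + bil Gh ps h - 1| <= sg * del + 2 * (eG * sg).
  have i1 : <[F ps, F p]> - 1 = - <[phis, fun x => phi x - F p x]>.
    rewrite (innerBr Lphi (LF p) Lphis) [<[phis, phi]>]innerC phi_phis [<[phis, _]>]innerC.
    rewrite (inner_comb_orth Lb p Lphis hps) innerC; ring.
  have i2 : <[F ps, F h]> = 0 by rewrite innerC -(inner_comb_orth Lb h Lphis hps).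
  have -> : bil Gh ps p + bil Gh ps h - 1 = (<[F ps, F p]> - 1) +
     ((bil Gh ps p - <[F ps, F p]>) + (bil Gh ps h - <[F ps, F h]>)) by rewrite i2; ring.
  apply: (le_trans (ler_normD _ _)); apply: lerD.
    by rewrite i1 normrN; apply: inner_le => //; exact: L2B.
  rewrite (_ : 2 * (eG * sg) = eG * sg * 1 + eG * sg * 1); last by ring.
  apply: (le_trans (ler_normD _ _)); apply: lerD.
    apply: (le_trans (hG ps p)); apply: ler_pM; rewrite ?mulr_ge0 ?l2norm_ge0 ?Fp_le1//.
    by rewrite ler_wpM2l// Fps_le.
  apply: (le_trans (hG ps h)); apply: ler_pM; rewrite ?mulr_ge0 ?l2norm_ge0//.
  by rewrite ler_wpM2l// Fps_le.
have mE : `|bil Mh ps h - rho * bil Gh ps h| <= (dels * (C + rho) + (eM + rho * eG) * sg) * n.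
  pose w := fun u => A (F h) u - rho * F h u.
  have Lw : L2 Q w by apply: L2B => //; exact: L2Z.
  have LD : L2 Q (fun x => phis x - F ps x) by exact: L2B.
  have nw : l2norm Q w <= (C + rho) * n.
    apply: (le_trans (l2normB LAh (L2Z rho (LF h)))); rewrite (l2normZ _ (LF h)) (gtr0_norm rho0) mulrDl.
    by apply: lerD => //; exact: Ab.
  (* [phis] annihilates [A h - rho h], so testing with its projection sees only the bias
     [phis - F ps]; this provides the second small factor. *)
  have i1 : <[F ps, A (F h)]> - rho * <[F ps, F h]> = - <[fun x => phis x - F ps x, w]>.
    rewrite (innerBl Lphis (LF ps) Lw) /w.
    rewrite !(innerBr LAh (L2Z rho (LF h))) ?(innerZr rho (LF h)) ?eigs//.
    rewrite [<[phis, F h]>]innerC Fh; ring.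
  have -> : bil Mh ps h - rho * bil Gh ps h = (<[F ps, A (F h)]> - rho * <[F ps, F h]>) +
    ((bil Mh ps h - <[F ps, A (F h)]>) - rho * (bil Gh ps h - <[F ps, F h]>)) by ring.
  rewrite mulrDl; apply: (le_trans (ler_normD _ _)); apply: lerD.
    by rewrite i1 normrN -mulrA; apply: inner_le.
  rewrite mulrDl mulrDl; apply: (le_trans (ler_normB _ _)); apply: lerD.
    apply: (le_trans (hM ps h)); rewrite ler_wpM2r//.
    by rewrite ler_wpM2l// Fps_le.
  rewrite normrM (gtr0_norm rho0) -!mulrA ler_wpM2l ?(ltW rho0)//.
  apply: (le_trans (hG ps h)); rewrite -mulrA ler_wpM2l// ler_wpM2r//.
  exact: Fps_le.
have -> : l - rho - (bil Mh ps p - rho * bil Gh ps p) =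
   (rho - l) * (bil Gh ps p + bil Gh ps h - 1) + (bil Mh ps h - rho * bil Gh ps h).
  have -> : bil Mh ps p = l * (bil Gh ps p + bil Gh ps h) - bil Mh ps h.
    by apply/eqP; rewrite -subr_eq0 -[X in _ == X]e1; apply/eqP; ring.
  by ring.
apply: (le_trans (ler_normD _ _)).
have t1 : sg * del + 2 * (eG * sg) <= 2 * sg * total_error.
  have -> : 2 * sg * total_error = (sg * del + 2 * (eG * sg)) + sg * (del + 2 * dels + 2 * eM).
    by rewrite /total_error; ring.
  by rewrite lerDl mulr_ge0// !addr_ge0// mulr_ge0.
have t2 : dels * (C + rho) + (eM + rho * eG) * sg <= cross_coef * total_error.
  have -> : cross_coef * total_error = (dels * (C + rho) + (eM + rho * eG) * sg) +
     ((C + rho) * (del + eM + eG) + sg * (del + dels + eG) + rho * sg * (del + dels + eM)).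
    by rewrite /cross_coef /total_error; ring.
  rewrite lerDl; have r0 := ltW rho0.
  by rewrite !addr_ge0// ?mulr_ge0// ?addr_ge0// ?addr_ge0.
have t3 := eta_le.
have b1 : `|(rho - l) * (bil Gh ps p + bil Gh ps h - 1)| <= (4 * sg * (eta_coef * total_error)) * (2 * sg * total_error).
  rewrite normrM; apply: ler_pM => //; last exact: le_trans gE t1.
  by apply: (le_trans nl); rewrite ler_wpM2l// mulr_ge0.
have K20 : 0 <= cross_coef * total_error.
  by apply: le_trans t2; rewrite addr_ge0// mulr_ge0// ?addr_ge0 ?mulr_ge0// ltW.
have b2 : `|bil Mh ps h - rho * bil Gh ps h| <= (cross_coef * total_error) * (8 * sg / c * (eta_coef * total_error)).
  apply: (le_trans mE); apply: ler_pM => //.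
    by rewrite addr_ge0// mulr_ge0// ?addr_ge0 ?mulr_ge0// ltW.
  by apply: (le_trans nh); rewrite ler_wpM2l// divr_ge0 ?(ltW c0)// mulr_ge0.
apply: (le_trans (lerD b1 b2)); rewrite le_eqVlt; apply/orP; left; apply/eqP.
by rewrite /expansion_coef; ring.
Qed.

Let q : 'cV[R]_k := \col_i inner Q (b i) phis.
(* Bordered matrix: [N l (x, s) = (0, 1)] means that [F x] solves the equation of [estimate] and
   [<F x, phis> = 1]; by Cramer's rule s = det (Mh - l Gh) / det (N l), and [estimate] makes s
   change sign between rho - c and rho + c while det (N l) does not vanish. *)
Let N l : 'M[R]_(k + 1) := block_mx (Mh - l *: Gh) (- (gram Q b *m p)) q^T 0.

Let qF x : (q^T *m x) 0 0 = <[F x, phis]>.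
Proof. by rewrite mxE inner_comb//; apply: eq_bigr => i _; rewrite !mxE mulrC. Qed.

Let N_sol l x s t : N l *m col_mx x (s%:M : 'M[R]_1) = col_mx 0 (t%:M : 'M[R]_1) ->
  <[F x, phis]> = t /\ forall y, bil Mh y x - l * bil Gh y x = s * <[F y, F p]>.
Proof.
rewrite mul_block_col => /eq_col_mx[h1 h2]; split.
  by rewrite -qF; move: h2; rewrite mul0mx addr0 => ->; rewrite mxE eqxx mulr1n.
move=> y; rewrite -bilZm -bilBm -(bil_gram Lb) /bil -mulmxA.
have -> : (Mh - l *: Gh) *m x = s *: (gram Q b *m p).
  move: h1 => /eqP; rewrite mulNmx addr_eq0 opprK => /eqP ->.
  by rewrite mul_mx_scalar.
by rewrite -scalemxAr mxE mulmxA.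
Qed.

Let interval_bound l : rho - c <= l <= rho + c -> `|l| <= eig_bound.
Proof. by move=> /andP[l1 l2]; rewrite ler_norml /eig_bound; apply/andP; split; move: C0 c0 rho0; lra. Qed.

Let N_unit l : rho - c <= l <= rho + c -> N l \in unitmx.
Proof.
move=> hl; have lL := interval_bound hl; have /andP[lc _] := hl.
apply: unitmx_inj0 => x'; rewrite -[x']vsubmxK.
set x := usubmx x'; rewrite [dsubmx x']mx11_scalar; set s := dsubmx x' 0 0.
have -> : (0 : 'cV[R]_(k + 1)) = col_mx 0 ((0 : R)%:M : 'M[R]_1) by rewrite raddf0 col_mx0.
move=> /N_sol[Fx eqn].
have [|nx ns] := @estimate l 0 s x lc lL Fx.
- by move=> y; rewrite scale0r add0r.
rewrite normr0 mulr0 in nx; rewrite mul0r sub0r normrN normr0 mulr0 in ns.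
have -> : x = 0.
  by apply: (comb_norm0 Lb indep); apply/eqP; rewrite eq_le nx l2norm_ge0.
by move: ns; rewrite normr_le0 => /eqP ->.
Qed.

Let N_s l : rho - c <= l <= rho + c -> exists s : R,
  \det (N l) * s = \det (Mh - l *: Gh) /\
  exists2 a, 0 < a & `|a * (rho - l) - s| <= a * (c / 2).
Proof.
move=> hl; have lL := interval_bound hl; have /andP[lc _] := hl.
have uN := N_unit hl.
pose x' := invmx (N l) *m col_mx 0 ((1 : R)%:M : 'M[R]_1).
have hx' : N l *m x' = col_mx 0 (1%:M : 'M[R]_1) by rewrite /x' mulmxA mulmxV// mul1mx.
pose x := usubmx x'; pose s := dsubmx x' 0 0.
have xE : x' = col_mx x (s%:M : 'M[R]_1) by rewrite -[LHS]vsubmxK [dsubmx x']mx11_scalar.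
rewrite xE in hx'; exists s; split.
  (* Cramer's rule: multiplying [N l] by this block matrix replaces its last column by [(0, 1)],
     which leaves the determinant of the pencil. *)
  have -> : s = \det (block_mx (1%:M : 'M[R]_k) x 0 (s%:M : 'M[R]_1)).
    by rewrite det_ublock det1 mul1r det_scalar expr1.
  rewrite -det_mulmx mulmx_block !mulmx1 !mulmx0 !addr0.
  move: hx'; rewrite mul_block_col => /eq_col_mx[-> ->].
  by rewrite det_lblock det1 mulr1.
have [Fx eqn] := N_sol hx'; have pp := Fp_phis_gt0.
(* Since [inner (F x) phis] is 1, this [a] makes [x - a *: p] orthogonal to [phis]. *)
pose a := <[F p, phis]>^-1; have a0 : 0 < a by rewrite invr_gt0.
exists a => //; pose h := x - a *: p.
have xE' : a *: p + h = x by rewrite /h addrC subrK.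
have Fh : <[F h, phis]> = 0.
  rewrite /h -scaleNr combD combZ (innerDl (LF x) (L2Z (- a) (LF p)) Lphis).
  by rewrite (innerZl (- a) (LF p) Lphis) Fx /a mulNr mulVf ?gt_eqF// subrr.
have [|_] := @estimate l a s h lc lL Fh; first by rewrite xE'.
move/le_trans; apply; rewrite (gtr0_norm a0) mulrC ler_wpM2l ?(ltW a0)//.
rewrite ler_pdivlMr//; apply: le_trans small2.
have -> : 4 * sg * eta * 2 = 8 * sg * eta by ring.
by rewrite ler_wpM2l ?mulr_ge0// lerDl.
Qed.

Lemma geneig_exists : exists2 l, rho - c <= l & real_geneig Mh Gh l.
Proof.
have [p1 hp1] := det_pencil_poly Mh Gh.
have [p2 hp2] := det_pencil_poly (block_mx Mh (- (gram Q b *m p)) q^T 0 : 'M[R]_(k + 1)) (block_mx Gh 0 0 0).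
have {}hp2 l : p2.[l] = \det (N l).
  by rewrite hp2 scale_block_mx opp_block_mx add_block_mx !scaler0 !oppr0 !addr0.
have ab : rho - c <= rho + c by move: c0; lra.
have hl1 : rho - c <= rho - c <= rho + c by rewrite lexx.
have hl2 : rho - c <= rho + c <= rho + c by rewrite lexx ab.
apply: contrapT => no.
have := @poly_no_root_sign R p1 (rho - c) (rho + c) ab.
have nr x : rho - c <= x <= rho + c -> p1.[x] != 0.
  move=> /andP[x1 x2]; apply/eqP; rewrite hp1 => h; apply: no.
  by exists x => //; apply/pencil_kernel.
move=> /(_ nr).
have q2 : 0 < p2.[rho - c] * p2.[rho + c].
  apply: poly_no_root_sign => // x hx; rewrite hp2.
  by have := N_unit hx; rewrite unitmxE unitfE.
have [s1 [e1 [a1 a10 h1]]] := N_s hl1.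
have [s2 [e2 [a2 a20 h2]]] := N_s hl2.
rewrite !hp1 -e1 -e2 -!hp2 mulrACA pmulr_rgt0// => ss.
have s1p : 0 < s1.
  move: h1; rewrite opprB addrCA subrr addr0 ler_norml => /andP[_ h1].
  have pc : 0 < a1 * (c / 2) by rewrite mulr_gt0// divr_gt0.
  have e : a1 * c = 2 * (a1 * (c / 2)) by field.
  by move: h1 pc; rewrite e; move: (a1 * (c / 2)) => z; lra.
have s2n : s2 < 0.
  move: h2; rewrite opprD addrA subrr add0r mulrN ler_norml => /andP[h2 _].
  have pc : 0 < a2 * (c / 2) by rewrite mulr_gt0// divr_gt0.
  have e : a2 * c = 2 * (a2 * (c / 2)) by field.
  by move: h2 pc; rewrite e; move: (a2 * (c / 2)) => z; lra.
by move: ss; rewrite pmulr_rgt0// ltNge (ltW s2n).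
Qed.

(** The largest real eigenvalue lies above the one supplied by [geneig_exists], hence above
    [rho - c], and [geneig_expand] applies to it. *)
Lemma largest_geneig_expand : exists2 l, is_largest_real_geneig Mh Gh l &
  `|l - rho - (bil Mh ps p - rho * bil Gh ps p)| <= expansion_coef * total_error ^+ 2.
Proof.
have [p1 hp1] := det_pencil_poly Mh Gh.
have [l0 l0c hl0] := geneig_exists.
(* A vanishing determinant polynomial would make every real number an eigenvalue, including
   [eig_bound + 1]. *)
have p10 : p1 != 0.
  apply/eqP => p0; have : p1.[eig_bound + 1] = 0 by rewrite p0 horner0.
  rewrite hp1 => /pencil_kernel /geneig_le_bound.
  move=> h; have := le_trans (ler_norm _) h.
  by rewrite gerDl ler10.
have pl0 : root p1 l0 by apply/rootP; rewrite hp1; apply/pencil_kernel.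
have [l pl hmax] := poly_largest_root p10 pl0.
have gl : real_geneig Mh Gh l by apply/pencil_kernel; rewrite -hp1; apply/rootP.
exists l; first split => //.
  by move=> s hs; apply: hmax; apply/rootP; rewrite hp1; apply/pencil_kernel.
by apply: geneig_expand => //; apply: (le_trans l0c); exact: hmax.
Qed.

End perturbation.

(** * Asymptotic expansion and normality *)

Lemma fine_le_add3 (R : realType) (x y z t : \bar R) : x \is a fin_num -> y \is a fin_num ->
  z \is a fin_num -> t \is a fin_num -> (x <= y + z + t)%E -> fine x <= fine y + fine z + fine t.
Proof. by case: x y z t => [x||] [y||] [z||] [t||]. Qed.

Section bilinear.
Context (R : realType) (k : nat).
Implicit Types (y x : 'cV[R]_k).

Lemma bil_rank1 (u v : 'I_k -> R) c y x :
  bil (\matrix_(i, j) (u i * c * v j)) y x = (\sum_i y i 0 * u i) * c * (\sum_j x j 0 * v j).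
Proof.
rewrite bilE !mulr_suml; apply: eq_bigr => i _; rewrite mulr_sumr; apply: eq_bigr => j _.
by rewrite mxE; ring.
Qed.

Lemma bil_sum n (B : nat -> 'M[R]_k) y x :
  bil (\sum_(0 <= t < n) B t) y x = \sum_(0 <= t < n) bil (B t) y x.
Proof. by rewrite /bil mulmx_sumr mulmx_suml summxE. Qed.

Lemma measurable_orthogonalize d (T : measurableType d) (G B : 'M[R]_k) (A : T -> 'M[R]_k) :
  (forall i j, measurable_fun setT (fun w => A w i j)) ->
  forall i j, measurable_fun setT (fun w => (orthogonalize G (A w) - B) i j).
Proof.
move=> mA i j; under eq_fun do rewrite !mxE.
apply: measurable_funB => //; apply: measurable_sum => l.
apply: measurable_funM => //; under eq_fun do rewrite mxE.
by apply: measurable_sum => h; exact: measurable_funM.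
Qed.

End bilinear.

Section estimator.
Context d d' (T : measurableType d) (E : measurableType d') (R : realType).
Variables (P : probability T R) (X : nat -> {RV P >-> E}) (S : set E) (m : E * E -> R).
Hypothesis X_in_S : forall t w, S (X t w).
Hypothesis X_stationary : strictly_stationary X.
Hypothesis m_measurable : measurable_fun setT m.
Hypothesis m_pos : forall x y, S x -> S y -> 0 < m (x, y).
Variables (rho : R) (phi phis : E -> R).
Hypothesis A1 : perron_frobenius X m rho phi phis.
Local Notation Q := (stat_dist X).
Local Notation M := (opM X m).
Local Notation C := (opM_const A1).

Let fInt f g : L2 Q f -> L2 Q g -> Int P (fun w => g (X 0%N w) * m (X 0%N w, X 1%N w) * f (X 1%N w)).
Proof. exact: (form_Int X_in_S X_stationary m_measurable m_pos A1). Qed.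

Let fE f g : L2 Q f -> L2 Q g ->
  \int[P]_w (g (X 0%N w) * m (X 0%N w, X 1%N w) * f (X 1%N w)) = inner Q g (M f).
Proof. exact: (form_E X_in_S X_stationary m_measurable m_pos A1). Qed.

Let fabs f g : L2 Q f -> L2 Q g ->
  Int P (fun w => `|g (X 0%N w) * m (X 0%N w, X 1%N w) * f (X 1%N w)|) /\
  \int[P]_w `|g (X 0%N w) * m (X 0%N w, X 1%N w) * f (X 1%N w)| <= C * l2norm Q f * l2norm Q g.
Proof. exact: (form_abs X_in_S X_stationary m_measurable m_pos A1). Qed.

Let ML f : L2 Q f -> L2 Q (M f). Proof. exact: (opM_L2 A1). Qed.

Let MD := opM_linear X_in_S X_stationary m_measurable m_pos A1.

Let Lphi : L2 Q phi := phi_L2 A1.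
Let Lphis : L2 Q phis := phis_L2 A1.

Section fixed_dimension.
Variables (k : nat) (b : 'I_k -> E -> R).
Hypotheses (Lb : forall i, L2 Q (b i)) (indep : lin_independent Q b).
Local Notation F := (comb b).
Let LF x : L2 Q (F x). Proof. exact: comb_L2. Qed.

Lemma mxG_gram : mxG X b = gram Q b.
Proof.
apply/matrixP => i j; rewrite !mxE.
exact: (Q_E X_stationary 0%N (L2_mul (Lb i) (Lb j))).
Qed.

Lemma bil_mxM y x : bil (mxM X m b) y x = inner Q (F y) (M (F x)).
Proof.
rewrite -fE// bilE.
transitivity (\int[P]_w \sum_i \sum_j (y i 0 * x j 0) * (b i (X 0%N w) * m (X 0%N w, X 1%N w) * b j (X 1%N w))).
  rewrite E_sum; last by move=> i; apply: Int_sum => j; apply: IntZ; exact: fInt.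
  apply: eq_bigr => i _; rewrite E_sum; last by move=> j; apply: IntZ; exact: fInt.
  by apply: eq_bigr => j _; rewrite mxE EZ; [ring|exact: fInt].
apply: eq_Rintegral => w _; rewrite !mulr_suml; apply: eq_bigr => i _.
rewrite mulr_sumr; apply: eq_bigr => j _; ring.
Qed.

Lemma bil_mxGhat n w y x : bil (mxGhat X b n w) y x =
  n%:R^-1 * \sum_(0 <= t < n) F y (X t w) * F x (X t w).
Proof.
have -> : mxGhat X b n w = n%:R^-1 *: \sum_(0 <= t < n) \matrix_(i, j) (b i (X t w) * 1 * b j (X t w)).
  apply/matrixP => i j; rewrite !mxE summxE; congr (_ * _); apply: eq_bigr => t _.
  by rewrite mxE mulr1.
rewrite bilZm bil_sum; congr (_ * _); apply: eq_bigr => t _.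
by rewrite bil_rank1 mulr1.
Qed.

Lemma bil_mxMhat n w y x : bil (mxMhat X m b n w) y x =
  n%:R^-1 * \sum_(0 <= t < n) F y (X t w) * m (X t w, X t.+1 w) * F x (X t.+1 w).
Proof.
have -> : mxMhat X m b n w = n%:R^-1 *:
    \sum_(0 <= t < n) \matrix_(i, j) (b i (X t w) * m (X t w, X t.+1 w) * b j (X t.+1 w)).
  apply/matrixP => i j; rewrite !mxE summxE; congr (_ * _); apply: eq_bigr => t _.
  by rewrite mxE.
rewrite bilZm bil_sum; congr (_ * _); apply: eq_bigr => t _.
by rewrite bil_rank1.
Qed.

Let mb t i : measurable_fun setT (fun w => b i (X t w)).
Proof. by apply: measurableT_comp; [exact: L2_meas (Lb i)|exact: measurable_funP]. Qed.

Lemma measurable_errG n e : measurable [set w | e < errG X b n w].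
Proof.
apply: measurable_mxopnorm; apply: measurable_orthogonalize => i j.
under eq_fun do rewrite mxE.
by apply: measurable_funM => //; apply: measurable_sum => t; exact: measurable_funM.
Qed.

Lemma measurable_errM n e : measurable [set w | e < errM X m b n w].
Proof.
apply: measurable_mxopnorm; apply: measurable_orthogonalize => i j.
under eq_fun do rewrite mxE.
apply: measurable_funM => //; apply: measurable_sum => t; apply: measurable_funM => //.
by apply: measurable_funM; [exact: mb|exact: (measurable_mX _ m_measurable)].
Qed.

Hypothesis S0 : inv_sqrtmx (mxG X b) != 0.

Let uG : mxG X b \in unitmx.
Proof. by rewrite mxG_gram; exact: gram_unit. Qed.

Let bilG y : Num.sqrt (bil (mxG X b) y y) = l2norm Q (F y).
Proof. by rewrite mxG_gram bil_gram// l2normE. Qed.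

Lemma errG_bil n w y x : `|bil (mxGhat X b n w) y x - inner Q (F y) (F x)| <=
  errG X b n w * l2norm Q (F y) * l2norm Q (F x).
Proof.
rewrite -(bil_gram Lb) -mxG_gram -bilBm -!bilG; apply: (le_trans (inv_sqrtmx_bil uG S0 _ _ _)).
by rewrite mulmxBr mulmxBl inv_sqrtmxK.
Qed.

Lemma errM_bil n w y x : `|bil (mxMhat X m b n w) y x - inner Q (F y) (M (F x))| <=
  errM X m b n w * l2norm Q (F y) * l2norm Q (F x).
Proof.
rewrite -bil_mxM -bilBm -!bilG; apply: (le_trans (inv_sqrtmx_bil uG S0 _ _ _)).
by rewrite mulmxBr mulmxBl.
Qed.

End fixed_dimension.

(* [inv_sqrtmx] is [0] when no square root exists; then [errG] cannot be [o_p(1)], so that no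
   spectral theorem is needed. *)
Lemma errG_no_sqrt k (b : 'I_k -> E -> R) n w : (0 < k)%N -> inv_sqrtmx (mxG X b) = 0 ->
  1 <= errG X b n w.
Proof.
by move=> k0 h; rewrite /errG /orthogonalize h !mul0mx sub0r; exact: mxopnorm_opp1.
Qed.

Lemma opnorm_le (B : (E -> R) -> E -> R) (e : R) : (opnorm Q B <= e%:E)%E ->
  forall f, L2 Q f -> l2norm Q f <= 1 -> l2norm Q (B f) <= e.
Proof.
move=> h f Lf f1; rewrite -lee_fin; apply: le_trans h.
by apply: ereal_sup_ubound; exists f.
Qed.

Local Notation projM b := (fun psi x => sieve_proj Q b (M psi) x - M psi x).

(** [opnorm] concerns the unit ball. Rescaling passes through the almost everywhere linearity of
    [M], under which the projection coefficients scale exactly; the null vector is treated apart, by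
    boundedness of [M]. *)
Lemma opnorm_proj k (b : 'I_k -> E -> R) (e : R) : (forall i, L2 Q (b i)) -> lin_independent Q b ->
  (opnorm Q (projM b) <= e%:E)%E -> forall x, exists z,
  (forall i, inner Q (fun y => M (comb b x) y - comb b z y) (b i) = 0) /\
  l2norm Q (fun y => M (comb b x) y - comb b z y) <= e * l2norm Q (comb b x).
Proof.
move=> Lb ind he x; have LF z : L2 Q (comb b z) := comb_L2 Lb z.
have LMx := ML (LF x); set n := l2norm Q (comb b x).
pose z := proj_coef Q b (M (comb b x)); exists z.
have hz := proj_coefP Lb ind LMx; split => //.
have LMz : L2 Q (fun y => M (comb b x) y - comb b z y) by exact: L2B.
have [n0|n0] := eqVneq n 0.
  rewrite n0 mulr0; apply: (@le_trans _ _ (l2norm Q (M (comb b x)))).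
    rewrite -ler_sqr ?nnegrE ?l2norm_ge0// !l2norm_sqr//.
    have e1 : M (comb b x) = fun y => (M (comb b x) y - comb b z y) + 1 * comb b z y.
      by apply/funext => y; rewrite mul1r subrK.
    rewrite [in leRHS]e1 inner_sqrD// orth_comb// mulr0 addr0 expr1n mul1r.
    by rewrite lerDl inner_ge0.
  by apply: (le_trans (opM_bound A1 (LF x))); rewrite -/n n0 mulr0.
have np : 0 < n by rewrite lt_neqAle eq_sym n0 l2norm_ge0.
pose f0 := comb b (n^-1 *: x).
have f01 : l2norm Q f0 <= 1.
  rewrite /f0 combZ l2normZ//; rewrite ger0_norm ?invr_ge0 ?(ltW np)//.
  by rewrite -/n mulVf.
have Lf0 : L2 Q f0 := LF _.
have := opnorm_le he Lf0 f01.
rewrite (sieve_projE Lb ind (ML Lf0)) => h.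
have xE : comb b x = fun y => comb b 0 y + n * f0 y.
  by apply/funext => y; rewrite comb0 add0r /f0 combZ mulrA divff// mul1r.
have M0 : M (comb b 0) = cst 0 %[ae Q] by rewrite comb0; exact: opM0 A1.
have ae1 : M (comb b x) = (fun y => n * M f0 y) %[ae Q].
  have hM : M (comb b x) = M (fun y => comb b 0 y + n * f0 y) by rewrite -xE.
  apply: filterS2 (MD n (LF 0) Lf0) M0 => y h1 h2 _.
  by rewrite hM (h1 I) (h2 I) add0r.
have zE : z = n *: proj_coef Q b (M f0).
  rewrite /z /proj_coef scalemxAr; congr (_ *m _); apply/matrixP => i j; rewrite !mxE.
  rewrite (inner_ae LMx (L2Z n (ML Lf0)) (Lb i) (Lb i) ae1); last exact: aeW.
  by rewrite innerZl//; exact: ML.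
have L1 : L2 Q (fun y => comb b (proj_coef Q b (M f0)) y - M f0 y) by apply: L2B => //; exact: ML.
rewrite (@l2norm_ae _ _ _ _ _ (fun y => (- n) * (comb b (proj_coef Q b (M f0)) y - M f0 y)))//.
- rewrite l2normZ// normrN (gtr0_norm np) mulrC; exact: ler_wpM2r (ltW np) _ _ h.
- exact: L2Z.
- apply: filterS ae1 => y + _ => /(_ I) ->.
  by rewrite zE combZ; ring.
Qed.

Variables (b : forall k : nat, 'I_k -> E -> R) (k : nat -> nat).
Hypotheses (b_L2 : forall k i, L2 Q (b (k := k) i)) (b_indep : forall k, lin_independent Q (b (k := k))).
Hypotheses (k_infty : k n @[n --> \oo] --> \oo)
  (A2 : opnorm Q (projM (b (k := k n))) @[n --> \oo] --> 0%E).

Lemma opnorm_near e : 0 < e -> \forall n \near \oo, (opnorm Q (projM (b (k := k n))) <= e%:E)%E.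
Proof.
move=> e0; move/fine_cvgP : A2 => [ffin /cvgr_le h].
have {}h : \forall n \near \oo, fine (opnorm Q (projM (b (k := k n)))) <= e by exact: h.
near=> n; rewrite -[leLHS]fineK ?lee_fin; first by near: n.
by near: n.
Unshelve. all: by end_near. Qed.

Hypothesis phi_phis : inner Q phi phis = 1.

(** The finite-rank approximations demanded by the compactness argument are the projections of [M]
    at a single large sieve index, with the inverse Gram matrix as the matrix of coefficients. *)
Lemma spectral_gap : exists2 c, 0 < c & forall l f, rho - c <= l -> L2 Q f ->
    inner Q f phis = 0 -> c * l2norm Q f <= l2norm Q (fun x => M f x - l * f x).
Proof.
apply: (resolvent_lower_bound (opM_const_ge0 A1) ML (opM_bound A1) MD (pf_rho_gt0 A1) Lphi Lphis phi_phis).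
- by move=> l f Lf; exact: (opM_top A1 Lf).
- by move=> f Lf h; exact: (opM_simple A1 Lf h).
move=> e e0; have [N _ hN] := opnorm_near e0.
exists (k N), (b (k := k N)), (invmx (gram Q (b (k := k N)))); split; first exact: b_L2.
move=> f Lf f1; have := opnorm_le (hN N (leqnn N)) Lf f1.
rewrite (sieve_projE (b_L2 (k := k N)) (b_indep (k := k N)) (ML Lf)).
congr (l2norm Q _ <= _); apply/funext => x; congr (lincomb _ _ _ - _); apply/funext => i.
by rewrite /proj_coef mxE; apply: eq_bigr => j _; rewrite mxE.
Qed.

Hypothesis phi_norm : l2norm Q phi = 1.
Variable rhohat : nat -> {RV P >-> R}.
Hypothesis rhohat_def : forall n w r,
     is_largest_real_geneig (mxMhat X m (b (k := k n)) n w) (mxGhat X (b (k := k n)) n w) r ->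
     rhohat n w = r.

Local Notation Fp n := (comb (b (k := k n)) (proj_coef Q (b (k := k n)) phi)).
Local Notation Fps n := (comb (b (k := k n)) (proj_coef Q (b (k := k n)) phis)).
Definition delta n := l2norm Q (fun x => sieve_proj Q (b (k := k n)) phi x - phi x).
Definition deltas n := l2norm Q (fun x => sieve_proj Q (b (k := k n)) phis x - phis x).
Definition main_term n w := n%:R^-1 * \sum_(0 <= t < n) Fps n (X t w) * m (X t w, X t.+1 w) * Fp n (X t.+1 w)
  - rho * (n%:R^-1 * \sum_(0 <= t < n) Fps n (X t w) * Fp n (X t w)).

Let LFp n : L2 Q (Fp n). Proof. exact: comb_L2. Qed.
Let LFps n : L2 Q (Fps n). Proof. exact: comb_L2. Qed.

Lemma deltaE n : l2norm Q (fun x => phi x - Fp n x) = delta n.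
Proof. by rewrite l2norm_distC// /delta sieve_projE. Qed.

Lemma deltasE n : l2norm Q (fun x => phis x - Fps n x) = deltas n.
Proof. by rewrite l2norm_distC// /deltas sieve_projE. Qed.

Let hp n : forall i, inner Q (fun x => phi x - Fp n x) (b (k := k n) i) = 0.
Proof. exact: proj_coefP. Qed.

Let hps n : forall i, inner Q (fun x => phis x - Fps n x) (b (k := k n) i) = 0.
Proof. exact: proj_coefP. Qed.

Lemma Fp_norm n : l2norm Q (Fp n) <= 1.
Proof. by rewrite -phi_norm; apply: proj_norm_le. Qed.

(** The threshold and the constant depend only on the gap [c], the bound of [M], [rho] and the norm
    of [phis], hence neither on [n] nor on the sample point. *)
Lemma good_event_expansion : exists z K, [/\ 0 < z, 0 <= K &
  forall n w, inv_sqrtmx (mxG X (b (k := k n))) != 0 -> delta n <= z ->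
    (opnorm Q (projM (b (k := k n))) <= z%:E)%E ->
    errM X m (b (k := k n)) n w <= z -> errG X (b (k := k n)) n w <= z ->
    `|rhohat n w - rho - main_term n w| <=
      K * (delta n + deltas n + errM X m (b (k := k n)) n w + errG X (b (k := k n)) n w) ^+ 2].
Proof.
have [c c0 gap] := spectral_gap.
have r0 := pf_rho_gt0 A1; have C0 := opM_const_ge0 A1.
set sg := l2norm Q phis.
have sg1 : 1 <= sg by exact: sg_ge1 phi_norm phi_phis.
have sg0 : 0 < sg by apply: lt_le_trans sg1.
pose L := eig_bound C c rho.
have L0 : 0 <= L by rewrite /L /eig_bound addr_ge0 ?(ltW c0)// addr_ge0 ?(ltW r0)// mulr_ge0// addr_ge0.
pose D := 8 * sg * (2 + L + C).
have D0 : 0 < D.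
  by rewrite /D mulr_gt0//; [rewrite mulr_gt0|rewrite -addrA ltr_pwDl// addr_ge0].
(* The three entries serve [eG <= 2^-1], [small1] and [small2]. In [D], the factor [2 + L + C]
   counts [eM], [L * eG], [C * delta n] and the projection error, each taken at the threshold. *)
pose z := Num.min 2^-1 (Num.min (2 * sg)^-1 (c / D)).
have z0 : 0 < z by rewrite /z !lt_min invr_gt0 ltr0n/= invr_gt0 mulr_gt0//= divr_gt0.
have z1 : z <= 2^-1 by rewrite /z ge_min lexx.
have z2 : z * sg <= 2^-1.
  by rewrite -ler_pdivlMr// -invfM /z !ge_min lexx orbT.
have z3 : D * z <= c.
  by rewrite mulrC -ler_pdivlMr// /z !ge_min lexx !orbT.
exists z, `|expansion_coef Q C c rho phis|; split => // n w S0 dz oz eMz eGz.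
have dl0 : 0 <= delta n by exact: l2norm_ge0.
have eM0 : 0 <= errM X m (b (k := k n)) n w by exact: mxopnorm_ge0.
have eG0 : 0 <= errG X (b (k := k n)) n w by exact: mxopnorm_ge0.
have small1 : delta n * sg <= 2^-1.
  by apply: le_trans z2; rewrite ler_wpM2r// ltW.
have small2 : 8 * sg * (eta C c rho (delta n) (errM X m (b (k := k n)) n w) (errG X (b (k := k n)) n w) + z) <= c.
  apply: le_trans z3.
  have -> : D * z = 8 * sg * ((2 + L + C) * z) by rewrite /D mulrA.
  apply: ler_wpM2l; first by rewrite mulr_ge0// ltW.
  rewrite /eta -/L.
  have q1 : L * errG X (b (k := k n)) n w <= L * z by rewrite ler_wpM2l.
  have q2 : C * delta n <= C * z by rewrite ler_wpM2l.
  have -> : (2 + L + C) * z = z + L * z + C * z + z by ring.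
  by rewrite lerD2r lerD// lerD.
have eM1 : errM X m (b (k := k n)) n w <= 1.
  by apply: (le_trans eMz); apply: (le_trans z1); rewrite invf_le1 ?ler1n.
have eG1 : errG X (b (k := k n)) n w <= 2^-1 by exact: le_trans z1.
have hd : l2norm Q (fun x => phi x - Fp n x) <= delta n by rewrite deltaE.
have hds : l2norm Q (fun x => phis x - Fps n x) <= deltas n by rewrite deltasE.
have [l lmax hl] := largest_geneig_expand C0 c0 r0 ML (opM_bound A1) MD Lphi Lphis phi_norm phi_phis
  (inner_opM_phi A1) (inner_phis_opM X_in_S X_stationary m_measurable m_pos A1) gap
  (b_L2 (k := k n)) (b_indep (k := k n)) (@hp n) (@hps n)
  hd hds
  (opnorm_proj (b_L2 (k := k n)) (b_indep (k := k n)) oz) (ltW z0) eM0 eG0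
  (errM_bil (b_L2 (k := k n)) (b_indep (k := k n)) S0 n w)
  (errG_bil (b_L2 (k := k n)) (b_indep (k := k n)) S0 n w) small1 small2 eM1 eG1.
rewrite (rhohat_def lmax).
rewrite bil_mxMhat bil_mxGhat in hl.
by apply: (le_trans hl); rewrite /total_error ler_wpM2r ?sqr_ge0// ler_norm.
Qed.

(** * Replacing the projected eigenfunctions by the true ones *)

Local Notation psi := (psi_rho m rho phi phis).
Local Notation sg := (l2norm Q phis).

Definition remainder n w := main_term n w - n%:R^-1 * \sum_(0 <= t < n) psi (X t w) (X t.+1 w).

Let rem1 n (p : E * E) := Fps n p.1 * m p * Fp n p.2 - phis p.1 * m p * phi p.2
  - rho * (Fps n p.1 * Fp n p.1 - phis p.1 * phi p.1).

Lemma remainderE n w : remainder n w = n%:R^-1 * \sum_(0 <= t < n) rem1 n (X t w, X t.+1 w).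
Proof.
rewrite /remainder /main_term mulrCA -mulrBr -mulrBr; congr (_ * _).
rewrite mulr_sumr -!sumrB; apply: eq_bigr => t _.
by rewrite /rem1 /psi_rho /=; ring.
Qed.

Let measurable_rem1 n : measurable_fun setT (rem1 n).
Proof.
have m1 (f : E -> R) : measurable_fun setT f -> measurable_fun setT (fun p : E * E => f p.1).
  by move=> mf; apply: (measurableT_comp mf).
have m2 (f : E -> R) : measurable_fun setT f -> measurable_fun setT (fun p : E * E => f p.2).
  by move=> mf; apply: (measurableT_comp mf).
have h1 (f g : E -> R) : L2 Q f -> L2 Q g -> measurable_fun setT (fun p => f p.1 * m p * g p.2).
  move=> /L2_meas mf /L2_meas mg; apply: measurable_funM; last exact: m2.
  by apply: measurable_funM => //; exact: m1.
have h2 (f g : E -> R) : L2 Q f -> L2 Q g -> measurable_fun setT (fun p : E * E => f p.1 * g p.1).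
  by move=> /L2_meas mf /L2_meas mg; apply: measurable_funM; exact: m1.
apply: measurable_funB; first by apply: measurable_funB; exact: h1.
by apply: measurable_funM => //; apply: measurable_funB; exact: h2.
Qed.

(** One factor is changed at a time, so that every term contains either [phis - Fps] or [phi - Fp]
    and is bounded in L1 by [form_abs] or by Cauchy-Schwarz. *)
Lemma rem1_bound n : Int P (fun w => rem1 n (X 0%N w, X 1%N w)) /\
  \int[P]_w `|rem1 n (X 0%N w, X 1%N w)| <= (C + rho) * (deltas n + sg * delta n).
Proof.
have r0 := pf_rho_gt0 A1; have C0 := opM_const_ge0 A1.
pose u x := phis x - Fps n x; pose v x := phi x - Fp n x.
have Lu : L2 Q u by exact: L2B.
have Lv : L2 Q v by exact: L2B.
have nu : l2norm Q u = deltas n := deltasE n.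
have nv : l2norm Q v = delta n := deltaE n.
have QI f g (Lf : L2 Q f) (Lg : L2 Q g) : Int P (fun w => f (X 0%N w) * g (X 0%N w)).
  exact: (Q_Int X_stationary 0%N (L2_mul Lf Lg)).
have QA f g : L2 Q f -> L2 Q g -> \int[P]_w `|f (X 0%N w) * g (X 0%N w)| <= l2norm Q f * l2norm Q g.
  move=> Lf Lg.
  rewrite (Q_E X_stationary 0%N (f := fun x => `|f x * g x|)); last by apply: Int_norm; exact: L2_mul.
  rewrite -(l2norm_norm Lf) -(l2norm_norm Lg).
  apply: le_trans (cauchy_schwarz (L2_norm Lf) (L2_norm Lg)).
  rewrite (_ : \int[Q]_x _ = inner Q (fun x => `|f x|) (fun x => `|g x|)) ?ler_norm//.
  by apply: eq_Rintegral => x _; rewrite normrM.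
have I1 : Int P (fun w => rem1 n (X 0%N w, X 1%N w)).
  apply: IntB; first by apply: IntB; exact: fInt.
  by apply: IntZ; apply: IntB; exact: QI.
split => //.
have [Ia Ea] := fabs (LFp n) Lu; have [Ib Eb] := fabs Lv Lphis.
pose G w := (`|u (X 0%N w) * m (X 0%N w, X 1%N w) * Fp n (X 1%N w)| + `|phis (X 0%N w) * m (X 0%N w, X 1%N w) * v (X 1%N w)|)
  + rho * (`|u (X 0%N w) * Fp n (X 0%N w)| + `|phis (X 0%N w) * v (X 0%N w)|).
have Ic := Int_norm (QI _ _ Lu (LFp n)); have Id := Int_norm (QI _ _ Lphis Lv).
have IG : Int P G by apply: IntD; [exact: IntD|apply: IntZ; exact: IntD].
apply: (@le_trans _ _ (\int[P]_w G w)).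
  apply: E_le => //; first exact: Int_norm.
  move=> w; rewrite /G /rem1 /=.
  set x0 := X 0%N w; set x1 := X 1%N w; set mm := m (x0, x1).
  have -> : Fps n x0 * mm * Fp n x1 - phis x0 * mm * phi x1 - rho * (Fps n x0 * Fp n x0 - phis x0 * phi x0) =
    (- (u x0 * mm * Fp n x1) - phis x0 * mm * v x1) + rho * (u x0 * Fp n x0 + phis x0 * v x0).
    by rewrite /u /v; ring.
  apply: (le_trans (ler_normD _ _)); apply: lerD.
    by apply: (le_trans (ler_normB _ _)); rewrite normrN.
  by rewrite normrM (gtr0_norm r0) ler_wpM2l ?(ltW r0)// ler_normD.
rewrite /G ED; [|exact: IntD|by apply: IntZ; exact: IntD].
rewrite (ED Ia Ib) EZ ?(ED Ic Id); last exact: IntD.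
have n1 := Fp_norm n.
have a1 : \int[P]_w `|u (X 0%N w) * m (X 0%N w, X 1%N w) * Fp n (X 1%N w)| <= C * deltas n.
  by apply: (le_trans Ea); rewrite nu ler_wpM2r ?l2norm_ge0// ler_piMr.
have a2 : \int[P]_w `|phis (X 0%N w) * m (X 0%N w, X 1%N w) * v (X 1%N w)| <= C * (sg * delta n).
  by apply: (le_trans Eb); rewrite nv le_eqVlt; apply/orP; left; apply/eqP; ring.
have a3 : \int[P]_w `|u (X 0%N w) * Fp n (X 0%N w)| <= deltas n.
  by apply: (le_trans (QA _ _ Lu (LFp n))); rewrite nu ler_piMr// l2norm_ge0.
have a4 : \int[P]_w `|phis (X 0%N w) * v (X 0%N w)| <= sg * delta n.
  by apply: (le_trans (QA _ _ Lphis Lv)); rewrite nv.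
rewrite mulrDl; apply: lerD; first by rewrite mulrDr; apply: lerD.
by rewrite ler_wpM2l ?(ltW r0)//; apply: lerD.
Qed.

Lemma remainder_bound n : Int P (remainder n) /\
  \int[P]_w `|remainder n w| <= (C + rho) * (deltas n + sg * delta n).
Proof.
have [I1 E1] := rem1_bound n.
have r0 := pf_rho_gt0 A1; have C0 := opM_const_ge0 A1.
have B0 : 0 <= (C + rho) * (deltas n + sg * delta n).
  by apply: le_trans E1; apply: E_ge0.
have It t : Int P (fun w => rem1 n (X t w, X t.+1 w)) by exact: stationary_Int.
have Et t : \int[P]_w `|rem1 n (X t w, X t.+1 w)| <= (C + rho) * (deltas n + sg * delta n).
  apply: le_trans E1.
  rewrite (stationary_E X_stationary (F := fun p => `|rem1 n p|))//.
    by apply: measurableT_comp => //.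
  exact: Int_norm.
have eR : remainder n = fun w => n%:R^-1 * \sum_(0 <= t < n) rem1 n (X t w, X t.+1 w).
  by apply/funext => w; exact: remainderE.
have IR : Int P (remainder n) by rewrite eR; apply: IntZ; exact: Int_sum.
split => //.
have [->|n0] := eqVneq n 0%N.
  have {}B0 := rem1_bound 0; have {}B0 := le_trans (E_ge0 P (fun _ => normr_ge0 _)) B0.2.
  apply: le_trans B0; rewrite le_eqVlt; apply/orP; left; apply/eqP.
  rewrite -[RHS](E0 P); apply: eq_Rintegral => w _.
  by rewrite remainderE big_geq// mulr0 normr0.
have np : (0 : R) < n%:R by rewrite ltr0n lt0n.
apply: (@le_trans _ _ (\int[P]_w (n%:R^-1 * \sum_(0 <= t < n) `|rem1 n (X t w, X t.+1 w)|))).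
  apply: E_le; [exact: Int_norm|by apply: IntZ; apply: Int_sum => t; exact: Int_norm|].
  move=> w; rewrite remainderE normrM ger0_norm ?invr_ge0// ler_wpM2l ?invr_ge0//.
  exact: ler_norm_sum.
rewrite EZ; last by apply: Int_sum => t; exact: Int_norm.
rewrite E_sum; last by move=> t; exact: Int_norm.
rewrite ler_pdivrMl//; apply: (@le_trans _ _ (\sum_(0 <= t < n) ((C + rho) * (deltas n + sg * delta n)))).
  by apply: ler_sum => t _.
by rewrite sumr_const_nat subn0 mulr_natl.
Qed.

(** * The stochastic expansion and the limit law *)

Hypotheses (A3G : little_op P (fun n => errG X (b (k := k n)) n) (fun=> 1))
  (A4a : delta =o_\oo (fun n => n%:R `^ (- 2^-1) : R))
  (A4a' : deltas =o_\oo (fun n => n%:R `^ (- 2^-1) : R))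
  (A4bG : little_op P (fun n => errG X (b (k := k n)) n) (fun n => n%:R `^ (- 4^-1)))
  (A4bM : little_op P (fun n => errM X m (b (k := k n)) n) (fun n => n%:R `^ (- 4^-1))).

(** Without a square root [errG] would be at least 1 everywhere, so that the event [errG > 1/2]
    would have probability 1. Positive dimension matters: the norm of the empty matrix is 0. *)
Lemma inv_sqrt_near : \forall n \near \oo, inv_sqrtmx (mxG X (b (k := k n))) != 0.
Proof.
have h2 : (0 : R) < 2^-1 by rewrite invr_gt0.
have /fine_cvgP[_ c] := A3G h2.
have c1 : \forall n \near \oo, fine (P [set w | 2^-1 * 1 < `|errG X (b (k := k n)) n w|]) < 1.
  by move/cvgr_lt : c; apply.
have kp : \forall n \near \oo, (0 < k n)%N.
  have := k_infty; move/(_ [set j | (0 < j)%N]); apply.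
  by exists 1%N.
near=> n; apply/eqP => h.
have n1 : fine (P [set w | 2^-1 * 1 < `|errG X (b (k := k n)) n w|]) < 1 by near: n.
have kn : (0 < k n)%N by near: n.
move: n1; rewrite (_ : [set w | _] = setT) ?probability_setT ?ltxx//.
apply/seteqP; split => // w _ /=; rewrite mulr1.
have g1 := errG_no_sqrt n w kn h.
rewrite ger0_norm; last by apply: le_trans g1.
by apply: lt_le_trans g1; rewrite invf_lt1 ?ltr1n.
Unshelve. all: by end_near. Qed.

Let rate n : R := n%:R `^ (- 4^-1).

Let rate_sqr n : rate n * rate n = n%:R `^ (- 2^-1).
Proof.
rewrite /rate -powRD.
  by congr (_ `^ _); field.
apply/implyP => /eqP h; exfalso; have : (4^-1 : R) != 0 by [].
by move/eqP; apply; lra.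
Qed.

Let sqrt_rate n : (0 < n)%N -> Num.sqrt n%:R * (n%:R `^ (- 2^-1)) = 1 :> R.
Proof.
move=> n0; rewrite powRN powR12_sqrt// mulfV// gt_eqF// sqrtr_gt0 ltr0n//.
Qed.

Let rate_bounds n : (0 < n)%N -> 0 < rate n <= 1.
Proof.
move=> n0; rewrite /rate powR_gt0 ?ltr0n//= powRN invf_le1 ?powR_gt0 ?ltr0n//.
rewrite -[leLHS](powRr0 n%:R); apply: ler_powR; first by rewrite ler1n.
by rewrite invr_ge0.
Qed.

Lemma scaled_bias_cvg : Num.sqrt n%:R * ((C + rho) * (deltas n + sg * delta n)) @[n --> \oo] --> (0 : R).
Proof.
have r0 := pf_rho_gt0 A1; have C0 := opM_const_ge0 A1.
have key (u : nat -> R) : (forall n, 0 <= u n) -> u =o_\oo (fun n => n%:R `^ (- 2^-1) : R) ->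
    Num.sqrt n%:R * u n @[n --> \oo] --> (0 : R).
  move=> u0 /eqoP h; apply/cvgrPdist_le => e e0.
  near=> n; have n0 : (0 < n)%N by near: n; exact: nbhs_infty_gt.
  have hn : `|u n| <= e * `|n%:R `^ (- 2^-1) : R| by near: n; exact: h.
  rewrite sub0r normrN ger0_norm ?mulr_ge0 ?sqrtr_ge0//.
  rewrite ger0_norm// ger0_norm ?powR_ge0// in hn.
  have := ler_wpM2l (sqrtr_ge0 n%:R) hn; by rewrite mulrCA sqrt_rate// mulr1.
have c1 := key _ (fun n => l2norm_ge0 _ _) A4a; have c2 := key _ (fun n => l2norm_ge0 _ _) A4a'.
have -> : (fun n => Num.sqrt n%:R * ((C + rho) * (deltas n + sg * delta n))) =
   (fun n => (C + rho) * (Num.sqrt n%:R * deltas n + sg * (Num.sqrt n%:R * delta n))).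
  by apply/funext => n; ring.
rewrite -[X in _ --> X](mulr0 (C + rho)); apply: cvgM; first exact: cvg_cst.
rewrite -[X in _ --> X](addr0 0); apply: cvgD => //.
by rewrite -[X in _ --> X](mulr0 sg); apply: cvgM => //; exact: cvg_cst.
Unshelve. all: by end_near. Qed.

Lemma measurable_psi_sum n : measurable_fun setT (fun w => \sum_(0 <= t < n) psi (X t w) (X t.+1 w)).
Proof.
apply: measurable_sum => t.
exact: Int_meas (increment_Int X_in_S X_stationary m_measurable m_pos A1 t).
Qed.

(** Outside [AG], [AM] and [AR] all four errors are at most [tau * rate n]; as
    [sqrt n * rate n ^+ 2] is 1, the quadratic term costs at most [16 * K * tau ^+ 2]. The other
    half of [e] goes to the remainder, whose L1 norm is [o(n^-1/2)], by Markov's inequality. *)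
Lemma expansion : little_op P
    (fun n w => Num.sqrt n%:R * (rhohat n w - rho) -
       (Num.sqrt n%:R)^-1 * \sum_(0 <= t < n) psi (X t w) (X t.+1 w)) (fun=> 1).
Proof.
move=> e e0; have [z [K [z0 K0 good]]] := good_event_expansion.
(* [z] ensures that the good event is reached, 1 gives [tau ^+ 2 <= tau], and the last entry makes
   [16 * K * tau] at most [e / 2]. *)
pose tau := Num.min z (Num.min 1 (e / (32 * (K + 1)))).
have K1 : 0 < 32 * (K + 1) by rewrite mulr_gt0// ltr_wpDl.
have tau0 : 0 < tau by rewrite /tau !lt_min z0 ltr01 divr_gt0.
have tauz : tau <= z by rewrite /tau ge_min lexx.
have tau1 : tau <= 1 by rewrite /tau !ge_min lexx orbT.
have taue : 16 * K * tau ^+ 2 <= e / 2.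
  have t1 : tau ^+ 2 <= tau by rewrite expr2 ler_piMr// ltW.
  have t2 : tau * (32 * (K + 1)) <= e by rewrite -ler_pdivlMr// /tau !ge_min lexx !orbT.
  have t3 : 16 * K * tau ^+ 2 <= 16 * K * tau by rewrite ler_wpM2l// mulr_ge0.
  have t4 : tau * (32 * (K + 1)) = 2 * (16 * K * tau) + 32 * tau by ring.
  by move: t2 t3 tau0; rewrite t4; move: (16 * K * tau) => y; lra.
pose AG n := [set w | tau * rate n < `|errG X (b (k := k n)) n w|].
pose AM n := [set w | tau * rate n < `|errM X m (b (k := k n)) n w|].
pose AR n := [set w | e / 2 < `|Num.sqrt n%:R * remainder n w|].
pose Y n w := Num.sqrt n%:R * (rhohat n w - rho) -
       (Num.sqrt n%:R)^-1 * \sum_(0 <= t < n) psi (X t w) (X t.+1 w).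
pose A n := [set w | e * 1 < `|Y n w|].
have mset (f : T -> R) (c : R) : measurable_fun setT f -> measurable [set w | c < `|f w|].
  move=> mf; rewrite -[X in measurable X]setTI.
  have -> : [set w | c < `|f w|] = (fun w => `|f w|) @^-1` `]c, +oo[%classic.
    by apply/seteqP; split => w /=; rewrite in_itv/= andbT.
  have mn : measurable_fun setT (fun w => `|f w|) by exact: measurableT_comp.
  exact: mn.
have mY n : measurable_fun setT (Y n).
  apply: measurable_funB; apply: measurable_funM => //; last exact: measurable_psi_sum.
  by apply: measurable_funB.
have mA n : measurable (A n) by exact: mset.
have mAG n : measurable (AG n).
  rewrite (_ : AG n = [set w | tau * rate n < errG X (b (k := k n)) n w]); first exact: measurable_errG.
  by apply/seteqP; split => w; rewrite /AG/= ger0_norm ?mxopnorm_ge0.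
have mAM n : measurable (AM n).
  rewrite (_ : AM n = [set w | tau * rate n < errM X m (b (k := k n)) n w]); first exact: measurable_errM.
  by apply/seteqP; split => w; rewrite /AM/= ger0_norm ?mxopnorm_ge0.
have IR n : Int P (fun w => Num.sqrt n%:R * remainder n w) by apply: IntZ; exact: (remainder_bound n).1.
have mAR n : measurable (AR n) by apply: mset; exact: Int_meas (IR n).
have mGM n : measurable (AG n `|` AM n) := measurableU _ _ (mAG n) (mAM n).
have mGMR n : measurable (AG n `|` AM n `|` AR n) := measurableU _ _ (mGM n) (mAR n).
have Pfin (B : set T) : measurable B -> P B \is a fin_num by move=> mB; rewrite fin_num_measure.
have e20 : 0 < e / 2 by rewrite divr_gt0.
have PR n : fine (P (AR n)) <= (e / 2)^-1 * (Num.sqrt n%:R * ((C + rho) * (deltas n + sg * delta n))).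
  rewrite -lee_fin fineK ?fin_num_measure//.
  apply: (le_trans (markov_R e20 (IR n))); rewrite lee_fin ler_wpM2l ?invr_ge0 ?(ltW e20)//.
  under eq_Rintegral do rewrite normrM (ger0_norm (sqrtr_ge0 _)).
  rewrite EZ; last by apply: Int_norm; exact: (remainder_bound n).1.
  by rewrite ler_wpM2l ?sqrtr_ge0//; exact: (remainder_bound n).2.
have cG : fine (P (AG n)) @[n --> \oo] --> (0 : R) by have /fine_cvgP[_] : P (AG n) @[n --> \oo] --> 0%E by exact: A4bG.
have cM : fine (P (AM n)) @[n --> \oo] --> (0 : R) by have /fine_cvgP[_] : P (AM n) @[n --> \oo] --> 0%E by exact: A4bM.
have cR : (e / 2)^-1 * (Num.sqrt n%:R * ((C + rho) * (deltas n + sg * delta n))) @[n --> \oo] --> (0 : R).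
  rewrite -[X in _ --> X](mulr0 (e / 2)^-1); apply: cvgM; first exact: cvg_cst.
  exact: scaled_bias_cvg.
have cS : fine (P (AG n)) + fine (P (AM n)) +
    (e / 2)^-1 * (Num.sqrt n%:R * ((C + rho) * (deltas n + sg * delta n))) @[n --> \oo] --> (0 + 0 + 0 : R).
  exact: cvgD (cvgD cG cM) cR.
rewrite !addr0 in cS.
have small (u : nat -> R) : (forall n, 0 <= u n) -> u =o_\oo (fun n => n%:R `^ (- 2^-1) : R) ->
    \forall n \near \oo, u n <= tau * (n%:R `^ (- 2^-1)).
  move=> u0 /eqoP h; near=> n.
  have hn : `|u n| <= tau * `|n%:R `^ (- 2^-1) : R| by near: n; exact: h.
  by rewrite ger0_norm// ger0_norm ?powR_ge0// in hn.
have sd := small _ (fun n => l2norm_ge0 _ _) A4a.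
have sds := small _ (fun n => l2norm_ge0 _ _) A4a'.
have incl : \forall n \near \oo, A n `<=` AG n `|` AM n `|` AR n.
  near=> n.
  have n0 : (0 < n)%N by near: n; exact: nbhs_infty_gt.
  have S0 : inv_sqrtmx (mxG X (b (k := k n))) != 0 by near: n; exact: inv_sqrt_near.
  have oz : (opnorm Q (projM (b (k := k n))) <= z%:E)%E by near: n; exact: opnorm_near.
  have dn : delta n <= tau * (n%:R `^ (- 2^-1)) by near: n.
  have dsn : deltas n <= tau * (n%:R `^ (- 2^-1)) by near: n.
  have /andP[ra0 ra1] := rate_bounds n0.
  have rr : n%:R `^ (- 2^-1) <= rate n by rewrite -rate_sqr ler_piMr// ltW.
  have tr : tau * rate n <= tau by rewrite ler_piMr// ltW.
  move=> w Aw; apply: contrapT => no.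
  have eG : errG X (b (k := k n)) n w <= tau * rate n.
    rewrite leNgt; apply/negP => h; apply: no; left; left.
    by rewrite /AG /= ger0_norm ?mxopnorm_ge0.
  have eM : errM X m (b (k := k n)) n w <= tau * rate n.
    rewrite leNgt; apply/negP => h; apply: no; left; right.
    by rewrite /AM /= ger0_norm ?mxopnorm_ge0.
  have eR : `|Num.sqrt n%:R * remainder n w| <= e / 2.
    by rewrite leNgt; apply/negP => h; apply: no; right.
  have dn' : delta n <= tau * rate n by apply: (le_trans dn); rewrite ler_wpM2l// ltW.
  have dsn' : deltas n <= tau * rate n by apply: (le_trans dsn); rewrite ler_wpM2l// ltW.
  have trz := le_trans tr tauz.
  have hx := good n w S0 (le_trans dn' trz) oz (le_trans eM trz) (le_trans eG trz).
  set tot := delta n + _ + _ + _ in hx.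
  have tot0 : 0 <= tot by rewrite /tot !addr_ge0 ?l2norm_ge0 ?mxopnorm_ge0.
  have tot1 : tot <= 4 * (tau * rate n).
    have -> : 4 * (tau * rate n) = tau * rate n + tau * rate n + tau * rate n + tau * rate n by ring.
    by rewrite /tot !lerD.
  have sn0 : 0 < Num.sqrt n%:R :> R by rewrite sqrtr_gt0 ltr0n.
  have b1 : Num.sqrt n%:R * `|rhohat n w - rho - main_term n w| <= e / 2.
    apply: (@le_trans _ _ (Num.sqrt n%:R * (K * (4 * (tau * rate n)) ^+ 2))).
      rewrite ler_wpM2l ?(ltW sn0)//; apply: (le_trans hx); rewrite ler_wpM2l//.
      by rewrite lerXn2r// nnegrE// (le_trans tot0).
    have -> : Num.sqrt n%:R * (K * (4 * (tau * rate n)) ^+ 2) =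
       16 * K * tau ^+ 2 * (Num.sqrt n%:R * (rate n * rate n)) by ring.
    by rewrite rate_sqr sqrt_rate// mulr1.
  have : `|Y n w| <= e.
    have -> : Y n w = Num.sqrt n%:R * (rhohat n w - rho - main_term n w) + Num.sqrt n%:R * remainder n w.
      have sE : (Num.sqrt n%:R)^-1 = Num.sqrt n%:R * n%:R^-1 :> R.
        rewrite -[X in _ / X](sqr_sqrtr (ler0n R n)).
        by rewrite expr2 invfM mulrA mulfV ?mul1r// gt_eqF.
      by rewrite /Y /remainder sE; ring.
    apply: (le_trans (ler_normD _ _)); rewrite normrM (gtr0_norm sn0).
    by apply: (le_trans (lerD b1 eR)); rewrite -splitr.
  by rewrite leNgt; move: Aw; rewrite /A /= mulr1 => ->.
rewrite -/Y; change (P (A n) @[n --> \oo] --> 0%E).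
apply/fine_cvgP; split; first by apply: nearW => n; rewrite fin_num_measure.
apply: (squeeze_cvgr _ (cvg_cst 0) cS); near=> n.
have AnI : A n `<=` AG n `|` AM n `|` AR n by near: n.
apply/andP; split; first exact: fine_ge0.
have PA : (P (A n) <= P (AG n) + P (AM n) + P (AR n))%E.
  apply: (le_trans (le_measure P (mem_set (mA n)) (mem_set (mGMR n)) AnI)).
  have u1 : (P (AG n `|` AM n `|` AR n) <= P (AG n `|` AM n) + P (AR n))%E := measureU2 P (mGM n) (mAR n).
  have u2 : (P (AG n `|` AM n) <= P (AG n) + P (AM n))%E := measureU2 P (mAG n) (mAM n).
  by apply: (le_trans u1); exact: leeD.
apply: (@le_trans _ _ (fine (P (AG n)) + fine (P (AM n)) + fine (P (AR n)))); last by rewrite lerD2l.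
exact: (fine_le_add3 (Pfin _ (mA n)) (Pfin _ (mAG n)) (Pfin _ (mAM n)) (Pfin _ (mAR n)) PA).
Unshelve. all: by end_near. Qed.

Hypothesis X_markov : homogeneous_markov X.
Hypothesis X_ergodic : ergodic X.
Hypothesis A4c : (\int[P]_w ((phis (X 0%N w) * m (X 0%N w, X 1%N w) * phi (X 1%N w)) ^+ 2)%:E < +oo)%E.

(** The normalized score has second moment exactly [V_rho] for [n >= 1], by orthogonality of the
    increments, which gives the moment bound for [portmanteau]; its limit law is computed on path
    space and transported back. *)
Lemma asymptotic_normality : cvg_in_dist P (fun n w => Num.sqrt n%:R * (rhohat n w - rho))
    (centered_normal (V_rho X m rho phi phis)).
Proof.
pose W n w := (Num.sqrt n%:R)^-1 * \sum_(0 <= t < n) psi (X t w) (X t.+1 w).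
have LS n := increment_sum_L2 X_in_S X_stationary m_measurable m_pos A1 A4c n.
apply: (@portmanteau _ _ _ P W _ _ (V_rho X m rho phi phis)).
- by move=> n; apply: measurable_funM => //; exact: measurable_funB.
- by move=> n; apply: measurable_funM => //; exact: measurable_psi_sum.
- move=> n; exact: L2_sqr (L2Z (Num.sqrt n%:R)^-1 (LS n)).
- move=> n.
  have -> : \int[P]_w (W n w ^+ 2) = (Num.sqrt n%:R)^-1 ^+ 2 * (n%:R * V_rho X m rho phi phis).
    rewrite -(increment_sum_sqr X_in_S X_stationary m_measurable m_pos A1 A4c X_markov n).
    rewrite -EZ; last exact: L2_sqr (LS n).
    by apply: eq_Rintegral => w _; rewrite exprMn.
  have V0 : 0 <= V_rho X m rho phi phis by apply: E_ge0 => w; exact: sqr_ge0.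
  rewrite exprVn sqr_sqrtr// mulrA; have [->|n0] := eqVneq n 0%N; first by rewrite mulr0 mul0r.
  by rewrite mulVf ?mul1r// pnatr_eq0.
- exact: expansion.
move=> K u u1 u2 tu.
have c := martingale_clt_normal (th := shift_rv X) (shift_preserves X_stationary) (shift_ergodic X_ergodic)
  (psi_path_Int X_in_S X_stationary m_measurable m_pos A1)
  (psi_path_sqr_Int X_in_S X_stationary m_measurable m_pos A1 A4c)
  (psi_path_sqr_E X_in_S X_stationary m_measurable m_pos A1 A4c)
  (psi_path_mart X_in_S X_stationary m_measurable m_pos A1 X_markov) tu.
apply: cvg_trans c; apply: near_eq_cvg; apply: nearW => n.
have mu_ := lipschitz_measurable (t2_l tu).
have ms : measurable_fun setT (fun x : pathT E => u ((Num.sqrt n%:R)^-1 * partial_sum (shift_rv X) (psi_path m rho phi phis) n x)).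
  apply: (measurableT_comp mu_); apply: measurable_funM => //.
  exact: measurable_partial_sum_psi.
rewrite path_E//.
  by apply: eq_Rintegral => w _; rewrite partial_sum_psi.
apply: (@Int_bounded _ _ _ P _ K); last by move=> w; exact: (t2_b tu).
apply: (measurableT_comp mu_); apply: measurable_funM => //.
under eq_fun do rewrite partial_sum_psi.
exact: measurable_psi_sum.
Qed.

End estimator.

(* S is the state space, a subset of R^dim. A measurable function on S (for the
   trace Borel sigma-algebra) is represented by a measurable function on R^dim
   extending it; its values off S, which X never visits, are irrelevant.
   rhohat n is arbitrary where the largest real generalized eigenvalue does not
   exist. *)
Theorem theorem3p2
  (R : realType) (d : measure_display) (T : measurableType d)
  (P : probability T R) (dim : nat)
  (S : set (dim.-tuple R)) (X : nat -> {RV P >-> dim.-tuple R})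
  (X_in_S : forall t w, S (X t w))
  (X_markov : homogeneous_markov X)
  (X_stationary : strictly_stationary X)
  (X_ergodic : ergodic X)
  (m : dim.-tuple R * dim.-tuple R -> R)
  (m_measurable : measurable_fun setT m)
  (m_pos : forall x y, S x -> S y -> 0 < m (x, y))
  (b : forall k : nat, 'I_k -> dim.-tuple R -> R)
  (b_L2 : forall k i, L2 (stat_dist X) (b k i))
  (b_indep : forall k, lin_independent (stat_dist X) (b k))
  (k : nat -> nat) (k_infty : k n @[n --> \oo] --> \oo)
  (rhohat : nat -> {RV P >-> R})
  (rhohat_def : forall n w r,
     is_largest_real_geneig (mxMhat X m (b (k n)) n w) (mxGhat X (b (k n)) n w) r ->
     rhohat n w = r)
  (rho : R) (phi phis : dim.-tuple R -> R)
  (A1 : perron_frobenius X m rho phi phis)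
  (A2 : opnorm (stat_dist X)
          (fun psi x => sieve_proj (stat_dist X) (b (k n)) (opM X m psi) x
                        - opM X m psi x) @[n --> \oo] --> 0%E)
  (A3G : little_op P (fun n => errG X (b (k n)) n) (fun=> 1))
  (A3M : little_op P (fun n => errM X m (b (k n)) n) (fun=> 1))
  (A4a : (fun n => l2norm (stat_dist X)
            (fun x => sieve_proj (stat_dist X) (b (k n)) phi x - phi x))
         =o_\oo (fun n => n%:R `^ (- 2^-1) : R))
  (A4a' : (fun n => l2norm (stat_dist X)
            (fun x => sieve_proj (stat_dist X) (b (k n)) phis x - phis x))
         =o_\oo (fun n => n%:R `^ (- 2^-1) : R))
  (A4bG : little_op P (fun n => errG X (b (k n)) n) (fun n => n%:R `^ (- 4^-1)))
  (A4bM : little_op P (fun n => errM X m (b (k n)) n) (fun n => n%:R `^ (- 4^-1)))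
  (A4c : (\int[P]_w ((phis (X 0%N w) * m (X 0%N w, X 1%N w) * phi (X 1%N w)) ^+ 2)%:E
          < +oo)%E)
  (phi_norm : l2norm (stat_dist X) phi = 1)
  (phi_phis : inner (stat_dist X) phi phis = 1) :
  little_op P
    (fun n w => Num.sqrt n%:R * (rhohat n w - rho) -
       (Num.sqrt n%:R)^-1 *
         \sum_(0 <= t < n) psi_rho m rho phi phis (X t w) (X t.+1 w))
    (fun=> 1) /\
  cvg_in_dist P (fun n w => Num.sqrt n%:R * (rhohat n w - rho))
    (centered_normal (V_rho X m rho phi phis)).
Proof.
have expn := expansion X_in_S X_stationary m_measurable m_pos A1 b_L2 b_indep k_infty A2
  phi_phis phi_norm rhohat_def A3G A4a A4a' A4bG A4bM.
split=> //.
have an := asymptotic_normality X_in_S X_stationary m_measurable m_pos A1 b_L2 b_indep k_infty A2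
  phi_phis phi_norm rhohat_def A3G A4a A4a' A4bG A4bM X_markov X_ergodic A4c.
exact: an.
Qed.
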